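(* Let $A,B>0$ be constants with $A<B^2$. Let $(u,\psi)$ be a nontrivial least-energy solution of $$\begin{cases} -\Delta_{g_0} u = A e^{2u} - 1 + B e^{u}|\psi|^2, & \text{on } \mathbb{S}^2,\\ D_{g_0}\psi = B e^{u}\psi, & \text{on } \mathbb{S}^2.\end{cases}$$ Then, up to the action of the Möbius group of $\mathbb{S}^2$, $$u\equiv-\log B,\qquad \psi=\sqrt{1-\frac{A}{B^2}}\;\varphi_1,$$ where $\varphi_1$ is a first positive eigenspinor of the standard Dirac operator on $(\mathbb{S}^2,g_0)$, normalized by $D_{g_0}\varphi_1=\varphi_1$, $|\varphi_1|\equiv1$. Equivalently, every nontrivial least-energy solution is of the form $$u=-\log B+\frac12\log\det(d\Phi)\quad\text{and}\quad \psi=\sqrt{1-\frac{A}{B^2}}\;\Phi^*\varphi_1$$ for some conformal transformation $\Phi\in\mathrm{Conf}(\mathbb{S}^2)$ and some such $\varphi_1$.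
   Context: $\mathbb{S}^2$ has its standard round metric $g_0$ with volume form $dv$ and its unique spin structure; $\Delta_{g_0}$ is the (nonpositive) Laplace–Beltrami operator and $D_{g_0}\psi=\sum_{\alpha=1}^2 e_\alpha\cdot\nabla_{e_\alpha}\psi$ the Dirac operator on the spinor bundle $\mathcal{S}\mathbb{S}^2$ (with $X\cdot Y+Y\cdot X=-2g_0(X,Y)$). Solutions are weak solutions in $H^1(\mathbb{S}^2)\times H^{1/2}(\mathcal{S}\mathbb{S}^2)$ ($u$ real-valued; $H^{1/2}(\mathcal{S}\mathbb{S}^2)$ is the domain in $L^2$ of $|D_{g_0}|^{1/2}$); they are smooth. They are the critical points of $$E(u,\psi)=\int_{\mathbb{S}^2}\left[|\nabla u|^2+2u-Ae^{2u}+2\left(\langle D_{g_0}\psi,\psi\rangle-Be^{u}|\psi|^2\right)\right]dv+4\pi .$$ A least-energy solution is a solution whose energy $E$ is minimal among all solutions; it is nontrivial if $\psi\not\equiv0$. Möbius action: $\mathrm{Conf}(\mathbb{S}^2)$ is the group of (orientation-preserving) conformal diffeomorphisms, $\cong PSL(2,\mathbb{C})$. For $\Phi\in\mathrm{Conf}(\mathbb{S}^2)$, $\Phi^*g_0=\det(d\Phi)g_0=e^{2v}g_0$ with $v=\frac12\log\det(d\Phi)$. Let $\beta$ be the canonical fibrewise isometric isomorphism from the spinor bundle of $g_0$ to that of $e^{2v}g_0=\Phi^*g_0$, and let $\hat\Phi$ be the isometric bundle map (a lift, unique up to sign) from the spinor bundle of $\Phi^*g_0$ to that of $g_0$ covering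 $\Phi$ and preserving Clifford multiplication and spin connections. The action of $\Phi$ on pairs is $(u,\psi)\mapsto(u_\Phi,\psi_\Phi)$ with $$u_\Phi=u\circ\Phi+v,\qquad \psi_\Phi=\beta^{-1}\left(e^{v/2}\,\hat\Phi^{-1}\circ\psi\circ\Phi\right),$$ which maps solutions to solutions. In the claim $\Phi^*\varphi_1$ denotes $(\varphi_1)_\Phi=\beta^{-1}(e^{v/2}\,\hat\Phi^{-1}\circ\varphi_1\circ\Phi)$. *)

(* Defs.v *)
From HB Require Import structures.
From mathcomp Require Import all_boot all_order all_algebra.
From mathcomp Require Import complex.
From mathcomp Require Import all_classical all_reals all_analysis.

Set Implicit Arguments.
Unset Strict Implicit.
Unset Printing Implicit Defensive.

Import Order.TTheory GRing.Theory Num.Theory.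
Import numFieldNormedType.Exports.

Local Open Scope classical_set_scope.
Local Open Scope complex_scope.
Local Open Scope ring_scope.

(** A field on S^2 is a function on R^3 of which only the values on [sphere]
    matter.  It is differentiated through its 0-homogeneous extension
    y |-> f (y / |y|), whose Euclidean derivatives at x in S^2 are the
    tangential ones (the radial derivative vanishes).  The norm that the
    library puts on row vectors is the sup norm, so the Euclidean structure
    is written out with [dot]. *)

Section Sphere.
Variable R : realType.
Local Notation E := 'rV[R]_3.

Definition dot (x y : E) : R := \sum_(i < 3) x 0 i * y 0 i.

Definition sphere : set E := [set x | dot x x = 1].

Definition tangent (x X : E) : Prop := dot x X = 0.

Definition tproj (x X : E) : E := X - dot x X *: x.

Definition bvec (i : 'I_3) : E := delta_mx 0 i.

Definition hext (T : Type) (f : E -> T) (y : E) : T :=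
  f ((Num.sqrt (dot y y))^-1 *: y).

Fixpoint Ck (k : nat) (g : E -> R) : Prop :=
  match k with
  | 0%N => forall x : E, x != 0 -> {for x, continuous g}
  | k'.+1 => (forall x v : E, x != 0 -> derivable g x v) /\
             (forall v : E, Ck k' (fun x => 'D_v g x))
  end.

Definition smooth (f : E -> R) : Prop := forall k, Ck k (hext f).

Definition tderiv (f : E -> R) (x X : E) : R := 'D_X (hext f) x.

Definition grad (f : E -> R) (x : E) : E := \row_i tderiv f x (bvec i).

Definition smooth_vec (V : E -> E) : Prop :=
  forall i, smooth (fun x => V x 0 i).

(* For V tangent this is the divergence of the round metric. *)
Definition sdiv (V : E -> E) (x : E) : R :=
  \sum_(i < 3) tderiv (fun y => V y 0 i) x (bvec i).

(* Spherical coordinates (theta, phi); the area form of S^2 is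
   sin(theta) dtheta dphi. *)

Definition sph (p : R * R) : E :=
  \row_k [:: sin p.1 * cos p.2; sin p.1 * sin p.2; cos p.1]`_k.

Definition sph_dom : set (R * R) := `[0, pi]%classic `*` `[0, 2 * pi]%classic.

Local Notation leb2 := (@lebesgue_measure R \x @lebesgue_measure R)%E.

Definition smeas (f : E -> R) : Prop :=
  measurable_fun (sph_dom : set (measurableTypeR R * measurableTypeR R))
                 (f \o sph).

Definition sintegrable (f : E -> R) : Prop :=
  leb2.-integrable sph_dom (fun p => (f (sph p) * sin p.1)%:E).

Definition sint (f : E -> R) : R :=
  \int[leb2]_(p in sph_dom) (f (sph p) * sin p.1).

Definition sae (P : E -> Prop) : Prop :=
  {ae leb2, forall p, sph_dom p -> P (sph p)}.

Definition is_wgrad (u : E -> R) (G : E -> E) : Prop :=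
  [/\ forall i, smeas (fun x => G x 0 i),
      sintegrable (fun x => dot (G x) (G x)),
      sae (fun x => tangent x (G x)) &
      forall V : E -> E, smooth_vec V ->
        (forall x, sphere x -> tangent x (V x)) ->
        sint (fun x => dot (G x) (V x)) = - sint (fun x => u x * sdiv V x)].

Definition H1 (u : E -> R) : Prop :=
  [/\ smeas u, sintegrable (fun x => u x ^+ 2) & exists G, is_wgrad u G].

(* The weak gradient is unique up to a null set. *)
Definition wgrad (u : E -> R) : E -> E := get [set G | is_wgrad u G].

(** The spinor bundle of S^2 is the restriction to S^2 of the trivial bundle
    R^3 x C^2.  With sigma(X) the Pauli matrix of X, tangent vectors act by
    X . psi = sigma(X) sigma(x) psi, which satisfies
    X.Y + Y.X = -2 <X, Y>, and the Gauss formula makes the spin connection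
    nabla_X psi = d_X psi - 1/2 X . psi: it is metric, and Clifford
    multiplication is parallel for it and the Levi-Civita connection.  As S^2
    has one spin structure, this bundle is the spinor bundle up to isomorphism;
    the sign of the action is immaterial, as the complex Clifford module in
    dimension two is unique. *)

Local Notation C := R[i].
Local Notation spinor := (E -> 'cV[C]_2).

Definition pauli (X : E) : 'M[C]_2 :=
  let x1 := X 0 0 in let x2 := X 0 1 in let x3 := X 0 (inord 2) in
  \matrix_(a, b) (nth [::] [:: [:: x3 +i* 0; x1 +i* (- x2)];
                              [:: x1 +i* x2; (- x3) +i* 0]] a)`_b.

Definition cliff (x X : E) : 'M[C]_2 := pauli X *m pauli x.

Definition smoothC (f : E -> C) : Prop :=
  smooth (fun x => complex.Re (f x)) /\ smooth (fun x => complex.Im (f x)).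

Definition smooth_spinor (psi : spinor) : Prop :=
  forall a, smoothC (fun x => psi x a 0).

Definition sderiv (psi : spinor) (x X : E) : 'cV[C]_2 :=
  \col_a (tderiv (fun y => complex.Re (psi y a 0)) x X +i*
          tderiv (fun y => complex.Im (psi y a 0)) x X).

Definition nabla (psi : spinor) (x X : E) : 'cV[C]_2 :=
  sderiv psi x X - 2^-1 *: (cliff x X *m psi x).

(* The sum of e_alpha . nabla_(e_alpha) over an orthonormal basis of the
   tangent plane is the trace of a bilinear expression, hence can be computed
   on the tangential projections of the standard basis of R^3. *)
Definition dirac_op (psi : spinor) (x : E) : 'cV[C]_2 :=
  \sum_(i < 3) cliff x (tproj x (bvec i)) *m nabla psi x (tproj x (bvec i)).

Definition hdot (s t : 'cV[C]_2) : C := \sum_a s a 0 * (t a 0)^*.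

Definition sqC (z : C) : R := complex.Re z ^+ 2 + complex.Im z ^+ 2.

Definition sqnorm (s : 'cV[C]_2) : R := \sum_a sqC (s a 0).

Definition sintC (f : E -> C) : C :=
  sint (fun x => complex.Re (f x)) +i* sint (fun x => complex.Im (f x)).

Definition L2dot (phi psi : spinor) : C := sintC (fun x => hdot (phi x) (psi x)).

Definition L2spinor (psi : spinor) : Prop :=
  [/\ forall a, smeas (fun x => complex.Re (psi x a 0)),
      forall a, smeas (fun x => complex.Im (psi x a 0)) &
      sintegrable (fun x => sqnorm (psi x))].

(** D is essentially self-adjoint with discrete spectrum and smooth
    eigenspinors.  By the spectral theorem psi in L^2 lies in the domain of
    |D|^(1/2) iff the sum of |lambda_j| |<psi, phi_j>|^2 over a Hilbert basis of
    eigenspinors is finite, i.e. iff these sums are bounded over finite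
    orthonormal families of eigenspinors. *)

Definition eigenfamily (n : nat) (lambda : 'I_n -> R) (phi : 'I_n -> spinor) :
    Prop :=
  [/\ forall j, smooth_spinor (phi j),
      forall j x, sphere x -> dirac_op (phi j) x = (lambda j)%:C *: phi j x &
      forall j k, L2dot (phi j) (phi k) = (j == k)%:R].

Definition H12 (psi : spinor) : Prop :=
  L2spinor psi /\
  exists M : R, forall n (lambda : 'I_n -> R) (phi : 'I_n -> spinor),
    eigenfamily lambda phi ->
    \sum_j `|lambda j| * sqC (L2dot psi (phi j)) <= M.

Definition dirac_sums (psi : spinor) : set R :=
  [set s | exists n (lambda : 'I_n -> R) (phi : 'I_n -> spinor),
     eigenfamily lambda phi /\
     s = \sum_j lambda j * sqC (L2dot psi (phi j))].

(* The integral of <D psi, psi> for psi in H^(1/2): the supremum is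
   || |D|^(1/2) P_+ psi ||^2 and the infimum - || |D|^(1/2) P_- psi ||^2, with
   P_+ and P_- the spectral projections of D. *)
Definition dirac_form (psi : spinor) : R :=
  sup (dirac_sums psi) + inf (dirac_sums psi).

(* Weak solutions, tested against smooth pairs, which are dense in
   H^1 x H^(1/2). *)
Definition is_solution (A B : R) (u : E -> R) (psi : spinor) : Prop :=
  [/\ H1 u, H12 psi,
      forall w : E -> R, smooth w ->
        sint (fun x => dot (wgrad u x) (grad w x)) =
        sint (fun x => (A * expR (2 * u x) - 1 +
                        B * expR (u x) * sqnorm (psi x)) * w x) &
      forall phi : spinor, smooth_spinor phi ->
        L2dot psi (dirac_op phi) =
        sintC (fun x => (B * expR (u x))%:C * hdot (psi x) (phi x))].

Definition energy (A B : R) (u : E -> R) (psi : spinor) : R :=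
  sint (fun x => dot (wgrad u x) (wgrad u x) + 2 * u x - A * expR (2 * u x)) +
  2 * (dirac_form psi - B * sint (fun x => expR (u x) * sqnorm (psi x))) +
  4 * pi.

Definition least_energy_solution (A B : R) (u : E -> R) (psi : spinor) : Prop :=
  is_solution A B u psi /\
  forall u' psi', is_solution A B u' psi' ->
    energy A B u psi <= energy A B u' psi'.

Definition nontrivial (psi : spinor) : Prop := ~ sae (fun x => psi x = 0).

Definition first_eigenspinor (phi : spinor) : Prop :=
  [/\ smooth_spinor phi,
      forall x, sphere x -> dirac_op phi x = phi x &
      forall x, sphere x -> sqnorm (phi x) = 1].

(* Differentials act on row vectors from the right: dPhi_x X = X *m jac Phi x. *)
Definition jac (Phi : E -> E) (x : E) : 'M[R]_3 :=
  \matrix_(i, j) tderiv (fun y => Phi y 0 j) x (bvec i).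

Definition diff_at (Phi : E -> E) (x X : E) : E := X *m jac Phi x.

(* The determinant of dPhi_x : T_x -> T_(Phi x) in oriented orthonormal bases:
   the rank one term extends dPhi_x to R^3 by mapping the normal x to the
   normal Phi x. *)
Definition jacdet (Phi : E -> E) (x : E) : R :=
  \det (jac Phi x + x^T *m Phi x).

Definition is_conf (Phi : E -> E) : Prop :=
  [/\ smooth_vec Phi,
      forall x, sphere x -> sphere (Phi x),
      exists2 Psi : E -> E, smooth_vec Psi &
        forall x, sphere x ->
          [/\ sphere (Psi x), Psi (Phi x) = x & Phi (Psi x) = x],
      forall x, sphere x -> 0 < jacdet Phi x &
      forall x X Y, sphere x -> tangent x X -> tangent x Y ->
        dot (diff_at Phi x X) (diff_at Phi x Y) = jacdet Phi x * dot X Y].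

Definition conf_factor (Phi : E -> E) (x : E) : R := 2^-1 * ln (jacdet Phi x).

(* The spinor bundle of e^(2v) g_0 is modelled on the same C^2-bundle through
   beta, which thereby becomes the identity: a vector X acts by e^v times its
   g_0-action, and the spin connection is the following one. *)
Definition conf_cliff (v : E -> R) (x X : E) : 'M[C]_2 :=
  (expR (v x))%:C *: cliff x X.

Definition conf_nabla (v : E -> R) (psi : spinor) (x X : E) : 'cV[C]_2 :=
  nabla psi x X - 2^-1 *: (cliff x X *m (cliff x (grad v x) *m psi x))
  - (2^-1 * tderiv v x X)%:C *: psi x.

(* The pullback by Phi of the spin connection of g_0, on sections x |-> xi x in
   the fibre over Phi x. *)
Definition pull_nabla (Phi : E -> E) (xi : spinor) (x X : E) : 'cV[C]_2 :=
  sderiv xi x X - 2^-1 *: (cliff (Phi x) (diff_at Phi x X) *m xi x).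

(* F is the lift of Phi to a map from the spinors of Phi^* g_0 to those of g_0.
   Isometry, Clifford multiplication and connection leave a constant phase
   free; spin frames are elements of SU(2) in the trivialization above, whence
   det F = 1 and uniqueness up to sign. *)
Definition is_spin_lift (Phi : E -> E) (F : E -> 'M[C]_2) : Prop :=
  let v := conf_factor Phi in
  [/\ forall a b, smoothC (fun x => F x a b),
      forall x s t, sphere x -> hdot (F x *m s) (F x *m t) = hdot s t,
      forall x, sphere x -> \det (F x) = 1,
      forall x X, sphere x -> tangent x X ->
        F x *m conf_cliff v x X = cliff (Phi x) (diff_at Phi x X) *m F x &
      forall (psi : spinor) x X, smooth_spinor psi ->
        sphere x -> tangent x X ->
        pull_nabla Phi (fun y => F y *m psi y) x X =
        F x *m conf_nabla v psi x X].

Definition conf_act_spinor (Phi : E -> E) (F : E -> 'M[C]_2) (psi : spinor)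
    (x : E) : 'cV[C]_2 :=
  (expR (conf_factor Phi x / 2))%:C *: (invmx (F x) *m psi (Phi x)).

End Sphere.

(* Main.v *)
Require Import Defs.
From HB Require Import structures.
From mathcomp Require Import all_boot all_order all_algebra.
From mathcomp Require Import complex.
From mathcomp Require Import all_classical all_reals all_analysis.
From mathcomp Require Import measurable_realfun ring lra zify.

(* The constant solution bounds the least energy by 4 pi (1 - A/B^2 - 2 ln B).
Conversely, let V be the mean of e^(2u). Testing the first equation with 1 gives
A V <= 1, Onofri's inequality bounds the Dirichlet part of the energy below by
4 pi ln V, the spectral definition of the Dirac form makes the spinor part
nonnegative, and Bär's inequality for D psi = B e^u psi gives V >= 1/B^2. As
ln V - A V is increasing, equality holds everywhere. The Euler-Lagrange equation
of Onofri's functional then reads |psi|^2 = (B^2 - A)/B e^u, and equality in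
Bär's inequality makes psi/|psi|^2 a twistor spinor p + sigma(x) q. The Dirac
equation forces q = sigma(w) p with |w| < 1, which is the constant spinor p
transported by the Möbius map x |-> w + (1 - |w|^2) (x + w)/|x + w|^2.

Functions on the sphere are mollified with the zonal kernels ((1 + x.y)/2)^N,
which commute with the rotation fields; no Sobolev theory is used. Spinors are
written in four real components, on which sigma(x) and D act by [sg] and [Df]. *)

Set Implicit Arguments.
Unset Strict Implicit.
Unset Printing Implicit Defensive.

Import Order.TTheory GRing.Theory Num.Theory.
Import numFieldNormedType.Exports.

Local Open Scope classical_set_scope.
Local Open Scope complex_scope.
Local Open Scope ring_scope.

Local Notation "p ^S" := (sph p) (at level 2, format "p ^S").

(** The solution is weak: [D psi] is not known to be square integrable, and [psi] might vanish on a
    set of positive measure. The kernel that recovers [psi] from [D psi] is dominated by a sum of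
    zonal kernels with exponents [16^k]; since Onofri's inequality puts [rho = B e^u] in every
    [L^p], this places [rho psi] in [L^2]. Bär's inequality comes from an integral identity for
    [psi / (|psi|^2 + d)]. A term with factor [d] in it forces the indicator of the set where [psi]
    is nonzero to have zero weak gradient, which is unique continuation, and then [d] can tend to 0.
    Onofri's inequality is proved by calibration: a function of the colatitude, built from the means
    of [u], [e^u] and [e^(2u)] over parallels, tends to 0 at both poles, and its derivative is at
    most the energy of the parallel. The bound on the Dirac form needs eigenspinors. They come from
    the kernels: the Laplacian maps the [N]-th zonal convolution into the span of itself and the
    previous one, so eigenfunctions split off by induction. *)

Lemma eq_lerW (d : Order.disp_t) (T : porderType d) (x y : T) : x = y -> (x <= y)%O.
Proof. by move=> ->. Qed.

Section Main.

Variable R : realType.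
Local Notation E := 'rV[R]_3.
Local Notation mR := (measurableTypeR R).
Local Notation leb := (@lebesgue_measure R).
Local Notation leb2 := (@lebesgue_measure R \x @lebesgue_measure R)%E.
Local Notation dom := (@sph_dom R : set (mR * mR)).
Local Notation ix := (bool * bool)%type.
Local Notation s00 := (false, false).
Local Notation s01 := (false, true).
Local Notation s10 := (true, false).
Local Notation s11 := (true, true).
Local Notation V4 := (ix -> R).
Local Notation spf := (ix -> E -> R).
Local Notation ppf := (ix -> R * R -> R).

(** * Integration in spherical coordinates *)

Definition pint (F : R * R -> R) : R := \int[leb2]_(p in dom) (F p * sin p.1).

Local Notation "'\I_' p F" := (pint (fun p => F)) (at level 10, p name, F at level 9).

Definition pmeas (F : R * R -> R) : Prop := measurable_fun dom (F : mR * mR -> R).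

(** Measurability of [F] is asked for separately: integrability of [F p * sin p.1] says nothing
    about [F] where the weight vanishes. *)
Definition pL1 (F : R * R -> R) : Prop :=
 pmeas F /\ leb2.-integrable dom (fun p => (F p * sin p.1)%:E).

Definition pae (P : R * R -> Prop) : Prop :=
 {ae leb2, forall p, dom p -> P p}.

Lemma dom_meas : measurable dom.
Proof. by apply: measurableX; exact: measurable_itv. Qed.

Lemma domP (p : R * R) : dom p <-> (0 <= p.1 <= pi) /\ (0 <= p.2 <= 2 * pi).
Proof. by rewrite /sph_dom /= !in_itv /=. Qed.

Lemma dom_sin_ge0 (p : R * R) : dom p -> 0 <= sin p.1.
Proof. by move=> /domP[/andP[h1 h2] _]; apply: sin_ge0_pi; rewrite h1. Qed.

Lemma leb2_dom_lty : (leb2 dom < +oo)%E.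
Proof.
rewrite /sph_dom product_measure1E; [|exact: measurable_itv..].
change (leb `[0%R, pi]%classic * leb `[0%R, (2 * pi)%R]%classic < +oo)%E.
rewrite !lebesgue_measure_itv /= !lte_fin pi_gt0 mulr_gt0 ?pi_gt0 //=.
by rewrite -!EFinB -EFinM ltry.
Qed.

Lemma pmeas_fst (f : R -> R) : measurable_fun setT (f : mR -> mR) -> pmeas (fun p => f p.1).
Proof.
move=> mf; apply: measurable_funTS.
exact: (measurableT_comp mf measurable_fst).
Qed.

Lemma pmeas_snd (f : R -> R) : measurable_fun setT (f : mR -> mR) -> pmeas (fun p => f p.2).
Proof.
move=> mf; apply: measurable_funTS.
exact: (measurableT_comp mf measurable_snd).
Qed.

Lemma pmeas_sin : pmeas (fun p => sin p.1).
Proof. by apply: pmeas_fst; apply: continuous_measurable_fun; exact: continuous_sin. Qed.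

Lemma pmeasC (c : R) : pmeas (fun _ => c).
Proof. exact: measurable_cst. Qed.

Lemma pmeasD F G : pmeas F -> pmeas G -> pmeas (fun p => F p + G p).
Proof. exact: measurable_funD. Qed.

Lemma pmeasB F G : pmeas F -> pmeas G -> pmeas (fun p => F p - G p).
Proof. exact: measurable_funB. Qed.

Lemma pmeasM F G : pmeas F -> pmeas G -> pmeas (fun p => F p * G p).
Proof. exact: measurable_funM. Qed.

Lemma pmeasN F : pmeas F -> pmeas (fun p => - F p).
Proof. by move=> h; exact: (measurableT_comp (@oppr_measurable _ setT)). Qed.

Lemma pmeas_comp (f : R -> R) F : measurable_fun setT (f : mR -> mR) -> pmeas F -> pmeas (fun p => f (F p)).
Proof. by move=> mf mF; exact: (measurableT_comp mf mF). Qed.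

Lemma pmeas_ct (f : R -> R) F : continuous f -> pmeas F -> pmeas (fun p => f (F p)).
Proof. by move=> cf; apply: pmeas_comp; exact: continuous_measurable_fun. Qed.

Lemma eq_pmeas F G : (forall p, dom p -> F p = G p) -> pmeas F -> pmeas G.
Proof. by move=> h mF; apply: (eq_measurable_fun F) => // p /set_mem hp; exact: h. Qed.

Lemma pmeas_sum (I : Type) (s : seq I) (F : I -> R * R -> R) : (forall i, pmeas (F i)) -> pmeas (fun p => \sum_(i <- s) F i p).
Proof.
move=> h; elim: s => [|i s ih].
 by apply: (eq_pmeas _ (pmeasC 0)) => p _; rewrite big_nil.
by apply: (eq_pmeas _ (pmeasD (h i) ih)) => p _; rewrite big_cons.
Qed.

Lemma pL1_le F G : pmeas F -> (forall p, dom p -> `|F p| <= G p) -> pL1 G -> pL1 F.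
Proof.
move=> mF FG [mG iG]; split=> //.
apply: (le_integrable dom_meas _ _ iG).
- apply/measurable_EFinP; exact: pmeasM mF pmeas_sin.
- move=> p hp; rewrite !abse_EFin lee_fin !normrM ler_wpM2r //.
 by rewrite (le_trans (FG _ hp)) // ler_norm.
Qed.

Lemma pL1C (c : R) : pL1 (fun _ => c).
Proof.
split; first exact: pmeasC.
apply: (@measurable_bounded_integrable _ _ _ leb2 (fun p => c * sin p.1)).
- exact: dom_meas.
- exact: leb2_dom_lty.
- exact: pmeasM (pmeasC c) pmeas_sin.
- exists `|c|; split; first by rewrite num_real.
 move=> x hx p hp /=; rewrite normrM (le_trans _ (ltW hx)) // ler_piMr //.
 by rewrite ler_norml sin_geN1 sin_le1.
Qed.

Lemma pL1_bounded F (C : R) : pmeas F -> (forall p, dom p -> `|F p| <= C) -> pL1 F.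
Proof. by move=> mF FC; exact: (pL1_le mF FC (pL1C C)). Qed.

Lemma eqL1 F G : (forall p, dom p -> F p = G p) -> pL1 F -> pL1 G.
Proof.
move=> h [mF iF]; split; first exact: eq_pmeas mF.
by move: iF; apply: eq_integrable => //; [exact: dom_meas|move=> p /set_mem hp /=; rewrite h].
Qed.

Lemma pL1D F G : pL1 F -> pL1 G -> pL1 (fun p => F p + G p).
Proof.
move=> [mF iF] [mG iG]; split; first exact: pmeasD.
have := integrableD dom_meas iF iG; apply: eq_integrable => //; [exact: dom_meas|] => p _ /=.
by rewrite -EFinD mulrDl.
Qed.

Lemma pL1Z (c : R) F : pL1 F -> pL1 (fun p => c * F p).
Proof.
move=> [mF iF]; split; first exact: pmeasM (pmeasC c) mF.
have := integrableZl dom_meas c iF; apply: eq_integrable => //; [exact: dom_meas|] => p _ /=.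
by rewrite -EFinM mulrA.
Qed.

Lemma pL1N F : pL1 F -> pL1 (fun p => - F p).
Proof. by move/(pL1Z (-1)); apply: eqL1 => p _; rewrite mulN1r. Qed.

Lemma pL1B F G : pL1 F -> pL1 G -> pL1 (fun p => F p - G p).
Proof. by move=> h1 /pL1N h2; exact: pL1D. Qed.

Lemma pL1S (I : Type) (s : seq I) (F : I -> R * R -> R) : (forall i, pL1 (F i)) -> pL1 (fun p => \sum_(i <- s) F i p).
Proof.
move=> h; elim: s => [|i s ih].
 by apply: (eqL1 _ (pL1C 0)) => p _; rewrite big_nil.
by apply: (eqL1 _ (pL1D (h i) ih)) => p _; rewrite big_cons.
Qed.

Lemma pL1n F : pL1 F -> pL1 (fun p => `|F p|).
Proof.
move=> [mF iF]; apply: (@pL1_le _ (fun p => `|F p|)) => //.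
- exact: pmeas_ct (@norm_continuous _ _) mF.
- by move=> p _; rewrite normr_id.
- split; first exact: pmeas_ct (@norm_continuous _ _) mF.
 apply: (le_integrable dom_meas _ _ iF).
 + apply/measurable_EFinP; apply: pmeasM pmeas_sin.
  exact: pmeas_ct (@norm_continuous _ _) mF.
 + by move=> p hp; rewrite !abse_EFin lee_fin !normrM normr_id.
Qed.

Lemma pL1_Mbounded F G (C : R) : pmeas F -> (forall p, dom p -> `|F p| <= C) -> pL1 G -> pL1 (fun p => F p * G p).
Proof.
move=> mF FC iG; apply: (@pL1_le _ (fun p => C * `|G p|)).
- by apply: pmeasM => //; case: iG.
- by move=> p hp; rewrite normrM ler_wpM2r // FC.
- exact: pL1Z (pL1n iG).
Qed.

Lemma eq_pint F G : (forall p, dom p -> F p = G p) -> pint F = pint G.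
Proof. by move=> h; apply: eq_Rintegral => p /set_mem hp; rewrite h. Qed.

Local Ltac eqp := apply: eq_pint => p _.
Local Ltac eqq := apply: eq_pint => q _.

Lemma pintD F G : pL1 F -> pL1 G -> \I_p (F p + G p) = pint F + pint G.
Proof.
move=> [_ iF] [_ iG]; rewrite /pint -(RintegralD dom_meas iF iG).
by apply: eq_Rintegral => p _; rewrite mulrDl.
Qed.

Lemma pintZ (c : R) F : pL1 F -> \I_p (c * F p) = c * pint F.
Proof.
move=> [_ iF]; rewrite /pint -(RintegralZl c dom_meas iF).
by apply: eq_Rintegral => p _; rewrite mulrA.
Qed.

Lemma pintN F : pL1 F -> \I_p (- F p) = - pint F.
Proof. by move=> h; rewrite -mulN1r -pintZ //; eqp; rewrite mulN1r. Qed.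

Lemma pintB F G : pL1 F -> pL1 G -> \I_p (F p - G p) = pint F - pint G.
Proof. by move=> h1 h2; rewrite pintD ?pintN //; exact: pL1N. Qed.

Lemma pint0 : pint (fun _ => 0) = 0.
Proof.
transitivity (pint (fun _ => 0 * 0)); first by eqp; rewrite mul0r.
by rewrite pintZ ?mul0r //; exact: pL1C.
Qed.

Lemma pintS (I : Type) (s : seq I) (F : I -> R * R -> R) : (forall i, pL1 (F i)) -> \I_p (\sum_(i <- s) F i p) = \sum_(i <- s) pint (F i).
Proof.
move=> h; elim: s => [|i s ih].
 by rewrite big_nil -[RHS]pint0; eqp; rewrite big_nil.
rewrite big_cons -ih -pintD //; last exact: pL1S.
by eqp; rewrite big_cons.
Qed.

Lemma le_pint F G : pL1 F -> pL1 G -> (forall p, dom p -> F p <= G p) -> pint F <= pint G.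
Proof.
move=> [_ iF] [_ iG] FG; apply: (le_Rintegral dom_meas iF iG) => p hp.
by rewrite ler_wpM2r ?FG // dom_sin_ge0.
Qed.

Lemma pint_ge0 F : (forall p, dom p -> 0 <= F p) -> 0 <= pint F.
Proof. by move=> h; apply: Rintegral_ge0 => p hp; rewrite mulr_ge0 ?h // dom_sin_ge0. Qed.

Lemma le_norm_pint F : pL1 F -> `|pint F| <= \I_p (`|F p|).
Proof.
move=> h; have h1 := pL1n h; rewrite ler_norml -pintN //.
by apply/andP; split; apply: le_pint => //; [exact: pL1N | move=> p _; rewrite lerNl -normrN ler_norm | move=> p _; rewrite ler_norm].
Qed.

Lemma ae_eq_pint F G : pmeas F -> pmeas G -> pae (fun p => F p = G p) -> pint F = pint G.
Proof.
move=> mF mG FG; congr fine; apply: ae_eq_integral.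
- exact: dom_meas.
- apply/measurable_EFinP; exact: pmeasM mF pmeas_sin.
- apply/measurable_EFinP; exact: pmeasM mG pmeas_sin.
- by move: FG; rewrite /pae; apply: filterS => p h hp; rewrite h.
Qed.

Lemma ae_eq_pL1 F G : pmeas G -> pae (fun p => F p = G p) -> pL1 F -> pL1 G.
Proof.
move=> mG FG [mF iF]; split=> //.
apply/integrableP; split; first by apply/measurable_EFinP; exact: pmeasM mG pmeas_sin.
case/integrableP : iF => m1; congr (_ < _)%E; apply: ae_eq_integral.
- exact: dom_meas.
- exact: measurableT_comp.
- by apply: measurableT_comp => //; apply/measurable_EFinP; exact: pmeasM mG pmeas_sin.
- by move: FG; rewrite /pae; apply: filterS => p h hp; rewrite /= h.
Qed.

Lemma pint0_ae F : pL1 F -> (forall p, dom p -> 0 <= F p) -> pint F = 0 -> pae (fun p => F p * sin p.1 = 0).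
Proof.
move=> [mF iF] F0 hF.
have mFs : measurable_fun dom (fun p => (F p * sin p.1)%:E).
 by apply/measurable_EFinP; exact: pmeasM mF pmeas_sin.
have /(ae_eq_integral_abs leb2 dom_meas mFs) : (\int[leb2]_(x in dom) `|(F x * sin x.1)%:E| = 0)%E.
 have h0 : (\int[leb2]_(x in dom) (F x * sin x.1)%:E = 0)%E.
  rewrite -[LHS]fineK ?[fine _]hF //.
  by apply: integrable_fin_num => //; exact: dom_meas.
 rewrite -[RHS]h0; apply: eq_integral => p /set_mem hp.
 by rewrite abse_EFin ger0_norm // mulr_ge0 ?F0 // dom_sin_ge0.
by apply: filterS => p h hp; have [] := h hp.
Qed.

Lemma paeI P Q : pae P -> pae Q -> pae (fun p => P p /\ Q p).
Proof. by rewrite /pae => h1 h2; apply: filterS2 h1 h2 => p a b hp; split; [exact: a|exact: b]. Qed.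

Lemma paeS P Q : (forall p, dom p -> P p -> Q p) -> pae P -> pae Q.
Proof. by rewrite /pae => h; apply: filterS => p a hp; apply: h => //; exact: a. Qed.

Lemma paeT P : (forall p, dom p -> P p) -> pae P.
Proof. by move=> h; rewrite /pae; apply: aeW => p; exact: h. Qed.

(** The weight vanishes only on the two segments over the poles, which are null. Statements about
    the weighted measure thereby become statements about [leb2]. *)
Lemma pae_sin : pae (fun p => 0 < sin p.1).
Proof.
have h : leb2 ([set 0; pi] `*` `[0, 2 * pi]) = 0%E.
 rewrite product_measure1E; [|by apply: measurableU; exact: measurable_set1|exact: measurable_itv].
 change (leb [set (0 : R)%R; pi] * leb (`[0%R, (2 * pi)%R]%classic) = 0)%E.
 by rewrite (_ : leb [set (0 : R)%R; pi] = 0%E) ?mul0e //; apply: countable_lebesgue_measure0; exact: finite_set_countable.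
exists ([set 0; pi] `*` `[0, 2 * pi]); split=> //.
 by apply: measurableX; [by apply: measurableU; exact: measurable_set1|exact: measurable_itv].
move=> [t f] /= /not_implyP[/domP /= [/andP[t0 tpi] hf]] hs; split=> /=; last by rewrite in_itv.
apply: contrapT => /not_orP[/eqP n0 /eqP npi]; apply: hs; apply: sin_gt0_pi.
by rewrite !lt_neqAle t0 tpi eq_sym n0 npi.
Qed.

Lemma pint_eq0_ae F : pL1 F -> (forall p, dom p -> 0 <= F p) -> pint F = 0 -> pae (fun p => F p = 0).
Proof.
move=> h1 h2 h3; have := paeI (pint0_ae h1 h2 h3) pae_sin.
apply: paeS => p _ [/eqP]; rewrite mulf_eq0 => /orP[/eqP //|/eqP ->]; by rewrite ltxx.
Qed.

Lemma pint_dct (F_ : nat -> R * R -> R) F G : (forall n, pmeas (F_ n)) -> pmeas F ->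
 pae (fun p => F_ n p @[n --> \oo] --> F p) -> pL1 G ->
 (forall n p, dom p -> `|F_ n p| <= G p) ->
 pL1 F /\ pint (F_ n) @[n --> \oo] --> pint F.
Proof.
move=> mF_ mF cF [mG iG] hG.
have ms H : pmeas H -> measurable_fun dom (fun p => (H p * sin p.1)%:E).
 by move=> mH; apply/measurable_EFinP; exact: pmeasM mH pmeas_sin.
have [] := dominated_convergence dom_meas (fun n => ms _ (mF_ n)) (ms _ mF) _ iG _.
- move: cF; rewrite /pae; apply: filterS => p h hp.
 apply: cvg_EFin; first by near=> n.
 by apply: cvgMl; exact: h.
- apply: aeW => p n hp; rewrite abse_EFin lee_fin normrM [`|sin _|]ger0_norm; last exact: dom_sin_ge0.
 by rewrite ler_wpM2r ?hG // dom_sin_ge0.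
- move=> iF _ h; split; first by split.
 rewrite /pint /Rintegral; apply: fine_cvg; rewrite fineK //.
 by apply: integrable_fin_num => //; exact: dom_meas.
Unshelve. all: by end_near.
Qed.

Lemma pint_fatou (F_ : nat -> R * R -> R) F (C : R) : (forall n, pL1 (F_ n)) -> pmeas F ->
 (forall p, dom p -> F_ n p @[n --> \oo] --> F p) ->
 (forall n p, dom p -> 0 <= F_ n p) ->
 (forall n, pint (F_ n) <= C) -> pL1 F /\ pint F <= C.
Proof.
move=> iF_ mF cF F0 hC.
have ms H : pmeas H -> measurable_fun dom (fun p => (H p * sin p.1)%:E).
 by move=> mH; apply/measurable_EFinP; exact: pmeasM mH pmeas_sin.
have FF0 p : dom p -> 0 <= F p.
 move=> hp; rewrite -(cvg_lim _ (cF p hp)) //.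
 by apply: limr_ge; [apply: cvgP (cF p hp)|apply: nearW => n; exact: F0].
have hle : (\int[leb2]_(p in dom) (F p * sin p.1)%:E <= C%:E)%E.
 have := @fatou _ _ _ leb2 dom dom_meas (fun n p => (F_ n p * sin p.1)%:E) (fun n => ms _ (iF_ n).1) _.
 move=> h; have {}h := h _.
 have e : (\int[leb2]_(x in dom) limn_einf (fun n => (F_ n x * sin x.1)%:E) = \int[leb2]_(p in dom) (F p * sin p.1)%:E)%E.
  apply: eq_integral => p /set_mem hp; apply: (cvg_limn_einf_sup _).1.
  apply: cvg_EFin; first by near=> n.
  by apply: cvgMl; exact: cF.
 rewrite -e; apply: le_trans (h _) _.
  by move=> n p hp; rewrite lee_fin mulr_ge0 ?F0 // dom_sin_ge0.
 rewrite limn_einf_lim; apply: lime_le.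
  by apply: ereal_nondecreasing_is_cvgn; exact: nondecreasing_einfs.
 apply: nearW => n; apply: (@le_trans _ _ (\int[leb2]_(x in dom) (F_ n x * sin x.1)%:E)%E).
  by apply: ereal_inf_lbound; exists n => //=.
 rewrite -[X in (X <= _)%E]fineK ?lee_fin; first exact: hC.
 by apply: integrable_fin_num; [exact: dom_meas|exact: (iF_ n).2].
have iF : leb2.-integrable dom (fun p => (F p * sin p.1)%:E).
 apply/integrableP; split; first exact: ms.
 apply: le_lt_trans (ltry C); apply: le_trans hle.
 apply: eq_lerW; apply: eq_integral => p /set_mem hp.
 by rewrite abse_EFin ger0_norm // mulr_ge0 ?FF0 // dom_sin_ge0.
split; first by split.
rewrite /pint /Rintegral -lee_fin fineK //.
by apply: integrable_fin_num => //; exact: dom_meas.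
Unshelve. all: by end_near.
Qed.

(** * Coordinates of R^3, and differentiability from continuous partial derivatives *)

Fact o2_key : {o : 'I_3 | o = inord 2}.
Proof. by exists (inord 2). Qed.

(* An opaque name keeps unification from evaluating [inord 2]. *)
Definition o2 : 'I_3 := sval o2_key.

Lemma o2E : inord 2 = o2.
Proof. by rewrite /o2; case: o2_key. Qed.

Lemma sum3 (V : nmodType) (F : 'I_3 -> V) : \sum_(i < 3) F i = F 0 + F 1 + F o2.
Proof.
rewrite !big_ord_recl big_ord0 addr0 addrA; congr (_ + F _ + F _); apply/val_inj => //=.
by rewrite -o2E inordK.
Qed.

Lemma ord3P (i : 'I_3) : [\/ i = 0, i = 1 | i = o2].
Proof.
case: i => [[|[|[|//]]] hi]; [apply: Or31|apply: Or32|apply: Or33]; apply/val_inj => //=.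
by rewrite -o2E inordK.
Qed.

Lemma rowP3 (x y : E) : x 0 0 = y 0 0 -> x 0 1 = y 0 1 -> x 0 o2 = y 0 o2 -> x = y.
Proof. by move=> h0 h1 h2; apply/rowP => i; case: (ord3P i) => ->. Qed.

Lemma o2_neq0 : (o2 == 0 :> 'I_3) = false.
Proof. by apply/negbTE/eqP => /(congr1 val) /=; rewrite -o2E inordK. Qed.

Lemma o2_neq1 : (o2 == 1 :> 'I_3) = false.
Proof. by apply/negbTE/eqP => /(congr1 val) /=; rewrite -o2E inordK. Qed.

Lemma bvecE (i j : 'I_3) : bvec R i 0 j = (j == i)%:R.
Proof. by rewrite /bvec mxE eqxx. Qed.

Definition b3 := (bvecE, o2_neq0, o2_neq1, eqxx, (eq_sym (0 : 'I_3) o2), (eq_sym (1 : 'I_3) o2)).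

Lemma vec3E (x : E) : x = x 0 0 *: bvec R 0 + x 0 1 *: bvec R 1 + x 0 o2 *: bvec R o2.
Proof. by apply: rowP3; rewrite !mxE !b3 /= ?mulr0 ?mulr1 ?addr0 ?add0r. Qed.

Lemma dotE (x y : E) : dot x y = x 0 0 * y 0 0 + x 0 1 * y 0 1 + x 0 o2 * y 0 o2.
Proof. by rewrite /dot sum3. Qed.

Lemma dot_bvec (y : E) i : dot y (bvec R i) = y 0 i.
Proof. by rewrite dotE !bvecE; case: (ord3P i) => ->; rewrite ?b3 /=; ring. Qed.

Lemma coord_le_norm (h : E) i : `|h 0 i| <= `|h|.
Proof.
rewrite -[`|h|]/(mx_norm h) mx_normrE.
exact: (@le_bigmax _ _ _ 0 (fun ij : 'I_1 * 'I_3 => `|h ij.1 ij.2|) (0, i)).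
Qed.

Lemma line_is_derive (g : E -> R) (y v : E) (s : R) :
 derivable g (y + s *: v) v ->
 is_derive s 1 (fun r : R => g (y + r *: v)) ('D_v g (y + s *: v)).
Proof.
move=> dg.
have e : (fun h : R => h^-1 *: (((fun r : R => g (y + r *: v)) \o shift s) (h *: 1) - g (y + s *: v)))
   = (fun h : R => h^-1 *: ((g \o shift (y + s *: v)) (h *: v) - g (y + s *: v))).
 apply/funext => h /=; congr (_ *: (g _ - _)).
 by rewrite [h *: 1]mulr1 scalerDl addrCA.
apply: DeriveDef; first by rewrite /derivable e.
by rewrite /derive e.
Qed.

Lemma line_mvt (g : E -> R) (y v : E) (h : R) :
 (forall s : R, `|s| <= `|h| -> derivable g (y + s *: v) v) ->
 exists2 s : R, `|s| <= `|h| & g (y + h *: v) - g y = h * 'D_v g (y + s *: v).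
Proof.
move=> dg.
have der (s : R) : `|s| <= `|h| -> is_derive s 1 (fun r : R => g (y + r *: v)) ('D_v g (y + s *: v)).
 by move=> hs; apply: line_is_derive; exact: dg.
have cont (a b : R) : `|a| <= `|h| -> `|b| <= `|h| -> {within `[a, b], continuous (fun r : R => g (y + r *: v))}.
 move=> ha hb; apply: derivable_within_continuous => r; rewrite in_itv /= => /andP[ar rb].
 have hr : `|r| <= `|h|.
  move: ha hb; rewrite !ler_norml => /andP[a1 a2] /andP[b1 b2].
  by rewrite (le_trans a1 ar) (le_trans rb b2).
 by case: (der r hr).
have h0 : `|0 : R| <= `|h| by rewrite normr0.
have hh : `|h| <= `|h| by [].
have g0 : g y = g (y + 0 *: v) by rewrite scale0r addr0.
case: (leP 0 h) => hs.
 have hd (s : R) : s \in `]0, h[ -> is_derive s 1 (fun r : R => g (y + r *: v)) ('D_v g (y + s *: v)).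
  by rewrite in_itv /= => /andP[s0 sh]; apply: der; rewrite (ger0_norm (ltW s0)) (ger0_norm hs) ltW.
 have [s sI e] := MVT_segment hs hd (cont _ _ h0 hh).
 have hs' : `|s| <= `|h|.
  by move: sI; rewrite in_itv /= => /andP[s0 sh]; rewrite !ger0_norm.
 by exists s => //; rewrite [in LHS]g0 e subr0 mulrC.
have hd (s : R) : s \in `]h, 0[ -> is_derive s 1 (fun r : R => g (y + r *: v)) ('D_v g (y + s *: v)).
 by rewrite in_itv /= => /andP[s0 sh]; apply: der; rewrite (ler0_norm (ltW sh)) (ler0_norm (ltW hs)) lerN2 ltW.
have [s sI e] := MVT_segment (ltW hs) hd (cont _ _ hh h0).
have hs' : `|s| <= `|h|.
 by move: sI; rewrite in_itv /= => /andP[s0 sh]; rewrite !ler0_norm ?lerN2 // ltW.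
by exists s => //; rewrite [in LHS]g0 -[LHS]opprK opprB e sub0r mulrC mulNr opprK.
Qed.

Definition lin3 (d : 'I_3 -> R) (h : E) : R := \sum_(i < 3) h 0 i * d i.

Lemma lin3_is_linear d : linear (lin3 d).
Proof.
move=> a x y; rewrite /lin3 scaler_sumr -big_split /=; apply: eq_bigr => i _.
by rewrite !mxE mulrDl /GRing.scale /= mulrA.
Qed.

HB.instance Definition _ d := GRing.isLinear.Build R E R *:%R (lin3 d) (lin3_is_linear d).

Lemma lin3_continuous d : continuous (lin3 d).
Proof.
move=> x; apply: differentiable_continuous.
rewrite (_ : lin3 d = (fun h : E => h 0 0) * cst (d 0) + (fun h : E => h 0 1) * cst (d 1)
  + (fun h : E => h 0 o2) * cst (d o2)); last first.
 by apply/funext => h; rewrite /lin3 sum3.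
have k i (c : R) : differentiable ((fun h : E => h 0 i) * cst c) x.
 by apply: differentiableM; [exact: differentiable_coord|exact: differentiable_cst].
by apply: differentiableD; [apply: differentiableD|]; exact: k.
Qed.

Lemma C1_algebra (G3 G2 G1 G0 h0 h1 h2 C0 C1 C2 D0 D1 D2 : R) :
 G1 - G0 = h0 * C0 -> G2 - G1 = h1 * C1 -> G3 - G2 = h2 * C2 ->
 G3 - (G0 + (h0 * D0 + h1 * D1 + h2 * D2)) =
 h0 * (C0 - D0) + h1 * (C1 - D1) + h2 * (C2 - D2).
Proof.
move=> e0 e1 e2; have -> : G3 = h2 * C2 + (h1 * C1 + (h0 * C0 + G0)).
 by rewrite -e0 -e1 -e2 !subrK.
ring.
Qed.

Local Ltac coord_lt i h :=
 case: (ord3P i) => ->; rewrite ?b3 /= ?mulr1 ?mulr0 ?addr0 ?add0r ?normr0 // (le_lt_trans h).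

(** Join [x] to [x + h] by three segments parallel to the axes. The mean value theorem turns each
    increment into a partial derivative at a nearby point, and continuity of the partials makes each
    of the three errors at most [e / 3] times [|h|]. *)
Lemma C1_diff_expansion (g : E -> R) (x : E) :
 (\forall y \near x, forall i, derivable g y (bvec R i)) ->
 (forall i, {for x, continuous (fun y => 'D_(bvec R i) g y)}) ->
 forall e : R, 0 < e -> \forall h \near (0 : E), `|g (h + x) - (g x + lin3 (fun i => 'D_(bvec R i) g x) h)| <= e * `|h|.
Proof.
move=> dg cg e e0.
have e3 : 0 < e / 3 by rewrite divr_gt0.
have : \forall y \near x, (forall i, derivable g y (bvec R i)) /\
  forall i, `|'D_(bvec R i) g x - 'D_(bvec R i) g y| < e / 3.
 have hc i : \forall y \near x, `|'D_(bvec R i) g x - 'D_(bvec R i) g y| < e / 3.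
  by have /cvgrPdist_lt := cg i; exact.
 apply: filterS (filterI dg (filterI (hc 0) (filterI (hc 1) (hc o2)))) => y [h [h0 [h1 h2]]].
 split; first exact: h.
 by move=> i; case: (ord3P i) => ->; [exact: h0|exact: h1|exact: h2].
move=> /nbhs_ballP[r /= r0 hr].
have {}hr (y : E) : (forall i, `|y 0 i| < r) -> (forall i, derivable g (x + y) (bvec R i)) /\
  forall i, `|'D_(bvec R i) g x - 'D_(bvec R i) g (x + y)| < e / 3.
 move=> hy; apply: hr; split => // i j; rewrite -ball_normE /= !mxE opprD addNKr normrN.
 by rewrite (ord1 i); exact: hy.
apply/nbhs_ballP; exists r => //= h; rewrite -ball_normE /= sub0r normrN => hn.
have hi i : `|h 0 i| < r by rewrite (le_lt_trans (coord_le_norm h i)).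
have [s0 hs0 e0'] : exists2 s : R, `|s| <= `|h 0 0| & g (x + h 0 0 *: bvec R 0) - g x = h 0 0 * 'D_(bvec R 0) g (x + s *: bvec R 0).
 apply: line_mvt => s hs; apply: (hr _ _).1 => i; rewrite !mxE b3.
 by coord_lt i hs.
have [s1 hs1 e1'] : exists2 s : R, `|s| <= `|h 0 1| & g (x + h 0 0 *: bvec R 0 + h 0 1 *: bvec R 1) - g (x + h 0 0 *: bvec R 0) = h 0 1 * 'D_(bvec R 1) g (x + h 0 0 *: bvec R 0 + s *: bvec R 1).
 apply: line_mvt => s hs; rewrite -addrA; apply: (hr _ _).1 => i; rewrite !mxE !b3.
 by coord_lt i hs.
have [s2 hs2 e2'] : exists2 s : R, `|s| <= `|h 0 o2| & g (x + h 0 0 *: bvec R 0 + h 0 1 *: bvec R 1 + h 0 o2 *: bvec R o2) - g (x + h 0 0 *: bvec R 0 + h 0 1 *: bvec R 1) = h 0 o2 * 'D_(bvec R o2) g (x + h 0 0 *: bvec R 0 + h 0 1 *: bvec R 1 + s *: bvec R o2).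
 apply: line_mvt => s hs; rewrite -!addrA; apply: (hr _ _).1 => i; rewrite !mxE !b3.
 by coord_lt i hs.
have E0 : `|'D_(bvec R 0) g x - 'D_(bvec R 0) g (x + s0 *: bvec R 0)| < e / 3.
 apply: (hr _ _).2 => i; rewrite !mxE b3.
 by coord_lt i hs0.
have E1 : `|'D_(bvec R 1) g x - 'D_(bvec R 1) g (x + h 0 0 *: bvec R 0 + s1 *: bvec R 1)| < e / 3.
 rewrite -!addrA; apply: (hr _ _).2 => i; rewrite !mxE !b3.
 by coord_lt i hs1.
have E2 : `|'D_(bvec R o2) g x - 'D_(bvec R o2) g (x + h 0 0 *: bvec R 0 + h 0 1 *: bvec R 1 + s2 *: bvec R o2)| < e / 3.
 rewrite -!addrA; apply: (hr _ _).2 => i; rewrite !mxE !b3.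
 by coord_lt i hs2.
rewrite /lin3 sum3.
have -> : g (h + x) = g (x + h 0 0 *: bvec R 0 + h 0 1 *: bvec R 1 + h 0 o2 *: bvec R o2).
 by rewrite addrC {1}(vec3E h) !addrA.
set D0 := 'D_(bvec R 0) g x in E0 *; set D1 := 'D_(bvec R 1) g x in E1 *; set D2 := 'D_(bvec R o2) g x in E2 *.
set C0 := 'D_(bvec R 0) g _ in E0 e0' *; set C1 := 'D_(bvec R 1) g _ in E1 e1' *; set C2 := 'D_(bvec R o2) g _ in E2 e2' *.
set G3 := g _ in e2' *; set G2 := g _ in e2' e1' *; set G1 := g _ in e1' e0'.
rewrite (C1_algebra _ _ _ e0' e1' e2').
have k i (a b : R) : `|a - b| < e / 3 -> `|h 0 i * (b - a)| <= `|h| * (e / 3).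
 by move=> hab; rewrite normrM ler_pM ?coord_le_norm // distrC ltW.
apply: le_trans (ler_normD _ _) _; apply: le_trans (lerD (ler_normD _ _) (lexx _)) _.
apply: le_trans (lerD (lerD (k 0 _ _ E0) (k 1 _ _ E1)) (k o2 _ _ E2)) _.
by rewrite -[`|id h|]/`|h| le_eqVlt; apply/orP; left; apply/eqP; field.
Qed.

(** [Ck] speaks of directional derivatives, whereas linearity in the direction and the chain rule
    along curves on the sphere rest on the full differential. *)
Lemma C1_differentiable (g : E -> R) (x : E) :
 (\forall y \near x, forall i, derivable g y (bvec R i)) ->
 (forall i, {for x, continuous (fun y => 'D_(bvec R i) g y)}) ->
 differentiable g x.
Proof.
move=> dg cg; have h := C1_diff_expansion dg cg.
have e := @diff_unique R E R g (lin3 (fun i => 'D_(bvec R i) g x)) x (@lin3_continuous _).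
apply/diff_locallyP; rewrite e; last by apply/eqaddoP => eps eps0; exact: h.
by split; [exact: lin3_continuous|apply/eqaddoP => eps eps0; exact: h].
Qed.

(** * Rules for derivatives in one variable and for continuity at a point *)

Section Derive1.

Implicit Types (f g : R -> R).

(* Not a class, so that no instance is searched for while a derivative is
 being computed. *)
Definition dva f (t a : R) : Prop := is_derive t 1 f a.

Lemma dvD f g (t a b : R) : dva f t a -> dva g t b -> dva (fun s => f s + g s) t (a + b).
Proof. by move=> h1 h2; exact: is_deriveD. Qed.

Lemma dvN f (t a : R) : dva f t a -> dva (fun s => - f s) t (- a).
Proof. by move=> h1; exact: is_deriveN. Qed.

Lemma dvB f g (t a b : R) : dva f t a -> dva g t b -> dva (fun s => f s - g s) t (a - b).
Proof. by move=> h1 h2; exact: is_deriveB. Qed.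

Lemma dvM f g (t a b : R) : dva f t a -> dva g t b ->
 dva (fun s => f s * g s) t (a * g t + f t * b).
Proof.
move=> h1 h2; have := is_deriveM h1 h2.
by rewrite addrC [g t *: a]mulrC.
Qed.

Lemma dvC (c t : R) : dva (fun _ : R => c) t 0.
Proof. exact: is_derive_cst. Qed.

Lemma dvX (t : R) : dva (fun s : R => s) t 1.
Proof. exact: is_derive_id. Qed.

Lemma dvV f (t a : R) : f t != 0 -> dva f t a -> dva (fun s => (f s)^-1) t (- (f t ^- 2 * a)).
Proof. by move=> h0 h1; rewrite -mulNr; exact: is_deriveV. Qed.

Lemma dv_comp f g (t a b : R) : dva f (g t) a -> dva g t b -> dva (fun s => f (g s)) t (a * b).
Proof. by move=> h1 h2; exact: is_derive1_comp. Qed.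

Lemma dv_sqrt f (t a : R) : 0 < f t -> dva f t a ->
 dva (fun s => Num.sqrt (f s)) t ((2 * Num.sqrt (f t))^-1 * a).
Proof. by move=> h0 h1; apply: (@dv_comp Num.sqrt) => //; exact: is_derive1_sqrt. Qed.

Lemma dv_eq f (t a b : R) : dva f t a -> a = b -> dva f t b.
Proof. by move=> h <-. Qed.

(** The homogeneous extensions of two functions that agree on the sphere agree away from the origin,
    so their derivatives are compared through germs. *)
Lemma near_is_derive (V : normedModType R) (F G : V -> R) (x v : V) (a : R) :
 (\forall y \near x, F y = G y) -> is_derive x v F a -> is_derive x v G a.
Proof.
move=> FG [dF <-]; have e : 'D_v G x = 'D_v F x.
 by apply/esym/near_eq_derive.
split; last exact: e.
have FGx : F x = G x by exact: nbhs_singleton FG.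
move: dF; rewrite /derivable => dF.
have: (fun h : R => h^-1 *: ((F \o shift x) (h *: v) - F x)) @ 0^' --> (lim ((fun h : R => h^-1 *: ((F \o shift x) (h *: v) - F x)) @ 0^') : R).
 exact: dF.
move=> cF; apply/cvg_ex; exists (lim ((fun h : R => h^-1 *: ((F \o shift x) (h *: v) - F x)) @ 0^')).
apply: cvg_trans cF; apply: near_eq_cvg.
have c0 : (fun h : R => h *: v + x) @ 0^' --> x.
 apply: cvg_within_filter.
 have : (fun h : R => h *: v + x) h @[h --> (0 : R)] --> (0 : R) *: v + x.
  by apply: cvgD; [apply: cvgZr_tmp; exact: cvg_id|exact: cvg_cst].
 by rewrite scale0r add0r.
have H : \forall h \near (0 : R)^', F (h *: v + x) = G (h *: v + x) by exact: c0 _ FG.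
by apply: filterS H => h /= ->; rewrite FGx.
Qed.

Lemma line_is_deriveP (V : normedModType R) (g : V -> R) (y v : V) (a : R) :
 dva (fun r : R => g (y + r *: v)) 0 a <-> is_derive y v g a.
Proof.
have e : (fun h : R => h^-1 *: (((fun r : R => g (y + r *: v)) \o shift 0) (h *: 1) - g (y + 0 *: v)))
   = (fun h : R => h^-1 *: ((g \o shift y) (h *: v) - g y)).
 apply/funext => h /=; rewrite scale0r addr0.
 by rewrite addr0 [h *: 1]mulr1 [y + _]addrC.
split=> -[h1 h2]; split.
- by move: h1; rewrite /derivable e.
- by move: h2; rewrite /derive e.
- by move: h1; rewrite /derivable e.
- by move: h2; rewrite /derive e.
Qed.

End Derive1.

Section ContinuityRules.

Variables (V : normedModType R).
Implicit Types (f g : V -> R) (x : V).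

Definition ctat f x : Prop := {for x, continuous f}.

Lemma ctC c x : ctat (fun _ => c) x.
Proof. exact: cst_continuous. Qed.

Lemma ctD f g x : ctat f x -> ctat g x -> ctat (fun y => f y + g y) x.
Proof. by move=> h1 h2; apply: cvgD; [exact: h1|exact: h2]. Qed.

Lemma ctM f g x : ctat f x -> ctat g x -> ctat (fun y => f y * g y) x.
Proof. by move=> h1 h2; apply: cvgM; [exact: h1|exact: h2]. Qed.

Lemma ctV f x : f x != 0 -> ctat f x -> ctat (fun y => (f y)^-1) x.
Proof. by move=> h1 h2; apply: cvgV; [exact: h1|exact: h2]. Qed.

Lemma ctX f x n : ctat f x -> ctat (fun y => f y ^+ n) x.
Proof.
move=> h; elim: n => [|n ih]; first exact: ctC.
by rewrite (_ : (fun y => _) = fun y => f y * f y ^+ n); [exact: ctM|apply/funext => y; rewrite exprS].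
Qed.

Lemma ct_comp (h : R -> R) f x : continuous h -> ctat f x -> ctat (fun y => h (f y)) x.
Proof. by move=> ch cf; apply: (@continuous_comp _ _ _ f h) => //; exact: ch. Qed.

Lemma ct_near f g x : (\forall y \near x, f y = g y) -> ctat f x -> ctat g x.
Proof.
move=> fg cf; rewrite /ctat /prop_for /continuous_at -(nbhs_singleton fg).
by apply: cvg_trans cf; exact: near_eq_cvg.
Qed.

End ContinuityRules.

(** * Differential calculus on the sphere *)

Definition rad (y : E) : R := Num.sqrt (dot y y).

Definition unitv (y : E) : E := (rad y)^-1 *: y.

Lemma dotC (x y : E) : dot x y = dot y x.
Proof. by rewrite /dot; apply: eq_bigr => i _; rewrite mulrC. Qed.

Lemma dotDl (x y z : E) : dot (x + y) z = dot x z + dot y z.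
Proof. by rewrite !dotE !mxE; ring. Qed.

Lemma dotDr (x y z : E) : dot z (x + y) = dot z x + dot z y.
Proof. by rewrite !dotE !mxE; ring. Qed.

Lemma dotZl a (x z : E) : dot (a *: x) z = a * dot x z.
Proof. by rewrite !dotE !mxE; ring. Qed.

Lemma dotZr a (x z : E) : dot z (a *: x) = a * dot z x.
Proof. by rewrite !dotE !mxE; ring. Qed.

Lemma dot_ge0 (x : E) : 0 <= dot x x.
Proof. by rewrite dotE !addr_ge0 // -expr2 sqr_ge0. Qed.

Lemma dot_gt0 (x : E) : x != 0 -> 0 < dot x x.
Proof.
move=> x0; rewrite lt_neqAle dot_ge0 andbT eq_sym; apply: contraNneq x0.
rewrite dotE -!expr2 => /eqP; rewrite !paddr_eq0 ?addr_ge0 ?sqr_ge0 // !sqrf_eq0.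
by move=> /andP[/andP[/eqP h0 /eqP h1] /eqP h2]; apply/eqP/rowP3; rewrite mxE.
Qed.

Lemma rad_gt0 (x : E) : x != 0 -> 0 < rad x.
Proof. by move=> x0; rewrite sqrtr_gt0 dot_gt0. Qed.

Lemma rad_sqr (x : E) : rad x ^+ 2 = dot x x.
Proof. by rewrite sqr_sqrtr // dot_ge0. Qed.

Lemma sphere0 (x : E) : sphere x -> x != 0.
Proof.
move=> hx; apply/eqP => x0; move: hx; rewrite /sphere /= x0 dotE !mxE.
by rewrite !mulr0 !addr0 => /esym/eqP; rewrite oner_eq0.
Qed.

Lemma rad_sphere (x : E) : sphere x -> rad x = 1.
Proof. by rewrite /sphere /rad /= => ->; rewrite sqrtr1. Qed.

Lemma unitv_sphere (x : E) : x != 0 -> sphere (unitv x).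
Proof.
move=> x0; rewrite /sphere /= dotZl dotZr -rad_sqr.
by have := rad_gt0 x0; move=> h; field; rewrite lt0r_neq0.
Qed.

Lemma unitv_id (x : E) : sphere x -> unitv x = x.
Proof. by move=> hx; rewrite /unitv rad_sphere // invr1 scale1r. Qed.

Lemma hextE (T : Type) (f : E -> T) (y : E) : hext f y = f (unitv y).
Proof. by []. Qed.

Lemma hext_sphere (T : Type) (f : E -> T) (y : E) : sphere y -> hext f y = f y.
Proof. by move=> h; rewrite hextE unitv_id. Qed.

Lemma near_neq0 (x : E) : x != 0 -> \forall y \near x, y != 0.
Proof.
move=> x0; apply: (@cvgr_neq0 _ _ _ (nbhs x) _ id x) => //; exact: cvg_id.
Qed.

Lemma dv_coord (y v : E) i : dva (fun r : R => (y + r *: v) 0 i) 0 (v 0 i).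
Proof.
have e : (fun r : R => (y + r *: v) 0 i) = (fun r => y 0 i + r * v 0 i) by apply/funext => r; rewrite !mxE.
rewrite e; apply: dv_eq; first by apply: dvD; [exact: dvC|apply: dvM; [exact: dvX|exact: dvC]].
by rewrite mulr0 addr0 add0r mul1r.
Qed.

Lemma dv_dot (y v : E) : dva (fun r : R => dot (y + r *: v) (y + r *: v)) 0 (2 * dot y v).
Proof.
have e : (fun r : R => dot (y + r *: v) (y + r *: v)) = (fun r => dot y y + r * (2 * dot y v + r * dot v v)).
 by apply/funext => r; rewrite !dotDl !dotDr !dotZl !dotZr (dotC v y); ring.
rewrite e; apply: dv_eq.
 apply: dvD; first exact: dvC.
 by apply: dvM; [exact: dvX|apply: dvD; [exact: dvC|apply: dvM; [exact: dvX|exact: dvC]]].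
by rewrite /=; ring.
Qed.

Lemma dv_radV (y v : E) : y != 0 -> is_derive y v (fun y => (rad y)^-1) (- (dot y v) * (rad y)^-1 ^+ 3).
Proof.
move=> y0; apply/line_is_deriveP.
have h0 := rad_gt0 y0.
have d0 : 0 < dot (y + (0 : R) *: v) (y + (0 : R) *: v) by rewrite scale0r addr0 dot_gt0.
apply: dv_eq.
 apply: dvV; last by apply: dv_sqrt; [exact: d0|exact: dv_dot].
 by rewrite scale0r addr0 lt0r_neq0.
rewrite /= scale0r addr0 -/(rad y); field; exact: lt0r_neq0.
Qed.

(** The test functions of the whole proof. The class is stable under the rotation fields, its
    members are smooth, and it contains the kernels, the mollified functions, the eigenspinors built
    from them and the Möbius maps. All side conditions concern the sphere alone. *)
Inductive Alg : (E -> R) -> Prop :=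
| AlgC c : Alg (fun _ => c)
| AlgX i : Alg (fun x => x 0 i)
| AlgD f g : Alg f -> Alg g -> Alg (fun x => f x + g x)
| AlgM f g : Alg f -> Alg g -> Alg (fun x => f x * g x)
| AlgV f : Alg f -> (forall x, sphere x -> f x != 0) -> Alg (fun x => (f x)^-1)
| Alg_sqr f : Alg f -> (forall x, sphere x -> 0 < f x) -> Alg (fun x => Num.sqrt (f x))
| Alg_ext f g : Alg f -> (forall x, sphere x -> f x = g x) -> Alg g.

Lemma AlgN f : Alg f -> Alg (fun x => - f x).
Proof.
move=> h; apply: Alg_ext; first exact: AlgM (AlgC (-1)) h.
by move=> x _; rewrite /= mulN1r.
Qed.

Lemma AlgB f g : Alg f -> Alg g -> Alg (fun x => f x - g x).
Proof. by move=> h1 h2; exact: AlgD h1 (AlgN h2). Qed.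

Lemma AlgXn f n : Alg f -> Alg (fun x => f x ^+ n).
Proof.
move=> h; elim: n => [|n ih]; first exact: AlgC 1.
by apply: Alg_ext (AlgM h ih) _ => x _; rewrite exprS.
Qed.

Lemma Alg_sum (I : Type) (s : seq I) (F : I -> E -> R) :
 (forall i, Alg (F i)) -> Alg (fun x => \sum_(i <- s) F i x).
Proof.
move=> h; elim: s => [|i s ih].
 by apply: Alg_ext (AlgC 0) _ => x _; rewrite big_nil.
by apply: Alg_ext (AlgD (h i) ih) _ => x _; rewrite big_cons.
Qed.

(** The derivative of a 0-homogeneous function is homogeneous of degree -1, hence [(rad y)^-1] times
    a function of the direction. The induction shows that this function is again in [Alg]. *)
Lemma Alg_deriv f : Alg f -> forall v, exists2 h, Alg h &
 forall y, y != 0 -> is_derive y v (hext f) ((rad y)^-1 * h (unitv y)).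
Proof.
elim=> {f} [c v|i v|f g _ hf _ hg v|f g af hf ag hg v|f af hf f0 v|f af hf f0 v|f g af hf fg v].
- exists (fun _ => 0); first exact: AlgC.
 by move=> y _; rewrite mulr0; exact: is_derive_cst.
(* The derivative of a coordinate is the matching entry of the projection of [v] onto the tangent
   plane at [x]. *)
- exists (fun x => v 0 i - x 0 i * (x 0 0 * v 0 0 + x 0 1 * v 0 1 + x 0 o2 * v 0 o2)).
  apply: AlgB; first exact: AlgC.
  apply: AlgM; first exact: AlgX.
  by apply: AlgD; [apply: AlgD|]; apply: AlgM; (exact: AlgX || exact: AlgC).
 move=> y y0; have e : hext (fun x : E => x 0 i) = (fun y => (rad y)^-1 * y 0 i).
  by apply/funext => z; rewrite /hext mxE.
 rewrite e; apply: is_derive_eq.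
  apply: is_deriveM; first exact: dv_radV.
  by apply/line_is_deriveP; exact: dv_coord.
 rewrite /= /unitv !mxE /GRing.scale /= dotE.
 have := lt0r_neq0 (rad_gt0 y0); set r := rad y => r0; field; exact: r0.
- have [hf' a1 d1] := hf v; have [hg' a2 d2] := hg v.
 exists (fun x => hf' x + hg' x); first exact: AlgD.
 by move=> y y0; rewrite mulrDr; apply: is_deriveD; [exact: d1|exact: d2].
- have [hf' a1 d1] := hf v; have [hg' a2 d2] := hg v.
 exists (fun x => f x * hg' x + g x * hf' x); first by apply: AlgD; exact: AlgM.
 move=> y y0; apply: is_derive_eq; first by apply: is_deriveM; [exact: d1|exact: d2].
 by rewrite /= /hext /unitv /rad /GRing.scale /=; ring.
- have [hf' a1 d1] := hf v.
 exists (fun x => - ((f x)^-1 ^+ 2 * hf' x)).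
  by apply: AlgN; apply: AlgM => //; apply: AlgXn; exact: AlgV.
 move=> y y0; apply/line_is_deriveP.
 have fy0 : hext f (y + (0 : R) *: v) != 0 by rewrite scale0r addr0 hextE f0 //; exact: unitv_sphere.
 apply: dv_eq.
  by apply: (@dvV (fun r => hext f (y + r *: v))) => //; apply/line_is_deriveP; exact: d1.
 by rewrite /= scale0r addr0 hextE exprVn; ring.
- have [hf' a1 d1] := hf v.
 exists (fun x => (2 * Num.sqrt (f x))^-1 * hf' x).
  apply: AlgM => //; apply: AlgV.
   by apply: AlgM; [exact: AlgC|exact: Alg_sqr].
  by move=> x hx; rewrite mulf_neq0 ?pnatr_eq0 // lt0r_neq0 // sqrtr_gt0 f0.
 move=> y y0; apply/line_is_deriveP.
 have fy0 : 0 < hext f (y + (0 : R) *: v) by rewrite scale0r addr0 hextE f0 //; exact: unitv_sphere.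
 apply: dv_eq.
  by apply: (@dv_sqrt (fun r => hext f (y + r *: v))) => //; apply/line_is_deriveP; exact: d1.
 by rewrite /= scale0r addr0 hextE; ring.
- have [hf' a1 d1] := hf v; exists hf' => // y y0.
 apply: near_is_derive (d1 y y0); apply: filterS (near_neq0 y0) => z z0.
 by rewrite !hextE fg //; exact: unitv_sphere.
Qed.

Lemma Alg_powrad_deriv f (m : nat) (g : E -> R) v : Alg f ->
 (forall y, y != 0 -> g y = (rad y)^-1 ^+ m * f (unitv y)) ->
 exists2 h, Alg h & forall y, y != 0 -> is_derive y v g ((rad y)^-1 ^+ m.+1 * h (unitv y)).
Proof.
move=> af hg; have [h ah dh] := Alg_deriv af v.
exists (fun x => h x - m%:R * (x 0 0 * v 0 0 + x 0 1 * v 0 1 + x 0 o2 * v 0 o2) * f x).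
 apply: AlgB => //; apply: AlgM => //; apply: AlgM; first exact: AlgC.
 by apply: AlgD; [apply: AlgD|]; apply: AlgM; (exact: AlgX || exact: AlgC).
move=> y y0; apply: (@near_is_derive _ ((fun y => (rad y)^-1) ^+ m * hext f)).
 by apply: filterS (near_neq0 y0) => z z0; rewrite hg // exprfctE.
apply: is_derive_eq.
 by apply: is_deriveM; [apply: is_deriveX; exact: dv_radV|exact: dh].
rewrite /= !hextE /unitv !mxE /GRing.scale /= dotE exprfctE /=.
have := lt0r_neq0 (rad_gt0 y0); set r := rad y => r0.
case: m hg => [|m] _ /=; first by field; exact: r0.
by rewrite !exprS; field; exact: r0.
Qed.

Lemma ct_coord (x : E) i : ctat (fun y : E => y 0 i) x.
Proof. exact: differentiable_continuous (differentiable_coord x 0 i). Qed.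

Lemma ct_radV (x : E) : x != 0 -> ctat (fun y => (rad y)^-1) x.
Proof.
move=> x0; apply: ctV; first by rewrite lt0r_neq0 // rad_gt0.
apply: ct_comp; first exact: sqrt_continuous.
rewrite (_ : (fun y : E => dot y y) = fun y => y 0 0 * y 0 0 + y 0 1 * y 0 1 + y 0 o2 * y 0 o2); last first.
 by apply/funext => y; rewrite dotE.
by apply: ctD; [apply: ctD|]; apply: ctM; exact: ct_coord.
Qed.

Lemma Alg_hext_continuous f (x : E) : Alg f -> x != 0 -> ctat (hext f) x.
Proof.
move=> af x0; elim: af => {f} [c|i|f g _ hf _ hg|f g af hf ag hg|f af hf f0|f af hf f0|f g af hf fg].
- exact: ctC.
- have e : hext (fun x : E => x 0 i) = (fun y => (rad y)^-1 * y 0 i).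
  by apply/funext => z; rewrite /hext mxE.
 by rewrite e; apply: ctM; [exact: ct_radV|exact: ct_coord].
- by apply: ctD; [exact: hf|exact: hg].
- by apply: ctM; [exact: hf|exact: hg].
- by apply: ctV; [apply: f0; exact: unitv_sphere|exact: hf].
- by apply: ct_comp; [exact: sqrt_continuous|exact: hf].
- apply: ct_near hf; apply: filterS (near_neq0 x0) => z z0.
 by rewrite !hextE fg //; exact: unitv_sphere.
Qed.

(** Each derivative raises the power of [(rad y)^-1] by one, so the induction on [k] has to run over
    all powers [m] at once. *)
Lemma Alg_powrad_Ck (k m : nat) f (g : E -> R) : Alg f ->
 (forall y, y != 0 -> g y = (rad y)^-1 ^+ m * f (unitv y)) -> Ck k g.
Proof.
elim: k f m g => [|k ih] f m g af hg /=.
 move=> x x0; apply: (@ct_near _ (fun y => (rad y)^-1 ^+ m * hext f y)).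
  by apply: filterS (near_neq0 x0) => z z0; rewrite hg.
 by apply: ctM; [apply: ctX; exact: ct_radV|exact: Alg_hext_continuous].
split=> [x v x0|v]; have [h ah dh] := Alg_powrad_deriv v af hg; first by case: (dh x x0).
by apply: (ih h m.+1) => // y y0; case: (dh y y0).
Qed.

Lemma Alg_smooth f : Alg f -> smooth f.
Proof. by move=> af k; apply: (@Alg_powrad_Ck k 0 f) => // y y0; rewrite expr0 mul1r. Qed.

(** Eigenfamilies and test pairs are smooth without being in [Alg]; one continuous derivative is
    what integration by parts against them uses. *)
Definition C1s (f : E -> R) : Prop := Ck 1 (hext f).

Lemma smooth_C1s f : smooth f -> C1s f.
Proof. by move=> h; exact: h 1%N. Qed.

Lemma AlgC1 f : Alg f -> C1s f.
Proof. by move=> /Alg_smooth/smooth_C1s. Qed.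

Lemma C1s_differentiable f (x : E) : C1s f -> x != 0 -> differentiable (hext f) x.
Proof.
move=> [d c] x0; apply: C1_differentiable; last by move=> i; exact: c.
by apply: filterS (near_neq0 x0) => y y0 i; exact: d.
Qed.

Lemma C1s_ct f (x : E) : C1s f -> x != 0 -> ctat (hext f) x.
Proof. by move=> h x0; apply: differentiable_continuous; exact: C1s_differentiable. Qed.

Lemma C1s_ctD f (x v : E) : C1s f -> x != 0 -> ctat ('D_v (hext f)) x.
Proof. by move=> [_ h] x0; exact: h. Qed.

Lemma C1s_is_derive f (x v : E) : C1s f -> x != 0 -> is_derive x v (hext f) (tderiv f x v).
Proof. by move=> [d _] x0; apply/derivableP; exact: d. Qed.

Lemma C1sC c : C1s (fun _ => c).
Proof. exact: AlgC1 (AlgC c). Qed.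

Lemma tderiv_eq f (x v : E) a : is_derive x v (hext f) a -> tderiv f x v = a.
Proof. by case. Qed.

Lemma tderivD f g (x v : E) : C1s f -> C1s g -> x != 0 ->
 tderiv (fun y => f y + g y) x v = tderiv f x v + tderiv g x v.
Proof. by move=> cf cg x0; apply: tderiv_eq; apply: is_deriveD; exact: C1s_is_derive. Qed.

Lemma tderivM f g (x v : E) : C1s f -> C1s g -> x != 0 ->
 tderiv (fun y => f y * g y) x v = tderiv f x v * hext g x + hext f x * tderiv g x v.
Proof.
move=> cf cg x0; apply: tderiv_eq; apply: is_derive_eq.
 by apply: is_deriveM; exact: C1s_is_derive.
by rewrite addrC /GRing.scale /=; congr (_ + _); rewrite mulrC.
Qed.

Lemma C1sD f g : C1s f -> C1s g -> C1s (fun y => f y + g y).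
Proof.
move=> cf cg; split=> [x v x0|v x x0].
 by apply: derivableD; [exact: cf.1|exact: cg.1].
apply: (@ct_near _ (fun y => 'D_v (hext f) y + 'D_v (hext g) y)).
 by apply: filterS (near_neq0 x0) => y y0; rewrite -[RHS]/(tderiv _ y v) tderivD.
by apply: ctD; exact: C1s_ctD.
Qed.

Lemma C1sM f g : C1s f -> C1s g -> C1s (fun y => f y * g y).
Proof.
move=> cf cg; split=> [x v x0|v x x0].
 by apply: derivableM; [exact: cf.1|exact: cg.1].
apply: (@ct_near _ (fun y => 'D_v (hext f) y * hext g y + hext f y * 'D_v (hext g) y)).
 by apply: filterS (near_neq0 x0) => y y0; rewrite -[RHS]/(tderiv _ y v) tderivM.
by apply: ctD; apply: ctM; (exact: C1s_ctD || exact: C1s_ct).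
Qed.

Lemma C1sN f : C1s f -> C1s (fun y => - f y).
Proof.
move=> h; rewrite (_ : (fun y => _) = fun y => -1 * f y); last by apply/funext => y; rewrite mulN1r.
exact: C1sM (C1sC _) h.
Qed.

Lemma hext_eq (f g : E -> R) : (forall x, sphere x -> f x = g x) -> forall y : E, y != 0 -> hext f y = hext g y.
Proof. by move=> fg y y0; rewrite !hextE fg //; exact: unitv_sphere. Qed.

Lemma tderiv_ext f g (x v : E) : (forall x, sphere x -> f x = g x) -> x != 0 ->
 tderiv f x v = tderiv g x v.
Proof.
move=> fg x0; apply: near_eq_derive.
by apply: filterS (near_neq0 x0) => y y0; exact: hext_eq.
Qed.

Lemma C1s_ext f g : (forall x, sphere x -> f x = g x) -> C1s f -> C1s g.
Proof.
move=> fg [d c]; split=> [x v x0|v x x0].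
 have := @near_is_derive _ (hext f) (hext g) x v ('D_v (hext f) x).
 case=> //; last by apply/derivableP; exact: d.
 by apply: filterS (near_neq0 x0) => y y0; exact: hext_eq.
apply: ct_near (c v x x0); apply: filterS (near_neq0 x0) => y y0.
exact: tderiv_ext.
Qed.

Lemma tderiv_lin f (x X : E) : C1s f -> x != 0 ->
 tderiv f x X = X 0 0 * tderiv f x (bvec R 0) + X 0 1 * tderiv f x (bvec R 1) + X 0 o2 * tderiv f x (bvec R o2).
Proof.
move=> cf x0; have d := C1s_differentiable cf x0.
by rewrite /tderiv !deriveE // {1}(vec3E X) !linearD !linearZ.
Qed.

Lemma tderiv_radial f (x : E) : x != 0 -> tderiv f x x = 0.
Proof.
move=> x0; apply: tderiv_eq; apply/line_is_deriveP.
apply: (@near_is_derive _ (fun _ : R => hext f x)).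
have : \forall r \near (0 : R), -1 < r by apply: lt_nbhsr; rewrite ltrN10.
apply: filterS => r hr; have r1 : 0 < 1 + r by rewrite -ltrBlDl sub0r.
have -> : x + r *: x = (1 + r) *: x by rewrite scalerDl scale1r.
rewrite !hextE; congr f; rewrite /unitv /rad dotZl dotZr mulrA -expr2 sqrtrM ?sqr_ge0 // sqrtr_sqr.
rewrite (gtr0_norm r1) scalerA; congr (_ *: _).
have := lt0r_neq0 (rad_gt0 x0); rewrite /rad => h; field.
by rewrite h lt0r_neq0.
Qed.

Lemma curve_deriv f (c : R -> E) (c' : E) (t : R) : C1s f -> c t != 0 ->
 (forall i, dva (fun s => c s 0 i) t (c' 0 i)) ->
 dva (fun s => hext f (c s)) t (tderiv f (c t) c').
Proof.
move=> cf c0 hc.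
have dc : derivable c t 1 by apply/derivable_mxP => i j; rewrite (ord1 i); case: (hc j).
have ec : 'D_1 c t = c'.
 by rewrite derive_mx //; apply/rowP => j; rewrite mxE; case: (hc j).
have df := C1s_differentiable cf c0.
have dct : differentiable c t by apply/derivable1_diffP.
have dfc : differentiable (hext f \o c) t by exact: differentiable_comp.
split; first by apply: diff_derivable.
have e1 := deriveE (1 : R) dfc; have e3 : 'd c t 1 = c' by rewrite -ec deriveE.
by rewrite [LHS]e1 (diff_comp dct df) /= e3 /tderiv deriveE.
Qed.

(** * Fubini's theorem for continuous functions on rectangles *)

Lemma open_measurable2 (U : set (R * R)) : open U -> measurable (U : set (mR * mR)).
Proof.
move=> oU.
(* Boxes with rational corners form a countable family, so an open set is a countable union of
   measurable boxes. *)
pose box (q : (rat * rat) * (rat * rat)) : set (mR * mR) :=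
 `]ratr q.1.1, ratr q.1.2[%classic `*` `]ratr q.2.1, ratr q.2.2[%classic.
have -> : U = \bigcup_(q in [set q | box q `<=` U]) box q.
 apply/seteqP; split; last by move=> p [q /= hq]; exact: hq.
 move=> [x y] Uxy.
 have /nbhs_ballP[e /= e0 he] : nbhs (x, y) U by rewrite nbhsE /=; exists U.
 have ltxe (z : R) : z - e < z by rewrite ltrBlDr ltrDl.
 have ltex (z : R) : z < z + e by rewrite ltrDl.
 have [a] := rat_in_itvoo (ltxe x); rewrite in_itv /= => /andP[a1 a2].
 have [b] := rat_in_itvoo (ltex x); rewrite in_itv /= => /andP[b1 b2].
 have [c] := rat_in_itvoo (ltxe y); rewrite in_itv /= => /andP[c1 c2].
 have [d] := rat_in_itvoo (ltex y); rewrite in_itv /= => /andP[d1 d2].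
 exists ((a, b), (c, d)) => /=; last by rewrite /box /= !in_itv /= a2 b1 c2 d1.
 move=> [z w]; rewrite /box /= !in_itv /= => -[/andP[az zb] /andP[cw wd]]; apply: he.
 split; rewrite /= -ball_normE /= ltr_distlC.
  by rewrite (lt_trans a1 az) (lt_trans zb b2).
 by rewrite (lt_trans c1 cw) (lt_trans wd d2).
rewrite bigcup_mkcond.
have mb q : measurable (if q \in [set q | box q `<=` U] then box q else set0).
 by case: ifP => _ //; apply: measurableX; exact: measurable_itv.
exact: countable_bigcupT_measurable.
Qed.

Lemma continuous_measurable2 (G : R * R -> R) (D : set (mR * mR)) :
 continuous G -> measurable D -> measurable_fun D (G : mR * mR -> mR).
Proof.
move=> cG mD; apply: measurable_funTS => mT.
apply: (measurability _ (RGenOInfty.measurableE R)) => // _ [_ [a ->] <-].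
rewrite setTI; apply: open_measurable2.
by apply: open_comp => // x _; exact: cG.
Qed.

Lemma continuous_rect_bounded (G : R * R -> R) (a b c d : R) : continuous G ->
 exists M, forall x y, a <= x <= b -> c <= y <= d -> `|G (x, y)| <= M.
Proof.
move=> cG.
have cpt : compact (`[a, b]%classic `*` `[c, d]%classic : set (R * R)).
 by apply: compact_setX; exact: segment_compact.
have cimg : compact (G @` (`[a, b]%classic `*` `[c, d]%classic)).
 by apply: continuous_compact => //; exact: continuous_subspaceT.
have [M [_ hM]] := compact_bounded cimg.
exists (M + 1) => x y xab ycd; apply: (hM (M + 1)); first by rewrite ltrDl.
by exists (x, y) => //=; rewrite !in_itv.
Qed.

Lemma continuous_rect_integrable (G : R * R -> R) (a b c d : R) : continuous G ->
 leb2.-integrable (`[a, b]%classic `*` `[c, d]%classic) (EFin \o G).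
Proof.
move=> cG; have mD : measurable (`[a, b]%classic `*` `[c, d]%classic : set (mR * mR)).
 by apply: measurableX; exact: measurable_itv.
apply: measurable_bounded_integrable => //.
- change (leb2 (`[a, b]%classic `*` `[c, d]%classic) < +oo)%E.
 rewrite product_measure1E; [|exact: measurable_itv..].
 change (leb `[a, b]%classic * leb `[c, d]%classic < +oo)%E.
 rewrite !lebesgue_measure_itv /=.
 by case: ifP => _; case: ifP => _; rewrite -?EFinB ?mul0e ?mule0 -?EFinM ?ltry.
- exact: continuous_measurable2.
- have [M hM] := continuous_rect_bounded a b c d cG.
 exists M; split; first by rewrite num_real.
 by move=> x Mx [y z] /= [h1 h2]; rewrite (le_trans _ (ltW Mx)) // hM // -?in_itv.
Qed.

Lemma continuous_pairr (x : R) : continuous (fun y : R => (x, y)).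
Proof.
move=> y A [[B C] /= [hB hC] hBC]; apply: filterS hC => z Cz.
by apply: (hBC (x, z)); split=> //; exact: nbhs_singleton hB.
Qed.

Lemma continuous_pairl (y : R) : continuous (fun x : R => (x, y)).
Proof.
move=> x A [[B C] /= [hB hC] hBC]; apply: filterS hB => z Bz.
by apply: (hBC (z, y)); split=> //; exact: nbhs_singleton hC.
Qed.

Lemma fubini_rect (G : R * R -> R) (a b c d : R) : continuous G ->
 \int[leb2]_(p in `[a, b]%classic `*` `[c, d]%classic) G p =
  \int[leb]_(x in `[a, b]) \int[leb]_(y in `[c, d]) G (x, y) /\
 \int[leb2]_(p in `[a, b]%classic `*` `[c, d]%classic) G p =
  \int[leb]_(y in `[c, d]) \int[leb]_(x in `[a, b]) G (x, y).
Proof.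
move=> cG; set D := `[a, b]%classic `*` `[c, d]%classic.
have mD : measurable (D : set (mR * mR)) by apply: measurableX; exact: measurable_itv.
have iG := continuous_rect_integrable a b c d cG.
have iG' : leb2.-integrable setT ((EFin \o G) \_ D) by exact: (integrable_mkcond _ mD).1 iG.
have sx x : continuous (fun y => G (x, y)).
 by move=> y; apply: (@continuous_comp _ _ _ (fun y => (x, y)) G); [exact: continuous_pairr|exact: cG].
have sy y : continuous (fun x => G (x, y)).
 by move=> x; apply: (@continuous_comp _ _ _ (fun x => (x, y)) G); [exact: continuous_pairl|exact: cG].
have fin (g : R -> R) (u v : R) : continuous g -> (\int[leb]_(x in `[u, v]) (g x)%:E)%E = (\int[leb]_(x in `[u, v]) g x)%:E.
 move=> cg; rewrite fineK //; apply: integrable_fin_num => //.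
 by apply: continuous_compact_integrable; [exact: segment_compact|exact: continuous_subspaceT].
split.
 rewrite /Rintegral integral_mkcond -(integral12_prod_meas1 iG').
 congr fine; rewrite [RHS]integral_mkcond; apply: eq_integral => x _ /=.
 rewrite /fubini_F /= patchE; case: ifPn => xab.
  rewrite -[RHS]fin // [RHS]integral_mkcond; apply: eq_integral => y _.
  by rewrite /= !patchE /D in_setX /= xab.
 by apply: integral0_eq => y _; rewrite patchE /D in_setX /= (negbTE xab).
rewrite /Rintegral integral_mkcond -(integral21_prod_meas1 iG').
congr fine; rewrite [RHS]integral_mkcond; apply: eq_integral => y _ /=.
rewrite /fubini_G /= patchE; case: ifPn => ycd.
 rewrite -[RHS]fin // [RHS]integral_mkcond; apply: eq_integral => x _.
 by rewrite /= !patchE /D in_setX /= ycd andbT.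
by apply: integral0_eq => x _; rewrite patchE /D in_setX /= (negbTE ycd) andbF.
Qed.

(** * Spherical coordinates and the rotation fields *)

Lemma sph0 (p : R * R) : sph p 0 0 = sin p.1 * cos p.2.
Proof. by rewrite /sph mxE. Qed.

Lemma sph1 (p : R * R) : sph p 0 1 = sin p.1 * sin p.2.
Proof. by rewrite /sph mxE. Qed.

Lemma sph2 (p : R * R) : sph p 0 o2 = cos p.1.
Proof. by rewrite /sph mxE -o2E inordK. Qed.

Lemma sphS (p : R * R) : sphere p^S.
Proof.
rewrite /sphere /= dotE sph0 sph1 sph2; have h1 := cos2Dsin2 p.1; have h2 := cos2Dsin2 p.2.
transitivity (sin p.1 ^+ 2 * (cos p.2 ^+ 2 + sin p.2 ^+ 2) + cos p.1 ^+ 2); first by ring.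
by rewrite h2 mulr1 addrC.
Qed.

Lemma sph_neq0 (p : R * R) : sph p != 0.
Proof. exact: sphere0 (sphS p). Qed.

Definition sph_dth (p : R * R) : E :=
 \row_k [:: cos p.1 * cos p.2; cos p.1 * sin p.2; - sin p.1]`_k.

Definition sph_dph (p : R * R) : E :=
 \row_k [:: - (sin p.1 * sin p.2); sin p.1 * cos p.2; 0]`_k.

Lemma sph_dthE p : (sph_dth p 0 0 = cos p.1 * cos p.2) * (sph_dth p 0 1 = cos p.1 * sin p.2) * (sph_dth p 0 o2 = - sin p.1).
Proof. by rewrite /sph_dth !mxE -o2E inordK. Qed.

Lemma sph_dphE p : (sph_dph p 0 0 = - (sin p.1 * sin p.2)) * (sph_dph p 0 1 = sin p.1 * cos p.2) * (sph_dph p 0 o2 = 0).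
Proof. by rewrite /sph_dph !mxE -o2E inordK. Qed.

Lemma dv_sin (t : R) : dva sin t (cos t).
Proof. exact: is_derive_sin. Qed.

Lemma dv_cos (t : R) : dva cos t (- sin t).
Proof. exact: is_derive_cos. Qed.

Lemma dth_deriv f (t s : R) : C1s f ->
 dva (fun t => f (sph (t, s))) t (tderiv f (sph (t, s)) (sph_dth (t, s))).
Proof.
move=> cf; have := @curve_deriv f (fun t => sph (t, s)) (sph_dth (t, s)) t cf (sph_neq0 _).
rewrite (_ : (fun s0 : R => hext f (sph (s0, s))) = fun t => f (sph (t, s))); last first.
 by apply/funext => r; rewrite hext_sphere //; exact: sphS.
apply=> i; case: (ord3P i) => ->; rewrite ?sph_dthE /=.
- rewrite (_ : (fun _ => _) = fun t => sin t * cos s); last by apply/funext => r; rewrite sph0.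
 by apply: dv_eq; [apply: dvM; [exact: dv_sin|exact: dvC]|rewrite mulr0 addr0].
- rewrite (_ : (fun _ => _) = fun t => sin t * sin s); last by apply/funext => r; rewrite sph1.
 by apply: dv_eq; [apply: dvM; [exact: dv_sin|exact: dvC]|rewrite mulr0 addr0].
- rewrite (_ : (fun _ => _) = fun t => cos t); last by apply/funext => r; rewrite sph2.
 exact: dv_cos.
Qed.

Lemma dph_deriv f (t s : R) : C1s f ->
 dva (fun s => f (sph (t, s))) s (tderiv f (sph (t, s)) (sph_dph (t, s))).
Proof.
move=> cf; have := @curve_deriv f (fun s => sph (t, s)) (sph_dph (t, s)) s cf (sph_neq0 _).
rewrite (_ : (fun s0 : R => hext f (sph (t, s0))) = fun s => f (sph (t, s))); last first.
 by apply/funext => r; rewrite hext_sphere //; exact: sphS.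
apply=> i; case: (ord3P i) => ->; rewrite ?sph_dphE /=.
- rewrite (_ : (fun _ => _) = fun s => sin t * cos s); last by apply/funext => r; rewrite sph0.
 by apply: dv_eq; [apply: dvM; [exact: dvC|exact: dv_cos]|rewrite mul0r add0r mulrN].
- rewrite (_ : (fun _ => _) = fun s => sin t * sin s); last by apply/funext => r; rewrite sph1.
 by apply: dv_eq; [apply: dvM; [exact: dvC|exact: dv_sin]|rewrite mul0r add0r].
- rewrite (_ : (fun _ => _) = fun s => cos t); last by apply/funext => r; rewrite sph2.
 exact: dvC.
Qed.

Definition rot (k : 'I_3) (x : E) : E :=
 \row_i (nth [::] [:: [:: 0; - x 0 o2; x 0 1]; [:: x 0 o2; 0; - x 0 0]; [:: - x 0 1; x 0 0; 0]] k)`_i.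

Lemma rot0E (x : E) : (rot 0 x 0 0 = 0) * (rot 0 x 0 1 = - x 0 o2) * (rot 0 x 0 o2 = x 0 1).
Proof. by rewrite /rot !mxE -o2E inordK. Qed.

Lemma rot1E (x : E) : (rot 1 x 0 0 = x 0 o2) * (rot 1 x 0 1 = 0) * (rot 1 x 0 o2 = - x 0 0).
Proof. by rewrite /rot !mxE -o2E inordK. Qed.

Lemma rot2E (x : E) : (rot o2 x 0 0 = - x 0 1) * (rot o2 x 0 1 = x 0 0) * (rot o2 x 0 o2 = 0).
Proof. by rewrite /rot !mxE -o2E inordK. Qed.

Definition rotE := (rot0E, rot1E, rot2E).

(* The derivative along the Killing field e_k x x. *)
Definition Xd (k : 'I_3) (f : E -> R) (x : E) : R := tderiv f x (rot k x).

Lemma XdE f (x : E) : C1s f -> x != 0 ->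
 [/\ Xd 0 f x = x 0 1 * tderiv f x (bvec R o2) - x 0 o2 * tderiv f x (bvec R 1),
   Xd 1 f x = x 0 o2 * tderiv f x (bvec R 0) - x 0 0 * tderiv f x (bvec R o2) &
   Xd o2 f x = x 0 0 * tderiv f x (bvec R 1) - x 0 1 * tderiv f x (bvec R 0)].
Proof.
move=> cf x0; rewrite /Xd !(tderiv_lin (rot _ _) cf x0) !rotE.
move: (tderiv f x _) (tderiv f x _) (tderiv f x _) (x 0 0) (x 0 1) (x 0 o2) => a b c d e g.
by split; ring.
Qed.

Lemma dot_rot k (x : E) : dot (rot k x) x = 0.
Proof. by case: (ord3P k) => ->; rewrite dotE !rotE; ring. Qed.

Lemma XdD k f g (x : E) : C1s f -> C1s g -> x != 0 -> Xd k (fun y => f y + g y) x = Xd k f x + Xd k g x.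
Proof. by move=> cf cg x0; exact: tderivD. Qed.

Lemma XdM k f g (x : E) : C1s f -> C1s g -> sphere x -> Xd k (fun y => f y * g y) x = Xd k f x * g x + f x * Xd k g x.
Proof. by move=> cf cg hx; rewrite /Xd tderivM ?hext_sphere //; exact: sphere0. Qed.

Lemma Xd_cst k c (x : E) : Xd k (fun _ => c) x = 0.
Proof. by apply: tderiv_eq; exact: is_derive_cst. Qed.

Lemma Xd_ext k f g (x : E) : (forall x, sphere x -> f x = g x) -> sphere x -> Xd k f x = Xd k g x.
Proof. by move=> h hx; apply: tderiv_ext => //; exact: sphere0. Qed.

Lemma XdZ k c f (x : E) : C1s f -> sphere x -> Xd k (fun y => c * f y) x = c * Xd k f x.
Proof. by move=> cf hx; rewrite (XdM _ (C1sC c) cf hx) Xd_cst mul0r add0r. Qed.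

Lemma XdN k f (x : E) : C1s f -> sphere x -> Xd k (fun y => - f y) x = - Xd k f x.
Proof.
move=> cf hx; rewrite -mulN1r -XdZ //; apply: Xd_ext => // y _; by rewrite mulN1r.
Qed.

Lemma XdB k f g (x : E) : C1s f -> C1s g -> sphere x -> Xd k (fun y => f y - g y) x = Xd k f x - Xd k g x.
Proof. by move=> cf cg hx; rewrite (XdD _ cf (C1sN cg) (sphere0 hx)) (XdN _ cg hx). Qed.

Lemma XdV k f (x : E) : C1s f -> C1s (fun y => (f y)^-1) -> f x != 0 -> (forall y, sphere y -> f y != 0) -> sphere x -> Xd k (fun y => (f y)^-1) x = - (f x ^- 2 * Xd k f x).
Proof.
move=> cf cif f0 hf hx; have := Xd_cst k 1 x.
rewrite -(@Xd_ext _ (fun y => f y * (f y)^-1)) => //; last by move=> y hy; rewrite divff // hf.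
by rewrite XdM // => /eqP; rewrite addrC addr_eq0 => /eqP h; rewrite -[LHS](mulKf f0) h; field.
Qed.

Lemma Alg_tderiv (f : E -> R) v : Alg f -> exists2 h : E -> R, Alg h & forall x, sphere x -> tderiv f x v = h x.
Proof.
move=> af; have [h ah dh] := Alg_deriv af v; exists h => // x hx.
by case: (dh x (sphere0 hx)) => _; rewrite rad_sphere // invr1 mul1r unitv_id.
Qed.

Lemma Alg_Xd k f : Alg f -> Alg (Xd k f).
Proof.
move=> af; have [h0 a0 e0] := Alg_tderiv (bvec R 0) af; have [h1 a1 e1] := Alg_tderiv (bvec R 1) af; have [h2 a2 e2] := Alg_tderiv (bvec R o2) af.
have cf := AlgC1 af; have ac i := AlgX i.
have e x (hx : sphere x) := XdE cf (sphere0 hx).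
case: (ord3P k) => ->.
- apply: Alg_ext (AlgB (AlgM (ac 1) a2) (AlgM (ac o2) a1)) _ => x hx.
 by have [-> _ _] := e x hx; rewrite e1 ?e2.
- apply: Alg_ext (AlgB (AlgM (ac o2) a0) (AlgM (ac 0) a2)) _ => x hx.
 by have [_ -> _] := e x hx; rewrite e0 ?e2.
- apply: Alg_ext (AlgB (AlgM (ac 0) a1) (AlgM (ac 1) a0)) _ => x hx.
 by have [_ _ ->] := e x hx; rewrite e0 ?e1.
Qed.

Lemma Xd_coord k i (x : E) : sphere x -> Xd k (fun y => y 0 i) x = rot k x 0 i.
Proof.
move=> hx; apply: tderiv_eq; have x0 := sphere0 hx.
have e : hext (fun x : E => x 0 i) = (fun y => (rad y)^-1 * y 0 i).
 by apply/funext => z; rewrite /hext mxE.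
rewrite e; apply: is_derive_eq.
 by apply: is_deriveM; [exact: dv_radV|apply/line_is_deriveP; exact: dv_coord].
by rewrite dotC dot_rot rad_sphere // invr1 oppr0 mul0r /GRing.scale /= mul1r mulr0 addr0.
Qed.

Lemma sum_coord_Xd f (x : E) : C1s f -> x != 0 -> x 0 0 * Xd 0 f x + x 0 1 * Xd 1 f x + x 0 o2 * Xd o2 f x = 0.
Proof.
move=> cf x0; have [-> -> ->] := XdE cf x0.
move: (tderiv f x _) (tderiv f x _) (tderiv f x _) (x 0 0) (x 0 1) (x 0 o2) => a b c d e g.
by ring.
Qed.

Definition cont2 (F : R * R -> R) : Prop := forall p : R * R, ctat F p.

Lemma cont2_continuous F : cont2 F -> continuous F.
Proof. by []. Qed.

Lemma cont2_fst : cont2 fst.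
Proof. by move=> p; exact: cvg_fst. Qed.

Lemma cont2_snd : cont2 snd.
Proof. by move=> p; exact: cvg_snd. Qed.

Lemma cont2_sin1 : cont2 (fun p => sin p.1).
Proof. by move=> p; apply: ct_comp; [exact: continuous_sin|exact: cont2_fst]. Qed.

Lemma cont2_c1 : cont2 (fun p => cos p.1).
Proof. by move=> p; apply: ct_comp; [exact: continuous_cos|exact: cont2_fst]. Qed.

Lemma cont2_sin2 : cont2 (fun p => sin p.2).
Proof. by move=> p; apply: ct_comp; [exact: continuous_sin|exact: cont2_snd]. Qed.

Lemma cont2_cos2 : cont2 (fun p => cos p.2).
Proof. by move=> p; apply: ct_comp; [exact: continuous_cos|exact: cont2_snd]. Qed.

Lemma cont2_cst c : cont2 (fun _ => c).
Proof. by move=> p; exact: ctC. Qed.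

Lemma cont2D F G : cont2 F -> cont2 G -> cont2 (fun p => F p + G p).
Proof. by move=> h1 h2 p; exact: ctD. Qed.

Lemma cont2M F G : cont2 F -> cont2 G -> cont2 (fun p => F p * G p).
Proof. by move=> h1 h2 p; exact: ctM. Qed.

Lemma cont2N F : cont2 F -> cont2 (fun p => - F p).
Proof.
move=> h1; rewrite (_ : (fun p => _) = (fun p => -1 * F p)); last by apply/funext => p; rewrite mulN1r.
by apply: cont2M => //; exact: cont2_cst.
Qed.

Lemma cont2_comp (h : R -> R) F : continuous h -> cont2 F -> cont2 (fun p => h (F p)).
Proof. by move=> h1 h2 p; exact: ct_comp. Qed.

Lemma cont2_pmeas F : cont2 F -> pmeas F.
Proof. by move=> h; apply: continuous_measurable2; [exact: h|exact: dom_meas]. Qed.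

Lemma cont2_sph (g : E -> R) : (forall x, x != 0 -> ctat g x) -> cont2 (fun p => g p^S).
Proof.
move=> cg p; apply: (@continuous_comp _ _ _ (@sph R) g); last exact: cg (sph_neq0 p).
apply/cvg_ballP => e e0.
have h i : \forall q \near p, `|sph p 0 i - sph q 0 i| < e.
 have : cont2 (fun q => sph q 0 i).
  case: (ord3P i) => ->.
  - rewrite (_ : (fun q => _) = (fun q : R * R => sin q.1 * cos q.2)); last by apply/funext => q; rewrite sph0.
   by apply: cont2M; [exact: cont2_sin1|exact: cont2_cos2].
  - rewrite (_ : (fun q => _) = (fun q : R * R => sin q.1 * sin q.2)); last by apply/funext => q; rewrite sph1.
   by apply: cont2M; [exact: cont2_sin1|exact: cont2_sin2].
  - rewrite (_ : (fun q => _) = (fun q : R * R => cos q.1)); last by apply/funext => q; rewrite sph2.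
   exact: cont2_c1.
 by move=> /(_ p) /cvgrPdist_lt; exact.
apply: filterS (filterI (h 0) (filterI (h 1) (h o2))) => q [h0 [h1 h2]].
split=> // i j; rewrite (ord1 i) -ball_normE /=; case: (ord3P j) => ->; [exact: h0|exact: h1|exact: h2].
Qed.

Lemma C1s_cont2 f : C1s f -> cont2 (fun p => f p^S).
Proof.
move=> cf; rewrite (_ : (fun p => _) = fun p => hext f p^S).
 by apply: cont2_sph => x x0; exact: C1s_ct.
by apply/funext => p; rewrite hext_sphere //; exact: sphS.
Qed.

Lemma C1s_tderiv_cont2 f v : C1s f -> cont2 (fun p => tderiv f p^S v).
Proof. by move=> cf; apply: (@cont2_sph (fun x => tderiv f x v)) => x x0; exact: C1s_ctD. Qed.

Lemma dth_cont2 f : C1s f -> cont2 (fun p => tderiv f p^S (sph_dth p)).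
Proof.
move=> cf; rewrite (_ : (fun p => _) = (fun p => cos p.1 * cos p.2 * tderiv f p^S (bvec R 0)
 + cos p.1 * sin p.2 * tderiv f p^S (bvec R 1) + (- sin p.1) * tderiv f p^S (bvec R o2))); last first.
 by apply/funext => p; rewrite (tderiv_lin _ cf (sph_neq0 p)) !sph_dthE.
have c1 := cont2_c1; have s1 := cont2_sin1; have c2 := cont2_cos2; have s2 := cont2_sin2.
apply: cont2D; [apply: cont2D|].
- by apply: cont2M; [exact: cont2M|exact: C1s_tderiv_cont2].
- by apply: cont2M; [exact: cont2M|exact: C1s_tderiv_cont2].
- by apply: cont2M; [exact: cont2N|exact: C1s_tderiv_cont2].
Qed.

Lemma dph_cont2 f : C1s f -> cont2 (fun p => tderiv f p^S (sph_dph p)).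
Proof.
move=> cf; rewrite (_ : (fun p => _) = (fun p => (- (sin p.1 * sin p.2)) * tderiv f p^S (bvec R 0)
 + sin p.1 * cos p.2 * tderiv f p^S (bvec R 1))); last first.
 by apply/funext => p; rewrite (tderiv_lin _ cf (sph_neq0 p)) !sph_dphE mul0r addr0.
have c1 := cont2_c1; have s1 := cont2_sin1; have c2 := cont2_cos2; have s2 := cont2_sin2.
apply: cont2D.
- by apply: cont2M; [apply: cont2N; exact: cont2M|exact: C1s_tderiv_cont2].
- by apply: cont2M; [exact: cont2M|exact: C1s_tderiv_cont2].
Qed.

Lemma Xd_cont2 k f : C1s f -> cont2 (fun p => Xd k f p^S).
Proof.
move=> cf; have e p := XdE cf (sph_neq0 p).
have cs i : cont2 (fun p => sph p 0 i) by apply: (@C1s_cont2 (fun x => x 0 i)); exact: AlgC1 (AlgX i).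
have ct v : cont2 (fun p => tderiv f p^S v) by exact: C1s_tderiv_cont2.
case: (ord3P k) => ->.
- rewrite (_ : (fun p => _) = (fun p => sph p 0 1 * tderiv f p^S (bvec R o2) + - (sph p 0 o2 * tderiv f p^S (bvec R 1)))).
  by apply: cont2D; [|apply: cont2N]; apply: cont2M.
 by apply/funext => p; have [-> _ _] := e p.
- rewrite (_ : (fun p => _) = (fun p => sph p 0 o2 * tderiv f p^S (bvec R 0) + - (sph p 0 0 * tderiv f p^S (bvec R o2)))).
  by apply: cont2D; [|apply: cont2N]; apply: cont2M.
 by apply/funext => p; have [_ -> _] := e p.
- rewrite (_ : (fun p => _) = (fun p => sph p 0 0 * tderiv f p^S (bvec R 1) + - (sph p 0 1 * tderiv f p^S (bvec R 0)))).
  by apply: cont2D; [|apply: cont2N]; apply: cont2M.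
 by apply/funext => p; have [_ _ ->] := e p.
Qed.

Lemma ftc1 (F f : R -> R) (a b : R) : a <= b -> (forall x, dva F x (f x)) -> continuous f ->
 \int[leb]_(x in `[a, b]) f x = F b - F a.
Proof.
rewrite le_eqVlt => /orP[/eqP -> _ _|ab dF cf].
 by rewrite subrr (_ : `[b, b]%classic = [set b]) ?Rintegral_set1 // set_itv1.
have cF : continuous F.
 by move=> x; apply: differentiable_continuous; apply/derivable1_diffP; case: (dF x).
rewrite /Rintegral (@continuous_FTC2 _ f F a b ab) ?EFinB //.
- exact: continuous_subspaceT.
- split.
 + by move=> x _; case: (dF x).
 + by apply: cvg_at_right_filter; exact: cF.
 + by apply: cvg_at_left_filter; exact: cF.
- by move=> x _; rewrite derive1E; case: (dF x).
Qed.

Lemma dom_int_dth (A G : R * R -> R) : cont2 G ->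
 (forall t s, dva (fun t => A (t, s)) t (G (t, s))) -> (forall s, A (pi, s) = A (0, s)) ->
 \int[leb2]_(p in dom) G p = 0.
Proof.
move=> cG dA hA; rewrite (fubini_rect 0 pi 0 (2 * pi) cG).2.
rewrite (@eq_Rintegral _ _ _ leb _ (fun _ => 0)) ?Rintegral_cst ?mul0r // => s _.
rewrite (@ftc1 (fun t => A (t, s))) ?hA ?subrr ?pi_ge0 //.
by move=> t; apply: (@continuous_comp _ _ _ (fun t => (t, s)) G); [exact: continuous_pairl|exact: cG].
Qed.

Lemma dom_int_dph (A G : R * R -> R) : cont2 G ->
 (forall t s, dva (fun s => A (t, s)) s (G (t, s))) -> (forall t, A (t, 2 * pi) = A (t, 0)) ->
 \int[leb2]_(p in dom) G p = 0.
Proof.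
move=> cG dA hA; rewrite (fubini_rect 0 pi 0 (2 * pi) cG).1.
rewrite (@eq_Rintegral _ _ _ leb _ (fun _ => 0)) ?Rintegral_cst ?mul0r // => t _.
rewrite (@ftc1 (fun s => A (t, s))) ?hA ?subrr ?mulr_ge0 ?pi_ge0 //.
by move=> s; apply: (@continuous_comp _ _ _ (fun s => (t, s)) G); [exact: continuous_pairr|exact: cG].
Qed.

Lemma cont2_dom_integrable F : cont2 F -> leb2.-integrable dom (EFin \o F).
Proof. by move=> cF; apply: continuous_rect_integrable. Qed.

Lemma cont2_pL1 F : cont2 F -> pL1 F.
Proof.
move=> cF; split; first exact: cont2_pmeas.
by apply: cont2_dom_integrable; exact: cont2M cF cont2_sin1.
Qed.

Lemma sph_2pi (t : R) : sph (t, 2 * pi) = sph (t, 0).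
Proof. by apply: rowP3; rewrite ?sph0 ?sph1 ?sph2 //= [2 * pi]mulr_natl ?cos2pi ?sin2pi ?cos0 ?sin0. Qed.

Lemma dom_int_D0 (G1 G2 : R * R -> R) : cont2 G1 -> cont2 G2 ->
 \int[leb2]_(p in dom) G1 p = 0 -> \int[leb2]_(p in dom) G2 p = 0 ->
 \int[leb2]_(p in dom) (G1 p + G2 p) = 0.
Proof.
move=> c1 c2 h1 h2.
have := RintegralD dom_meas (cont2_dom_integrable c1) (cont2_dom_integrable c2).
by rewrite h1 h2 addr0.
Qed.

(** The rotation fields are divergence free. In coordinates, [sin theta] times such a derivative is
    a [theta]-derivative plus a [phi]-derivative: the weight absorbs the cotangent, and the boundary
    terms disappear because [sin 0 = sin pi = 0] and by periodicity in [phi]. *)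
Lemma sint_Xd k (f : E -> R) : C1s f -> sint (Xd k f) = 0.
Proof.
move=> cf; rewrite /sint; have e p := XdE cf (sph_neq0 p).
have cF := C1s_cont2 cf; have ct := dth_cont2 cf; have cp := dph_cont2 cf.
have c1 := cont2_c1; have s1 := cont2_sin1; have c2 := cont2_cos2; have s2 := cont2_sin2.
have tl p X := tderiv_lin X cf (sph_neq0 p).
case: (ord3P k) => ->.
(* [G1] is the [theta]-derivative of [- sin phi sin theta f] and [G2] the [phi]-derivative of
   [- cos theta cos phi f]; the terms in [f] itself cancel in the sum. *)
- pose G1 := fun p : R * R => (- sin p.2) * (cos p.1 * f p^S + sin p.1 * tderiv f p^S (sph_dth p)).
 pose G2 := fun p : R * R => (- cos p.1) * ((- sin p.2) * f p^S + cos p.2 * tderiv f p^S (sph_dph p)).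
 have cG1 : cont2 G1 by apply: cont2M; [exact: cont2N|apply: cont2D; exact: cont2M].
 have cG2 : cont2 G2 by apply: cont2M; [exact: cont2N|apply: cont2D; [apply: cont2M => //; exact: cont2N|exact: cont2M]].
 have h1 : \int[leb2]_(p in dom) G1 p = 0.
  apply: (@dom_int_dth (fun p => (- sin p.2) * (sin p.1 * f p^S))) => // [t s|s] /=; last by rewrite sinpi sin0 !mul0r.
  apply: dv_eq.
   by apply: dvM; [exact: dvC|apply: dvM; [exact: dv_sin|exact: dth_deriv]].
  by rewrite mul0r add0r.
 have h2 : \int[leb2]_(p in dom) G2 p = 0.
  apply: (@dom_int_dph (fun p => (- cos p.1) * (cos p.2 * f p^S))) => // [t s|t] /=; last by rewrite sph_2pi [2 * pi]mulr_natl cos2pi cos0.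
  apply: dv_eq.
   by apply: dvM; [exact: dvC|apply: dvM; [exact: dv_cos|exact: dph_deriv]].
  by rewrite mul0r add0r.
 transitivity (\int[leb2]_(p in dom) (G1 p + G2 p)).
  apply: eq_Rintegral => p _; have [-> _ _] := e p.
  rewrite /G1 /G2 (tl p (sph_dth p)) (tl p (sph_dph p)) !sph_dthE !sph_dphE; rewrite sph1 sph2.
  have hs : cos p.2 ^+ 2 = 1 - sin p.2 ^+ 2 by rewrite cos2sin2.
  move: (tderiv f _ _) (tderiv f _ _) (tderiv f _ _) (f _) (sin p.1) (cos p.1) (sin p.2) (cos p.2) hs => a b c d s1' c1' s2' c2' hs.
  rewrite -[RHS]addr0.
  transitivity (s1' * s2' * c * s1' - c1' * b * s1' + c1' * s1' * b * (1 - s2' ^+ 2 - c2' ^+ 2)); first by rewrite hs; ring.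
  by ring.
 exact: dom_int_D0 cG1 cG2 h1 h2.
- pose G1 := fun p : R * R => cos p.2 * (cos p.1 * f p^S + sin p.1 * tderiv f p^S (sph_dth p)).
 pose G2 := fun p : R * R => (- cos p.1) * (cos p.2 * f p^S + sin p.2 * tderiv f p^S (sph_dph p)).
 have cG1 : cont2 G1 by apply: cont2M => //; apply: cont2D; exact: cont2M.
 have cG2 : cont2 G2 by apply: cont2M; [exact: cont2N|apply: cont2D; exact: cont2M].
 have h1 : \int[leb2]_(p in dom) G1 p = 0.
  apply: (@dom_int_dth (fun p => cos p.2 * (sin p.1 * f p^S))) => // [t s|s] /=; last by rewrite sinpi sin0 !mul0r.
  apply: dv_eq.
   by apply: dvM; [exact: dvC|apply: dvM; [exact: dv_sin|exact: dth_deriv]].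
  by rewrite mul0r add0r.
 have h2 : \int[leb2]_(p in dom) G2 p = 0.
  apply: (@dom_int_dph (fun p => (- cos p.1) * (sin p.2 * f p^S))) => // [t s|t] /=; last by rewrite sph_2pi [2 * pi]mulr_natl sin2pi sin0.
  apply: dv_eq.
   by apply: dvM; [exact: dvC|apply: dvM; [exact: dv_sin|exact: dph_deriv]].
  by rewrite mul0r add0r.
 transitivity (\int[leb2]_(p in dom) (G1 p + G2 p)).
  apply: eq_Rintegral => p _; have [_ -> _] := e p.
  rewrite /G1 /G2 (tl p (sph_dth p)) (tl p (sph_dph p)) !sph_dthE !sph_dphE; rewrite sph0 sph2.
  have hs : cos p.2 ^+ 2 = 1 - sin p.2 ^+ 2 by rewrite cos2sin2.
  move: (tderiv f _ _) (tderiv f _ _) (tderiv f _ _) (f _) (sin p.1) (cos p.1) (sin p.2) (cos p.2) hs => a b c d s1' c1' s2' c2' hs.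
  rewrite -[RHS]addr0.
  transitivity (c1' * c * s1' - s1' * c2' * b * s1' - c1' * s1' * c * (1 - s2' ^+ 2 - c2' ^+ 2)); first by rewrite hs; ring.
  by ring.
 exact: dom_int_D0 cG1 cG2 h1 h2.
- apply: (@dom_int_dph (fun p => f p^S * sin p.1)) => [|t s|t] /=; last by rewrite sph_2pi.
  by apply: cont2M; [exact: Xd_cont2|exact: s1].
 have [_ _ ->] := e (t, s).
 apply: dv_eq; first by apply: dvM; [exact: dph_deriv|exact: dvC].
 by rewrite mulr0 addr0 (tl _ (sph_dph _)) !sph_dphE mul0r addr0 sph0 sph1 /= mulNr addrC.
Qed.

Lemma cont2_bounded (F : R * R -> R) : cont2 F -> exists C, forall p, dom p -> `|F p| <= C.
Proof.
move=> cF; have [M hM] := continuous_rect_bounded 0 pi 0 (2 * pi) cF.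
by exists M => -[t s] /domP[h1 h2]; exact: hM.
Qed.

Lemma L1Mct (F G : R * R -> R) : cont2 F -> pL1 G -> pL1 (fun p => F p * G p).
Proof. by move=> cF; have [C hC] := cont2_bounded cF; apply: pL1_Mbounded hC; exact: cont2_pmeas. Qed.

Lemma Alg_cont2 (f : E -> R) : Alg f -> cont2 (fun p => f p^S).
Proof. by move=> af; apply: C1s_cont2; exact: AlgC1. Qed.

Lemma AlgL1 (f : E -> R) : Alg f -> pL1 (fun p => f p^S).
Proof. by move=> af; apply: cont2_pL1; exact: Alg_cont2. Qed.

(** * Kernels of finite rank and zonal kernels *)

Lemma Xd_sum (I : Type) (s : seq I) (c : I -> R) (f : I -> E -> R) k (x : E) :
 (forall i, Alg (f i)) -> sphere x ->
 Xd k (fun y => \sum_(i <- s) c i * f i y) x = \sum_(i <- s) c i * Xd k (f i) x.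
Proof.
move=> af hx; elim: s => [|i s ih].
 by rewrite big_nil; transitivity (Xd k (fun _ => 0) x); [apply: Xd_ext hx => y _; rewrite big_nil|exact: Xd_cst].
rewrite big_cons -ih -(XdZ k (c i) (AlgC1 (af i)) hx) -XdD; last exact: sphere0.
- by apply: Xd_ext hx => y _; rewrite big_cons.
- exact: C1sM (C1sC _) (AlgC1 (af i)).
- by apply: AlgC1; apply: Alg_sum => j; exact: AlgM (AlgC _) (af j).
Qed.

(** Kernels of finite rank. Integrating one variable leaves a finite combination of [Alg] functions
    of the other, so smoothness, differentiation under the integral and exchange of integrals are
    all statements about finite sums. *)
Definition Kern (k : E -> E -> R) : Prop :=
 exists (I : finType) (c d : I -> E -> R),
  [/\ forall i, Alg (c i), forall i, Alg (d i) &
    forall x y, k x y = \sum_i c i x * d i y].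

Lemma Kern_prod (f g : E -> R) : Alg f -> Alg g -> Kern (fun x y => f x * g y).
Proof.
move=> af ag; exists unit, (fun _ => f), (fun _ => g); split=> // x y.
by rewrite (big_pred1 tt) // => -[].
Qed.

Lemma Kern_cst c : Kern (fun _ _ => c).
Proof.
have [I [a [b [h1 h2 h3]]]] := Kern_prod (AlgC c) (AlgC (1 : R)).
by exists I, a, b; split=> // x y; rewrite -h3 mulr1.
Qed.

Lemma Kern_add k1 k2 : Kern k1 -> Kern k2 -> Kern (fun x y => k1 x y + k2 x y).
Proof.
move=> [I [c [d [h1 h2 h3]]]] [J [c' [d' [h1' h2' h3']]]].
exists (I + J)%type, (fun s => match s with inl i => c i | inr j => c' j end),
 (fun s => match s with inl i => d i | inr j => d' j end).
split; [by case|by case|] => x y.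
by rewrite big_sumType /= h3 h3'.
Qed.

Lemma Kern_mul k1 k2 : Kern k1 -> Kern k2 -> Kern (fun x y => k1 x y * k2 x y).
Proof.
move=> [I [c [d [h1 h2 h3]]]] [J [c' [d' [h1' h2' h3']]]].
exists (I * J)%type, (fun s x => c s.1 x * c' s.2 x), (fun s x => d s.1 x * d' s.2 x).
split=> [i|i|x y]; [exact: AlgM|exact: AlgM|].
rewrite h3 h3' big_distrlr /= pair_big /=; apply: eq_bigr => s _; exact: mulrACA.
Qed.

Lemma Kern_exp k n : Kern k -> Kern (fun x y => k x y ^+ n).
Proof.
move=> hk; elim: n => [|n ih]; first exact: Kern_cst.
have [I [a [b [h1 h2 h3]]]] := Kern_mul hk ih.
by exists I, a, b; split=> // x y; rewrite -h3 exprS.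
Qed.

Lemma Kern_dot : Kern (@dot R).
Proof.
have h i := Kern_prod (AlgX i) (AlgX i).
have [I [a [b [h1 h2 h3]]]] := Kern_add (Kern_add (h 0) (h 1)) (h o2).
by exists I, a, b; split=> // x y; rewrite -h3 dotE.
Qed.

Definition kint (k : E -> E -> R) (F : R * R -> R) (x : E) : R :=
 \I_q (k x q^S * F q).

Lemma Kern_Algr k (x : E) : Kern k -> Alg (k x).
Proof.
move=> [I [c [d [h1 h2 h3]]]].
apply: (@Alg_ext (fun y => \sum_i c i x * d i y)); last by move=> y _; rewrite h3.
by apply: Alg_sum => i; exact: AlgM (AlgC _) (h2 i).
Qed.

Lemma Kern_Algl k (y : E) : Kern k -> Alg (k ^~ y).
Proof.
move=> [I [c [d [h1 h2 h3]]]].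
apply: (@Alg_ext (fun x => \sum_i c i x * d i y)); last by move=> x _; rewrite h3.
by apply: Alg_sum => i; exact: AlgM (h1 i) (AlgC _).
Qed.

Lemma kint_pL1 k F (x : E) : Kern k -> pL1 F -> pL1 (fun q => k x q^S * F q).
Proof. by move=> hk iF; apply: L1Mct => //; apply: Alg_cont2; exact: Kern_Algr. Qed.

Lemma kintE k F : Kern k -> pL1 F -> exists (I : finType) (c d : I -> E -> R),
 [/\ forall i, Alg (c i), forall i, Alg (d i),
  (forall x y, k x y = \sum_i c i x * d i y) &
  forall x, kint k F x = \sum_i \I_q (d i q^S * F q) * c i x].
Proof.
move=> [I [c [d [h1 h2 h3]]]] iF; exists I, c, d; split=> // x.
have iD i : pL1 (fun q => d i q^S * F q) by apply: L1Mct => //; exact: Alg_cont2.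
transitivity (\I_q (\sum_i c i x * (d i q^S * F q))).
 eqq; rewrite h3 mulr_suml; apply: eq_bigr => i _; by rewrite mulrA.
rewrite pintS; last by move=> i; exact: pL1Z.
by apply: eq_bigr => i _; rewrite pintZ // mulrC.
Qed.

Lemma kint_Alg k F : Kern k -> pL1 F -> Alg (kint k F).
Proof.
move=> hk iF; have [I [c [d [h1 h2 _ h4]]]] := kintE hk iF.
apply: (@Alg_ext (fun x => \sum_i \I_q (d i q^S * F q) * c i x)); last by move=> x _; rewrite h4.
by apply: Alg_sum => i; exact: AlgM (AlgC _) (h1 i).
Qed.

Lemma Xd_kint k F j (x : E) : Kern k -> pL1 F -> sphere x ->
 Xd j (kint k F) x = \I_q (Xd j (k ^~ q^S) x * F q).
Proof.
move=> hk iF hx; have [I [c [d [h1 h2 h3 h4]]]] := kintE hk iF.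
have iD i : pL1 (fun q => d i q^S * F q) by apply: L1Mct => //; exact: Alg_cont2.
rewrite (@Xd_ext j _ _ x (fun y _ => h4 y) hx) Xd_sum //.
transitivity (\I_q (\sum_i Xd j (c i) x * (d i q^S * F q))).
 rewrite pintS; last by move=> i; exact: pL1Z.
 by apply: eq_bigr => i _; rewrite pintZ // mulrC.
apply: eq_pint => q _.
have -> : Xd j (k ^~ q^S) x = \sum_i d i q^S * Xd j (c i) x.
 rewrite -Xd_sum //; apply: Xd_ext hx => y _; rewrite h3; apply: eq_bigr => i _; exact: mulrC.
by rewrite mulr_suml; apply: eq_bigr => i _; ring.
Qed.

Lemma kint_fubini k F G : Kern k -> pL1 F -> pL1 G ->
 \I_p (G p * kint k F p^S) = \I_q (F q * kint (fun y x => k x y) G q^S).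
Proof.
move=> hk iF iG; have [I [c [d [h1 h2 h3 h4]]]] := kintE hk iF.
have iD i : pL1 (fun q => d i q^S * F q) by apply: L1Mct => //; exact: Alg_cont2.
have iC i : pL1 (fun q => c i q^S * G q) by apply: L1Mct => //; exact: Alg_cont2.
transitivity (\sum_i \I_q (d i q^S * F q) * \I_q (c i q^S * G q)).
 transitivity (\I_p (\sum_i \I_q (d i q^S * F q) * (c i p^S * G p))).
  by eqp; rewrite h4 mulr_sumr; apply: eq_bigr => i _; ring.
 rewrite pintS; last by move=> i; exact: pL1Z.
 by apply: eq_bigr => i _; rewrite pintZ.
transitivity (\I_p (\sum_i \I_q (c i q^S * G q) * (d i p^S * F p))).
 rewrite pintS; last by move=> i; exact: pL1Z.
 by apply: eq_bigr => i _; rewrite pintZ // mulrC.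
eqp; rewrite /kint.
have -> : \I_q (k q^S p^S * G q) = \sum_i \I_q (c i q^S * G q) * d i p^S.
 transitivity (\I_q (\sum_i d i p^S * (c i q^S * G q))).
  by eqq; rewrite h3 mulr_suml; apply: eq_bigr => i _; ring.
 rewrite pintS; last by move=> i; exact: pL1Z.
 by apply: eq_bigr => i _; rewrite pintZ // mulrC.
by rewrite mulr_sumr; apply: eq_bigr => i _; ring.
Qed.

(** A polynomial in [dot x y], hence of finite rank. On the sphere it is 1 at [y = x] and decays
    geometrically in [N] elsewhere. *)
Definition zon (N : nat) (x y : E) : R := ((1 + dot x y) / 2) ^+ N.

Lemma Kern_zon N : Kern (zon N).
Proof. by apply: Kern_exp; apply: Kern_mul (Kern_cst _); apply: Kern_add (Kern_cst _) Kern_dot. Qed.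

Lemma zonC N x y : zon N x y = zon N y x.
Proof. by rewrite /zon dotC. Qed.

Lemma rot_dot j (x y : E) : dot (rot j x) y = - dot x (rot j y).
Proof. by case: (ord3P j) => ->; rewrite !dotE !rotE; move: (x 0 0) (x 0 1) (x 0 o2) (y 0 0) (y 0 1) (y 0 o2) => *; ring. Qed.

Lemma Alg_dotr (x : E) : Alg (dot x).
Proof. exact: Kern_Algr Kern_dot. Qed.

Lemma Xd_dotr j (x y : E) : sphere y -> Xd j (dot x) y = dot x (rot j y).
Proof.
move=> hy.
rewrite (@Xd_ext j _ (fun y => \sum_i x 0 i * y 0 i) y) //.
rewrite (@Xd_sum _ _ (fun i => x 0 i) (fun i y => y 0 i)) //; last by move=> i; exact: AlgX.
by apply: eq_bigr => i _; rewrite Xd_coord.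
Qed.

Lemma Xd_exp j f n (x : E) : Alg f -> sphere x -> Xd j (fun y => f y ^+ n) x = n%:R * f x ^+ n.-1 * Xd j f x.
Proof.
move=> af hx; elim: n => [|n ih]; first by rewrite mul0r mul0r; exact: Xd_cst.
rewrite (@Xd_ext j _ (fun y => f y * f y ^+ n) x) //; last by move=> y _; rewrite exprS.
rewrite (XdM _ (AlgC1 af) (AlgC1 (AlgXn n af)) hx) ih /= {ih}.
move: (Xd j f x) (f x) => a b.
case: n => [|n] /=; first by rewrite expr0 mulr1; ring.
by rewrite exprS -[n.+2%:R]natr1; ring.
Qed.

Lemma Xd_zonr j N (x y : E) : sphere y -> Xd j (zon N x) y = N%:R / 2 * zon N.-1 x y * dot x (rot j y).
Proof.
move=> hy; have a1 : Alg (fun y => (1 + dot x y) / 2).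
 by apply: AlgM (AlgC _); apply: AlgD (AlgC _) (Alg_dotr x).
rewrite (Xd_exp j N a1 hy) /zon.
have -> : Xd j (fun y0 => (1 + dot x y0) / 2) y = 2^-1 * dot x (rot j y).
 rewrite (@Xd_ext j _ (fun y => 2^-1 + 2^-1 * dot x y) y) //; last by move=> z _; rewrite mulrDl mul1r [_ * 2^-1]mulrC.
 rewrite XdD; last exact: sphere0.
 - by rewrite Xd_cst add0r XdZ ?Xd_dotr //; exact: AlgC1 (Alg_dotr x).
 - exact: C1sC.
 - exact: C1sM (C1sC _) (AlgC1 (Alg_dotr x)).
by move: (dot x (rot j y)) (((1 + dot x y) / 2) ^+ N.-1) => a b; ring.
Qed.

(** A function of [dot x y] is invariant under rotating both points at once; infinitesimally, the
    two derivatives cancel. This is why mollification commutes with the rotation fields. *)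
Lemma Xd_zonl j N (x y : E) : sphere x -> sphere y -> Xd j (zon N ^~ y) x = - Xd j (zon N x) y.
Proof.
move=> hx hy; rewrite (Xd_zonr j N x hy).
rewrite (@Xd_ext j _ (zon N y) x) //; last by move=> z _; rewrite zonC.
by rewrite (Xd_zonr j N y hx) zonC [dot y _]dotC rot_dot mulrN.
Qed.

Lemma sph_dth_rot (p : R * R) : sph_dth p = (- sin p.2) *: rot 0 p^S + cos p.2 *: rot 1 p^S.
Proof.
have h := cos2Dsin2 p.2.
have e i : ((- sin p.2) *: rot 0 p^S + cos p.2 *: rot 1 p^S) 0 i = (- sin p.2) * rot 0 p^S 0 i + cos p.2 * rot 1 p^S 0 i by rewrite !mxE.
apply: rowP3; rewrite sph_dthE e !rotE ?sph0 ?sph1 ?sph2;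
 move: (sin p.1) (cos p.1) (sin p.2) (cos p.2) h => a b c d h; [ring|ring|].
by rewrite -[LHS]mulr1 -h; ring.
Qed.

Lemma sph_dph_rot (p : R * R) : sph_dph p = rot o2 p^S.
Proof. by apply: rowP3; rewrite sph_dphE rotE ?sph0 ?sph1. Qed.

Lemma tderiv_lin2 f (x v w : E) a b : C1s f -> x != 0 ->
 tderiv f x (a *: v + b *: w) = a * tderiv f x v + b * tderiv f x w.
Proof.
move=> cf x0; rewrite (tderiv_lin (a *: v + b *: w) cf x0) (tderiv_lin v cf x0) (tderiv_lin w cf x0) !mxE.
move: (tderiv f x (bvec R 0)) (tderiv f x (bvec R 1)) (tderiv f x (bvec R o2)) => u1 u2 u3.
by move: (v 0 0) (v 0 1) (v 0 o2) (w 0 0) (w 0 1) (w 0 o2) => *; ring.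
Qed.

(** The coordinate directions are [- sin phi X_0 + cos phi X_1] and [X_2], so the function is
    constant along meridians and along parallels. *)
Lemma Xd0_cst (f : E -> R) : C1s f -> (forall k x, sphere x -> Xd k f x = 0) ->
 forall p q, f p^S = f q^S.
Proof.
move=> cf h.
have hth s t t' : f (sph (t, s)) = f (sph (t', s)).
 apply: (@is_derive_0_is_cst R (fun t => f (sph (t, s)))) => z.
 apply: dv_eq (dth_deriv z s cf) _.
 rewrite sph_dth_rot tderiv_lin2 //; last exact: sph_neq0.
 rewrite -/(Xd 0 f _) -/(Xd 1 f _) !h ?mulr0 ?addr0 //; exact: sphS.
have hph t s s' : f (sph (t, s)) = f (sph (t, s')).
 apply: (@is_derive_0_is_cst R (fun s => f (sph (t, s)))) => z.
 apply: dv_eq (dph_deriv t z cf) _.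
 rewrite sph_dph_rot -/(Xd o2 f _) h //; exact: sphS.
by move=> [t s] [t' s']; rewrite (hth s t t') (hph t' s s').
Qed.

Lemma sph_surj (x : E) : sphere x -> exists2 p : R * R, dom p & sph p = x.
Proof.
rewrite /sphere /= dotE -!expr2 => hx.
set a := x 0 0; set b := x 0 1; set c := x 0 o2; rewrite -/a -/b -/c in hx.
have hc : -1 <= c <= 1.
 by apply/andP; have := sqr_ge0 a; have := sqr_ge0 b; split; nra.
have hsin : sin (acos c) ^+ 2 = a ^+ 2 + b ^+ 2.
 by rewrite sin2cos2 acosK //; lra.
have hs0 : 0 <= sin (acos c) by apply: sin_ge0_pi; rewrite acos_ge0 // acos_lepi.
case: (eqVneq (sin (acos c)) 0) => [s0|s0].
 exists (acos c, 0).
  by apply/domP; rewrite /= acos_ge0 // acos_lepi // lexx mulr_ge0 // pi_ge0.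
 rewrite s0 in hsin; apply: rowP3; rewrite ?sph0 ?sph1 ?sph2 /= ?acosK // s0 mul0r;
 apply/esym/eqP; rewrite -sqrf_eq0; apply/eqP; rewrite -/a -/b; have := sqr_ge0 a; have := sqr_ge0 b; lra.
set s := sin (acos c) in hsin hs0 s0.
have sp : 0 < s by rewrite lt_neqAle eq_sym s0.
pose d := a / s; pose e := b / s.
have hde : d ^+ 2 + e ^+ 2 = 1.
 by rewrite /d /e !expr_div_n -mulrDl -hsin mulfV // expf_neq0.
have hd : -1 <= d <= 1 by apply/andP; have := sqr_ge0 e; split; nra.
have hse : sin (acos d) = `|e|.
 rewrite sin_acos // -sqrtr_sqr; congr Num.sqrt; lra.
have ha : a = s * d by rewrite /d mulrC divfK.
have hb : b = s * e by rewrite /e mulrC divfK.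
have pi0 := pi_gt0 R.
have [l1 l2] : 0 <= acos d /\ acos d <= pi by split; [exact: acos_ge0|exact: acos_lepi].
case: (leP 0 e) => he.
 exists (acos c, acos d).
  by apply/domP; rewrite /= acos_ge0 // acos_lepi // l1; split=> //; lra.
 apply: rowP3; rewrite ?sph0 ?sph1 ?sph2 /= -/s; rewrite ?acosK //.
 by rewrite hse ger0_norm.
(* [acos] only covers the half circle where the sine is nonnegative, so a negative second coordinate
   calls for the reflected angle. *)
exists (acos c, 2 * pi - acos d).
 by apply/domP; rewrite /= acos_ge0 // acos_lepi //; split=> //; lra.
have h2 : 2 * pi = pi *+ 2 :> R by rewrite mulr_natl.
apply: rowP3; rewrite ?sph0 ?sph1 ?sph2 /= -/s.
- by rewrite cosB h2 cos2pi sin2pi mul1r mul0r addr0 acosK.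
- by rewrite sinB h2 cos2pi sin2pi mul1r mul0r sub0r hse ltr0_norm // opprK.
- by rewrite acosK.
Qed.

Lemma dvXn (f : R -> R) t a n : dva f t a -> dva (fun s => f s ^+ n) t (n%:R * f t ^+ n.-1 * a).
Proof.
move=> df; elim: n => [|n ih]; first by rewrite mul0r mul0r; exact: dvC.
rewrite (_ : (fun s => f s ^+ n.+1) = (fun s => f s * f s ^+ n)); last by apply/funext => s; rewrite exprS.
apply: dv_eq (dvM df ih) _; move: (f t) => b {ih}.
case: n => [|n] /=; first by rewrite expr0; ring.
by rewrite exprS -[n.+2%:R]natr1; ring.
Qed.

Lemma pint_theta (h H : R -> R) : (forall t, dva H t (h t * sin t)) -> continuous (fun t => h t) ->
 \I_p (h p.1) = 2 * pi * (H pi - H 0).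
Proof.
move=> hH ch; have pi0 := pi_ge0 R.
have ct : continuous (fun t => h t * sin t).
 by move=> t; apply: ctM; [exact: ch|exact: continuous_sin].
have cG : continuous (fun p : R * R => h p.1 * sin p.1).
 by apply: cont2_continuous; apply: (cont2_comp ct); exact: cont2_fst.
rewrite /pint (proj1 (fubini_rect 0 pi 0 (2 * pi) cG)) /=.
rewrite (@eq_Rintegral _ _ _ leb _ (fun t => 2 * pi * (h t * sin t))); last first.
 move=> t _; rewrite Rintegral_cst //=.
 by rewrite lebesgue_measure_itv /= lte_fin mulr_gt0 ?pi_gt0 //= subr0 mulrC.
rewrite (@ftc1 (fun t => 2 * pi * H t) (fun t => 2 * pi * (h t * sin t)) _ _ pi0).
- by rewrite mulrBr.
- by move=> t; apply: dv_eq (dvM (dvC _ t) (hH t)) _; rewrite mul0r add0r.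
- move=> t; change (ctat (fun t : R => 2 * pi * (h t * sin t)) t).
 by apply: ctM; [exact: ctC|exact: ct].
Qed.

(** The integral does not depend on [x]: a derivative in [x] moves to [q], where it integrates to 0.
    At the north pole it is an elementary integral in [theta]. *)
Lemma pint_zon N (x : E) : sphere x -> \I_q (zon N x q^S) = 4 * pi / N.+1%:R.
Proof.
move=> hx; have [p _ <-] := sph_surj hx.
have i1 : pL1 (fun _ : R * R => 1) := pL1C 1.
have h : kint (zon N) (fun _ => 1) p^S = kint (zon N) (fun _ => 1) (sph (0, 0)).
 apply: Xd0_cst; first by apply: AlgC1; apply: kint_Alg => //; exact: Kern_zon.
 move=> k y hy; rewrite Xd_kint //; last exact: Kern_zon.
 transitivity (- sint (Xd k (zon N y))); last by rewrite sint_Xd ?oppr0 //; apply: AlgC1; exact: Kern_Algr (Kern_zon N).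
 rewrite -[sint _]/(\I_q (Xd k (zon N y) q^S)) -pintN; last first.
  by apply: AlgL1; apply: Alg_Xd; exact: Kern_Algr (Kern_zon N).
 by eqq; rewrite mulr1 Xd_zonl //; exact: sphS.
have e z : kint (zon N) (fun _ => 1) z = \I_q (zon N z q^S).
 by eqq; rewrite mulr1.
rewrite -e h e.
transitivity (pint (fun q : R * R => ((1 + cos q.1) / 2) ^+ N)).
 eqq; rewrite /zon dotE !sph0 !sph1 !sph2 /= sin0 cos0.
 by rewrite !mul0r !add0r mul1r.
rewrite (@pint_theta (fun t => ((1 + cos t) / 2) ^+ N) (fun t => - (2 / N.+1%:R) * ((1 + cos t) / 2) ^+ N.+1)).
- rewrite cospi cos0 (_ : (1 + -1) / 2 = 0) ?expr0n /=; last by lra.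
 by rewrite (_ : (1 + 1) / 2 = 1) ?expr1n; [|lra]; move: N.+1%:R (pnatr_eq0 R N.+1) pi => k k0 q; field; rewrite k0.
- move=> t.
 have d1 : dva (fun t => (1 + cos t) / 2) t (- sin t / 2).
  by apply: dv_eq (dvM (dvD (dvC 1 t) (dv_cos t)) (dvC _ t)) _; ring.
 apply: dv_eq (dvM (dvC _ t) (dvXn N.+1 d1)) _; rewrite mul0r add0r /=.
 by move: (((1 + cos t) / 2) ^+ N) (sin t) => u v; move: N.+1%:R (pnatr_eq0 R N.+1) => k k0; field; rewrite k0.
- move=> t; change (ctat (fun t : R => ((1 + cos t) / 2) ^+ N) t); apply: ctX; apply: ctM; last exact: ctC.
 by apply: ctD; [exact: ctC|exact: continuous_cos].
Qed.

(** * Mollification on the sphere *)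

Definition molk (N : nat) (x y : E) : R := N.+1%:R / (4 * pi) * zon N x y.

Definition conv (N : nat) (F : R * R -> R) : E -> R := kint (molk N) F.

Lemma Kern_molk N : Kern (molk N).
Proof. exact: Kern_mul (Kern_cst _) (Kern_zon N). Qed.

Lemma dot_sphere_itv (x y : E) : sphere x -> sphere y -> -1 <= dot x y <= 1.
Proof.
move=> hx hy; have := dot_ge0 (x + y); have := dot_ge0 (x - y).
rewrite -scaleN1r !dotDl !dotDr !dotZl !dotZr [dot y x]dotC hx hy => h1 h2.
by lra.
Qed.

Lemma zon_ge0 N (x y : E) : sphere x -> sphere y -> 0 <= zon N x y.
Proof. by move=> hx hy; have /andP[h _] := dot_sphere_itv hx hy; apply: exprn_ge0; lra. Qed.

Lemma molk_ge0 N (x y : E) : sphere x -> sphere y -> 0 <= molk N x y.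
Proof. by move=> hx hy; apply: mulr_ge0; [rewrite divr_ge0 // mulr_ge0 // pi_ge0|exact: zon_ge0]. Qed.

Lemma molkC N (x y : E) : molk N x y = molk N y x.
Proof. by rewrite /molk zonC. Qed.

Lemma pint_molk N (x : E) : sphere x -> \I_q (molk N x q^S) = 1.
Proof.
move=> hx; rewrite pintZ; last by apply: AlgL1; exact: Kern_Algr (Kern_zon N).
rewrite pint_zon //; have := pi_gt0 R; move: N.+1%:R (pnatr_eq0 R N.+1) pi => k k0 q q0; field.
by rewrite k0 (gt_eqF q0).
Qed.

Lemma molk_pL1 N (x : E) F : pL1 F -> pL1 (fun q => molk N x q^S * F q).
Proof. exact: kint_pL1 (Kern_molk N). Qed.

Lemma conv_Alg N F : pL1 F -> Alg (conv N F).
Proof. exact: kint_Alg (Kern_molk N). Qed.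

Lemma conv_L1 N F : pL1 F -> pL1 (fun p => conv N F p^S).
Proof. by move=> iF; apply: AlgL1; exact: conv_Alg. Qed.

Lemma conv_pmeas N F : pL1 F -> pmeas (fun p => conv N F p^S).
Proof. by move=> iF; have [] := conv_L1 N iF. Qed.

Lemma eq_conv N F G x : (forall p, dom p -> F p = G p) -> conv N F x = conv N G x.
Proof. by move=> h; apply: eq_pint => p hp; rewrite h. Qed.

Lemma convD N F G x : pL1 F -> pL1 G -> conv N (fun p => F p + G p) x = conv N F x + conv N G x.
Proof.
move=> iF iG; rewrite /conv /kint -pintD; [|exact: molk_pL1..].
by eqq; rewrite mulrDr.
Qed.

Lemma convZ N c F x : pL1 F -> conv N (fun p => c * F p) x = c * conv N F x.
Proof.
move=> iF; rewrite /conv /kint -pintZ; last exact: molk_pL1.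
by eqq; rewrite mulrCA.
Qed.

Lemma convB N F G x : pL1 F -> pL1 G -> conv N (fun p => F p - G p) x = conv N F x - conv N G x.
Proof.
move=> iF iG; rewrite /conv /kint -pintB; [|exact: molk_pL1..].
by eqq; rewrite mulrBr.
Qed.

Lemma conv_sum N (I : Type) (s : seq I) (F : I -> R * R -> R) x : (forall i, pL1 (F i)) ->
 conv N (fun p => \sum_(i <- s) F i p) x = \sum_(i <- s) conv N (F i) x.
Proof.
move=> iF; rewrite /conv /kint -pintS; last by move=> i; exact: molk_pL1.
by eqq; rewrite mulr_sumr.
Qed.

Lemma conv_cst N c (x : E) : sphere x -> conv N (fun _ => c) x = c.
Proof.
move=> hx; have -> : conv N (fun _ => c) x = conv N (fun _ => c * 1) x by apply: eq_conv => p _; rewrite mulr1.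
rewrite convZ; last exact: pL1C.
rewrite -[RHS]mulr1 -[in RHS](pint_molk N hx); congr (_ * _).
by eqq; rewrite mulr1.
Qed.

Lemma conv_le N F G x : sphere x -> pL1 F -> pL1 G -> (forall p, dom p -> F p <= G p) ->
 conv N F x <= conv N G x.
Proof.
move=> hx iF iG h; apply: le_pint; [exact: molk_pL1|exact: molk_pL1|] => p hp.
by apply: ler_wpM2l; [apply: molk_ge0 => //; exact: sphS|exact: h].
Qed.

Lemma conv_norm N F x : sphere x -> pL1 F -> `|conv N F x| <= conv N (fun p => `|F p|) x.
Proof.
move=> hx iF; rewrite (le_trans (le_norm_pint (molk_pL1 N x iF))) //.
have e p : dom p -> `|molk N x p^S * F p| = molk N x p^S * `|F p|.
 by move=> _; rewrite normrM ger0_norm //; apply: molk_ge0 => //; exact: sphS.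
by rewrite (eq_pint e).
Qed.

Lemma conv_sym N F G : pL1 F -> pL1 G ->
 \I_p (G p * conv N F p^S) = \I_p (F p * conv N G p^S).
Proof.
move=> iF iG; rewrite (kint_fubini (Kern_molk N) iF iG); eqq; congr (_ * _).
by eqp; rewrite molkC.
Qed.

Lemma pint_conv N F : pL1 F -> \I_p (conv N F p^S) = pint F.
Proof.
move=> iF; transitivity (\I_p (1 * conv N F p^S)).
 by eqp; rewrite mul1r.
rewrite conv_sym //; last exact: pL1C.
by eqp; rewrite conv_cst ?mulr1 //; exact: sphS.
Qed.

Lemma pint_norm_conv N F : pL1 F -> \I_p (`|conv N F p^S|) <= \I_p (`|F p|).
Proof.
move=> iF; rewrite -(pint_conv N (pL1n iF)); apply: le_pint.
- exact: pL1n (conv_L1 N iF).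
- exact: conv_L1 (pL1n iF).
- by move=> p _; apply: conv_norm => //; exact: sphS.
Qed.

(** Moving the field from [x] to [q] in the kernel changes the sign, and weak integration by parts
    changes it back. *)
Lemma conv_wderiv N F G k (x : E) : pL1 F -> pL1 G -> sphere x ->
 (forall f : E -> R, Alg f -> \I_q (G q * f q^S) = - \I_q (F q * Xd k f q^S)) ->
 Xd k (conv N F) x = conv N G x.
Proof.
move=> iF iG hx h; rewrite (Xd_kint k (Kern_molk N) iF hx) /conv /kint.
have aK := Kern_Algr x (Kern_molk N).
transitivity (\I_q (G q * molk N x q^S)); last by eqq; rewrite mulrC.
rewrite h // -pintN; last first.
 have h1 := Alg_Xd k aK; apply: (eqL1 _ (L1Mct (Alg_cont2 h1) iF)) => p _; exact: mulrC.
eqq; have hq := sphS q.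
have -> : Xd k (molk N ^~ q^S) x = N.+1%:R / (4 * pi) * Xd k (zon N ^~ q^S) x.
 by rewrite -(XdZ k _ (AlgC1 (Kern_Algl _ (Kern_zon N))) hx).
have -> : Xd k (molk N x) q^S = N.+1%:R / (4 * pi) * Xd k (zon N x) q^S.
 by rewrite -(XdZ k _ (AlgC1 (Kern_Algr x (Kern_zon N))) hq).
by rewrite Xd_zonl // mulrN mulNr [F q * _]mulrC.
Qed.

(** Jensen's inequality for a probability kernel: mollify [(F - c)^2 >= 0] with [c] the mean at
    [x]. *)
Lemma conv_sqr_le N F (x : E) : pL1 F -> pL1 (fun p => F p ^+ 2) -> sphere x ->
 conv N F x ^+ 2 <= conv N (fun p => F p ^+ 2) x.
Proof.
move=> iF iF2 hx; set c := conv N F x.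
have i1 : pL1 (fun p => 2 * c * F p - c ^+ 2) by apply: pL1B; [exact: pL1Z|exact: pL1C].
have -> : c ^+ 2 = conv N (fun p => 2 * c * F p - c ^+ 2) x.
 rewrite convB; [|exact: pL1Z|exact: pL1C].
 by rewrite convZ // conv_cst // -/c; ring.
apply: conv_le => // p _; rewrite -subr_ge0.
by rewrite (_ : _ - _ = (F p - c) ^+ 2) ?sqr_ge0 //; ring.
Qed.

Lemma geom_lin_le (w : R) n : 0 <= w <= 1 -> n.+1%:R * w ^+ n * (1 - w) + w ^+ n.+1 <= 1.
Proof.
move=> /andP[w0 w1]; elim: n => [|n ih]; first by rewrite expr0 expr1; lra.
rewrite -[n.+2%:R]natr1.
have h : w ^+ n.+1 <= 1 by apply: exprn_ile1.
have h2 : 0 <= w ^+ n by apply: exprn_ge0.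
have := ler_wpM2l w0 ih; rewrite [w ^+ n.+2]exprS [w ^+ n.+1]exprS; rewrite exprS in h; move: {ih} (n.+1%:R) (w ^+ n) h h2 => k z h h2 h3.
have h4 : w * z * (1 - w) <= 1 - w by rewrite ler_piMl // subr_ge0.
nra.
Qed.

(** With [w = sqrt z], the product [(N + 1) w^N] stays below [1 / (1 - w)] while the remaining
    factor [w^N] tends to 0. *)
Lemma lin_geom_cvg0 (z : R) : 0 <= z < 1 -> N.+1%:R * z ^+ N @[N --> \oo] --> (0 : R).
Proof.
move=> /andP[z0 z1]; pose w := Num.sqrt z.
have w0 : 0 <= w by exact: sqrtr_ge0.
have ww : w ^+ 2 = z by exact: sqr_sqrtr.
have w1 : w < 1 by rewrite -sqrtr1 ltr_sqrt.
have g : w ^+ N * (1 - w)^-1 @[N --> \oo] --> (0 : R).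
 rewrite -(mul0r (1 - w)^-1); apply: cvgMl; apply: cvg_expr; by rewrite ger0_norm.
apply: (squeeze_cvgr _ (cvg_cst 0) g); apply: nearW => N.
rewrite mulr_ge0 ?exprn_ge0 //=.
rewrite ler_pdivlMr ?subr_gt0 // -ww -exprM mul2n -addnn exprD.
have := @geom_lin_le w N; rewrite w0 ltW //= => /(_ isT) h.
have h1 : N.+1%:R * w ^+ N * (1 - w) <= 1 by have := exprn_ge0 N.+1 w0; lra.
have h2 := exprn_ge0 N w0.
rewrite (_ : _ * _ * _ = N.+1%:R * w ^+ N * (1 - w) * w ^+ N); last by ring.
by rewrite ler_piMl.
Qed.

(** [2 - 2 dot] is the squared chordal distance. Where it is at least [r], the base of the kernel is
    at most [1 - r / 4]; elsewhere [F q - F p] vanishes. *)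
Lemma conv_local N F p r C : pL1 F -> dom p -> 0 <= C -> 0 < r <= 1 ->
 (forall q, dom q -> `|F q - F p| <= C) ->
 (forall q, dom q -> 2 - 2 * dot p^S q^S < r -> F q = F p) ->
 `|conv N F p^S - F p| <= C * (N.+1%:R * (1 - r / 4) ^+ N).
Proof.
move=> iF hp C0 /andP[r0 r1] hC hr; have hs := sphS p.
rewrite -{1}(conv_cst N (F p) hs) -convB //; last exact: pL1C.
have i1 : pL1 (fun q => F q - F p) by apply: pL1B; [|exact: pL1C].
apply: le_trans (conv_norm N hs i1) _.
pose K := N.+1%:R / (4 * pi) * (1 - r / 4) ^+ N * C.
apply: (@le_trans _ _ (pint (fun _ => K))).
 apply: le_pint; [exact: molk_pL1 (pL1n i1)|exact: pL1C|] => q hq.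
 have pi0 := pi_gt0 R; have hsq := sphS q.
 have k0 : 0 <= N.+1%:R / (4 * pi) :> R by rewrite divr_ge0 // mulr_ge0 // pi_ge0.
 have z0 : 0 <= 1 - r / 4 by lra.
 have K0 : 0 <= K by rewrite mulr_ge0 // mulr_ge0 // exprn_ge0.
 case: (ltP (2 - 2 * dot p^S q^S) r) => hd.
  by rewrite hr // subrr normr0 mulr0.
 apply: ler_pM; [exact: molk_ge0|exact: normr_ge0| |exact: hC].
 apply: ler_wpM2l => //; have /andP[d1 d2] := dot_sphere_itv hs hsq.
 by apply: lerXn2r; rewrite ?nnegrE //; lra.
rewrite (_ : K = K * 1) ?mulr1 //; have -> : pint (fun _ : R * R => K) = K * (4 * pi).
 transitivity (pint (fun q : R * R => K * zon 0 p^S q^S)).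
  by eqq; rewrite /zon expr0 mulr1.
 rewrite pintZ; last by apply: AlgL1; exact: Kern_Algr (Kern_zon 0).
 by rewrite pint_zon // divr1.
have := pi_gt0 R; rewrite /K; move: ((1 - r / 4) ^+ N) pi => a b b0.
by apply: eq_lerW; field; rewrite gt_eqF.
Qed.

Lemma dot_sphE (p q : R * R) : dot p^S q^S = cos (p.1 - q.1) - sin p.1 * sin q.1 * (1 - cos (p.2 - q.2)).
Proof. by rewrite dotE !sph0 !sph1 !sph2 !cosB; ring. Qed.

Lemma pae_line (a : R) : pae (fun p => p.1 != a) /\ pae (fun p => p.2 != a).
Proof.
have s0 : leb [set a] = 0%E by apply: countable_lebesgue_measure0; exact: countable1.
have h1 : leb2 ([set a] `*` setT) = 0%E.
 rewrite product_measure1E; [|exact: measurable_set1|exact: measurableT].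
 change (leb [set a] * leb setT = 0)%E; by rewrite s0 mul0e.
have h2 : leb2 (setT `*` [set a]) = 0%E.
 rewrite product_measure1E; [|exact: measurableT|exact: measurable_set1].
 change (leb setT * leb [set a] = 0)%E; by rewrite s0 mule0.
split.
 exists ([set a] `*` setT); split=> //; first by apply: measurableX; [exact: measurable_set1|exact: measurableT].
 by move=> [t f] /= h; split=> //=; apply: contrapT => /eqP n; exact: h.
exists (setT `*` [set a]); split=> //; first by apply: measurableX; [exact: measurableT|exact: measurable_set1].
by move=> [t f] /= h; split=> //=; apply: contrapT => /eqP n; exact: h.
Qed.

(** * Convergence of the mollified functions in L^1 and almost everywhere *)

Definition L1cvg (F_ : nat -> R * R -> R) (F : R * R -> R) : Prop :=
 [/\ forall n, pL1 (F_ n), pL1 F & \I_p (`|F_ n p - F p|) @[n --> \oo] --> (0 : R)].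

(** The functions that mollification recovers. The class is closed under linear combinations and
    [L^1] limits, so everything reduces to indicators of quadrants in the coordinate plane. *)
Definition convs (F : R * R -> R) : Prop := L1cvg (fun N p => conv N F p^S) F.

Lemma eq_convs F G : (forall p, dom p -> F p = G p) -> convs F -> convs G.
Proof.
move=> e [h1 h2 h3]; have iG := eqL1 e h2.
split=> //; first by move=> n; exact: conv_L1.
apply: cvg_trans h3; apply: near_eq_cvg; apply: nearW => n.
by apply: eq_pint => p hp; rewrite (e p hp) (eq_conv n p^S e).
Qed.

(** Mollification does not increase the [L^1] norm, so the error for [F] is at most that for [G]
    plus twice the distance from [F] to [G]. *)
Lemma convs_closed F : pL1 F ->
 (forall e : R, 0 < e -> exists2 G, convs G & \I_p (`|F p - G p|) <= e) -> convs F.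
Proof.
move=> iF h; split=> //; first by move=> n; exact: conv_L1.
apply/cvgrPdist_le => e e0.
have [G [h1 iG h3] hG] := h (e / 3) ltac:(lra).
move/cvgrPdist_le : h3 => /(_ (e / 3) ltac:(lra)); apply: filterS => n.
have i1 := conv_L1 n iF; have i2 := conv_L1 n iG.
rewrite !sub0r !normrN ger0_norm; last by apply: pint_ge0.
rewrite ger0_norm; last by apply: pint_ge0.
move=> hn.
apply: (@le_trans _ _ (\I_p (`|conv n (fun q => F q - G q) p^S| + `|conv n G p^S - G p| + `|F p - G p|))).
 apply: le_pint.
 - exact: pL1n (pL1B i1 iF).
 - apply: pL1D; first apply: pL1D.
  + exact: pL1n (conv_L1 n (pL1B iF iG)).
  + exact: pL1n (pL1B i2 iG).
  + exact: pL1n (pL1B iF iG).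
 - move=> p _; rewrite convB // [`|F p - G p|]distrC.
  rewrite (_ : conv n F p^S - F p = conv n F p^S - conv n G p^S + (conv n G p^S - G p) + (G p - F p)); last by ring.
  by apply: le_trans (ler_normD _ _) _; rewrite lerD2r ler_normD.
rewrite pintD; [|apply: pL1D|]; [|exact: pL1n (conv_L1 n (pL1B iF iG))|exact: pL1n (pL1B i2 iG)|exact: pL1n (pL1B iF iG)].
rewrite pintD; [|exact: pL1n (conv_L1 n (pL1B iF iG))|exact: pL1n (pL1B i2 iG)].
have := pint_norm_conv n (pL1B iF iG); lra.
Qed.

Lemma convsD (a b : R) F G : convs F -> convs G -> convs (fun p => a * F p + b * G p).
Proof.
move=> [h1 iF h3] [h1' iG h3'].
have i1 : pL1 (fun p => a * F p + b * G p) by apply: pL1D; exact: pL1Z.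
split=> //; first by move=> n; exact: conv_L1.
have h : (fun n => `|a| * \I_p (`|conv n F p^S - F p|) + `|b| * \I_p (`|conv n G p^S - G p|)) @ \oo --> (0 : R).
 rewrite -[0]addr0 -[X in X + _](mulr0 `|a|) -[X in _ + X](mulr0 `|b|).
 by apply: cvgD; apply: cvgMr.
apply: (squeeze_cvgr _ (cvg_cst 0) h); apply: nearW => n; apply/andP; split; first by apply: pint_ge0.
have j1 := pL1n (pL1B (conv_L1 n iF) iF); have j2 := pL1n (pL1B (conv_L1 n iG) iG).
rewrite -!pintZ // -pintD; [|exact: pL1Z..].
apply: le_pint; [exact: pL1n (pL1B (conv_L1 n i1) i1)|by apply: pL1D; exact: pL1Z|] => p _.
rewrite convD; [|exact: pL1Z..]; rewrite !convZ // -!normrM.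
by apply: le_trans (ler_normD _ _); apply: eq_lerW; congr `|_|; ring.
Qed.

Lemma L1cvg_bounded (F_ : nat -> R * R -> R) F (C : R) : (forall n, pmeas (F_ n)) -> pmeas F ->
 pae (fun p => F_ n p @[n --> \oo] --> F p) ->
 (forall n p, dom p -> `|F_ n p| <= C) -> (forall p, dom p -> `|F p| <= C) -> L1cvg F_ F.
Proof.
move=> mF_ mF cF hC hF.
split=> [n||]; [exact: pL1_bounded (hC n)|exact: pL1_bounded hF|].
have m1 n : pmeas (fun p => `|F_ n p - F p|).
 by apply: (pmeas_ct (f := fun x : R => `|x|)); [exact: norm_continuous|exact: pmeasB].
have [] := @pint_dct (fun n p => `|F_ n p - F p|) (fun _ => 0) (fun _ => C + C) m1 (pmeasC 0) _ (pL1C _) _.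
- apply: paeS cF => p _ h; rewrite -[0](normr0 R) -(subrr (F p)).
 by apply: cvg_norm; apply: cvgB h (cvg_cst _).
- by move=> n p hp; rewrite normr_id; apply: le_trans (ler_normB _ _) _; apply: lerD; [exact: hC|exact: hF].
- by rewrite pint0.
Qed.

(** Quadrants are stable under intersection, generate the product sigma-algebra, and have indicators
    that are locally constant off two lines. *)
Definition quadr (a b : R) : set (mR * mR) := `]-oo, a[ `*` `]-oo, b[.

Lemma cos_decr (x y : R) : 0 <= x -> x < y -> y <= pi -> cos y < cos x.
Proof. by move=> x0 xy y1; rewrite ltr_cos // in_itv /= ?x0 ?y1 /=; lra. Qed.

Lemma cos_ndecr (x y : R) : 0 <= x -> x <= y -> y <= pi -> cos y <= cos x.
Proof. by move=> x0; rewrite le_eqVlt => /orP[/eqP -> //|h y1]; apply: ltW; exact: cos_decr. Qed.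

Lemma lt_near_side (x y a : R) : `|x - y| < `|x - a| -> (y < a) = (x < a).
Proof. by case: (ltP x a) => h1; case: (ltP y a) => h2 //; case: (ger0P (x - y)); case: (ger0P (x - a)); lra. Qed.

Lemma cvg_dist_le (f u : nat -> R) (a : R) : (forall n, `|f n - a| <= u n) ->
 u n @[n --> \oo] --> (0 : R) -> f n @[n --> \oo] --> a.
Proof.
move=> h /cvgr0Pnorm_le hu; apply/cvgrPdist_le => e e0; have := hu e e0.
by apply: filterS => n hn; rewrite distrC; apply: le_trans (h n) (le_trans (ler_norm _) hn).
Qed.

(** Points close on the sphere are close in coordinates when [p] is off the poles and off the seam
    [phi = 0], [phi = 2 pi]. By [dot_sphE] the squared chordal distance is a sum of two nonnegative
    terms, one for each angle. *)
Lemma quadr_local (a b : R) (p : R * R) : dom p -> 0 < sin p.1 ->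
 p.2 != 0 -> p.2 != 2 * pi -> p.1 != a -> p.2 != b ->
 exists2 r : R, 0 < r <= 1 & forall q, dom q -> 2 - 2 * dot p^S q^S < r ->
  ((q.1 < a) = (p.1 < a)) /\ ((q.2 < b) = (p.2 < b)).
Proof.
case: p => [t f] /domP /= [/andP[t0 t1] /andP[f0 f1]] st nf0 nf1 nt nf.
have pi0 := pi_gt0 R.
have f0' : 0 < f by rewrite lt_neqAle eq_sym nf0.
have f1' : f < 2 * pi by rewrite lt_neqAle nf1.
have [d d0 hd] : exists2 d : R, 0 < d & forall t' : R, `|t - t'| < d -> sin t / 2 < sin t'.
 have h : \forall t' \near t, sin t / 2 < sin t' by apply: (cvgr_gt (sin t) (@continuous_sin R t)); lra.
 by move/nbhs_ballP : h => [d d0 hd]; exists d => // t' ht'; apply: hd.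
pose m (x y : R) := Num.min x y.
(* [eta] keeps the first angle on its side of [a] and, through [d], keeps [sin t'] above
   [sin t / 2]. The bounds on [zeta] below also exclude wrapping around the seam. *)
pose eta : R := m (m `|t - a| d) 1.
have eta0 : 0 < eta by rewrite /eta /m !lt_min ltr01 d0 normr_gt0 subr_eq0 nt.
have [e1 [e2 e3]] : eta <= `|t - a| /\ eta <= d /\ eta <= 1.
 by rewrite /eta /m; split; [|split]; rewrite !ge_min ?lexx ?orbT.
have pi1 : 1 <= pi :> R by have := @pi_ge2 R; lra.
pose zeta : R := m (m `|f - b| f) (m (2 * pi - f) pi).
have zeta0 : 0 < zeta by rewrite /zeta /m !lt_min f0' pi0 normr_gt0 subr_eq0 nf subr_gt0 f1'.
have [z1 [z2 [z3 z4]]] : zeta <= `|f - b| /\ zeta <= f /\ zeta <= 2 * pi - f /\ zeta <= pi.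
 by rewrite /zeta /m; split; [|split; [|split]]; rewrite !ge_min ?lexx ?orbT.
have ce : cos eta < 1 by rewrite -cos0; apply: cos_decr => //; lra.
have cz : cos zeta < 1 by rewrite -cos0; apply: cos_decr => //; lra.
pose r : R := m (m (2 * (1 - cos eta)) (sin t ^+ 2 * (1 - cos zeta))) 1.
have r0 : 0 < r by rewrite /r /m !lt_min ltr01 !mulr_gt0 ?subr_gt0 // exprn_gt0.
have [r1 [r2 r3]] : r <= 2 * (1 - cos eta) /\ r <= sin t ^+ 2 * (1 - cos zeta) /\ r <= 1.
 by rewrite /r /m; split; [|split]; rewrite !ge_min ?lexx ?orbT.
exists r; first by rewrite r0.
move=> [t' f'] /domP /= [/andP[t0' t1'] /andP[f0'' f1'']].
rewrite dot_sphE /= => hr.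
have st' : 0 <= sin t' by apply: sin_ge0_pi; rewrite t0' t1'.
have c1 : 0 <= 1 - cos (f - f') by rewrite subr_ge0 cos_le1.
have c2 : cos (t - t') <= 1 by exact: cos_le1.
have ss : 0 <= sin t * sin t' * (1 - cos (f - f')) by rewrite mulr_ge0 // mulr_ge0 // ltW.
have ht : `|t - t'| < eta.
 rewrite ltNge; apply/negP => hle.
 have l1 : `|t - t'| <= pi by rewrite ler_norml; lra.
 have : cos `|t - t'| <= cos eta by apply: cos_ndecr => //; lra.
 rewrite cos_norm; lra.
split.
 by apply: lt_near_side; apply: lt_le_trans ht e1.
have hst : sin t / 2 < sin t' by apply: hd; apply: lt_le_trans ht e2.
have hf : `|f - f'| < zeta.
 rewrite ltNge; apply/negP => hle.
 have l1 : `|f - f'| <= 2 * pi - zeta by rewrite ler_norml; lra.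
 have h3 : cos (f - f') <= cos zeta.
  (* Beyond [pi] the cosine increases again; there [|f - f'| <= 2 pi - zeta] gives the bound by
     symmetry. *)
  rewrite -cos_norm; case: (leP `|f - f'| pi) => h4.
   by apply: cos_ndecr => //; lra.
  rewrite -[cos `|_|]cosN -[cos (- _)]cosD2pi.
  by apply: cos_ndecr; rewrite ?mulr2n; lra.
 have h5 : sin t ^+ 2 * (1 - cos zeta) <= 2 * (sin t * sin t' * (1 - cos (f - f'))).
  rewrite expr2; have h6 : sin t * sin t <= 2 * (sin t * sin t') by nra.
  have k1 : 0 <= sin t * sin t by rewrite mulr_ge0 // ltW.
  have k2 : 0 <= 1 - cos zeta by rewrite subr_ge0 cos_le1.
  have k3 : 1 - cos zeta <= 1 - cos (f - f') by rewrite lerD2l lerN2.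
  by rewrite !mulrA in h6 *; exact: (ler_pM k1 k2 h6 k3).
 lra.
by apply: lt_near_side; apply: lt_le_trans hf z1.
Qed.

Lemma convs_quadr (a b : R) : convs (\1_(quadr a b)).
Proof.
have mq : pmeas (\1_(quadr a b)).
 have -> : \1_(quadr a b) = (fun p : R * R => \1_(`]-oo, a[) p.1 * \1_(`]-oo, b[) p.2 :> R).
  by apply/funext => -[x y]; rewrite !indicE /quadr in_setX /= -natrM mulnb.
 by apply: pmeasM; [apply: pmeas_fst|apply: pmeas_snd]; exact: measurable_indic.
have b1 p : `|\1_(quadr a b) p : R| <= 1 by rewrite indicE; case: (_ \in _); rewrite ?normr0 ?normr1.
have iq : pL1 (\1_(quadr a b)) by apply: pL1_bounded mq _ => p _; exact: b1.
apply: (@L1cvg_bounded _ _ 1) => //.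
- by move=> n; exact: conv_pmeas.
- have [_ h1] := pae_line 0; have [_ h2] := pae_line (2 * pi).
 have [h3 _] := pae_line a; have [_ h4] := pae_line b.
 have := paeI pae_sin (paeI (paeI h1 h2) (paeI h3 h4)).
 apply: paeS => p hp [s0 [[k1 k2] [k3 k4]]].
 have [r r0 hr] := quadr_local hp s0 k1 k2 k3 k4.
 have hz : 0 <= 1 - r / 4 < 1 by case/andP: r0 => *; lra.
 have g : 2 * (N.+1%:R * (1 - r / 4) ^+ N) @[N --> \oo] --> (0 : R).
  by rewrite -(mulr0 2); apply: cvgMr; exact: lin_geom_cvg0.
 apply: (cvg_dist_le _ g) => n; apply: conv_local => //.
  by move=> q _; apply: le_trans (ler_normB _ _) _; have := b1 q; have := b1 p; lra.
 move=> q hq hd; have [e1 e2] := hr q hq hd.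
 by move: e1 e2; case: p {hp s0 k1 k2 k3 k4 hr hd} => x y; case: q {hq} => x' y' /= e1 e2; rewrite !indicE /quadr !in_setX !mem_setE !in_itv /= e1 e2.
- move=> n p _; have hs := sphS p; apply: le_trans (conv_norm n hs iq) _.
 rewrite -[leRHS](conv_cst n 1 hs); apply: conv_le => //; [exact: pL1n|exact: pL1C].
Qed.

Lemma convs_indicD (A B : set (mR * mR)) : B `<=` A -> convs (\1_A) -> convs (\1_B) -> convs (\1_(A `\` B)).
Proof.
move=> BA h1 h2; apply: eq_convs (convsD 1 (-1) h1 h2) => p _.
rewrite mul1r mulN1r !indicE in_setD; case: (boolP (p \in B)) => [/set_mem /BA /mem_set ->|_] /=.
 by rewrite subrr.
by rewrite subr0 andbT.
Qed.

Lemma indic_pmeas (A : set (mR * mR)) : measurable A -> pmeas (\1_A).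
Proof. by move=> mA; apply: measurable_funTS; exact: measurable_indic. Qed.

Lemma indic_norm_le1 (A : set (mR * mR)) p : `|\1_A p : R| <= 1.
Proof. by rewrite indicE; case: (_ \in _); rewrite ?normr0 ?normr1. Qed.

Lemma convs_cvg (F_ : nat -> R * R -> R) F : (forall n, convs (F_ n)) -> L1cvg F_ F -> convs F.
Proof.
move=> h [h1 h2 h3]; apply: convs_closed => // e e0.
move/cvgrPdist_le : h3 => /(_ e e0) [n _ hn]; exists (F_ n) => //.
have := hn n (leqnn n); rewrite /= sub0r normrN ger0_norm; last by apply: pint_ge0.
by apply: le_trans; apply: eq_lerW; eqp; rewrite distrC.
Qed.

Lemma convs_indicU (F : nat -> set (mR * mR)) : (forall n, measurable (F n)) -> nondecreasing_seq F ->
 (forall n, convs (\1_(F n))) -> convs (\1_(\bigcup_n F n)).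
Proof.
move=> mF ndF hF; apply: (convs_cvg hF); apply: (@L1cvg_bounded _ _ 1).
- by move=> n; exact: indic_pmeas.
- by apply: indic_pmeas; exact: bigcup_measurable.
- apply: paeT => p _; case: (pselect ((\bigcup_n F n) p)) => [[n _ hn]|hp].
  apply: cvg_near_cst; exists n => // m /= nm.
  rewrite !indicE (mem_set (_ : (\bigcup_n F n) p)) ?mem_set //; last by exists n.
  by have /subsetPset := ndF _ _ nm; exact.
 apply: cvg_near_cst; apply: nearW => n.
 by rewrite !indicE !memNset // => h; apply: hp; exists n.
- by move=> n p _; exact: indic_norm_le1.
- by move=> p _; exact: indic_norm_le1.
Qed.

(** Dynkin's argument: the measurable sets with indicator in [convs] form a lambda-system that
    contains the quadrants. *)
Lemma convs_indic (S : set (mR * mR)) : measurable S -> convs (\1_S).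
Proof.
set Q := [set quadr a b | a in @setT R & b in @setT R].
have mq a b : measurable (quadr a b : set (mR * mR)) by apply: measurableX; exact: measurable_itv.
have qP a b p : quadr a b p = (p.1 < a /\ p.2 < b) by rewrite /quadr /= !in_itv.
have QI : setI_closed Q.
 move=> _ _ [a _ [b _ <-]] [c _ [d _ <-]]; exists (Num.min a c) => //; exists (Num.min b d) => //.
 apply/seteqP; split=> p; rewrite /setI /= !qP !lt_min; first by move=> [/andP[? ?] /andP[? ?]].
 by move=> [[-> ->] [-> ->]].
have h : lambda_system setT [set A : set (mR * mR) | measurable A /\ convs (\1_A)].
 split=> //.
 - split; first exact: measurableT.
  apply: eq_convs (convs_quadr (pi + 1) (2 * pi + 1)) => -[x y] /domP /= [/andP[_ hx] /andP[_ hy]].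
  by rewrite !indicE in_setT mem_set //= qP /=; split; lra.
 - by move=> X Y YX [mX pX] [mY pY]; split; [exact: measurableD|exact: convs_indicD].
 - move=> F ndF hF; split; first by apply: bigcup_measurable => n _; have [] := hF n.
  by apply: convs_indicU => // n; have [] := hF n.
have sQ : <<s Q>> `<=` [set A : set (mR * mR) | measurable A /\ convs (\1_A)].
 by apply: (lambda_system_subset QI h) => // _ [a _ [b _ <-]]; split; [exact: mq|exact: convs_quadr].
(* Conversely, every measurable set of the product is generated by quadrants, because both
   projections are measurable for the sigma-algebra that they generate. *)
have qQ a b : measurable (quadr a b : set (g_sigma_algebraType Q)) by apply: sub_sigma_algebra; exists a => //; exists b.
have m1 : measurable_fun setT (fst : g_sigma_algebraType Q -> mR).
 apply: (measurability (@RGenInftyO.G R) (RGenInftyO.measurableE R)) => _ [_ [a ->] <-].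
 rewrite setTI (_ : _ @^-1` _ = \bigcup_n quadr a n%:R); first exact: bigcupT_measurable.
 apply/seteqP; split=> -[x y] /=; rewrite in_itv /=; last by move=> [n _]; rewrite qP => -[].
 by exists (Num.truncn y).+1 => //; rewrite qP /=; split=> //; exact: truncnS_gt.
have m2 : measurable_fun setT (snd : g_sigma_algebraType Q -> mR).
 apply: (measurability (@RGenInftyO.G R) (RGenInftyO.measurableE R)) => _ [_ [a ->] <-].
 rewrite setTI (_ : _ @^-1` _ = \bigcup_n quadr n%:R a); first exact: bigcupT_measurable.
 apply/seteqP; split=> -[x y] /=; rewrite in_itv /=; last by move=> [n _]; rewrite qP => -[].
 by exists (Num.truncn x).+1 => //; rewrite qP /=; split=> //; exact: truncnS_gt.
move=> mS; suff /sQ[] : <<s Q>> S by [].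
move: S mS; rewrite measurable_prod_measurableType; apply: smallest_sub; first exact: smallest_sigma_algebra.
move=> _ [A mA [B mB <-]]; have := measurableI _ _ (m1 measurableT _ mA) (m2 measurableT _ mB); rewrite !setTI; exact.
Qed.

Lemma convs_sum (I : Type) (s : seq I) (F : I -> R * R -> R) : (forall i, convs (F i)) ->
 convs (fun p => \sum_(i <- s) F i p).
Proof.
move=> h; elim: s => [|i s ih].
 have h0 : convs (\1_(set0 : set (mR * mR))) by exact: convs_indic.
 by apply: eq_convs h0 => p _; rewrite big_nil indic0.
by apply: eq_convs (convsD 1 1 (h i) ih) => p _; rewrite big_cons !mul1r.
Qed.

Import HBNNSimple.

Lemma convs_nneg F : pL1 F -> (forall p, dom p -> 0 <= F p) -> convs F.
Proof.
move=> iF F0; have [mF _] := iF; have mE : measurable_fun dom (EFin \o F) by exact/measurable_EFinP.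
pose g := nnsfun_approx dom_meas mE.
have F0' p : dom p -> (0 <= (EFin \o F) p)%E by move=> hp; rewrite lee_fin F0.
have cg p : dom p -> g n p @[n --> \oo] --> F p.
 by move=> hp; apply: (fine_cvg (cvg_nnsfun_approx _ _ F0' hp)).
have gF n p : dom p -> 0 <= g n p <= F p.
 move=> hp; rewrite fun_ge0 -(cvg_lim _ (cg p hp)) //.
 apply: (nondecreasing_cvgn_le _ (cvgP _ (cg p hp))) => k m km.
 by have /lefP := nd_nnsfun_approx dom_meas mE km; exact.
have cG n : convs (g n).
 have h (y : R) : convs (fun p => y * \1_(g n @^-1` [set y]) p).
  have h := convs_indic (measurable_funPTI (g n) (measurable_set1 y)).
  by apply: eq_convs (convsD y 0 h h) => p _; rewrite mul0r addr0.
 apply: (eq_convs (fun p _ => esym (fimfunEord (g n) p))).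
 by apply: (@convs_sum _ _ (fun i p => _ * \1_(g n @^-1` [set _]) p)) => i; exact: h.
apply: (convs_cvg cG); split=> //; first by move=> n; have [] := cG n.
have m1 n : pmeas (fun p => `|g n p - F p|) by case: (pL1n (pL1B (let: And3 _ h _ := cG n in h) iF)).
have [] := @pint_dct (fun n p => `|g n p - F p|) (fun _ => 0) F m1 (pmeasC 0) _ iF _.
- apply: paeT => p hp; have h : g n p - F p @[n --> \oo] --> F p - F p by apply: cvgB (cg p hp) _; exact: cvg_cst.
 by rewrite -(@normr0 _ R) -(subrr (F p)); exact: cvg_norm h.
- by move=> n p /(gF n) /andP[h1 h2]; rewrite normr_id ler_norml; lra.
- by rewrite pint0.
Qed.

Theorem conv_cvg F : pL1 F -> convs F.
Proof.
move=> iF; have iN := pL1n iF.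
have c1 := convs_nneg iN (fun p _ => normr_ge0 (F p)).
have c2 : convs (fun p => `|F p| + F p).
 apply: convs_nneg; first exact: pL1D.
 by move=> p _; have := ler_norm (- F p); rewrite normrN; lra.
by apply: eq_convs (convsD (-1) 1 c1 c2) => p _; ring.
Qed.

(** Integrability of the limit is part of the conclusion; [e^(2u)] and the square of [rho psi]
    obtain theirs here. The exceptional set is cut away by an indicator, after which convergence
    holds everywhere. *)
Lemma pint_fatou_ae (F_ : nat -> R * R -> R) F (C : R) : (forall n, pL1 (F_ n)) -> pmeas F ->
 pae (fun p => F_ n p @[n --> \oo] --> F p) ->
 (forall n p, dom p -> 0 <= F_ n p) ->
 (forall n, pint (F_ n) <= C) -> pL1 F /\ pint F <= C.
Proof.
move=> iF mF [N [mN N0 sN]] F0 hC.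
pose c (p : R * R) : R := \1_(~` N) p.
have mc : pmeas c by apply: indic_pmeas; exact: measurableC.
have c1 p : `|c p| <= 1 by exact: indic_norm_le1.
have c0 p : 0 <= c p by rewrite /c indicE.
have ae1 G : pae (fun p => c p * G p = G p).
 exists N; split=> // p /= hp; apply: contrapT => hN; apply: hp => _.
 by rewrite /c indicE mem_set // mul1r.
have ic n : pL1 (fun p => c p * F_ n p) by exact: pL1_Mbounded (fun p _ => c1 p) (iF n).
have [] := @pint_fatou (fun n p => c p * F_ n p) (fun p => c p * F p) C ic.
- exact: pmeasM.
- move=> p hp; case: (pselect (N p)) => hN.
  by rewrite /c indicE memNset ?mul0r; [under eq_fun do rewrite mul0r; exact: cvg_cst|rewrite /=; tauto].
 apply: cvgMr; apply: contrapT => h; apply: hN; apply: sN => /= h'; exact: h (h' hp).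
- by move=> n p hp; rewrite mulr_ge0 // F0.
- move=> n; rewrite (@ae_eq_pint _ (F_ n)) //; [exact: (ic n).1|exact: (iF n).1].
- move=> iF' h; have mF' : pmeas (fun p => c p * F p) by exact: pmeasM.
 have ae2 : pae (fun p => c p * F p = F p) by exact: ae1.
 split; first exact: (ae_eq_pL1 mF ae2 iF').
 by rewrite -(ae_eq_pint mF' mF ae2).
Qed.

(** Indices with [L^1] errors at most [2^-n] make the sum of the errors integrable, hence finite
    almost everywhere, so the errors tend to 0 there. The condition [n <= s n] is enough for [s] to
    preserve limits. *)
Lemma L1cvg_subseq (F_ : nat -> R * R -> R) F : L1cvg F_ F ->
 exists2 s : nat -> nat, (forall n, (n <= s n)%N) & pae (fun p => F_ (s n) p @[n --> \oo] --> F p).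
Proof.
move=> [iF_ iF cF].
have /choice[s hs] : forall n : nat, exists m : nat, (n <= m)%N /\ \I_p (`|F_ m p - F p|) <= 2^-1 ^+ n.
 move=> n; have e0 : 0 < 2^-1 ^+ n :> R by rewrite exprn_gt0 // invr_gt0.
 move/cvgr0Pnorm_le : cF => /(_ _ e0) [m _ hm]; exists (maxn n m); split; first exact: leq_maxl.
 by apply: le_trans (ler_norm _) (hm _ _); rewrite /= leq_maxr.
exists s; first by move=> n; have [] := hs n.
pose g n p := `|F_ (s n) p - F p|.
have ig n : pL1 (g n) by exact: pL1n (pL1B (iF_ _) iF).
pose G n (p : R * R) : \bar R := (g n p * sin p.1)%:E.
have mG n : measurable_fun dom (G n).
 by have h := pmeasM (ig n).1 pmeas_sin; apply/measurable_EFinP; exact: h.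
have G0 n p : dom p -> (0 <= G n p)%E by move=> hp; rewrite lee_fin mulr_ge0 ?normr_ge0 // dom_sin_ge0.
have hG n : (\int[leb2]_(p in dom) G n p = (pint (g n))%:E)%E.
 by rewrite /pint /Rintegral fineK //; apply: integrable_fin_num; [exact: dom_meas|exact: (ig n).2].
have h1 : (\int[leb2]_(p in dom) (\sum_(0 <= k <oo) G k p) <= 2%:E)%E.
 rewrite (integral_nneseries _ dom_meas mG) //.
 apply: lime_le; first by apply: is_cvg_nneseries => n _ _; apply: integral_ge0 => p hp; exact: G0.
 apply: nearW => n; rewrite (eq_bigr (fun k => (pint (g k))%:E)); last by move=> k _; exact: hG.
 rewrite sumEFin lee_fin.
 have h : \sum_(0 <= k < n) pint (g k) + 2 * 2^-1 ^+ n <= 2.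
  elim: n => [|n ih]; first by rewrite big_geq // expr0; lra.
  rewrite big_nat_recr //= exprS; have [_] := hs n; rewrite -/(g n) => h; lra.
 have : 0 <= 2^-1 ^+ n :> R by rewrite exprn_ge0 // invr_ge0.
 lra.
pose S p := (\sum_(0 <= k <oo) G k p)%E.
have mS : measurable_fun dom S by apply: ge0_emeasurable_sum => // k p hp _; exact: G0.
have S0 p : dom p -> (0 <= S p)%E by move=> hp; apply: nneseries_ge0 => n _ _; exact: G0.
have iS : leb2.-integrable dom S.
 apply/integrableP; split=> //; apply: le_lt_trans (ltry 2); apply: le_trans h1.
 apply: eq_lerW; apply: eq_integral => p /set_mem hp.
 by rewrite gee0_abs ?S0.
have hfin : pae (fun p => S p \is a fin_num) by apply: integrable_ae iS; exact: dom_meas.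
apply: paeS (paeI hfin pae_sin) => p hp [hS sp].
have bnd n : \sum_(0 <= k < n) g k p <= fine (S p) / sin p.1.
 rewrite ler_pdivlMr // mulr_suml -lee_fin fineK // -sumEFin.
 by apply: (@nneseries_lim_ge R (fun k => G k p) xpredT 0%N n) => k _ _; exact: G0.
have hc : cvgn (series (fun k => g k p)).
 apply: nondecreasing_is_cvgn; first by apply: nondecreasing_series => n _ _; exact: normr_ge0.
 by exists (fine (S p) / sin p.1) => _ [n _ <-]; rewrite /series /=; exact: bnd.
have := cvg_series_cvg_0 hc => h; apply: (cvg_dist_le _ h) => n; exact: lexx.
Qed.

Lemma cvg_sumf (I : Type) (s : seq I) (f : I -> nat -> R) (l : I -> R) :
 (forall i, f i n @[n --> \oo] --> l i) -> \sum_(i <- s) f i n @[n --> \oo] --> \sum_(i <- s) l i.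
Proof.
move=> h; elim: s => [|i s ih].
 by rewrite big_nil; under eq_fun do rewrite big_nil; exact: cvg_cst.
by rewrite big_cons; under eq_fun do rewrite big_cons; exact: cvgD.
Qed.

(** A single subsequence serves a finite family when it is chosen for the sum of the errors. *)
Lemma L1cvg_subseq_fam (I : finType) (F_ : I -> nat -> R * R -> R) (F : I -> R * R -> R) :
 (forall i, L1cvg (F_ i) (F i)) ->
 exists2 s : nat -> nat, (forall n, (n <= s n)%N) & pae (fun p => forall i, F_ i (s n) p @[n --> \oo] --> F i p).
Proof.
move=> h.
have i1 i n : pL1 (fun p => `|F_ i n p - F i p|) by have [a b _] := h i; exact: pL1n (pL1B (a n) b).
have [] := @L1cvg_subseq (fun n p => \sum_i `|F_ i n p - F i p|) (fun _ => 0).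
 split; [by move=> n; apply: pL1S|exact: pL1C|].
 have e n : \I_p (`|\sum_i `|F_ i n p - F i p| - 0|) = \sum_i \I_p (`|F_ i n p - F i p|).
  by rewrite -pintS //; eqp; rewrite subr0 ger0_norm // sumr_ge0.
 have h3 i : \I_p (`|F_ i n p - F i p|) @[n --> \oo] --> (0 : R) by have [] := h i.
 have := @cvg_sumf I (index_enum I) _ _ h3.
 by rewrite big1 //; under [in X in _ -> X]eq_fun do rewrite e.
move=> s hs hae; exists s => //; apply: paeS hae => p _ hp i.
apply: (cvg_dist_le _ hp) => n; rewrite (bigD1 i) //= lerDl; exact: sumr_ge0.
Qed.

Lemma conv_subseq (I : finType) (F : I -> R * R -> R) : (forall i, pL1 (F i)) ->
 exists2 s : nat -> nat, (forall n, (n <= s n)%N) &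
  pae (fun p => forall i, conv (s n) (F i) p^S @[n --> \oo] --> F i p).
Proof.
move=> h; apply: (@L1cvg_subseq_fam I (fun i n p => conv n (F i) p^S) F).
by move=> i; exact: conv_cvg.
Qed.

(** The kernel at a fixed point is itself a test function, so every mollification of [F] is zero. *)
Lemma pint_orth0 F : pL1 F -> (forall f : E -> R, Alg f -> \I_p (F p * f p^S) = 0) ->
 pae (fun p => F p = 0).
Proof.
move=> iF h; have [_ _ hc] := conv_cvg iF.
have e n : \I_p (`|conv n F p^S - F p|) = \I_p (`|F p|).
 eqp; rewrite (_ : conv n F p^S = 0) ?sub0r ?normrN //.
 rewrite -(h (molk n p^S)); last by exact: Kern_Algr (Kern_molk n).
 by eqq; rewrite mulrC.
have h0 : \I_p (`|F p|) = 0.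
 have hc' : (fun _ : nat => \I_p (`|F p|)) @ \oo --> (0 : R) by under eq_fun => n do rewrite -(e n).
 by rewrite -(cvg_lim _ hc') // lim_cst.
apply: paeS (pint_eq0_ae (pL1n iF) (fun p _ => normr_ge0 (F p)) h0) => p _ /eqP.
by rewrite normr_eq0 => /eqP.
Qed.

(** * One-variable inequalities *)

Lemma dva_ct (f : R -> R) t a : dva f t a -> ctat f t.
Proof. by case=> h _; apply: differentiable_continuous; apply/derivable1_diffP. Qed.

Lemma ctR (f : R -> R) (x : R) : continuous f -> ctat f x.
Proof. by move=> h; exact: h. Qed.

Lemma ctN (f : R -> R) (t : R) : ctat f t -> ctat (fun y => - f y) t.
Proof. exact: cvgN. Qed.

Ltac ct := repeat first [exact: ctC | assumption | (apply: ctR; assumption) | apply: ctX | apply: ctD | apply: ctN | apply: ctM ].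

Lemma ftc_in (F f : R -> R) (a b : R) : a <= b -> (forall x, a <= x <= b -> dva F x (f x)) -> continuous f ->
 \int[leb]_(x in `[a, b]) f x = F b - F a.
Proof.
rewrite le_eqVlt => /orP[/eqP -> _ _|ab dF cf].
 by rewrite subrr (_ : `[b, b]%classic = [set b]) ?Rintegral_set1 // set_itv1.
rewrite /Rintegral (@continuous_FTC2 _ f F a b ab) ?EFinB //.
- exact: continuous_subspaceT.
- split.
 + by move=> x; rewrite in_itv /= => /andP[x1 x2]; case: (dF x) => //; rewrite !ltW.
 + by apply: cvg_at_right_filter; apply: (dva_ct (dF a _)); rewrite lexx ltW.
 + by apply: cvg_at_left_filter; apply: (dva_ct (dF b _)); rewrite lexx ltW.
- move=> x; rewrite in_itv /= => /andP[x1 x2]; rewrite derive1E; by case: (dF x) => //; rewrite !ltW.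
Qed.

Lemma ct_itv_integrable (f : R -> R) (a b : R) : continuous f -> leb.-integrable `[a, b] (EFin \o f).
Proof. by move=> cf; apply: continuous_compact_integrable; [exact: segment_compact|exact: continuous_subspaceT]. Qed.

Lemma prim_ex (f : R -> R) (a b : R) : continuous f -> exists K : R -> R, forall x, a < x < b -> dva K x (f x).
Proof.
move=> cf; exists (fun x => \int[leb]_(t in `[a, x]) f t) => x /andP[ax xb].
have [h1 h2] := @continuous_FTC1_closed R f a x b xb (ct_itv_integrable a b cf) ax (cf x).
by split; [exact: h1|rewrite -derive1E; exact: h2].
Qed.

Lemma dva_mvt (f f' : R -> R) x y : x < y -> (forall z, x <= z <= y -> ctat f z) -> (forall z, x < z < y -> dva f z (f' z)) ->
 exists2 c, x < c < y & f y - f x = f' c * (y - x).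
Proof.
move=> xy cf df; have [|c hc e] := @MVT R f f' x y xy df; last by exists c.
by apply: continuous_in_subspaceT => z; rewrite inE /= in_itv /=; exact: cf.
Qed.

Lemma dva_le (f f' : R -> R) x y : x <= y -> (forall z, x <= z <= y -> ctat f z) ->
 (forall z, x < z < y -> dva f z (f' z) /\ 0 <= f' z) -> f x <= f y.
Proof.
case: ltgtP => // [xy _ cf h|-> //]; have [z /h[_ z0] e] := dva_mvt xy cf (fun z hz => (h z hz).1).
by rewrite -subr_ge0 e mulr_ge0 // subr_ge0 ltW.
Qed.

Lemma dva_lt (f f' : R -> R) x y : x < y -> (forall z, x <= z <= y -> ctat f z) ->
 (forall z, x < z < y -> dva f z (f' z) /\ 0 < f' z) -> f x < f y.
Proof.
move=> xy cf h; have [z /h[_ z0] e] := dva_mvt xy cf (fun z hz => (h z hz).1).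
by rewrite -subr_gt0 e mulr_gt0 // subr_gt0.
Qed.

(** Comparison with a function [L] that may be singular at the ends, where it is controlled through
    its limit 0. Both the circle inequality and Onofri's inequality are proved this way, with [L] a
    calibration and [l <= k] a pointwise inequality. *)
Lemma mono_end (K L k l : R -> R) (a b : R) : a < b -> ctat K a -> ctat K b ->
 (forall x, a < x < b -> [/\ dva K x (k x), dva L x (l x) & l x <= k x]) ->
 L (a + y) @[y --> 0^'+] --> (0 : R) -> L (b - y) @[y --> 0^'+] --> (0 : R) -> K a <= K b.
Proof.
move=> ab ca cb h La Lb.
pose D x := K x - L x.
have mD x y : a < x -> x <= y -> y < b -> D x <= D y.
 have dD z : a < z < b -> dva D z (k z - l z) /\ 0 <= k z - l z.
  by move=> /h[d1 d2 d3]; split; [exact: dvB|rewrite subr_ge0].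
 move=> ax xy yb; apply: (dva_le xy) => z /andP[z1 z2].
  by have [d _] : dva D z (k z - l z) /\ _ := dD z ltac:(lra); exact: dva_ct d.
 by apply: dD; lra.
have cvgK (c z : R) (s : R -> R) : s 0 = c -> ctat s 0 -> ctat K c -> K (s y) @[y --> 0^'+] --> K c.
 move=> <- cs cK; rewrite -[K (s 0)]/((K \o s) 0); apply: cvg_at_right_filter.
 exact: continuous_comp cs cK.
have s1 : ctat (fun y => a + y) 0 by apply: (dva_ct (dvD (dvC a 0) (dvX 0))).
have s2 : ctat (fun y => b - y) 0 by apply: (dva_ct (dvB (dvC b 0) (dvX 0))).
have Da : D (a + y) @[y --> 0^'+] --> K a.
 by rewrite -[K a]subr0; apply: cvgB La; apply: (cvgK _ 0 (fun y => a + y)) => //; rewrite addr0.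
have Db : D (b - y) @[y --> 0^'+] --> K b.
 by rewrite -[K b]subr0; apply: cvgB Lb; apply: (cvgK _ 0 (fun y => b - y)) => //; rewrite subr0.
apply: (ler_cvg_to Da Db); near=> y.
have y0 : 0 < y by near: y; exact: nbhs_right_gt.
have y1 : y < (b - a) / 2 by near: y; apply: nbhs_right_lt; rewrite divr_gt0 // subr_gt0.
by apply: mD; lra.
Unshelve. all: by end_near.
Qed.

Definition ci (a b : R) (f : R -> R) : R := \int[leb]_(x in `[a, b]) f x.

Lemma ciD a b (f g : R -> R) : continuous f -> continuous g -> ci a b (fun x => f x + g x) = ci a b f + ci a b g.
Proof. by move=> cf cg; rewrite /ci RintegralD //; exact: ct_itv_integrable. Qed.

Lemma ciZ a b c (f : R -> R) : continuous f -> ci a b (fun x => c * f x) = c * ci a b f.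
Proof. by move=> cf; rewrite /ci RintegralZl //; exact: ct_itv_integrable. Qed.

Lemma ci_cst (a b c : R) : a <= b -> ci a b (fun _ => c) = (b - a) * c.
Proof.
move=> ab; rewrite /ci Rintegral_cst //= .
rewrite lebesgue_measure_itv /= lte_fin mulrC; case: ltgtP ab => // h _; by rewrite h subrr !mul0r.
Qed.

Lemma ci_le a b (f g : R -> R) : continuous f -> continuous g -> (forall x, a <= x <= b -> f x <= g x) -> ci a b f <= ci a b g.
Proof.
move=> cf cg h; apply: le_Rintegral; [exact: measurable_itv|exact: ct_itv_integrable..|].
by move=> x /=; rewrite in_itv /= => hx; exact: h.
Qed.

Lemma eq_ci a b (f g : R -> R) : (forall x, a <= x <= b -> f x = g x) -> ci a b f = ci a b g.
Proof. by move=> h; apply: eq_Rintegral => x /set_mem /=; rewrite in_itv /= => hx; exact: h. Qed.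

Lemma ci_gt0 a b (f : R -> R) : a < b -> continuous f -> (forall x, 0 < f x) -> 0 < ci a b f.
Proof.
move=> ab cf f0.
have [c hc hm] := @EVT_min R f a b (ltW ab) (continuous_subspaceT cf).
apply: (@lt_le_trans _ _ ((b - a) * f c)); first by rewrite mulr_gt0 // subr_gt0.
rewrite -ci_cst; last exact: ltW.
by apply: (@ci_le a b (fun _ => f c) f) => [x|//|x hx]; [exact: cst_continuous|apply: hm; rewrite in_itv].
Qed.

Lemma param_ct (G : R * R -> R) (a b : R) : continuous G -> continuous (fun t => ci a b (fun s => G (t, s))).
Proof.
move=> cG t.
have [M hM] := continuous_rect_bounded (t - 1) (t + 1) a b cG.
have ht : t \in (`]t - 1, t + 1[%classic : set R) by rewrite inE /= in_itv /=; lra.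
apply: (@continuity_under_integral R _ mR leb (fun x y => G (x, y)) `[a, b]%classic (measurable_itv `[a, b]) (t - 1) (t + 1) _ _ (fun _ => M)) => //.
- by move=> x _; apply: (ct_itv_integrable a b); move=> y; apply: continuous_comp; [exact: continuous_pairr|exact: cG].
- apply: aeW => y _ x _; apply: (@continuous_comp _ _ _ (fun x : R => (x, y)) G); [exact: continuous_pairl|exact: cG].
- by apply: (ct_itv_integrable a b); exact: cst_continuous.
- move=> x /=; rewrite in_itv /= => /andP[x1 x2]; apply: aeW => y /=; rewrite in_itv /= => hy.
 by apply: hM => //; rewrite !ltW.
Qed.

(** By Fubini and the fundamental theorem, the parameter integral has the same increments as a
    primitive [K] of the continuous function on the right. *)
Lemma param_dva (A G : R * R -> R) (a b : R) : continuous A -> continuous G ->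
 (forall t s, dva (fun t => A (t, s)) t (G (t, s))) ->
 forall t, dva (fun t => ci a b (fun s => A (t, s))) t (ci a b (fun s => G (t, s))).
Proof.
move=> cA cG dA t.
have cA1 z : continuous (fun s => A (z, s)).
 by move=> y; apply: continuous_comp; [exact: continuous_pairr|exact: cA].
have cG1 z : continuous (fun s => G (z, s)).
 by move=> y; apply: continuous_comp; [exact: continuous_pairr|exact: cG].
have cG2 y : continuous (fun z => G (z, y)).
 by move=> z; apply: (@continuous_comp _ _ _ (fun x : R => (x, y)) G); [exact: continuous_pairl|exact: cG].
have [K hK] := prim_ex (t - 2) (t + 2) (@param_ct G a b cG).
have e x : t - 1 < x < t + 1 -> ci a b (fun s => A (x, s)) = K x - K (t - 1) + ci a b (fun s => A (t - 1, s)).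
 move=> /andP[x1 x2]; rewrite -(@ftc_in K (fun t => ci a b (fun s => G (t, s)))) ?(ltW x1) //; last first.
 - exact: param_ct.
 - by move=> *; apply: hK; lra.
 have [h1 h2] := fubini_rect (t - 1) x a b cG.
 have -> : \int[leb]_(z in `[(t - 1)%R, x]) ci a b (fun s : R => G (z, s)) = ci a b (fun s => A (x, s) - A (t - 1, s)).
  rewrite -[LHS]h1 h2; apply: eq_Rintegral => y _.
  by rewrite (@ftc1 (fun z => A (z, y)) (fun z => G (z, y)) _ _ (ltW x1)).
 rewrite -ciD //; first by apply: eq_ci => y _; rewrite subrK.
 by move=> y; apply: cvgB; exact: cA1.
apply: (@near_is_derive R (fun x => K x - K (t - 1) + ci a b (fun s => A (t - 1, s)))); last first.
 have ht : t - 2 < t < t + 2 by lra.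
 by apply: dv_eq (dvD (dvB (hK t ht) (dvC _ t)) (dvC _ t)) _; rewrite subr0 addr0.
near=> x; apply/esym/e; near: x.
by exists 1 => //= x; rewrite /ball /= ltr_distl => /andP[x1 x2]; lra.
Unshelve. all: by end_near.
Qed.

Lemma periodic_shift (f : R -> R) : continuous f -> (forall x, f (x + 2 * pi) = f x) ->
 ci 0 (2 * pi) (fun x => f (x + pi)) = ci 0 (2 * pi) f.
Proof.
move=> cf pf; have pi0 := pi_gt0 R.
have [K hK] := prim_ex (-1) (4 * pi) cf.
have dsh c x : dva (fun y : R => y + c) x 1 by apply: dv_eq (dvD (dvX x) (dvC c x)) _; rewrite addr0.
rewrite /ci (@ftc_in K f) //; [|lra|by move=> *; apply: hK; lra].
rewrite (@ftc_in (fun x => K (x + pi)) (fun x => f (x + pi))); first last.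
- move=> x; apply: (@continuous_comp _ _ _ (fun x => x + pi) f); [exact: (dva_ct (dsh pi x))|exact: cf].
- move=> x /andP[x1 x2]; apply: dv_eq (dv_comp (g := fun x => x + pi) (hK _ _) (dsh pi x)) _; last by rewrite mulr1.
 by lra.
- lra.
pose P x := K (x + 2 * pi) - K x.
have dP z : 0 <= z <= pi -> dva P z 0.
 move=> /andP[z1 z2].
 apply: dv_eq (dvB (dv_comp (g := fun x => x + 2 * pi) (hK (z + 2 * pi) _) (dsh _ z)) (hK z _)) _.
 - by lra.
 - by lra.
 - by rewrite mulr1 pf subrr.
have [z _ e] := dva_mvt pi0 (fun z hz => dva_ct (dP z hz)) (fun z (hz : 0 < z < pi) => dP z ltac:(lra)).
by move: e; rewrite mul0r /P !add0r (_ : pi + 2 * pi = 2 * pi + pi); [lra|ring].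
Qed.

Lemma dva_quot0 (f : R -> R) l : dva f 0 l -> f 0 = 0 -> f y / y @[y --> 0^'+] --> l.
Proof.
move=> [df el] f0.
have h : h^-1 *: ((f \o shift 0) (h *: 1) - f 0) @[h --> 0^'] --> l.
 by rewrite -el; move: df; rewrite /derivable => /cvg_ex[l' hl']; rewrite /derive (cvg_lim _ hl').
have h2 : h^-1 *: ((f \o shift 0) (h *: 1) - f 0) @[h --> 0^'+] --> l.
 apply: cvg_trans h; apply: cvg_app => A [e e0 hA]; exists e => // y hy y0; apply: (hA _ hy); by rewrite gt_eqF.
apply: cvg_trans h2; apply: near_eq_cvg; near=> y.
by rewrite /= f0 subr0 addr0 -[_ *: _]/(_ * _) -[y *: 1]/(y * 1) mulr1 mulrC.
Unshelve. all: by end_near.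
Qed.

Lemma quot_cvg0 (f g k : R -> R) (l m : R) : l != 0 -> f y / y @[y --> 0^'+] --> (0 : R) ->
 g y / y @[y --> 0^'+] --> l -> k y @[y --> 0^'+] --> m -> f y * k y / g y @[y --> 0^'+] --> (0 : R).
Proof.
move=> l0 hf hg hk.
have h : f y / y * k y / (g y / y) @[y --> 0^'+] --> (0 : R).
 by have h := cvgM (cvgM hf hk) (cvgV l0 hg); rewrite !mul0r in h; exact: h.
apply: cvg_trans h; apply: near_eq_cvg; near=> y.
have y0 : y != 0 by rewrite gt_eqF //; near: y; exact: nbhs_right_gt.
by rewrite invf_div; move: (g y)^-1 => q; field.
Unshelve. all: by end_near.
Qed.

Lemma cvg_mul0 (F : set_system R) (FF : Filter F) (c : R) (f : R -> R) : f @ F --> (0 : R) -> (fun x => c * f x) @ F --> (0 : R).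
Proof. by move=> h; rewrite -[0](mulr0 c); exact: cvgMr h. Qed.

Lemma ct_circle (c s U E : R -> R) x : ctat c x -> ctat s x -> ctat U x -> ctat E x ->
 ctat (fun x => (1 + c x) * U x ^+ 2 - 2 * s x * U x + (1 - c x) - (1 + c x) * E x) x /\
 ctat (fun x => (1 - c x) * U x ^+ 2 + 2 * s x * U x + (1 + c x) - (1 - c x) * E x) x.
Proof. by move=> h1 h2 h3 h4; split; ct. Qed.

Lemma cvg_right_ct (f : R -> R) a : dva f 0 a -> f y @[y --> 0^'+] --> f 0.
Proof. by move=> d; apply: cvg_at_right_filter; exact: dva_ct d. Qed.

(** * A sharp exponential inequality on the circle *)

Section CircleInequality.
Variables u u1 : R -> R.
Hypotheses (du : forall x, dva u x (u1 x))
(cu1 : continuous u1).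
Let A := ci 0 (2 * pi) (fun x => expR (u x)).
Let h x := 2 * pi * expR (u x) / A.

Lemma dv_exp (f : R -> R) x a : dva f x a -> dva (fun y => expR (f y)) x (expR (f x) * a).
Proof. exact: (dv_comp (is_derive_expR _)). Qed.

(** Let [al] be the primitive of [h] with [al 0 = 0]; it increases from 0 to [2 pi]. The integrand
    exceeds the derivative of [2 (1 - cos x) h cot (al / 2)] by a perfect square. That function
    tends to 0 at both ends, where [1 - cos x] vanishes to second order and [sin (al / 2)] to first
    order. *)
Lemma circle_half : 0 <= ci 0 (2 * pi) (fun x => (1 - cos x) * u1 x ^+ 2 + 2 * sin x * u1 x + (1 + cos x) - (1 - cos x) * h x ^+ 2).
Proof.
have pi0 := pi_gt0 R.
have cu : continuous u by move=> x; exact: dva_ct (du x).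
have ceu : continuous (fun x => expR (u x)) by move=> x; exact: dva_ct (dv_exp (du x)).
have A0 : 0 < A by apply: ci_gt0 => //; [by rewrite mulr_gt0|move=> x; exact: expR_gt0].
have h0 x : 0 < h x by rewrite /h divr_gt0 // mulr_gt0 ?expR_gt0 // mulr_gt0.
have dh x : dva h x (h x * u1 x).
 by apply: dv_eq (dvM (dvM (dvC (2 * pi) x) (dv_exp (du x))) (dvC A^-1 x)) _; rewrite /h; ring.
have ch : continuous h by move=> x; exact: dva_ct (dh x).
have [K hK] := prim_ex (-1) (4 * pi) ch.
pose al x := K x - K 0.
have dal x : -1 < x < 4 * pi -> dva al x (h x) by move=> hx; apply: dv_eq (dvB (hK x hx) (dvC _ x)) _; rewrite subr0.
have al0 : al 0 = 0 by rewrite /al subrr.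
have al2 : al (2 * pi) = 2 * pi.
 rewrite /al -(@ftc_in K h) //; [|lra|by move=> *; apply: hK; lra].
 rewrite -/(ci 0 (2 * pi) h) (@eq_ci _ _ _ (fun x => 2 * pi / A * expR (u x))); last by move=> x _; rewrite /h; ring.
 by rewrite ciZ // -/A divfK // gt_eqF.
have mal x y : -1 < x -> x < y -> y < 4 * pi -> al x < al y.
 move=> x0 xy y1; have dl z : x <= z <= y -> dva al z (h z) by move=> /andP[z0 z1]; apply: dal; lra.
 by apply: (dva_lt xy) => z; [move=> /dl/dva_ct|move=> /andP[z0 z1]; split; [apply: dl; rewrite !ltW|exact: h0]].
have alp x : 0 < x < 2 * pi -> 0 < al x / 2 < pi.
 move=> /andP[x0 x1]; have := mal 0 x; have := mal x (2 * pi); rewrite al0 al2 => m1 m2.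
 by apply/andP; split; [have := m2 ltac:(lra) ltac:(lra) ltac:(lra)|have := m1 ltac:(lra) ltac:(lra) ltac:(lra)]; lra.
pose Q x := (1 - cos x) * u1 x ^+ 2 + 2 * sin x * u1 x + (1 + cos x) - (1 - cos x) * h x ^+ 2.
have cc := @continuous_cos R; have cs := @continuous_sin R.
have cQ : continuous Q.
 move=> x; change (ctat Q x); rewrite /Q.
 have c1 : ctat (fun x : R => 1 - cos x) x by exact: dva_ct (dvB (dvC 1 x) (dv_cos x)).
 have c2 : ctat (fun x : R => - ((1 - cos x) * h x ^+ 2)) x.
  by apply: ctN; apply: ctM c1 _; apply: ctX; exact: ctR.
 apply: ctD c2; apply: ctD; last by apply: ctD; [exact: ctC|exact: ctR].
 apply: ctD; [apply: ctM c1 _; apply: ctX; exact: ctR|].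
 by apply: ctM; [apply: ctM; [exact: ctC|exact: ctR]|exact: ctR].
have [P hP] := prim_ex (-1) (4 * pi) cQ.
rewrite -/Q /ci (@ftc_in P Q) //; [|lra|by move=> *; apply: hP; lra].
rewrite subr_ge0.
pose B x := 2 * ((1 - cos x) * (h x * cos (al x / 2)) / sin (al x / 2)).
pose B1 x := 2 * (sin x * (h x * cos (al x / 2)) / sin (al x / 2) + (1 - cos x) * (h x * u1 x * cos (al x / 2) - h x * (sin (al x / 2) * (h x / 2))) / sin (al x / 2)
 - (1 - cos x) * (h x * cos (al x / 2)) * (sin (al x / 2) ^- 2 * (cos (al x / 2) * (h x / 2)))).
have dh2 x : -1 < x < 4 * pi -> dva (fun x => al x / 2) x (h x / 2).
 by move=> hx; apply: dv_eq (dvM (dal x hx) (dvC _ x)) _; ring.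
have dS x : -1 < x < 4 * pi -> dva (fun x => sin (al x / 2)) x (cos (al x / 2) * (h x / 2)).
 by move=> hx; exact: (dv_comp (dv_sin _) (dh2 x hx)).
have dC x : -1 < x < 4 * pi -> dva (fun x => cos (al x / 2)) x (- sin (al x / 2) * (h x / 2)).
 by move=> hx; exact: (dv_comp (dv_cos _) (dh2 x hx)).
apply: (@mono_end P B Q B1).
- lra.
- by apply: (dva_ct (hP 0 _)); lra.
- by apply: (dva_ct (hP (2 * pi) _)); lra.
- move=> x hx; have hx' : -1 < x < 4 * pi by case/andP: hx => *; lra.
 have sp : 0 < sin (al x / 2) by apply: sin_gt0_pi; exact: alp.
 have sn : sin (al x / 2) != 0 by rewrite gt_eqF.
 split; first exact: hP.
  apply: dv_eq (dvM (dvC 2 x) (dvM (dvM (dvB (dvC 1 x) (dv_cos x)) (dvM (dh x) (dC x hx'))) (dvV sn (dS x hx')))) _.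
  rewrite /B1; move: (sin (al x / 2)) (cos (al x / 2)) (sin x) (cos x) (h x) (u1 x) sn => S C s c H U sn.
  by field.
 rewrite -subr_ge0 /Q /B1.
 have e0 : x = x / 2 + x / 2 by field.
 have e1 : 1 - cos x = 2 * sin (x / 2) ^+ 2.
  by have hh := cos2Dsin2 (x / 2); rewrite {1}e0 cosD; lra.
 have e2 : 1 + cos x = 2 * cos (x / 2) ^+ 2.
  by have hh := cos2Dsin2 (x / 2); rewrite {1}e0 cosD; lra.
 have e3 : sin x = 2 * sin (x / 2) * cos (x / 2) by rewrite {1}e0 sinD; ring.
 rewrite e1 e2 e3; move: sn.
 move: (sin (al x / 2)) (cos (al x / 2)) (sin (x / 2)) (cos (x / 2)) (h x) (u1 x) => S C s c H U sn.
 (* In half angles the difference is a square: [s], [c] are taken at [x / 2] and [S], [C] at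
    [al x / 2]. *)
 rewrite (_ : _ - _ = 2 * (s * U + c - s * H * C / S) ^+ 2); first by rewrite mulr_ge0 // sqr_ge0.
 by field.
- have i0 : -1 < (0 : R) < 4 * pi by lra.
 rewrite (_ : (fun y : R => B (0 + y)) = B); last by apply/funext => y; rewrite add0r.
 apply: cvg_mul0.
 apply: (@quot_cvg0 (fun x => 1 - cos x) (fun x => sin (al x / 2)) (fun x => h x * cos (al x / 2)) (h 0 / 2)).
 + by rewrite gt_eqF // divr_gt0.
 + by apply: dva_quot0; [apply: dv_eq (dvB (dvC 1 0) (dv_cos 0)) _; rewrite sin0; ring|rewrite cos0 subrr].
 + by apply: dva_quot0; [apply: dv_eq (dS 0 i0) _; rewrite al0 mul0r cos0 mul1r|rewrite al0 mul0r sin0].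
 + by apply: cvg_right_ct (dvM (dh 0) (dC 0 i0)).
- have i0 : -1 < 2 * (pi : R) < 4 * pi by lra.
 have d0 : dva (fun y : R => 2 * pi - y) 0 (-1) by apply: dv_eq (dvB (dvC _ 0) (dvX 0)) _; rewrite sub0r.
 have e0 : 2 * pi - 0 = 2 * pi :> R by rewrite subr0.
 apply: cvg_mul0.
 apply: (@quot_cvg0 (fun y => 1 - cos (2 * pi - y)) (fun y => sin (al (2 * pi - y) / 2)) (fun y => h (2 * pi - y) * cos (al (2 * pi - y) / 2)) (h (2 * pi) / 2)).
 + by rewrite gt_eqF // divr_gt0.
 + apply: dva_quot0; last by rewrite subr0 mulr_natl cos2pi subrr.
  apply: dv_eq (dvB (dvC 1 0) (dv_comp (g := fun y => 2 * pi - y) (dv_cos _) d0)) _.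
  by rewrite subr0 mulr_natl sin2pi; ring.
 + apply: dva_quot0; last by rewrite subr0 al2 (_ : 2 * pi / 2 = pi) ?sinpi //; field.
  have hS : dva (fun x => sin (al x / 2)) (2 * pi - 0) (cos (al (2 * pi) / 2) * (h (2 * pi) / 2)) by rewrite e0; exact: dS.
  apply: dv_eq (dv_comp (f := fun x => sin (al x / 2)) (g := fun y => 2 * pi - y) hS d0) _.
  by rewrite al2 (_ : 2 * pi / 2 = pi) ?cospi; [ring|field].
 + have hM : dva (fun x => h x * cos (al x / 2)) (2 * pi - 0) (h (2 * pi) * u1 (2 * pi) * cos (al (2 * pi) / 2) + h (2 * pi) * (- sin (al (2 * pi) / 2) * (h (2 * pi) / 2))).
   by rewrite e0; exact: dvM (dh _) (dC _ i0).
  have h1 := cvg_right_ct (dv_comp (f := fun x => h x * cos (al x / 2)) (g := fun y => 2 * pi - y) hM d0); exact: h1.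
Qed.

End CircleInequality.

Lemma ct_expR (f : R -> R) x : ctat f x -> ctat (fun y => expR (f y)) x.
Proof. by apply: ct_comp; exact: continuous_expR. Qed.

Lemma circle_arith (U P z W g f : R) : 2 * U + 2 * P + - (2 * z) * W = g + f -> 0 <= g -> 0 <= f -> z * W - P <= U.
Proof. by lra. Qed.

(** With [al] as in [circle_half], [u' = al'' / al'], and this is the integrated Schwarzian bound
    for diffeomorphisms of the circle. It is the sum of [circle_half] for [u] and for its translate
    by [pi], since the weights [1 - cos x] and [1 + cos x] add up to 2. *)
Lemma circle_ineq (u u1 : R -> R) : (forall x, dva u x (u1 x)) -> continuous u1 -> (forall x, u (x + 2 * pi) = u x) ->
 (2 * pi) ^+ 2 * ci 0 (2 * pi) (fun x => expR (2 * u x)) / ci 0 (2 * pi) (fun x => expR (u x)) ^+ 2 - 2 * pi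
 <= ci 0 (2 * pi) (fun x => u1 x ^+ 2).
Proof.
move=> du cu1 pu; have pi0 := pi_gt0 R.
have cu : continuous u by move=> x; exact: dva_ct (du x).
have dsh c x : dva (fun y : R => y + c) x 1 by apply: dv_eq (dvD (dvX x) (dvC c x)) _; rewrite addr0.
have ceu : continuous (fun x => expR (u x)) by move=> x; apply: ct_expR; exact: ctR.
have ceu2 : continuous (fun x => expR (2 * u x)).
 by move=> x; apply: (ct_expR (f := fun x => 2 * u x)); ct.
have tw : 0 <= 2 * pi :> R by rewrite mulr_ge0 // ltW.
have e22 : ci 0 (2 * pi) (fun _ : R => 2) = 2 * (2 * pi) :> R by rewrite (ci_cst 2 tw) subr0 mulrC.
have h1 := circle_half du cu1.
have pu1 x : u1 (x + 2 * pi) = u1 x.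
 have d1 : dva (fun y => u (y + 2 * pi)) x (u1 (x + 2 * pi)).
  by apply: dv_eq (dv_comp (du _) (dsh _ x)) _; rewrite mulr1.
 have e : (fun y => u (y + 2 * pi)) = u by apply/funext.
 by rewrite e in d1; case: (du x) => _ <-; case: d1 => _ <-.
pose v x := u (x + pi); pose v1 x := u1 (x + pi).
have dv x : dva v x (v1 x) by apply: dv_eq (dv_comp (du _) (dsh pi x)) _; rewrite mulr1.
have ctsh (f : R -> R) : continuous f -> continuous (fun x => f (x + pi)).
 by move=> cf x; apply: (@continuous_comp _ _ _ (fun x => x + pi) f); [exact: (dva_ct (dsh pi x))|exact: cf].
have h2 := circle_half dv (ctsh _ cu1).
have eA : ci 0 (2 * pi) (fun x => expR (v x)) = ci 0 (2 * pi) (fun x => expR (u x)).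
 by apply: (@periodic_shift (fun x => expR (u x))) => // x; rewrite pu.
rewrite eA in h2.
have A0 : 0 < ci 0 (2 * pi) (fun x => expR (u x)) by apply: ci_gt0 => //; [by rewrite mulr_gt0|move=> x; exact: expR_gt0].
move: h1 h2 A0; set A := ci 0 (2 * pi) (fun x => expR (u x)) => h1 h2 A0.
pose f x := (1 + cos x) * u1 x ^+ 2 - 2 * sin x * u1 x + (1 - cos x) - (1 + cos x) * (2 * pi * expR (u x) / A) ^+ 2.
pose g x := (1 - cos x) * u1 x ^+ 2 + 2 * sin x * u1 x + (1 + cos x) - (1 - cos x) * (2 * pi * expR (u x) / A) ^+ 2.
have cc x : ctat (cos : R -> R) x by apply: ctR; exact: continuous_cos.
have cs x : ctat (sin : R -> R) x by apply: ctR; exact: continuous_sin.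
have cu1' x : ctat u1 x by exact: ctR.
have cE x : ctat (fun x => (2 * pi * expR (u x) / A) ^+ 2) x.
 by ct.
have cf : continuous f.
 by move=> x; exact: (proj1 (ct_circle (cc x) (cs x) (cu1' x) (cE x))).
have cg : continuous g.
 by move=> x; exact: (proj2 (ct_circle (cc x) (cs x) (cu1' x) (cE x))).
have pD (x : R) : cos (x + 2 * pi) = cos x /\ sin (x + 2 * pi) = sin x.
 by rewrite !mulr_natl cosD sinD cos2pi sin2pi !mulr1 !mulr0 subr0 addr0.
have e2 : ci 0 (2 * pi) (fun x => f (x + pi)) = ci 0 (2 * pi) f.
 by apply: periodic_shift => // x; rewrite /f; have [-> ->] := pD x; rewrite pu pu1.
have h3 : 0 <= ci 0 (2 * pi) f.
 rewrite -e2 (_ : ci _ _ _ = ci 0 (2 * pi) (fun x => (1 - cos x) * v1 x ^+ 2 + 2 * sin x * v1 x + (1 + cos x) - (1 - cos x) * (2 * pi * expR (v x) / A) ^+ 2)); first exact: h2.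
 by apply: eq_ci => x _; rewrite /f /v /v1 cosDpi sinDpi; ring.
have cu12 : continuous (fun x => u1 x ^+ 2) by move=> x; ct.
have h4 : ci 0 (2 * pi) (fun x => g x + f x) = 2 * ci 0 (2 * pi) (fun x => u1 x ^+ 2) + 2 * (2 * pi) + - (2 * ((2 * pi) ^+ 2 / A ^+ 2)) * ci 0 (2 * pi) (fun x => expR (2 * u x)).
 rewrite -e22.
 have k1 x : ctat (fun x => 2 * u1 x ^+ 2) x by ct.
 have k2 : continuous (fun _ : R => 2 : R) by move=> x; exact: ctC.
 have k3 x : ctat (fun x => - (2 * ((2 * pi) ^+ 2 / A ^+ 2)) * expR (2 * u x)) x by ct.
 have k4 x : ctat (fun x => 2 * u1 x ^+ 2 + 2) x by ct.
 rewrite -(ciZ 0 (2 * pi) 2 cu12) -(ciZ 0 (2 * pi) _ ceu2) -(ciD _ _ k1 k2) -(ciD _ _ k4 k3); apply: eq_ci => x _.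
 rewrite /g /f (_ : 2 * u x = u x + u x) ?expRD; last by ring.
 by move: (cos x) (sin x) (expR (u x)) (u1 x) => c s E U; field; rewrite gt_eqF.
have h5 := ciD 0 (2 * pi) cg cf.
have h6 : 0 <= ci 0 (2 * pi) g by exact: h1.
rewrite h4 in h5.
move: h5; rewrite (_ : (2 * pi) ^+ 2 * _ / _ = (2 * pi) ^+ 2 / A ^+ 2 * ci 0 (2 * pi) (fun x => expR (2 * u x))); last by rewrite mulrAC.
by move=> h5; exact: (circle_arith h5 h6 h3).
Qed.

(** * The calibration for Onofri's inequality *)

Section Pole.
Variables (a ub b c : R -> R) (m a1 ub1 : R).
Hypotheses (da : dva a 0 a1)
(a0 : a 0 = expR m)
(dub : dva ub 0 ub1)
(ub0 : ub 0 = m)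
(cb : ctat b 0)
(b0 : b 0 = expR (2 * m))
(dc : forall y, -1 < y < 1 -> dva c y (- b y * sin y))
(c0 : c 0 = 1).

(** The calibration. On the parallel at colatitude [t], [a] and [ub] stand for the means of [e^u]
    and [u], and [c] for the cosine of the angle of the round cap whose area is the [e^(2u)]-area of
    the cap of angle [t]. For [u = 0] one has [a = 1], [ub = 0], [c = cos t], and the expression is
    0. *)
Definition Lam (a ub c t : R) : R :=
 2 * a * (c * sin t / Num.sqrt (1 - c ^+ 2)) - 2 * cos t * ub - (ln (1 + c) - ln (1 - c))
 - (ln (1 - cos t) - ln (1 + cos t)) - c - cos t.

Lemma cosm1_gt0 (y : R) : 0 < y < 1 -> 0 < 1 - cos y /\ 0 < 1 + cos y /\ 0 < sin y.
Proof.
move=> /andP[y0 y1]; have p2 := @pi_ge2 R.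
have s0 : 0 < sin y by apply: sin_gt0_pi; lra.
have := cos2Dsin2 y; have := exprn_gt0 2 s0; have := cos_le1 y; have := cos_geN1 y => h1 h2 h3 h4.
split; [|split] => //; rewrite ltNge; apply/negP => h; nra.
Qed.

(** L'Hôpital's rule: the derivatives of both terms carry the factor [sin y]. For either sign [s]
    the auxiliary function [f] has nonnegative derivative and starts at 0, which gives the two sides
    of the estimate. *)
Lemma pole_ratio : (1 - c y) / (1 - cos y) @[y --> 0^'+] --> b 0.
Proof.
apply/cvgrPdist_le => e e0.
have [d d0 hd] : exists2 d : R, 0 < d & forall y : R, `|y| < d -> `|b 0 - b y| <= e.
 have := cb => /cvgrPdist_le /(_ e e0) [d d0 hd]; exists d => // y hy.
 by apply: hd; rewrite /= /ball /= sub0r normrN.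
near=> y.
have y0 : 0 < y by near: y; exact: nbhs_right_gt.
have y1 : y < Num.min d 1 by near: y; apply: nbhs_right_lt; rewrite lt_min d0 ltr01.
move: y1; rewrite lt_min => /andP[yd y1].
have [k1 [k2 k3]] := @cosm1_gt0 y (introT andP (conj y0 y1)).
pose dd := Num.min d 1.
have key (s : R) : s ^+ 2 = 1 -> 0 <= e * (1 - cos y) + s * (1 - c y - b 0 * (1 - cos y)).
 move=> s2.
 pose f x := e * (1 - cos x) + s * (1 - c x - b 0 * (1 - cos x)).
 pose f1 x := sin x * (e + s * (b x - b 0)).
 have df x : -1 < x < 1 -> dva f x (f1 x).
  move=> hx; apply: dv_eq (dvD (dvM (dvC e x) (dvB (dvC 1 x) (dv_cos x))) (dvM (dvC s x) (dvB (dvB (dvC 1 x) (dc hx)) (dvM (dvC (b 0) x) (dvB (dvC 1 x) (dv_cos x)))))) _.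
  by rewrite /f1; ring.
 have fp x : 0 < x < dd -> 0 <= f1 x.
  rewrite lt_min => /andP[x0 /andP[xd x1]].
  have [_ [_ h3]] := @cosm1_gt0 x (introT andP (conj x0 x1)).
  apply: mulr_ge0; first exact: ltW.
  have hx : `|x| < d by rewrite gtr0_norm.
  have := hd x hx; rewrite ler_norml => /andP[l1 l2].
  have : (s - 1) * (s + 1) = 0 by rewrite -subr_sqr s2; ring.
  by move/eqP; rewrite mulf_eq0 subr_eq0 addr_eq0 => /orP[/eqP -> |/eqP ->]; lra.
 have f0 : f 0 = 0 by rewrite /f cos0 c0; ring.
 rewrite -/(f y) -f0; apply: (dva_le (ltW y0)) => z /andP[z0 z1]; first by apply: dva_ct (df z _); lra.
 by split; [apply: df|apply: fp; rewrite /dd lt_min]; lra.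
have h1 := key 1 (expr1n _ _); have h2 := key (-1) ltac:(ring).
rewrite (_ : b 0 - _ = (b 0 * (1 - cos y) - (1 - c y)) / (1 - cos y)); last by field; rewrite gt_eqF.
rewrite normrM [`|(1 - cos y)^-1|]gtr0_norm ?invr_gt0 // ler_pdivrMr //.
by rewrite ler_norml; lra.
Unshelve. all: by end_near.
Qed.

(** The logarithms of [1 - c] and [1 - cos y] diverge separately, but their difference tends to
    [2 m], and [sin y / sqrt (1 - c^2)] tends to [e^(- m)]. What remains is
    [2 - 2 m + 2 m - 1 - 1 = 0]. *)
Lemma pole_limit : Lam (a y) (ub y) (c y) y @[y --> 0^'+] --> (0 : R).
Proof.
have hr := pole_ratio; rewrite b0 in hr.
have b0p : 0 < expR (2 * m) by exact: expR_gt0.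
have i0 : -1 < (0 : R) < 1 by lra.
have hc : c y @[y --> 0^'+] --> (1 : R) by rewrite -c0; exact: cvg_right_ct (dc i0).
have hcos : cos y @[y --> 0^'+] --> (1 : R) by rewrite -cos0; exact: cvg_right_ct (dv_cos 0).
have ha : a y @[y --> 0^'+] --> expR m by rewrite -a0; exact: cvg_right_ct da.
have hu : ub y @[y --> 0^'+] --> m by rewrite -ub0; exact: cvg_right_ct dub.
have h1c : 1 + c y @[y --> 0^'+] --> (1 + 1 : R) by apply: cvgD hc; exact: cvg_cst.
have h1k : 1 + cos y @[y --> 0^'+] --> (1 + 1 : R) by apply: cvgD hcos; exact: cvg_cst.
have two : 0 < 1 + 1 :> R by lra.
have hl1 : ln (1 + c y) @[y --> 0^'+] --> ln (1 + 1 : R) by apply: continuous_cvg h1c; exact: continuous_ln.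
have hl2 : ln (1 + cos y) @[y --> 0^'+] --> ln (1 + 1 : R) by apply: continuous_cvg h1k; exact: continuous_ln.
have hl3 : ln ((1 - c y) / (1 - cos y)) @[y --> 0^'+] --> 2 * m.
 by rewrite -[2 * m]expRK; apply: continuous_cvg hr; exact: continuous_ln.
have hq : Num.sqrt ((1 + cos y) / ((1 + c y) * ((1 - c y) / (1 - cos y)))) @[y --> 0^'+] --> expR (- m).
 have e : Num.sqrt ((1 + 1) / ((1 + 1) * expR (2 * m))) = expR (- m).
  rewrite (_ : _ / _ = expR (- m) ^+ 2).
   by rewrite sqrtr_sqr ger0_norm // expR_ge0.
  rewrite -expRM_natl mulrN expRN.
  by move: (expR (2 * m)) b0p => z z0; field; rewrite gt_eqF.
 rewrite -e; apply: continuous_cvg; first exact: sqrt_continuous.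
 apply: cvgM h1k _; apply: cvgV; first by rewrite gt_eqF // mulr_gt0.
 by apply: cvgM h1c hr.
pose G y := 2 * a y * (c y * Num.sqrt ((1 + cos y) / ((1 + c y) * ((1 - c y) / (1 - cos y))))) - 2 * cos y * ub y
 - (ln (1 + c y) - ln (1 + cos y)) + ln ((1 - c y) / (1 - cos y)) - c y - cos y.
have hG : G y @[y --> 0^'+] --> 2 * expR m * (1 * expR (- m)) - 2 * 1 * m - (ln (1 + 1) - ln (1 + 1)) + 2 * m - 1 - 1.
 apply: (cvgB _ hcos); apply: (cvgB _ hc); apply: (cvgD _ hl3); apply: (cvgB _ (cvgB hl1 hl2)).
 apply: cvgB; [apply: cvgM; [exact: cvgMr ha|exact: cvgM hc hq]|exact: cvgM (cvgMr hcos) hu].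
have e0 : 2 * expR m * (1 * expR (- m)) - 2 * 1 * m - (ln (1 + 1) - ln (1 + 1)) + 2 * m - 1 - 1 = 0 :> R.
 by rewrite mul1r -mulrA expRxMexpNx_1; ring.
rewrite e0 in hG; apply: cvg_trans hG; apply: near_eq_cvg; near=> y.
have y0 : 0 < y by near: y; exact: nbhs_right_gt.
have y1 : y < 1 by near: y; apply: nbhs_right_lt.
have [k1 [k2 k3]] := @cosm1_gt0 y (introT andP (conj y0 y1)).
have r0 : 0 < (1 - c y) / (1 - cos y) by near: y; apply: (cvgr_gt _ hr); exact: b0p.
have c1 : 0 < 1 + c y by near: y; apply: (cvgr_gt _ h1c).
have c2 : 0 < 1 - c y by move: r0; rewrite pmulr_lgt0 ?invr_gt0.
rewrite /G /Lam ln_div ?posrE //.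
have -> : Num.sqrt ((1 + cos y) / ((1 + c y) * ((1 - c y) / (1 - cos y)))) = sin y / Num.sqrt (1 - c y ^+ 2).
 have e1 : 0 < 1 - c y ^+ 2 by rewrite (_ : _ - _ = (1 - c y) * (1 + c y)); [exact: mulr_gt0|ring].
 rewrite -[sin y](@ger0_norm R) ?(ltW k3) // -sqrtr_sqr -sqrtrV ?(ltW e1) // -sqrtrM ?sqr_ge0 //.
 congr Num.sqrt; rewrite (_ : sin y ^+ 2 = (1 - cos y) * (1 + cos y)); last by have := cos2Dsin2 y; lra.
 by field; rewrite !gt_eqF.
by ring.
Unshelve. all: by end_near.
Qed.

End Pole.

(** Reduces the south pole to [pole_limit] in the reversed variable [pi - t]. *)
Lemma Lam_reflect (a ub c t : R) : Lam a ub (- c) (pi - t) = - Lam a ub c t.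
Proof.
rewrite /Lam sinB cosB sinpi cospi sqrrN.
by rewrite !mul0r !mulN1r !add0r addr0 !opprK; ring.
Qed.

Lemma dva_Lam (a ub c : R -> R) (t A U b : R) : 0 < sin t -> -1 < c t < 1 ->
 dva a t A -> dva ub t U -> dva c t (- b * sin t) ->
 let r := Num.sqrt (1 - c t ^+ 2) in
 dva (fun t => Lam (a t) (ub t) (c t) t) t
 (2 * A * (c t * sin t / r) + 2 * a t * (c t * cos t / r - b * sin t ^+ 2 / r ^+ 3)
  - 2 * cos t * U + 2 * sin t * ub t + 2 * b * sin t / r ^+ 2 - 2 / sin t + b * sin t + sin t).
Proof.
move=> s0 /andP[c1 c2] da du dc r.
have p1 : 0 < 1 + c t by lra.
have p2 : 0 < 1 - c t by lra.
have e1 : 0 < 1 - c t ^+ 2 by rewrite (_ : _ - _ = (1 - c t) * (1 + c t)); [exact: mulr_gt0|ring].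
have rp : 0 < r by rewrite sqrtr_gt0.
have rr : r ^+ 2 = 1 - c t ^+ 2 by rewrite sqr_sqrtr // ltW.
have hcs := cos2Dsin2 t; have s2 := exprn_gt0 2 s0.
have kk : -1 < cos t /\ cos t < 1.
 have h1 := cos_le1 t; have h2 := cos_geN1 t.
 by split; rewrite ltNge; apply/negP => h; nra.
have [q1 q2] : 0 < 1 - cos t /\ 0 < 1 + cos t by split; lra.
have dr : dva (fun t => Num.sqrt (1 - c t ^+ 2)) t ((2 * r)^-1 * (0 - 2 * c t ^+ 1 * (- b * sin t))).
 exact: (dv_sqrt (f := fun t => 1 - c t ^+ 2) e1 (dvB (dvC 1 t) (dvXn 2 dc))).
have dln (f : R -> R) (x l : R) : 0 < f x -> dva f x l -> dva (fun y => ln (f y)) x ((f x)^-1 * l).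
 by move=> f0 df; exact: dv_comp (is_derive1_ln f0) df.
have rn : Num.sqrt (1 - c t ^+ 2) != 0 by rewrite -/r gt_eqF.
rewrite /Lam; apply: dv_eq (dvB (dvB (dvB (dvB (dvB (dvM (dvM (dvC 2 t) da) (dvM (dvM dc (dv_sin t)) (dvV (f := fun t => Num.sqrt (1 - c t ^+ 2)) rn dr)))
 (dvM (dvM (dvC 2 t) (dv_cos t)) du)) (dvB (dln (fun t => 1 + c t) t _ p1 (dvD (dvC 1 t) dc)) (dln (fun t => 1 - c t) t _ p2 (dvB (dvC 1 t) dc))))
 (dvB (dln (fun t => 1 - cos t) t _ q1 (dvB (dvC 1 t) (dv_cos t))) (dln (fun t => 1 + cos t) t _ q2 (dvD (dvC 1 t) (dv_cos t))))) dc) (dv_cos t)) _.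
rewrite -/r.
have f1 : (1 + c t)^-1 * (0 + - b * sin t) - (1 - c t)^-1 * (0 - - b * sin t) = - (2 * b * sin t / r ^+ 2).
 by rewrite rr (_ : 1 - c t ^+ 2 = (1 - c t) * (1 + c t)); [field; rewrite !gt_eqF|ring].
have f2 : (1 - cos t)^-1 * (0 - - sin t) - (1 + cos t)^-1 * (0 + - sin t) = 2 / sin t.
 have -> : (sin t)^-1 = sin t / ((1 - cos t) * (1 + cos t)).
  rewrite (_ : (1 - cos t) * (1 + cos t) = sin t ^+ 2); last by lra.
  by field; rewrite gt_eqF.
 by field; rewrite !gt_eqF.
rewrite f1 f2; have c2E : c t ^+ 2 = 1 - r ^+ 2 by lra.
have f3 : (- b * sin t * sin t + c t * cos t) / r + c t * sin t * - (r ^- 2 * ((2 * r)^-1 * (0 - 2 * c t ^+ 1 * (- b * sin t)))) = c t * cos t / r - b * sin t ^+ 2 / r ^+ 3.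
 rewrite (_ : c t * sin t * - _ = - (c t ^+ 2) * (b * sin t ^+ 2 / r ^+ 3)); last by field; rewrite gt_eqF.
 by rewrite c2E; field; rewrite gt_eqF.
rewrite f3; ring.
Qed.

(** The inequality of means for [x^2], [y^3 / x] and [y^3 / x]. *)
Lemma amgm3 (x y : R) : 0 < x -> 0 < y -> 3 * y ^+ 2 <= x ^+ 2 + 2 * y ^+ 3 / x.
Proof.
move=> x0 y0; rewrite -subr_ge0 (_ : _ - _ = (x - y) ^+ 2 * (x + 2 * y) / x); last by field; rewrite gt_eqF.
by apply: divr_ge0 (ltW x0); apply: mulr_ge0 (sqr_ge0 _) _; lra.
Qed.

(** Three inequalities bound the derivative of the calibration: the completed square for the
    [theta]-derivative with parameter [w = c s / r], the circle inequality for the [phi]-derivative,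
    and [amgm3] with [x = 1 / a], [y = s / r]. *)
Lemma onofri_arith (s k a b c r P W A U ub : R) : 0 < s -> k ^+ 2 + s ^+ 2 = 1 -> 0 < a -> 0 < b -> 0 < r ->
 r ^+ 2 = 1 - c ^+ 2 -> b / a ^+ 2 - 1 <= W ->
 (forall w, 2 * (w * A - k * U) - (w ^+ 2 * b - 2 * w * k * a + k ^+ 2) / s <= s * P) ->
 2 * A * (c * s / r) + 2 * a * (c * k / r - b * s ^+ 2 / r ^+ 3)
  - 2 * k * U + 2 * s * ub + 2 * b * s / r ^+ 2 - 2 / s + b * s + s <= s * P + W / s + 2 * s * ub.
Proof.
move=> s0 hks a0 b0 r0 hr hW hP.
have h1 := hP (c * s / r).
have h2 : (b / a ^+ 2 - 1) / s <= W / s by rewrite ler_pM2r ?invr_gt0.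
have h3 : 3 * (s / r) ^+ 2 <= (a^-1) ^+ 2 + 2 * (s / r) ^+ 3 * a.
 have := @amgm3 a^-1 (s / r); rewrite invrK; apply; by [rewrite invr_gt0|rewrite divr_gt0].
have h4 : b / s * (3 * (s / r) ^+ 2) <= b / s * ((a^-1) ^+ 2 + 2 * (s / r) ^+ 3 * a).
 by rewrite ler_pM2l // divr_gt0.
have k2 : k ^+ 2 = 1 - s ^+ 2 by lra.
have c2 : c ^+ 2 = 1 - r ^+ 2 by lra.
rewrite -subr_ge0.
have -> : s * P + W / s + 2 * s * ub - (2 * A * (c * s / r) + 2 * a * (c * k / r - b * s ^+ 2 / r ^+ 3)
  - 2 * k * U + 2 * s * ub + 2 * b * s / r ^+ 2 - 2 / s + b * s + s) =
 (s * P - (2 * (c * s / r * A - k * U) - ((c * s / r) ^+ 2 * b - 2 * (c * s / r) * k * a + k ^+ 2) / s))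
 + (W / s - (b / a ^+ 2 - 1) / s)
 + (b / s * ((a^-1) ^+ 2 + 2 * (s / r) ^+ 3 * a) - b / s * (3 * (s / r) ^+ 2)); last by lra.
have e1 : (c * s / r) ^+ 2 = (1 - r ^+ 2) * s ^+ 2 / r ^+ 2 by rewrite -c2; field; rewrite gt_eqF.
rewrite e1 k2; field; by rewrite !gt_eqF.
Qed.

Lemma onofri_ar1 (s q X Y Z : R) : s != 0 -> q != 0 ->
 (X + (s ^- 2 * Y + 2 * Z)) * s / q = s * (X / q) + Y / q / s + 2 * s * (Z / q).
Proof. by move=> s0 q0; field; rewrite ?s0 ?q0. Qed.

Lemma onofri_ar2 (w k s q X U B A : R) : s != 0 -> q != 0 ->
 (2 * (w * (X / q) - k * (U / q)) - (w ^+ 2 * (B / q) - 2 * w * k * (A / q) + k ^+ 2) / s) * q =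
 2 * w * X + (- (2 * k) * U + (- (w ^+ 2 / s) * B + (2 * w * k / s * A + q * - (k ^+ 2 / s)))).
Proof. by move=> s0 q0; field; rewrite ?s0 ?q0. Qed.

Lemma onofri_ar3 (q A B : R) : q != 0 -> A != 0 -> (B / q / (A / q) ^+ 2 - 1) * q = q ^+ 2 * B / A ^+ 2 - q.
Proof. by move=> q0 A0; field; rewrite ?q0 ?A0. Qed.

(** The square behind the hypothesis on [w] in [onofri_arith], with [T] the [theta]-derivative and
    [E = e^u] at one point of a parallel. *)
Lemma onofri_ar4 (s k w E T : R) : 0 < s ->
 2 * w * (E * T) + (- (2 * k) * T + (- (w ^+ 2 / s) * (E * E) + (2 * w * k / s * E + - (k ^+ 2 / s)))) <= s * T ^+ 2.
Proof.
move=> s0; rewrite -subr_ge0 (_ : _ - _ = (s * T - (E * w - k)) ^+ 2 / s); last by field; rewrite gt_eqF.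
by rewrite divr_ge0 ?sqr_ge0 ?(ltW s0).
Qed.

Lemma onofri_ar5 (A0 A1 A2 X Y F q : R) : A0 + A1 + A2 = X + Y / q -> A0 + A1 + A2 + 2 * F = X + (q^-1 * Y + 2 * F).
Proof. by move=> ->; ring. Qed.

(** * Onofri's inequality *)

(** The squared length of the gradient in spherical coordinates. The relation
    [x_0 X_0 + x_1 X_1 + x_2 X_2 = 0] determines the combination of [X_0] and [X_1] that is not the
    [theta]-derivative. *)
Lemma sum_Xd_sqr (u : E -> R) (t s : R) : C1s u -> sin t != 0 ->
 \sum_k Xd k u (sph (t, s)) ^+ 2 =
 tderiv u (sph (t, s)) (sph_dth (t, s)) ^+ 2 + tderiv u (sph (t, s)) (sph_dph (t, s)) ^+ 2 / sin t ^+ 2.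
Proof.
move=> cu s0; have x0 := sph_neq0 (t, s).
have h := sum_coord_Xd cu x0; rewrite sph0 sph1 sph2 /= in h.
rewrite sum3 sph_dth_rot sph_dph_rot tderiv_lin2 // -/(Xd 0 u _) -/(Xd 1 u _) -/(Xd o2 u _) /=.
move: h (cos2Dsin2 t) (cos2Dsin2 s) s0.
move: (Xd 0 u (sph (t, s))) (Xd 1 u (sph (t, s))) (Xd o2 u (sph (t, s))) => p q r.
move: (sin t) (cos t) (sin s) (cos s) => a b c d h h1 h2 a0.
have e : d * p + c * q = - (b * r / a).
 by apply: (mulfI a0); rewrite mulrN mulrCA mulfV // mulr1; lra.
have e2 : p ^+ 2 + q ^+ 2 = (- c * p + d * q) ^+ 2 + (d * p + c * q) ^+ 2.
 rewrite (_ : _ + (d * p + c * q) ^+ 2 = (d ^+ 2 + c ^+ 2) * (p ^+ 2 + q ^+ 2)); last by ring.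
 by rewrite h2 mul1r.
rewrite e2 e.
have -> : r ^+ 2 / a ^+ 2 = (b ^+ 2 + a ^+ 2) * (r ^+ 2 / a ^+ 2) by rewrite h1 mul1r.
by field.
Qed.

Lemma sph_per (t s : R) : sph (t, s + 2 * pi) = sph (t, s).
Proof.
have e1 : cos (s + 2 * pi) = cos s by rewrite mulr_natl cosD cos2pi sin2pi mulr1 mulr0 subr0.
have e2 : sin (s + 2 * pi) = sin s by rewrite mulr_natl sinD cos2pi sin2pi mulr1 mulr0 addr0.
by apply: rowP3; rewrite ?sph0 ?sph1 ?sph2 /= ?e1 ?e2.
Qed.

Lemma sph_north (s : R) : sph (0, s) = sph (0, 0).
Proof. by apply: rowP3; rewrite ?sph0 ?sph1 ?sph2 //= sin0 !mul0r. Qed.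

Lemma sph_south (s : R) : sph (pi, s) = sph (pi, 0).
Proof. by apply: rowP3; rewrite ?sph0 ?sph1 ?sph2 //= sinpi !mul0r. Qed.

Section Alg1.
Variable u : E -> R.
Hypotheses (au : Alg u)
(hu : \I_p (expR (2 * u p^S)) = 4 * pi).

Let F (p : R * R) : R := u p^S.
Let Ft (p : R * R) : R := tderiv u p^S (sph_dth p).
Let Fs (p : R * R) : R := tderiv u p^S (sph_dph p).
Let cu : C1s u := AlgC1 au.
Let tp : R := 2 * pi.
Let I (G : R * R -> R) (t : R) : R := ci 0 tp (fun s => G (t, s)).

Lemma Ial_dF : (forall t s, dva (fun t => F (t, s)) t (Ft (t, s))) /\ (forall t s, dva (fun s => F (t, s)) s (Fs (t, s))).
Proof. by split=> t s; [exact: dth_deriv|exact: dph_deriv]. Qed.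

Lemma sphere_split (G : R * R -> R) : cont2 G -> pint G = ci 0 pi (fun t => I G t * sin t).
Proof.
move=> cG.
have cS : cont2 (fun p => G p * sin p.1) by apply: cont2M => //; exact: cont2_sin1.
rewrite /pint (proj1 (fubini_rect 0 pi 0 tp (cont2_continuous cS))).
apply: eq_ci => t _; rewrite mulrC -ciZ; last first.
 by move=> s; apply: (@continuous_comp _ _ _ (fun s : R => (t, s)) G); [exact: continuous_pairr|exact: cont2_continuous].
by apply: eq_ci => s _; rewrite mulrC.
Qed.

Lemma onofri_alg_norm : 0 <= \I_p (\sum_k Xd k u p^S ^+ 2 + 2 * u p^S).
Proof.
have pi0 := pi_gt0 R; have p2 := @pi_ge2 R.
have tp0 : 0 < tp by rewrite mulr_gt0.
have tpn : tp != 0 by rewrite gt_eqF.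
have [dFt dFs] := Ial_dF.
have cF : cont2 F := C1s_cont2 cu.
have cFt : cont2 Ft := dth_cont2 cu.
have cFs : cont2 Fs := dph_cont2 cu.
have cE1 : cont2 (fun p => expR (F p)) by apply: cont2_comp => //; exact: continuous_expR.
have cE2 : cont2 (fun p => expR (2 * F p)).
 by apply: (@cont2_comp _ (fun p => 2 * F p)); [exact: continuous_expR|apply: cont2M; [exact: cont2_cst|exact: cF]].
have cEt : cont2 (fun p => expR (F p) * Ft p) by exact: cont2M.
have ctI G : cont2 G -> continuous (I G) by move=> cG; apply: param_ct; exact: cont2_continuous.
have cts (G : R * R -> R) (t : R) : cont2 G -> continuous (fun s : R => G (t, s)).
 by move=> cG s; apply: (@continuous_comp _ _ _ (fun s : R => (t, s)) G); [exact: continuous_pairr|exact: cont2_continuous].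
pose a t := I (fun p => expR (F p)) t / tp.
pose A t := I (fun p => expR (F p) * Ft p) t / tp.
pose ub t := I F t / tp.
pose U t := I Ft t / tp.
pose b t := I (fun p => expR (2 * F p)) t / tp.
have dI G H t : cont2 G -> cont2 H -> (forall t s, dva (fun t => G (t, s)) t (H (t, s))) -> dva (fun t => I G t / tp) t (I H t / tp).
 move=> cG cH dG; apply: dv_eq (dvM (param_dva _ _ (cont2_continuous cG) (cont2_continuous cH) dG t) (dvC tp^-1 t)) _.
 by rewrite mulr0 addr0.
have da t : dva a t (A t) := dI _ _ t cE1 cEt (fun t s => dv_exp (dFt t s)).
have dub t : dva ub t (U t) := dI _ _ t cF cFt dFt.
have cb : continuous b by move=> t; apply: (@ctM R (I (fun p => expR (2 * F p))) (fun _ => tp^-1)); [exact: ctI|exact: ctC].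
have bp t : 0 < b t by rewrite divr_gt0 //; apply: (ci_gt0 tp0 (cts _ t cE2)) => x; exact: expR_gt0.
have ap t : 0 < a t by rewrite divr_gt0 //; apply: (ci_gt0 tp0 (cts _ t cE1)) => x; exact: expR_gt0.
have cbs : continuous (fun t => b t * sin t) by move=> t; apply: (@ctM R b sin); [exact: ctR|apply: ctR; exact: continuous_sin].
have [B hB] := prim_ex (-1) (2 * pi) cbs.
(* The area function falls from 1 at the north pole to -1 at the south pole exactly because [e^(2u)]
   has total mass [4 pi]. *)
pose c t := 1 - (B t - B 0).
have dc t : -1 < t < 2 * pi -> dva c t (- b t * sin t).
 by move=> ht; apply: dv_eq (dvB (dvC 1 t) (dvB (hB t ht) (dvC _ t))) _; rewrite subr0 sub0r mulNr.
have c0 : c 0 = 1 by rewrite /c subrr subr0.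
have cpi : c pi = -1.
 rewrite /c -(@ftc_in B (fun t => b t * sin t)) //; [|exact: ltW|by move=> *; apply: hB; lra].
 rewrite -/(ci 0 pi (fun t => b t * sin t)) (@eq_ci _ _ _ (fun t => tp^-1 * (I (fun p => expR (2 * F p)) t * sin t))); last by move=> t _; rewrite /b; ring.
 rewrite ciZ; last by move=> t; apply: (@ctM R (I (fun p => expR (2 * F p))) sin); [exact: ctI|apply: ctR; exact: continuous_sin].
 rewrite -(sphere_split cE2) (hu : \I_p (expR (2 * F p)) = _) /tp.
 have e (q : R) : 0 < q -> 1 - (2 * q)^-1 * (4 * q) = -1 by move=> q0; field; rewrite gt_eqF.
 exact: e.
have eI G k t : (forall s, G (t, s) = k) -> I G t / tp = k.
 move=> e; rewrite /I (@eq_ci _ _ _ (fun _ => k)); last by move=> s _.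
 by rewrite (ci_cst _ (ltW tp0)) subr0 mulrAC mulfV // mul1r.
have mc x y : 0 <= x -> x < y -> y <= pi -> c y < c x.
 move=> x0 xy y1; rewrite -ltrN2; apply: (@dva_lt (fun t => - c t) (fun t => b t * sin t)) => // z /andP[z0 z1].
  by apply: ctN; apply: dva_ct (dc z _); lra.
 split; first by apply: dv_eq (dvN (dc z _)) _; [lra|rewrite mulNr opprK].
 by rewrite mulr_gt0 //; apply: sin_gt0_pi; lra.
have c1 t : 0 < t < pi -> -1 < c t < 1.
 move=> ht; have := mc 0 t; have := mc t pi; rewrite c0 cpi => h1 h2.
 by apply/andP; split; [apply: h1|apply: h2]; lra.
have cXk k : cont2 (fun p => Xd k u p^S) by exact: Xd_cont2.
pose H (p : R * R) := Xd 0 u p^S ^+ 2 + Xd 1 u p^S ^+ 2 + Xd o2 u p^S ^+ 2 + 2 * u p^S.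
have cH : cont2 H.
 apply: cont2D; last by apply: cont2M; [exact: cont2_cst|exact: cF].
 by apply: cont2D; first apply: cont2D; move=> p; apply: ctX; exact: cXk.
have -> : \I_p (\sum_k Xd k u p^S ^+ 2 + 2 * u p^S) = pint H.
 by eqp; rewrite sum3.
rewrite sphere_split //.
have cT : continuous (fun t => I H t * sin t) by move=> t; apply: (@ctM R (I H) sin); [apply: ctR; exact: ctI|apply: ctR; exact: continuous_sin].
have [K hK] := prim_ex (-1) (2 * pi) cT.
rewrite /ci (@ftc_in K (fun t => I H t * sin t)) //; [|exact: ltW|by move=> *; apply: hK; lra].
rewrite subr_ge0.
pose r t := Num.sqrt (1 - c t ^+ 2).
pose L t := tp * Lam (a t) (ub t) (c t) t.
pose L1 t := tp * (2 * A t * (c t * sin t / r t) + 2 * a t * (c t * cos t / r t - b t * sin t ^+ 2 / r t ^+ 3)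
  - 2 * cos t * U t + 2 * sin t * ub t + 2 * b t * sin t / r t ^+ 2 - 2 / sin t + b t * sin t + sin t).
apply: (@mono_end K L (fun t => I H t * sin t) L1).
- exact: pi0.
- by apply: (dva_ct (hK 0 _)); lra.
- by apply: (dva_ct (hK pi _)); lra.
- move=> t ht; have /andP[t0 t1] := ht.
 have s0 : 0 < sin t by apply: sin_gt0_pi.
 have hc := c1 t ht; have ht' : -1 < t < 2 * pi by lra.
 split; first exact: hK.
  by apply: dv_eq (dvM (dvC tp t) (dva_Lam s0 hc (da t) (dub t) (dc t ht'))) _; rewrite mul0r add0r.
 rewrite /L1 -(@divfK _ tp tpn (I H t * sin t)) mulrC ler_pM2r //.
 have e1 : 0 < 1 - c t ^+ 2 by rewrite (_ : _ - _ = (1 - c t) * (1 + c t)); [case/andP: hc => *; apply: mulr_gt0; lra|ring].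
 have rp : 0 < r t by rewrite sqrtr_gt0.
 have rr : r t ^+ 2 = 1 - c t ^+ 2 by rewrite sqr_sqrtr // ltW.
 have c1t : continuous (fun s : R => Ft (t, s) ^+ 2) by move=> s; apply: (@ctX R (fun s => Ft (t, s)) s 2); apply: ctR; exact: cts.
 have c2t : continuous (fun s : R => Fs (t, s) ^+ 2) by move=> s; apply: (@ctX R (fun s => Fs (t, s)) s 2); apply: ctR; exact: cts.
 have ctZ (k : R) (g : R -> R) : continuous g -> continuous (fun s : R => k * g s) by move=> cg s; apply: (@ctM R (fun _ => k) g); [exact: ctC|exact: ctR].
 have ctS (g h : R -> R) : continuous g -> continuous h -> continuous (fun s : R => g s + h s) by move=> cg ch s; apply: (@ctD R g h); exact: ctR.
 pose P := ci 0 tp (fun s => Ft (t, s) ^+ 2) / tp.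
 pose W := ci 0 tp (fun s => Fs (t, s) ^+ 2) / tp.
 have eT : I H t * sin t / tp = sin t * P + W / sin t + 2 * sin t * ub t.
  have -> : I H t = ci 0 tp (fun s => Ft (t, s) ^+ 2 + (sin t ^- 2 * Fs (t, s) ^+ 2 + 2 * F (t, s))).
   apply: eq_ci => s _; have hS := @sum_Xd_sqr u t s cu (lt0r_neq0 s0); rewrite sum3 in hS; exact: onofri_ar5 hS.
  rewrite ciD; [|exact: c1t|by apply: ctS; apply: ctZ => //; exact: cts].
  rewrite ciD; [|exact: ctZ|by apply: ctZ; exact: cts].
  rewrite !ciZ //; last exact: cts.
  exact: onofri_ar1 (lt0r_neq0 s0) tpn.
 rewrite eT; apply: onofri_arith.
 + exact: s0.
 + exact: cos2Dsin2.
 + exact: ap.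
 + exact: bp.
 + exact: rp.
 + exact: rr.
 + have pF s : F (t, s + 2 * pi) = F (t, s).
   by rewrite /F sph_per.
  have hci := circle_ineq (dFs t) (cts Fs t cFs) pF.
  rewrite -/tp in hci; rewrite /W ler_pdivlMr //; apply: le_trans hci.
  have a0 : 0 < ci 0 tp (fun s => expR (F (t, s))) by apply: (ci_gt0 tp0 (cts _ t cE1)) => x; exact: expR_gt0.
  apply: eq_lerW; exact: onofri_ar3 tpn (lt0r_neq0 a0).
 + move=> w.
  have cf1 := ctZ (2 * w) _ (cts _ t cEt).
  have cf2 := ctZ (- (2 * cos t)) _ (cts _ t cFt).
  have cf3 := ctZ (- (w ^+ 2 / sin t)) _ (cts _ t cE2).
  have cf4 := ctZ (2 * w * cos t / sin t) _ (cts _ t cE1).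
  have cf5 : continuous (fun _ : R => - (cos t ^+ 2 / sin t)) by move=> s; exact: ctC.
  have cf45 := ctS _ _ cf4 cf5; have cf345 := ctS _ _ cf3 cf45; have cf2345 := ctS _ _ cf2 cf345.
  have hall s : 2 * w * (expR (F (t, s)) * Ft (t, s)) + (- (2 * cos t) * Ft (t, s) + (- (w ^+ 2 / sin t) * expR (2 * F (t, s)) +
    (2 * w * cos t / sin t * expR (F (t, s)) + - (cos t ^+ 2 / sin t)))) <= sin t * Ft (t, s) ^+ 2.
   rewrite (_ : 2 * F (t, s) = F (t, s) + F (t, s)) ?expRD; last by rewrite mulr_natl mulr2n.
   exact: onofri_ar4.
  have h := @ci_le 0 tp _ _ (ctS _ _ cf1 cf2345) (ctZ (sin t) _ c1t) (fun s _ => hall s).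
  rewrite (ciD _ _ cf1 cf2345) (ciD _ _ cf2 cf345) (ciD _ _ cf3 cf45) (ciD _ _ cf4 cf5) in h.
  rewrite (ciZ _ _ _ (cts _ t cEt)) (ciZ _ _ _ (cts _ t cFt)) (ciZ _ _ _ (cts _ t cE2)) (ciZ _ _ _ (cts _ t cE1)) (ciZ _ _ _ c1t) (ci_cst _ (ltW tp0)) in h.
  rewrite -(ler_pM2r tp0).
  have eR : sin t * P * tp = sin t * ci 0 tp (fun s => Ft (t, s) ^+ 2) by rewrite /P -mulrA divfK.
  rewrite eR; apply: le_trans h.
  apply: eq_lerW; rewrite subr0; exact: onofri_ar2 (lt0r_neq0 s0) tpn.
- have dc' y : -1 < y < 1 -> dva c y (- b y * sin y) by move=> /andP[y0 y1]; apply: dc; lra.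
 have e0 s : F (0, s) = F (0, 0).
  by rewrite /F sph_north.
 rewrite (_ : (fun y : R => L (0 + y)) = L); last by apply/funext => y; rewrite add0r.
 apply: cvg_mul0; apply: (@pole_limit a ub b c (F (0, 0)) (A 0) (U 0)).
 + exact: da.
 + by apply: eI => s; rewrite e0.
 + exact: dub.
 + by apply: eI => s; rewrite e0.
 + exact: ctR.
 + by apply: eI => s; rewrite e0.
 + exact: dc'.
 + exact: c0.
- have dp y : dva (fun y : R => pi - y) y (-1) by apply: dv_eq (dvB (dvC _ y) (dvX y)) _; rewrite sub0r.
 have dcomp (f : R -> R) y l : dva f (pi - y) l -> dva (fun y => f (pi - y)) y (- l).
  by move=> df; apply: dv_eq (dv_comp (g := fun y => pi - y) df (dp y)) _; rewrite mulrN1.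
 have e0 s : F (pi - 0, s) = F (pi, 0).
  by rewrite subr0 /F sph_south.
 rewrite (_ : (fun y : R => L (pi - y)) = (fun y => - tp * Lam (a (pi - y)) (ub (pi - y)) (- c (pi - y)) y)); last first.
  apply/funext => y; have h := Lam_reflect (a (pi - y)) (ub (pi - y)) (c (pi - y)) (pi - y).
  have e : pi - (pi - y) = y by rewrite opprB addrC subrK.
  by rewrite e in h; rewrite /L h mulrNN.
 apply: cvg_mul0; apply: (@pole_limit (fun y => a (pi - y)) (fun y => ub (pi - y)) (fun y => b (pi - y)) (fun y => - c (pi - y)) (F (pi, 0)) (- A (pi - 0)) (- U (pi - 0))).
 + exact: dcomp.
 + by apply: eI => s; rewrite e0.
 + exact: dcomp.
 + by apply: eI => s; rewrite e0.
 + apply: (@continuous_comp _ _ _ (fun y : R => pi - y) b); [exact: (dva_ct (dp 0))|exact: cb].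
 + by apply: eI => s; rewrite e0.
 + move=> y /andP[y0 y1].
  have hy : -1 < pi - y < 2 * pi by lra.
  apply: dv_eq (dvN (dcomp _ _ _ (dc _ hy))) _.
  by rewrite sinB sinpi cospi; ring.
 + by rewrite subr0 cpi opprK.
Unshelve. all: by end_near.
Qed.

End Alg1.

Lemma pint_cst (c : R) : pint (fun _ => c) = c * (4 * pi).
Proof.
have h : pint (fun q : R * R => zon 0 (sph (0, 0)) q^S) = 4 * pi.
 by rewrite pint_zon ?divr1 //; exact: sphS.
rewrite -h -pintZ; last by apply: AlgL1; exact: Kern_Algr (Kern_zon 0).
by eqp; rewrite /zon expr0 mulr1.
Qed.

Lemma pae_contra : ~ @pae (fun _ => False).
Proof.
move=> h; have := ae_eq_pint (pmeasC 1) (pmeasC 0) (paeS (fun p _ f => False_ind _ f) h).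
by rewrite pint0 pint_cst mul1r => /eqP; rewrite mulf_eq0 pnatr_eq0 /= gt_eqF // pi_gt0.
Qed.

Lemma pint_gt0 (F : R * R -> R) : pL1 F -> (forall p, dom p -> 0 < F p) -> 0 < pint F.
Proof.
move=> iF F0; rewrite lt_neqAle pint_ge0 ?andbT; last by move=> p hp; exact: ltW (F0 p hp).
apply/negP => /eqP h; apply: pae_contra.
apply: paeS (pint_eq0_ae iF (fun p hp => ltW (F0 p hp)) (esym h)) => p hp e.
by have := F0 p hp; rewrite e ltxx.
Qed.

(** Adding a constant [d] to [u] adds [8 pi d] to both sides; the chosen [d] normalizes the mass to
    [4 pi]. *)
Lemma onofri_Alg (u : E -> R) : Alg u ->
 4 * pi * ln (\I_p (expR (2 * u p^S)) / (4 * pi)) <=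
 \I_p (\sum_k Xd k u p^S ^+ 2 + 2 * u p^S).
Proof.
move=> au; have fp0 : 0 < 4 * pi :> R by rewrite mulr_gt0 // pi_gt0.
have cE : cont2 (fun p : R * R => expR (2 * u p^S)).
 apply: (@cont2_comp _ (fun p => 2 * u p^S)); [exact: continuous_expR|].
 exact: (Alg_cont2 (f := fun x => 2 * u x) (AlgM (AlgC 2) au)).
have iE := cont2_pL1 cE.
have E0 := pint_gt0 iE (fun p _ => expR_gt0 _).
set V := pint _ / (4 * pi); have V0 : 0 < V by rewrite divr_gt0.
pose d := - (ln V / 2).
have av : Alg (fun x => u x + d) by exact: AlgD au (AlgC d).
have h1 : \I_p (expR (2 * (u p^S + d))) = 4 * pi.
 rewrite -(eq_pint (F := fun p => expR (2 * d) * expR (2 * u p^S))); last first.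
  by move=> p _; rewrite mulrDr expRD mulrC.
 rewrite pintZ // (_ : 2 * d = - ln V); last by rewrite /d; field.
 by rewrite expRN lnK ?posrE // /V invf_div mulfVK // gt_eqF.
have := onofri_alg_norm av h1.
have eX p : \sum_k Xd k (fun x => u x + d) p^S ^+ 2 = \sum_k Xd k u p^S ^+ 2.
 apply: eq_bigr => k _; congr (_ ^+ 2); rewrite XdD ?Xd_cst ?addr0 //; [exact: AlgC1|exact: C1sC|exact: sph_neq0].
have iX k : pL1 (fun p => Xd k u p^S ^+ 2) by apply: (AlgL1 (f := fun x => Xd k u x ^+ 2)); apply: AlgXn; exact: Alg_Xd.
have iS : pL1 (fun p => \sum_k Xd k u p^S ^+ 2) by exact: pL1S.
have iu := AlgL1 au.
rewrite -(eq_pint (F := fun p => (\sum_k Xd k u p^S ^+ 2 + 2 * u p^S) + 2 * d)); last first.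
 by move=> p _; rewrite eX -addrA -mulrDr.
rewrite pintD; [|by apply: pL1D => //; exact: pL1Z|exact: pL1C].
by rewrite pint_cst /d; move: (ln V) (4 * pi) => x y; lra.
Qed.

(** Weak derivatives along the rotation fields rather than a weak gradient: they are scalar
    functions that can be mollified, and as the fields are divergence free, integration by parts has
    no zeroth order term. *)
Definition wH1 (U : R * R -> R) (G : 'I_3 -> R * R -> R) : Prop :=
 [/\ pL1 U, forall k, pL1 (G k), forall k, pL1 (fun p => G k p ^+ 2) &
   forall k f, Alg f -> \I_p (G k p * f p^S) = - \I_p (U p * Xd k f p^S)].

Lemma wH1Z (s : R) U G : wH1 U G -> wH1 (fun p => s * U p) (fun k p => s * G k p).
Proof.
move=> [h1 h2 h3 h4]; split=> [|k|k|k f af]; [exact: pL1Z|exact: pL1Z| |].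
 by apply: eqL1 (pL1Z (s ^+ 2) (h3 k)) => p _; rewrite exprMn.
have i1 : pL1 (fun p => G k p * f p^S).
 by apply: (eqL1 _ (L1Mct (Alg_cont2 af) (h2 k))) => p _; exact: mulrC.
have i2 : pL1 (fun p => U p * Xd k f p^S).
 by apply: (eqL1 _ (L1Mct (Alg_cont2 (Alg_Xd k af)) h1)) => p _; exact: mulrC.
transitivity (s * \I_p (G k p * f p^S)); first by rewrite -pintZ //; eqp; rewrite mulrA.
by rewrite h4 // mulrN -pintZ //; congr (- _); eqp; rewrite mulrA.
Qed.

Lemma wH1_Alg (u : E -> R) : Alg u -> wH1 (fun p => u p^S) (fun k p => Xd k u p^S).
Proof.
move=> au; split=> [|k|k|k f af].
- exact: AlgL1.
- exact: AlgL1 (Alg_Xd k au).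
- by apply: (AlgL1 (f := fun x => Xd k u x ^+ 2)); apply: AlgXn; exact: Alg_Xd.
have h : \I_p (Xd k (fun x => u x * f x) p^S) = 0.
 by apply: (sint_Xd k (f := fun x => u x * f x)); apply: AlgC1; exact: AlgM.
apply/eqP; rewrite -subr_eq0 opprK -pintD; last first.
- exact: (AlgL1 (f := fun x => u x * Xd k f x)) (AlgM au (Alg_Xd k af)).
- exact: (AlgL1 (f := fun x => Xd k u x * f x)) (AlgM (Alg_Xd k au) af).
rewrite -[X in _ == X]h; apply/eqP; apply: eq_pint => p _.
by rewrite XdM //; [exact: AlgC1|exact: AlgC1|exact: sphS].
Qed.

Lemma wH1D U G V H : wH1 U G -> wH1 V H -> wH1 (fun p => U p + V p) (fun k p => G k p + H k p).
Proof.
move=> [h1 h2 h3 h4] [g1 g2 g3 g4]; split=> [|k|k|k f af]; [exact: pL1D|exact: pL1D| |].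
 have mk : pmeas (fun p => (G k p + H k p) ^+ 2).
  by apply: (pmeas_ct (f := fun x : R => x ^+ 2)); [exact: exprn_continuous|exact: (pL1D (h2 k) (g2 k)).1].
 apply: pL1_le mk _ (pL1D (pL1Z 2 (h3 k)) (pL1Z 2 (g3 k))) => p _.
 rewrite ger0_norm ?sqr_ge0 // -subr_ge0 (_ : _ - _ = (G k p - H k p) ^+ 2) ?sqr_ge0 //; ring.
have j (F : R * R -> R) g : pL1 F -> Alg g -> pL1 (fun p => F p * g p^S).
 by move=> iF ag; apply: (eqL1 _ (L1Mct (Alg_cont2 ag) iF)) => p _; exact: mulrC.
have aX := Alg_Xd k af.
transitivity (\I_p (G k p * f p^S) + \I_p (H k p * f p^S)).
 by rewrite -pintD; [|exact: j..]; eqp; rewrite mulrDl.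
rewrite h4 // g4 // -opprD -pintD; [|exact: j..].
by congr (- _); eqp; rewrite mulrDl.
Qed.

Lemma cvg_ctf (f : R -> R) (u : nat -> R) l : continuous f -> u n @[n --> \oo] --> l -> f (u n) @[n --> \oo] --> f l.
Proof. by move=> cf h; apply: continuous_cvg h; exact: cf. Qed.

(** Mollification does not increase the Dirichlet integral, by Jensen's inequality, and keeps the
    mean of [u]. The exponentials converge almost everywhere along a subsequence, and Fatou's lemma
    carries their bound to the limit. *)
Theorem onofri U G : wH1 U G -> pL1 (fun p => expR (2 * U p)) /\
 4 * pi * ln (\I_p (expR (2 * U p)) / (4 * pi)) <= \I_p (\sum_k G k p ^+ 2) + 2 * pint U.
Proof.
move=> [iU iG iG2 hG]; have fp0 : 0 < 4 * pi :> R by rewrite mulr_gt0 // pi_gt0.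
have [s _ hs] := conv_subseq (fun _ : unit => iU).
pose u n := conv (s n) U.
have au n : Alg (u n) by exact: conv_Alg.
set J := pint _ + 2 * pint U.
have hJ n : \I_p (\sum_k Xd k (u n) p^S ^+ 2 + 2 * u n p^S) <= J.
 have iu := conv_L1 (s n) iU.
 have iX k : pL1 (fun p => Xd k (u n) p^S ^+ 2) by apply: (AlgL1 (f := fun x => Xd k (u n) x ^+ 2)); apply: AlgXn; exact: Alg_Xd.
 rewrite pintD; [|exact: pL1S|exact: pL1Z].
 rewrite pintZ // /u pint_conv // lerD2r.
 rewrite !pintS //; apply: ler_sum => k _; rewrite -(pint_conv (s n) (iG2 k)).
 apply: le_pint => //; first exact: conv_L1.
 move=> p _; have hp := sphS p; rewrite (conv_wderiv (s n) iU (iG k) hp (hG k)).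
 exact: conv_sqr_le.
have cE n : cont2 (fun p : R * R => expR (2 * u n p^S)).
 apply: (@cont2_comp _ (fun p => 2 * u n p^S)); [exact: continuous_expR|].
 exact: (Alg_cont2 (f := fun x => 2 * u n x) (AlgM (AlgC 2) (au n))).
have iE n := cont2_pL1 (cE n).
have E0 n := pint_gt0 (iE n) (fun p _ => expR_gt0 _).
have bnd n : \I_p (expR (2 * u n p^S)) <= 4 * pi * expR (J / (4 * pi)).
 rewrite mulrC -ler_pdivrMr //.
 have v0 : 0 < \I_p (expR (2 * u n p^S)) / (4 * pi) by rewrite divr_gt0.
 rewrite -[leLHS](lnK v0) ler_expR ler_pdivlMr // mulrC.
 exact: le_trans (onofri_Alg (au n)) (hJ n).
have mE : pmeas (fun p => expR (2 * U p)).
 apply: (pmeas_ct (f := fun x : R => expR (2 * x))) iU.1 => x.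
 by apply: (@ct_expR (fun x => 2 * x)); apply: (dva_ct (dvM (dvC 2 x) (dvX x))).
have cex : continuous (fun x : R => expR (2 * x)).
 by move=> x; apply: (@ct_expR (fun x => 2 * x)); apply: (dva_ct (dvM (dvC 2 x) (dvX x))).
have cE2 : pae (fun p => expR (2 * u n p^S) @[n --> \oo] --> expR (2 * U p)).
 by apply: paeS hs => p _ h; apply: (cvg_ctf cex); exact: h tt.
have [iEU hEU] := pint_fatou_ae iE mE cE2 (fun n p _ => expR_ge0 _) bnd.
split=> //; have V0 : 0 < \I_p (expR (2 * U p)) / (4 * pi) by rewrite divr_gt0 // pint_gt0 // => p _; exact: expR_gt0.
rewrite mulrC -ler_pdivlMr // -[leRHS]expRK ler_ln ?posrE ?expR_gt0 //.
by rewrite ler_pdivrMr // mulrC.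
Qed.

(** Onofri's inequality for [(s / 2) u]: all real powers of [e^u] are integrable. *)
Lemma wH1_exp U G (s : R) : wH1 U G -> pL1 (fun p => expR (s * U p)).
Proof.
move=> h; have [h1 _] := onofri (wH1Z (s / 2) h).
by apply: eqL1 h1 => p _; congr expR; field.
Qed.

(** * From the weak gradient to weak derivatives along rotation fields *)

Lemma rot_tangent k (x : E) : tangent x (rot k x).
Proof. by rewrite /tangent dotC dot_rot. Qed.

Lemma Alg_rot k i : Alg (fun x : E => rot k x 0 i).
Proof.
have aN j := AlgN (AlgX j).
case: (ord3P k) => ->; case: (ord3P i) => ->; (apply: Alg_ext; [|move=> x _; rewrite rotE; reflexivity]);
 by [exact: AlgC|exact: AlgX|exact: aN].
Qed.

Lemma tderiv_coord i j (x : E) : sphere x -> tderiv (fun y => y 0 i) x (bvec R j) = (i == j)%:R - x 0 i * x 0 j.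
Proof.
move=> hx; have x0 := sphere0 hx.
apply: tderiv_eq; rewrite /hext.
apply: (@near_is_derive _ (fun y : E => (rad y)^-1 * y 0 i)).
 by near=> y; rewrite !mxE.
have d1 := dv_radV (bvec R j) x0.
have d2 : is_derive x (bvec R j) (fun y : E => y 0 i) (bvec R j 0 i).
 by apply/line_is_deriveP; exact: dv_coord.
have d := is_deriveM d1 d2.
apply: (@near_is_derive _ (fun y : E => (rad y)^-1 * y 0 i)); first by near=> y.
apply: is_derive_eq d _.
rewrite rad_sphere // invr1 expr1n mulr1 bvecE -![_ *: _]/(_ * _) mul1r.
by rewrite dot_bvec mulrN.
Unshelve. all: by end_near.
Qed.

(** [rot k] is divergence free, so only the derivative of [f] is left. Fields of this form test the
    weak gradient. *)
Lemma sdiv_rot k (f : E -> R) (x : E) : Alg f -> sphere x -> sdiv (fun y => f y *: rot k y) x = Xd k f x.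
Proof.
move=> af hx; have x0 := sphere0 hx; have cf := AlgC1 af.
have e i : tderiv (fun y => (f y *: rot k y) 0 i) x (bvec R i) =
 tderiv f x (bvec R i) * rot k x 0 i + f x * tderiv (fun y : E => rot k y 0 i) x (bvec R i).
 rewrite (@tderiv_ext _ (fun y => f y * rot k y 0 i)) //; last by move=> y _; rewrite mxE.
 by rewrite (tderivM _ cf (AlgC1 (Alg_rot k i)) x0) (hext_sphere _ hx) (hext_sphere _ hx).
rewrite /sdiv (eq_bigr _ (fun i _ => e i)) big_split /= -mulr_sumr.
have d0 (i : 'I_3) (c : R) : tderiv (fun y : E => c) x (bvec R i) = 0 by rewrite /tderiv /hext derive_cst.
have dN (i j : 'I_3) : tderiv (fun y : E => - y 0 i) x (bvec R j) = - ((i == j)%:R - x 0 i * x 0 j).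
 rewrite (@tderiv_ext _ (fun y => (-1) * y 0 i)) //; last by move=> y _; rewrite mulN1r.
 rewrite (tderivM _ (C1sC (-1 : R)) (AlgC1 (AlgX i)) x0) d0 (tderiv_coord _ _ hx) (hext_sphere _ hx).
 by rewrite mul0r add0r mulN1r.
have -> : \sum_i tderiv (fun y : E => rot k y 0 i) x (bvec R i) = 0.
 have ex (i j : 'I_3) (g : E -> R) : (forall y : E, rot k y 0 j = g y) -> tderiv (fun y : E => rot k y 0 j) x (bvec R i) = tderiv g x (bvec R i).
  by move=> h; apply: tderiv_ext.
 rewrite sum3; case: (ord3P k) ex => -> ex.
 - transitivity (tderiv (fun _ : E => 0 : R) x (bvec R 0) + tderiv (fun y : E => - y 0 o2) x (bvec R 1) + tderiv (fun y : E => y 0 1) x (bvec R o2)).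
   by congr (_ + _ + _); apply: ex => y; rewrite rotE.
  rewrite d0 dN (tderiv_coord _ _ hx) o2_neq1 (eq_sym 1 o2) o2_neq1.
  by move: (x 0 1) (x 0 o2) => a b; ring.
 - transitivity (tderiv (fun y : E => y 0 o2) x (bvec R 0) + tderiv (fun _ : E => 0 : R) x (bvec R 1) + tderiv (fun y : E => - y 0 0) x (bvec R o2)).
   by congr (_ + _ + _); apply: ex => y; rewrite rotE.
  rewrite d0 dN (tderiv_coord _ _ hx) o2_neq0 (eq_sym 0 o2) o2_neq0.
  by move: (x 0 0) (x 0 o2) => a b; ring.
 - transitivity (tderiv (fun y : E => - y 0 1) x (bvec R 0) + tderiv (fun y : E => y 0 0) x (bvec R 1) + tderiv (fun _ : E => 0 : R) x (bvec R o2)).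
   by congr (_ + _ + _); apply: ex => y; rewrite rotE.
  have e10 : (1 == 0 :> 'I_3) = false by [].
  have e01 : (0 == 1 :> 'I_3) = false by [].
  rewrite d0 dN (tderiv_coord _ _ hx) e10 e01.
  by move: (x 0 0) (x 0 1) => a b; ring.
rewrite mulr0 addr0 /Xd (tderiv_lin (rot k x) cf x0) sum3.
by move: (tderiv f x (bvec R 0)) (tderiv f x (bvec R 1)) (tderiv f x (bvec R o2)) (rot k x 0 0) (rot k x 0 1) (rot k x 0 o2) => *; ring.
Qed.

Lemma dot_CS (a b : E) : dot a b ^+ 2 <= dot a a * dot b b.
Proof.
rewrite !dotE -subr_ge0.
move: (a 0 0) (a 0 1) (a 0 o2) (b 0 0) (b 0 1) (b 0 o2) => a1 a2 a3 b1 b2 b3.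
rewrite (_ : _ - _ = (a1 * b2 - a2 * b1) ^+ 2 + (a2 * b3 - a3 * b2) ^+ 2 + (a1 * b3 - a3 * b1) ^+ 2); last by ring.
by rewrite !addr_ge0 ?sqr_ge0.
Qed.

Lemma rot_norm_le1 k (x : E) : sphere x -> dot (rot k x) (rot k x) <= 1.
Proof.
rewrite /sphere /= => hx; rewrite -[leRHS]hx !dotE.
by case: (ord3P k) => ->; rewrite !rotE; have := sqr_ge0 (x 0 0); have := sqr_ge0 (x 0 1); have := sqr_ge0 (x 0 o2); lra.
Qed.

(** The three vectors [rot k x] form a tight frame of the tangent plane at [x]. *)
Lemma dot_sum_rot (x a b : E) : sphere x -> dot x a = 0 -> dot a b = \sum_k dot a (rot k x) * dot b (rot k x).
Proof.
rewrite /sphere /= sum3 !dotE !rotE.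
move: (x 0 0) (x 0 1) (x 0 o2) (a 0 0) (a 0 1) (a 0 o2) (b 0 0) (b 0 1) (b 0 o2) => x1 x2 x3 a1 a2 a3 b1 b2 b3 hx ha.
rewrite -[LHS]mul1r -hx.
transitivity ((x1 * x1 + x2 * x2 + x3 * x3) * (a1 * b1 + a2 * b2 + a3 * b3) - (x1 * a1 + x2 * a2 + x3 * a3) * (x1 * b1 + x2 * b2 + x3 * b3)).
 by rewrite ha mul0r subr0.
by ring.
Qed.

Lemma dot_grad_rot f k (x : E) : C1s f -> x != 0 -> dot (grad f x) (rot k x) = Xd k f x.
Proof.
move=> cf x0; rewrite /Xd (tderiv_lin (rot k x) cf x0) dotE !mxE.
by move: (tderiv f x (bvec R 0)) (tderiv f x (bvec R 1)) (tderiv f x (bvec R o2)) (rot k x 0 0) (rot k x 0 1) (rot k x 0 o2) => *; ring.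
Qed.

Definition wgk (u : E -> R) (k : 'I_3) (p : R * R) : R := dot (wgrad u p^S) (rot k p^S).

Lemma wgradP (u : E -> R) : H1 u -> is_wgrad u (wgrad u).
Proof. by move=> [_ _ [G hG]]; exact: (@getPex _ [set G | is_wgrad u G] (ex_intro _ G hG)). Qed.

(** The dictionary between the weak gradient and its components along the rotation fields. [wgrad]
    is tangent almost everywhere, so the pointwise frame identity becomes an identity of
    integrals. *)
Lemma H1_wgrad (u : E -> R) : H1 u ->
 [/\ wH1 (fun p => u p^S) (wgk u), pL1 (fun p => u p^S ^+ 2),
   pL1 (fun p => dot (wgrad u p^S) (wgrad u p^S)),
   \I_p (\sum_k wgk u k p ^+ 2) = \I_p (dot (wgrad u p^S) (wgrad u p^S)) &
   forall w, C1s w -> \I_p (dot (wgrad u p^S) (grad w p^S)) = \I_p (\sum_k wgk u k p * Xd k w p^S)].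
Proof.
move=> hu; have [g1 g2 g3 g4] := wgradP hu; have [h1 h2 _] := hu.
have mu : pmeas (fun p => u p^S) by exact: h1.
have mu2 : pmeas (fun p => u p^S ^+ 2) by apply: (pmeas_ct (f := fun x : R => x ^+ 2)) mu; exact: exprn_continuous.
have iu2 : pL1 (fun p => u p^S ^+ 2) by split.
have iu : pL1 (fun p => u p^S).
 apply: pL1_le mu _ (pL1D (pL1C 1) iu2) => p _; rewrite -[_ ^+ 2]real_normK ?num_real //.
 by have := normr_ge0 (u p^S); move: `|_| => z z0; nra.
have mG i : pmeas (fun p => wgrad u p^S 0 i) by exact: g1.
have mdot (b : R * R -> E) : (forall i, pmeas (fun p => b p 0 i)) -> pmeas (fun p => dot (wgrad u p^S) (b p)).
 by move=> mb; apply: pmeas_sum => i; exact: pmeasM.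
have mk k : pmeas (wgk u k).
 by apply: mdot => i; apply: cont2_pmeas; exact: Alg_cont2 (Alg_rot k i).
have iG2 : pL1 (fun p => dot (wgrad u p^S) (wgrad u p^S)) by split => //; apply: mdot => i.
have tG : pae (fun p => dot p^S (wgrad u p^S) = 0) by exact: g3.
have mk2 k : pmeas (fun p => wgk u k p ^+ 2) by apply: (pmeas_ct (f := fun x : R => x ^+ 2)) (mk k); exact: exprn_continuous.
have le2 (x a : E) k : sphere x -> dot a (rot k x) ^+ 2 <= dot a a.
 move=> hx; apply: le_trans (dot_CS _ _) _.
 by rewrite ler_piMr ?dot_ge0 ?rot_norm_le1.
have ik2 k : pL1 (fun p => wgk u k p ^+ 2).
 apply: pL1_le (mk2 k) _ iG2 => p _; rewrite ger0_norm ?sqr_ge0 //; apply: le2; exact: sphS.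
have ik k : pL1 (wgk u k).
 apply: pL1_le (mk k) _ (pL1D (pL1C 1) (ik2 k)) => p _; rewrite -[_ ^+ 2]real_normK ?num_real //.
 by have := normr_ge0 (wgk u k p); move: `|_| => z z0; nra.
split=> //.
- split=> // k f af.
 have sV : smooth_vec (fun y => f y *: rot k y).
  move=> i; apply: Alg_smooth; apply: (Alg_ext (AlgM af (Alg_rot k i))) => y _; by rewrite [RHS]mxE.
 have tV x : sphere x -> tangent x (f x *: rot k x) by move=> _; rewrite /tangent dotZr rot_tangent mulr0.
 have h := g4 _ sV tV.
 transitivity (sint (fun x => dot (wgrad u x) (f x *: rot k x))).
  by eqp; rewrite dotZr mulrC.
 rewrite h; congr (- _); eqp; congr (_ * _).
 by apply: sdiv_rot => //; exact: sphS.
- apply: ae_eq_pint; [exact: pmeas_sum|exact: iG2.1|].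
 by apply: paeS tG => p _ h; rewrite (dot_sum_rot _ (sphS p) h); apply: eq_bigr => k _; rewrite expr2.
- move=> w cw; apply: ae_eq_pint.
 + apply: mdot => i; apply: (eq_pmeas (F := fun p => tderiv w p^S (bvec R i))); first by move=> p _; rewrite mxE.
  by apply: cont2_pmeas; exact: C1s_tderiv_cont2.
 + by apply: pmeas_sum => k; apply: pmeasM => //; apply: cont2_pmeas; exact: Xd_cont2.
 + apply: paeS tG => p _ h; rewrite (dot_sum_rot _ (sphS p) h); apply: eq_bigr => k _.
  by rewrite (dot_grad_rot _ cw (sph_neq0 p)).
Qed.

(** * Spinors in real coordinates *)

Lemma sum4 (F : V4) :
 \sum_i F i = F s00 + F s01 + F s10 + F s11.
Proof.
have -> : \sum_i F i = \sum_a \sum_b F (a, b) by rewrite pair_bigA; apply: eq_bigr => -[].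
by rewrite !big_bool /=; ring.
Qed.

(** In an index of type [ix], the first boolean selects the spinor component, the second its real
    ([false]) or imaginary ([true]) part. *)
Definition J0 (v : V4) : V4 := fun i => match i with
 | s00 => v s11 | s01 => - v s10
 | s10 => v s01 | s11 => - v s00 end.

Definition J1 (v : V4) : V4 := fun i => match i with
 | s00 => - v s10 | s01 => - v s11
 | s10 => v s00 | s11 => v s01 end.

Definition J2 (v : V4) : V4 := fun i => match i with
 | s00 => v s01 | s01 => - v s00
 | s10 => - v s11 | s11 => v s10 end.

(* [Jk k] is multiplication by [-i sigma_k] in the real components. *)
Definition Jk (k : 'I_3) (v : V4) : V4 := if k == 0 then J0 v else if k == 1 then J1 v else J2 v.

(** Multiplication by [i] in the real components. *)
Definition Ic (v : V4) : V4 := fun i => match i with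
 | (a, false) => - v (a, true) | (a, true) => v (a, false) end.

Lemma JkE (v : V4) : (Jk 0 v = J0 v) * (Jk 1 v = J1 v) * (Jk o2 v = J2 v).
Proof. by rewrite /Jk o2_neq0 o2_neq1. Qed.

Definition sg (X : E) (v : V4) : V4 := fun i => match i with
 | s00 => X 0 o2 * v s00 + X 0 0 * v s10 + X 0 1 * v s11
 | s01 => X 0 o2 * v s01 + X 0 0 * v s11 - X 0 1 * v s10
 | s10 => X 0 0 * v s00 - X 0 1 * v s01 - X 0 o2 * v s10
 | s11 => X 0 0 * v s01 + X 0 1 * v s00 - X 0 o2 * v s11 end.

Definition ip (v w : V4) : R := \sum_i v i * w i.

Lemma ipE v w : ip v w = v s00 * w s00 + v s01 * w s01
 + v s10 * w s10 + v s11 * w s11.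
Proof. exact: sum4. Qed.

Definition cidx (s : bool) : 'I_2 := if s then 1 else 0.

Local Notation C := R[i].

Definition comps (s : 'cV[C]_2) : V4 := fun i =>
 if i.2 then complex.Im (s (cidx i.1) 0) else complex.Re (s (cidx i.1) 0).

Definition mkC (v : V4) : 'cV[C]_2 := \col_a (if a == 0 then v s00 +i* v s01 else v s10 +i* v s11).

Lemma compsK s : mkC (comps s) = s.
Proof.
apply/matrixP => i j; rewrite ord1 !mxE /comps /=.
have [-> | ->] : i = 0 \/ i = 1 by case: i => -[|[|//]] hi; [left|right]; apply: val_inj.
- by case: (s 0 0).
- by rewrite /=; case: (s 1 0).
Qed.

Lemma mkCK v : comps (mkC v) = v.
Proof. by apply/funext => -[[] []]; rewrite /comps !mxE. Qed.

Lemma comps_inj : injective comps.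
Proof. exact: can_inj compsK. Qed.

Lemma sum2 (V : nmodType) (F : 'I_2 -> V) : \sum_a F a = F 0 + F 1.
Proof. by rewrite !big_ord_recl big_ord0 addr0; congr (_ + F _); apply: val_inj. Qed.

Lemma comps_pauli X s : comps (pauli X *m s) = sg X (comps s).
Proof.
apply/funext => -[a b]; rewrite /comps /= !mxE !sum2 /pauli !mxE /= o2E.
case: a => /=; case: (s 0 0) => x1 y1; case: (s 1 0) => x2 y2; case: b; simpc => /=; ring.
Qed.

Lemma comps_add s t : comps (s + t) = (fun i => comps s i + comps t i).
Proof. by apply/funext => -[a []]; rewrite /comps /= mxE; case: (s _ 0) => ? ?; case: (t _ 0). Qed.

Lemma comps_sum (I : Type) (r : seq I) (F : I -> 'cV[C]_2) : comps (\sum_(j <- r) F j) = (fun i => \sum_(j <- r) comps (F j) i).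
Proof.
elim: r => [|j r ih]; apply/funext => i; first by rewrite !big_nil /comps !mxE; case: ifP.
by rewrite !big_cons comps_add ih.
Qed.

Lemma comps_scale (c : R) s : comps (c%:C *: s) = (fun i => c * comps s i).
Proof. by apply/funext => -[a []]; rewrite /comps /= mxE; case: (s _ 0) => ? ? /=; ring. Qed.

Lemma sqnormE s : sqnorm s = ip (comps s) (comps s).
Proof. by rewrite /sqnorm sum2 ipE /comps /sqC /=; ring. Qed.

Lemma hdotE s t : hdot s t = ip (comps s) (comps t) +i* ip (comps s) (Ic (comps t)).
Proof.
have ce (z : C) : z^* = complex.Re z +i* (- complex.Im z) by case: z.
rewrite /hdot sum2 !ce !ipE /comps /Ic /=.
by case: (s 0 0) => ? ?; case: (s 1 0) => ? ?; case: (t 0 0) => ? ?; case: (t 1 0) => ? ?; apply/eqP; rewrite eq_complex /=; apply/andP; split; apply/eqP; ring.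
Qed.

Definition fcomp (psi : E -> 'cV[C]_2) (i : bool * bool) (x : E) : R := comps (psi x) i.

(** This is [sigma . L] for the angular momentum [L = - i x cross nabla]; [1 + sigma . L] is the
    Dirac operator in the chosen trivialization. *)
Definition Tf (f : bool * bool -> E -> R) (i : bool * bool) (x : E) : R :=
 \sum_k Jk k (fun j => Xd k (f j) x) i.

Definition Df (f : bool * bool -> E -> R) (i : bool * bool) (x : E) : R := f i x + Tf f i x.

Lemma comps_sderiv psi x X : comps (sderiv psi x X) = (fun i => tderiv (fcomp psi i) x X).
Proof. by apply/funext => -[a []]; rewrite /comps !mxE. Qed.

Lemma sg_sg (X Y : E) v i : sg X (sg Y v) i + sg Y (sg X v) i = 2 * dot X Y * v i.
Proof.
rewrite dotE; case: i => -[] [] /=;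
by move: (X 0 0) (X 0 1) (X 0 o2) (Y 0 0) (Y 0 1) (Y 0 o2) => *; ring.
Qed.

Lemma sgDZ (X : E) (a : R) v w i : sg X (fun j => v j + a * w j) i = sg X v i + a * sg X w i.
Proof. by case: i => -[] [] /=; move: (X 0 0) (X 0 1) (X 0 o2) => *; ring. Qed.

Lemma sgZ (X : E) (c : R) (v : V4) i : sg X (fun j => c * v j) i = c * sg X v i.
Proof. by case: i => -[] [] /=; move: (X 0 0) (X 0 1) (X 0 o2) => *; ring. Qed.

Lemma sg_sphere (x : E) (v : V4) : sphere x -> sg x (sg x v) = v.
Proof. by move=> hx; apply/funext => i; have := sg_sg x x v i; rewrite hx; lra. Qed.

Lemma halfC : (2^-1 : C) = (2^-1)%:C.
Proof. by rewrite rmorphV ?unitfE ?pnatr_eq0 // rmorph_nat. Qed.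

(** Two Clifford products by a tangent [X] give [- |X|^2], so the term [- 1/2 X . psi] of the
    connection contributes half the sum of the squared lengths of the projected basis vectors, which
    is 1. In the derivative part, [sigma(e_k) sigma(x)] splits into a scalar, killed because the
    extension is radially constant, and a cross product, which yields [T]. *)
Lemma comps_dirac psi (x : E) : (forall i, C1s (fcomp psi i)) -> sphere x ->
 comps (dirac_op psi x) = (fun i => Df (fcomp psi) i x).
Proof.
move=> cf hx; have x0 := sphere0 hx.
pose d k : V4 := fun i => tderiv (fcomp psi i) x (bvec R k).
have d0 i : x 0 0 * d 0 i + x 0 1 * d 1 i + x 0 o2 * d o2 i = 0.
 by rewrite -(tderiv_lin x (cf i) x0) tderiv_radial.
have dX k i : tderiv (fcomp psi i) x (tproj x (bvec R k)) = d k i.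
 rewrite /tproj (_ : bvec R k - dot x (bvec R k) *: x = 1 *: bvec R k + (- dot x (bvec R k)) *: x); last by rewrite scale1r scaleNr.
 by rewrite (tderiv_lin2 _ _ _ _ (cf i) x0) (tderiv_radial _ x0) mulr0 addr0 mul1r.
have sxx v := sg_sphere v hx.
have hsg X v (j : bool * bool) : dot x X = 0 -> sg X (sg x (sg X (sg x v))) j = - (dot X X * v j).
 move=> hX.
 have e1 : sg x (sg X (sg x v)) = (fun j => (-1) * sg X v j).
  by apply/funext => l; have := sg_sg x X (sg x v) l; rewrite hX sxx; lra.
 by rewrite e1 sgZ; have := sg_sg X X v j; lra.
have hT k : dot x (tproj x (bvec R k)) = 0.
 by rewrite /tproj -scaleN1r !dotDr !dotZr hx; ring.
have e k : comps (cliff x (tproj x (bvec R k)) *m nabla psi x (tproj x (bvec R k))) =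
 (fun i => sg (tproj x (bvec R k)) (sg x (d k)) i + 2^-1 * (dot (tproj x (bvec R k)) (tproj x (bvec R k)) * fcomp psi i x)).
 have m (X : E) s : cliff x X *m s = pauli X *m (pauli x *m s) by rewrite /cliff mulmxA.
 set X := tproj x (bvec R k).
 have n1 : comps (nabla psi x X) = (fun i => d k i + (- 2^-1) * sg X (sg x (comps (psi x))) i).
  rewrite /nabla m halfC -scaleNr -rmorphN comps_add comps_scale comps_sderiv !comps_pauli.
  by apply/funext => j; rewrite dX.
 rewrite m !comps_pauli n1; apply/funext => i.
 have n2 : sg x (fun i => d k i + (- 2^-1) * sg X (sg x (comps (psi x))) i) = (fun i => sg x (d k) i + (- 2^-1) * sg x (sg X (sg x (comps (psi x)))) i).
  by apply/funext => j; rewrite sgDZ.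
 by rewrite n2 sgDZ hsg ?hT // mulrN mulNr opprK.
have sgl v j (k : 'I_3) : sg (tproj x (bvec R k)) v j = sg (bvec R k) v j - x 0 k * sg x v j.
 have c i : tproj x (bvec R k) 0 i = bvec R k 0 i - x 0 k * x 0 i by rewrite /tproj dot_bvec !mxE.
 by case: j => -[] [] /=; rewrite !c; move: (bvec R k 0 0) (bvec R k 0 1) (bvec R k 0 o2) (x 0 k) (x 0 0) (x 0 1) (x 0 o2) => *; ring.
have n2 : \sum_k dot (tproj x (bvec R k)) (tproj x (bvec R k)) = 2.
 have q k : dot (tproj x (bvec R k)) (tproj x (bvec R k)) = 1 - x 0 k ^+ 2.
  by rewrite /tproj -scaleN1r !dotDl !dotDr !dotZl !dotZr [dot (bvec R k) x]dotC !dot_bvec bvecE eqxx hx /=; ring.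
 by rewrite (eq_bigr _ (fun k _ => q k)) sum3; have := hx; rewrite /sphere /= dotE; lra.
rewrite /dirac_op comps_sum; apply/funext => i.
rewrite (eq_bigr (fun k => sg (bvec R k) (sg x (d k)) i - x 0 k * d k i + 2^-1 * (dot (tproj x (bvec R k)) (tproj x (bvec R k)) * fcomp psi i x))); last first.
 by move=> k _; rewrite e sgl sxx.
rewrite big_split /= -mulr_sumr -mulr_suml n2 mulrA mulVf ?pnatr_eq0 // mul1r addrC; congr (_ + _).
rewrite /Tf !sum3 !JkE.
have [X0 X1 X2] : [/\ forall j, Xd 0 (fcomp psi j) x = x 0 1 * d o2 j - x 0 o2 * d 1 j,
 forall j, Xd 1 (fcomp psi j) x = x 0 o2 * d 0 j - x 0 0 * d o2 j &
 forall j, Xd o2 (fcomp psi j) x = x 0 0 * d 1 j - x 0 1 * d 0 j].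
 by split=> j; case: (XdE (cf j) x0) => h0 h1 h2; [exact: h0|exact: h1|exact: h2].
have := d0 i; case: i {e} => -[] [] h; rewrite /J0 /J1 /J2 !X0 !X1 !X2 /sg /= !b3 /=; move: h;
move: (d 0) (d 1) (d o2) => a b c;
move: (a s00) (a s01) (a s10) (a s11)
(b s00) (b s01) (b s10) (b s11)
(c s00) (c s01) (c s10) (c s11) (x 0 0) (x 0 1) (x 0 o2) => *; lra.
Qed.

Opaque Xd tderiv pint.

(** Each [Jk] is a signed permutation of the four real components, with involution [jp] and sign
    [js]. In this form sums over components can be reindexed. *)
Definition jp (k : 'I_3) (i : ix) : ix := if k == 0 then (~~ i.1, ~~ i.2) else if k == 1 then (~~ i.1, i.2) else (i.1, ~~ i.2).

Definition js (k : 'I_3) (i : ix) : R := if k == 0 then (-1) ^+ i.2 else if k == 1 then - (-1) ^+ i.1 else (-1) ^+ (i.1 (+) i.2).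

Lemma JkS k (v : V4) i : Jk k v i = js k i * v (jp k i).
Proof.
by case: (ord3P k) => ->; rewrite JkE /js /jp ?o2_neq0 ?o2_neq1 /=; case: i => -[] [] /=; rewrite ?expr0 ?expr1 ?opprK ?mul1r ?mulN1r.
Qed.

Lemma jpK k : involutive (jp k).
Proof. by case: (ord3P k) => -> -[[] []]; rewrite /jp /= ?o2_neq0 ?o2_neq1. Qed.

Lemma jsN k i : js k (jp k i) = - js k i.
Proof. by case: (ord3P k) => ->; case: i => -[] []; rewrite /js /jp ?o2_neq0 ?o2_neq1 /= ?expr0 ?expr1 ?opprK. Qed.

Lemma js_sqr k i : js k i * js k i = 1.
Proof. by case: (ord3P k) => ->; case: i => -[] []; rewrite /js ?o2_neq0 ?o2_neq1 /= ?expr0 ?expr1 ?mulrNN ?opprK ?mulr1. Qed.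

Lemma TfE (f : spf) i x : Tf f i x = \sum_k js k i * Xd k (f (jp k i)) x.
Proof. by apply: eq_bigr => k _; rewrite JkS. Qed.

Lemma Alg_Tf (f : spf) i : (forall j, Alg (f j)) -> Alg (Tf f i).
Proof.
move=> af; apply: (@Alg_ext (fun x => \sum_k js k i * Xd k (f (jp k i)) x)); last by move=> x _; rewrite TfE.
by apply: Alg_sum => k; exact: AlgM (AlgC _) (Alg_Xd k (af _)).
Qed.

Lemma Alg_Df (f : spf) i : (forall j, Alg (f j)) -> Alg (Df f i).
Proof. by move=> af; exact: AlgD (af i) (Alg_Tf i af). Qed.

Lemma Xd_Tf j (f : spf) i x : (forall j, Alg (f j)) -> sphere x ->
 Xd j (Tf f i) x = \sum_k js k i * Xd j (Xd k (f (jp k i))) x.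
Proof.
move=> af hx; rewrite (@Xd_ext j _ (fun x => \sum_k js k i * Xd k (f (jp k i)) x) x) //; last by move=> y _; rewrite TfE.
by rewrite (@Xd_sum _ _ (fun k => js k i) (fun k y => Xd k (f (jp k i)) y)) // => k; exact: Alg_Xd.
Qed.

(** The defect in the commutation relation [[X_k, X_l] = - X_m] of the rotation fields, for cyclic
    indices. *)
Definition Cm (k l m : 'I_3) (f : E -> R) (x : E) : R := Xd k (Xd l f) x - Xd l (Xd k f) x + Xd m f x.

Lemma Xd_XdM k l f g (x : E) : Alg f -> Alg g -> sphere x ->
 Xd k (Xd l (fun y => f y * g y)) x = Xd k (Xd l f) x * g x + Xd l f x * Xd k g x + Xd k f x * Xd l g x + f x * Xd k (Xd l g) x.
Proof.
move=> af ag hx; have aXf := Alg_Xd l af; have aXg := Alg_Xd l ag.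
rewrite (@Xd_ext k _ (fun y => Xd l f y * g y + f y * Xd l g y) x) //; last first.
 by move=> y hy; rewrite XdM //; exact: AlgC1.
rewrite XdD; [|exact: AlgC1 (AlgM _ _)|exact: AlgC1 (AlgM _ _)|exact: sphere0].
rewrite (XdM k (AlgC1 aXf) (AlgC1 ag) hx) (XdM k (AlgC1 af) (AlgC1 aXg) hx).
exact: addrA.
Qed.

Lemma CmM k l m f g (x : E) : Alg f -> Alg g -> sphere x ->
 Cm k l m (fun y => f y * g y) x = Cm k l m f x * g x + f x * Cm k l m g x.
Proof.
move=> af ag hx; rewrite /Cm !Xd_XdM // (XdM m (AlgC1 af) (AlgC1 ag) hx).
move: (Xd k (Xd l f) x) (Xd l (Xd k f) x) (Xd k (Xd l g) x) (Xd l (Xd k g) x) (Xd k f x) (Xd l f x) (Xd m f x) (Xd k g x) (Xd l g x) (Xd m g x) (f x) (g x) => *; ring.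
Qed.

Lemma Cm_ext k l m f g (x : E) : (forall x, sphere x -> f x = g x) -> sphere x -> Cm k l m f x = Cm k l m g x.
Proof.
move=> h hx; have e j y : sphere y -> Xd j f y = Xd j g y by move=> hy; exact: Xd_ext.
by rewrite /Cm (e m x hx) (Xd_ext k (e l) hx) (Xd_ext l (e k) hx).
Qed.

Lemma Cm_cst k l m c (x : E) : sphere x -> Cm k l m (fun _ => c) x = 0.
Proof.
move=> hx; have e j y : sphere y -> Xd j (fun _ => c) y = (fun _ => 0) y by move=> hy; rewrite Xd_cst.
by rewrite /Cm (Xd_ext k (e l) hx) (Xd_ext l (e k) hx) !Xd_cst; ring.
Qed.

Lemma Cm_add k l m f g (x : E) : Alg f -> Alg g -> sphere x -> Cm k l m (fun y => f y + g y) x = Cm k l m f x + Cm k l m g x.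
Proof.
move=> af ag hx; have e j y : sphere y -> Xd j (fun y => f y + g y) y = Xd j f y + Xd j g y.
 by move=> hy; apply: XdD; [exact: AlgC1|exact: AlgC1|exact: sphere0].
have e2 i j : Xd i (Xd j (fun y => f y + g y)) x = Xd i (Xd j f) x + Xd i (Xd j g) x.
 rewrite (Xd_ext i (e j) hx) XdD //; [exact: AlgC1 (Alg_Xd _ _)|exact: AlgC1 (Alg_Xd _ _)|exact: sphere0].
rewrite /Cm !e2 (e m x hx).
by move: (Xd k (Xd l f) x) (Xd l (Xd k f) x) (Xd m f x) (Xd k (Xd l g) x) (Xd l (Xd k g) x) (Xd m g x) => *; ring.
Qed.

(** By [CmM] the defect is a derivation, so on [Alg] it vanishes once it does on the coordinates.
    For inverses and square roots, apply the product rule to [f * f^-1 = 1] and to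
    [sqrt f * sqrt f = f]. *)
Lemma Cm0 k l m : (forall i (x : E), sphere x -> Cm k l m (fun y => y 0 i) x = 0) ->
 forall f, Alg f -> forall x, sphere x -> Cm k l m f x = 0.
Proof.
move=> hc f; elim=> {f}.
- by move=> c x hx; exact: Cm_cst.
- exact: hc.
- by move=> f g af hf ag hg x hx; rewrite Cm_add // hf // hg // addr0.
- by move=> f g af hf ag hg x hx; rewrite CmM // hf // hg // mul0r mulr0 addr0.
- move=> f af hf f0 x hx; have ai := AlgV af f0.
 have h : Cm k l m (fun y => f y * (f y)^-1) x = 0.
  by rewrite (@Cm_ext k l m _ (fun _ => 1)) ?Cm_cst // => y hy; rewrite mulfV // f0.
 rewrite CmM // hf // mul0r add0r in h; move/eqP: h; rewrite mulf_eq0 => /orP[/eqP h|/eqP //].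
 by have := f0 x hx; rewrite h eqxx.
- move=> f af hf f0 x hx; have ai := Alg_sqr af f0.
 have h : Cm k l m (fun y => Num.sqrt (f y) * Num.sqrt (f y)) x = 0.
  rewrite (@Cm_ext k l m _ f) ?hf // => y hy; rewrite -expr2 sqr_sqrtr //; exact: ltW (f0 y hy).
 rewrite CmM // mulrC -mulr2n -mulr_natl in h; move/eqP: h; rewrite !mulf_eq0 pnatr_eq0 /= => /orP[/eqP h|/eqP //].
 by have := f0 x hx; rewrite -sqrtr_gt0 h ltxx.
- by move=> f g af hf e x hx; rewrite -(Cm_ext k l m e hx) hf.
Qed.

Lemma Xd_Xd_coord k l i (x : E) : sphere x -> Xd k (Xd l (fun y => y 0 i)) x = rot l (rot k x) 0 i.
Proof.
move=> hx; rewrite (Xd_ext k (fun y hy => Xd_coord l i hy) hx).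
have rN j : Xd k (fun y : E => - y 0 j) x = - rot k x 0 j by rewrite XdN ?Xd_coord //; exact: AlgC1 (AlgX _).
by case: (ord3P l) => ->; case: (ord3P i) => ->; rewrite !rotE;
[rewrite (@Xd_ext k _ (fun _ => 0)) ?Xd_cst // => y _; rewrite rotE
|rewrite (@Xd_ext k _ (fun y => - y 0 o2)) ?rN // => y _; rewrite rotE
|rewrite (@Xd_ext k _ (fun y => y 0 1)) ?Xd_coord // => y _; rewrite rotE
|rewrite (@Xd_ext k _ (fun y => y 0 o2)) ?Xd_coord // => y _; rewrite rotE
|rewrite (@Xd_ext k _ (fun _ => 0)) ?Xd_cst // => y _; rewrite rotE
|rewrite (@Xd_ext k _ (fun y => - y 0 0)) ?rN // => y _; rewrite rotE
|rewrite (@Xd_ext k _ (fun y => - y 0 1)) ?rN // => y _; rewrite rotE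
|rewrite (@Xd_ext k _ (fun y => y 0 0)) ?Xd_coord // => y _; rewrite rotE
|rewrite (@Xd_ext k _ (fun _ => 0)) ?Xd_cst // => y _; rewrite rotE].
Qed.

Lemma Xd_comm f (x : E) : Alg f -> sphere x ->
 [/\ Cm 0 1 o2 f x = 0, Cm 1 o2 0 f x = 0 & Cm o2 0 1 f x = 0].
Proof.
move=> af hx; split; apply: Cm0 => // i {}x {}hx; rewrite /Cm !Xd_Xd_coord // Xd_coord //;
 case: (ord3P i) => ->; rewrite !rotE; ring.
Qed.

Lemma js_jp :
 [/\ forall j, js 0 j = (-1) ^+ j.2, forall j, js 1 j = - (-1) ^+ j.1, forall j, js o2 j = (-1) ^+ (j.1 (+) j.2),
 forall j, jp 0 j = (~~ j.1, ~~ j.2) & (forall j, jp 1 j = (~~ j.1, j.2)) /\ (forall j, jp o2 j = (j.1, ~~ j.2))].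
Proof. by rewrite /js /jp !o2_neq0 !o2_neq1. Qed.

Lemma Tf_Tf_arith (D : 'I_3 -> 'I_3 -> ix -> R) (d : 'I_3 -> ix -> R) i :
 (forall j, D 0 1 j - D 1 0 j + d o2 j = 0) -> (forall j, D 1 o2 j - D o2 1 j + d 0 j = 0) ->
 (forall j, D o2 0 j - D 0 o2 j + d 1 j = 0) ->
 js 0 i * (js 0 (jp 0 i) * D 0 0 (jp 0 (jp 0 i)) + js 1 (jp 0 i) * D 0 1 (jp 1 (jp 0 i)) + js o2 (jp 0 i) * D 0 o2 (jp o2 (jp 0 i))) +
 js 1 i * (js 0 (jp 1 i) * D 1 0 (jp 0 (jp 1 i)) + js 1 (jp 1 i) * D 1 1 (jp 1 (jp 1 i)) + js o2 (jp 1 i) * D 1 o2 (jp o2 (jp 1 i))) +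
 js o2 i * (js 0 (jp o2 i) * D o2 0 (jp 0 (jp o2 i)) + js 1 (jp o2 i) * D o2 1 (jp 1 (jp o2 i)) + js o2 (jp o2 i) * D o2 o2 (jp o2 (jp o2 i)))
 = - (D 0 0 i + D 1 1 i + D o2 o2 i) - (js 0 i * d 0 (jp 0 i) + js 1 i * d 1 (jp 1 i) + js o2 i * d o2 (jp o2 i)).
Proof.
have [s0 s1 s2 p0 [p1 p2]] := js_jp; rewrite !s0 !s1 !s2 !p0 !p1 !p2 /=.
move: D d => D d h1 h2 h3.
have g1 := h1 (i.1, ~~ i.2); have g2 := h2 (~~ i.1, ~~ i.2); have g3 := h3 (~~ i.1, i.2).
move: g1 g2 g3 {h1 h2 h3}; case: i => -[] [] /=; rewrite ?expr0 ?expr1;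
move: (D 0 0) (D 0 1) (D 0 o2) (D 1 0) (D 1 1) (D 1 o2) (D o2 0) (D o2 1) (D o2 o2) (d 0) (d 1) (d o2) => a b c a' b' c' a'' b'' c'' u v w; lra.
Qed.

(** Skew symmetry of the matrices [Jk] in summed form, from [js k (jp k i) = - js k i]. *)
Lemma swap_jp (P Q : ix -> 'I_3 -> R) : (forall i k, Q (jp k i) k = P i k) ->
 \sum_i \sum_k js k i * P i k = \sum_i - \sum_k js k i * Q i k.
Proof.
move=> h; transitivity (\sum_k \sum_i js k i * P i k); first exact: exchange_big.
transitivity (- \sum_k \sum_i js k i * Q i k); last first.
 by rewrite sumrN; congr (- _); exact: exchange_big.
rewrite -sumrN; apply: eq_bigr => k _.
rewrite (reindex_inj (inv_inj (@jpK k))) /= -sumrN; apply: eq_bigr => i _.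
by rewrite jsN -h jpK mulNr.
Qed.

(** The relation [T (T + 1) = - Delta]: products [J_k J_l] with [k != l] are antisymmetric and see
    only the commutators of the fields. On harmonics of degree [l] it leaves the eigenvalues [l] and
    [- l - 1] of [T]. *)
Lemma Tf_Tf (f : spf) i (x : E) : (forall j, Alg (f j)) -> sphere x ->
 Tf (Tf f) i x = - \sum_k Xd k (Xd k (f i)) x - Tf f i x.
Proof.
move=> af hx.
pose D k l j := Xd k (Xd l (f j)) x; pose d k j := Xd k (f j) x.
have e1 k j : Xd k (Tf f j) x = js 0 j * D k 0 (jp 0 j) + js 1 j * D k 1 (jp 1 j) + js o2 j * D k o2 (jp o2 j).
 by rewrite (Xd_Tf k j af hx) sum3.
have e2 j : Tf f j x = js 0 j * d 0 (jp 0 j) + js 1 j * d 1 (jp 1 j) + js o2 j * d o2 (jp o2 j).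
 by rewrite TfE sum3.
have e3 : \sum_k Xd k (Xd k (f i)) x = D 0 0 i + D 1 1 i + D o2 o2 i by rewrite sum3.
have h1 j : D 0 1 j - D 1 0 j + d o2 j = 0 by have [h _ _] := Xd_comm (af j) hx.
have h2 j : D 1 o2 j - D o2 1 j + d 0 j = 0 by have [_ h _] := Xd_comm (af j) hx.
have h3 j : D o2 0 j - D 0 o2 j + d 1 j = 0 by have [_ _ h] := Xd_comm (af j) hx.
rewrite TfE sum3 !e1 e2 e3.
move: D d h1 h2 h3 {e1 e2 e3 af hx} => D d h1 h2 h3; exact: Tf_Tf_arith.
Qed.

Lemma L1MAlg (F : R * R -> R) (g : E -> R) : pL1 F -> Alg g -> pL1 (fun p => F p * g p^S).
Proof. by move=> iF ag; apply: (eqL1 _ (L1Mct (Alg_cont2 ag) iF)) => p _; exact: mulrC. Qed.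

(* Weak formulation of [D Psi = Theta], with the derivatives moved to the test function. *)
Definition wD (Psi Theta : ppf) : Prop :=
 [/\ forall i, pL1 (Psi i), forall i, pL1 (Theta i) &
   forall i f, Alg f -> \I_p (Theta i p * f p^S) =
    \I_p (Psi i p * f p^S) - \sum_k js k i * \I_p (Psi (jp k i) p * Xd k f p^S)].

(** The matrices are constant and the kernel is rotation invariant, so [D] commutes with
    mollification. *)
Lemma wD_conv N Psi Theta i (x : E) : wD Psi Theta -> sphere x ->
 Df (fun j => conv N (Psi j)) i x = conv N (Theta i) x.
Proof.
move=> [h1 h2 h3] hx; have aK := Kern_Algr x (Kern_molk N).
rewrite /Df TfE.
have -> : conv N (Theta i) x = \I_p (Theta i p * molk N x p^S) by eqp; exact: mulrC.
rewrite h3 // -sumrN; congr (_ + _); first by eqp; exact: mulrC.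
apply: eq_bigr => k _; rewrite -mulrN; congr (_ * _).
rewrite (Xd_kint k (Kern_molk N) (h1 _) hx) -pintN; last exact: L1MAlg (h1 _) (Alg_Xd k aK).
eqq; have hq := sphS q.
have -> : Xd k (molk N ^~ q^S) x = N.+1%:R / (4 * pi) * Xd k (zon N ^~ q^S) x.
 by rewrite -(XdZ k _ (AlgC1 (Kern_Algl _ (Kern_zon N))) hx).
have -> : Xd k (molk N x) q^S = N.+1%:R / (4 * pi) * Xd k (zon N x) q^S.
 by rewrite -(XdZ k _ (AlgC1 (Kern_Algr x (Kern_zon N))) hq).
by rewrite Xd_zonl // mulrN mulNr [Psi _ q * _]mulrC.
Qed.

Lemma wD_test Psi Theta (phi : spf) : wD Psi Theta -> (forall i, Alg (phi i)) ->
 \I_p (ip (Psi ^~ p) (fun i => Df phi i p^S)) = \I_p (ip (Theta ^~ p) (fun i => phi i p^S)).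
Proof.
move=> [h1 h2 h3] aphi.
have iA i (F : ppf) g : (forall j, pL1 (F j)) -> Alg g -> pL1 (fun p => F i p * g p^S) by move=> hF ag; exact: L1MAlg.
transitivity (\sum_i \I_p (Psi i p * Df phi i p^S)).
 by rewrite -pintS // => i; apply: L1MAlg => //; exact: Alg_Df.
transitivity (\sum_i \I_p (Theta i p * phi i p^S)); last first.
 by rewrite -pintS // => i; exact: L1MAlg.
have e i : \I_p (Psi i p * Df phi i p^S) = \I_p (Psi i p * phi i p^S) + \sum_k js k i * \I_p (Psi i p * Xd k (phi (jp k i)) p^S).
 have ik k : pL1 (fun p => Psi i p * Xd k (phi (jp k i)) p^S) by apply: L1MAlg => //; exact: Alg_Xd.
 transitivity (\I_p (Psi i p * phi i p^S + \sum_k js k i * (Psi i p * Xd k (phi (jp k i)) p^S))).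
  by eqp; rewrite /Df TfE mulrDr mulr_sumr; congr (_ + _); apply: eq_bigr => k _; rewrite mulrCA.
 rewrite pintD; [|exact: L1MAlg|by apply: pL1S => k; exact: pL1Z].
 congr (_ + _); rewrite pintS; last by move=> k; exact: pL1Z.
 by apply: eq_bigr => k _; rewrite pintZ.
rewrite (eq_bigr _ (fun i _ => e i)) (eq_bigr _ (fun i _ => h3 i _ (aphi i))) !big_split /=; congr (_ + _).
pose P i k := \I_p (Psi i p * Xd k (phi (jp k i)) p^S).
pose Q i k := \I_p (Psi (jp k i) p * Xd k (phi i) p^S).
by apply: (@swap_jp P Q) => i k; rewrite /P /Q jpK.
Qed.

(** * Higher integrability *)

Lemma disc_le (a b c : R) : (forall t : R, 0 <= a * t ^+ 2 + 2 * b * t + c) -> b ^+ 2 <= a * c.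
Proof.
move=> h; have [a0|a0] := eqVneq a 0.
 subst a; have [-> | b0] := eqVneq b 0; first by rewrite mul0r expr0n.
 have := h (- (c + 1) / (2 * b)); rewrite mul0r add0r (_ : 2 * b * _ + c = -1); last by field.
 by rewrite lerNr oppr0 ler10.
have a1 : 0 <= a.
 rewrite leNgt; apply/negP => an.
 pose t := 1 + (`|b| + `|c|) * 2 / - a.
 have na : 0 < - a by rewrite oppr_gt0.
 have t1 : 1 <= t by rewrite lerDl; apply: divr_ge0; [apply: mulr_ge0 => //; exact: addr_ge0|exact: ltW].
 have e : a * t = a - (`|b| + `|c|) * 2 by rewrite /t; field.
 have := h t; rewrite (_ : a * t ^+ 2 + 2 * b * t + c = t * (a * t + 2 * b) + c); last by ring.
 rewrite e; have nb := ler_norm b; have nc := ler_norm c; have hb := normr_ge0 b; have hc := normr_ge0 c.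
 by rewrite leNgt => /negP; apply; nra.
have ap : 0 < a by rewrite lt_neqAle eq_sym a0.
have := h (- b / a); rewrite (_ : a * _ ^+ 2 + 2 * b * _ + c = (a * c - b ^+ 2) / a); last by field.
by rewrite pmulr_lge0 ?invr_gt0 // subr_ge0.
Qed.

Lemma pint_CS (P Q S : R * R -> R) : pL1 P -> pL1 Q -> pL1 S ->
 (forall p, dom p -> 0 <= P p) -> (forall p, dom p -> 0 <= S p) ->
 (forall p, dom p -> Q p ^+ 2 <= P p * S p) -> pint Q ^+ 2 <= pint P * pint S.
Proof.
move=> iP iQ iS P0 S0 h; apply: disc_le => t.
have i1 := pL1Z (t ^+ 2) iP; have i2 := pL1Z (2 * t) iQ.
have -> : pint P * t ^+ 2 + 2 * pint Q * t + pint S = \I_p (t ^+ 2 * P p + 2 * t * Q p + S p).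
 rewrite pintD //; last exact: pL1D.
 by rewrite pintD // !pintZ //; ring.
apply: pint_ge0 => p hp; have := h p hp; have := P0 p hp; have := S0 p hp.
move: (P p) (Q p) (S p) => a b c c0 a0 hb.
have [a1|a1] := eqVneq a 0.
 rewrite a1 in hb *; have b0 : b = 0 by apply/eqP; rewrite -sqrf_eq0 eq_le sqr_ge0 andbT -(mul0r c).
 by rewrite b0; lra.
have ap : 0 < a by rewrite lt_neqAle eq_sym a1.
have -> : t ^+ 2 * a + 2 * t * b + c = ((a * t + b) ^+ 2 + (a * c - b ^+ 2)) / a by field.
by apply: divr_ge0 => //; apply: addr_ge0; [exact: sqr_ge0|rewrite subr_ge0].
Qed.

Lemma pL1_prod (F G : R * R -> R) : pmeas F -> pmeas G -> pL1 (fun p => F p ^+ 2) -> pL1 (fun p => G p ^+ 2) ->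
 pL1 (fun p => F p * G p).
Proof.
move=> mF mG iF iG; apply: (@pL1_le _ (fun p => F p ^+ 2 + G p ^+ 2)); [exact: pmeasM| |exact: pL1D].
move=> p _; rewrite normrM -(real_normK (num_real (F p))) -(real_normK (num_real (G p))).
by move: `|F p| `|G p| => a b; nra.
Qed.

Definition dzon (k : 'I_3) (N : nat) (x y : E) : R := N%:R / 2 * zon N.-1 x y * dot y (rot k x).

Lemma Kern_dzon k N : Kern (@dzon k N).
Proof.
apply: Kern_mul; first exact: Kern_mul (Kern_cst _) (Kern_zon _).
exists 'I_3, (fun i x => rot k x 0 i), (fun i y => y 0 i); split=> [i|i|x y]; [exact: Alg_rot|exact: AlgX|].
by apply: eq_bigr => i _; exact: mulrC.
Qed.

Lemma Xd_zonl' k N (x y : E) : sphere x -> Xd k (zon N ^~ y) x = dzon k N x y.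
Proof. by move=> hx; rewrite (@Xd_ext k _ (zon N y) x) ?(Xd_zonr k N y hx) ?[zon _ y x]zonC // => z _; rewrite zonC. Qed.

Lemma Xd_kint_zon k N F (x : E) : pL1 F -> sphere x -> Xd k (kint (zon N) F) x = kint (dzon k N) F x.
Proof. by move=> iF hx; rewrite (Xd_kint k (Kern_zon N) iF hx); eqq; rewrite Xd_zonl'. Qed.

Lemma Xd_dzon k N (x y : E) : sphere x ->
 Xd k (dzon k N ^~ y) x = N%:R / 2 * (N.-1%:R / 2 * zon N.-2 x y * dot y (rot k x) ^+ 2 - zon N.-1 x y * dot (rot k y) (rot k x)).
Proof.
move=> hx; have a1 := Kern_Algl y (Kern_zon N.-1); have a2 := Alg_dotr (rot k y).
rewrite (@Xd_ext k _ (fun z => - (N%:R / 2) * (zon N.-1 z y * dot (rot k y) z)) x) //; last first.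
 by move=> z _; rewrite /dzon -[dot y _]opprK -rot_dot mulrN mulNr mulrA.
rewrite XdZ ?XdM ?Xd_zonl' ?Xd_dotr //; [|exact: AlgC1|exact: AlgC1|exact: AlgC1 (AlgM _ _)].
by rewrite /dzon rot_dot; move: (zon _ _ _) (zon _ _ _) (dot _ _) (dot _ _) => *; ring.
Qed.

Lemma Alg_dzon' k N (x : E) : Alg (fun y =>
 N%:R / 2 * (N.-1%:R / 2 * zon N.-2 x y * dot y (rot k x) ^+ 2 - zon N.-1 x y * dot (rot k y) (rot k x))).
Proof.
have a1 n := Kern_Algr x (Kern_zon n).
have a2 : Alg (fun y => dot y (rot k x)) by apply: (Alg_ext (Alg_dotr (rot k x))) => y _; exact: dotC.
have a3 : Alg (fun y => dot (rot k y) (rot k x)).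
 by apply: (Alg_ext (AlgN (Alg_dotr (rot k (rot k x))))) => y _; rewrite (rot_dot k y) dotC.
apply: AlgM; first exact: AlgC.
apply: AlgB; last exact: AlgM (a1 _) a3.
apply: AlgM; last exact: AlgXn 2 a2.
exact: AlgM (AlgC _) (a1 _).
Qed.

(** In [t = dot x y] the Laplacian is [(1 - t^2) f'' - 2 t f'], which maps [((1 + t) / 2)^N] into
    the span of itself and the previous power. The formula for the Green kernel and the spectral
    decomposition both rest on this two-term relation. *)
Lemma lap_zon N (x y : E) : sphere x -> sphere y ->
 \sum_k Xd k (dzon k N ^~ y) x = N%:R ^+ 2 * zon N.-1 x y - N%:R * N.+1%:R * zon N x y.
Proof.
move=> hx hy; rewrite (eq_bigr _ (fun k _ => Xd_dzon k N y hx)) -mulr_sumr big_split /= sumrN -!mulr_sumr.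
have -> : \sum_k dot y (rot k x) ^+ 2 = 1 - dot x y ^+ 2.
 have -> : 1 - dot x y ^+ 2 = dot x x * dot y y - dot x y ^+ 2 by rewrite hx hy mulr1.
 by rewrite sum3 !dotE !rotE; ring.
have -> : \sum_k dot (rot k y) (rot k x) = 2 * dot x y by rewrite sum3 !dotE !rotE; ring.
rewrite /zon; move: (dot x y) => t; case: N => [|[|n]]; rewrite /= ?expr0; [ring|by field|].
rewrite (exprS _ n.+1) (exprS _ n) -(natr1 n.+2) -(natr1 n.+1) -(natr1 n); move: (_ ^+ n) (n%:R : R) => a b; by field.
Qed.

Lemma kint_lap N F (x : E) : pL1 F -> sphere x ->
 \sum_k Xd k (Xd k (kint (zon N) F)) x = N%:R ^+ 2 * kint (zon N.-1) F x - N%:R * N.+1%:R * kint (zon N) F x.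
Proof.
move=> iF hx; have e k : Xd k (Xd k (kint (zon N) F)) x = \I_q (Xd k (dzon k N ^~ q^S) x * F q).
 by rewrite (Xd_ext k (fun y hy => Xd_kint_zon k N iF hy) hx) (Xd_kint k (Kern_dzon k N) iF hx).
have i1 n := kint_pL1 x (Kern_zon n) iF.
rewrite (eq_bigr _ (fun k _ => e k)) -pintS; last first.
 move=> k; apply: (eqL1 _ (L1Mct (Alg_cont2 (Alg_dzon' k N x)) iF)) => q _.
 by rewrite Xd_dzon.
rewrite -!pintZ // -pintB; [|exact: pL1Z|exact: pL1Z].
by eqq; rewrite -mulr_suml lap_zon //; [ring|exact: sphS].
Qed.

Lemma conv_kint N F (x : E) : pL1 F -> conv N F x = N.+1%:R / (4 * pi) * kint (zon N) F x.
Proof. by move=> iF; rewrite -pintZ; [eqq; rewrite mulrA|exact: kint_pL1 (Kern_zon N) iF]. Qed.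

Lemma Xd_conv_kint k N F (x : E) : pL1 F -> sphere x -> Xd k (conv N F) x = N.+1%:R / (4 * pi) * Xd k (kint (zon N) F) x.
Proof.
move=> iF hx; rewrite -(XdZ k _ (AlgC1 (kint_Alg (Kern_zon N) iF)) hx).
by apply: Xd_ext hx => y _; exact: conv_kint.
Qed.

Lemma wD_kint N Psi Theta i (x : E) : wD Psi Theta -> sphere x ->
 Tf (fun j => kint (zon N) (Psi j)) i x = kint (zon N) (Theta i) x - kint (zon N) (Psi i) x.
Proof.
move=> hw hx; have [h1 h2 h3] := hw; have aK := Kern_Algr x (Kern_zon N).
have c0 : N.+1%:R / (4 * pi) != 0 :> R by rewrite mulf_neq0 ?invr_eq0 ?mulf_neq0 ?pnatr_eq0 // gt_eqF ?pi_gt0.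
have := wD_conv N i hw hx; rewrite /Df (conv_kint N x (h1 i)) (conv_kint N x (h2 i)) !TfE.
rewrite (eq_bigr (fun k => N.+1%:R / (4 * pi) * (js k i * Xd k (kint (zon N) (Psi (jp k i))) x))); last first.
 by move=> k _; rewrite Xd_conv_kint // mulrCA.
by rewrite -mulr_sumr -mulrDr => /(mulfI c0) <-; rewrite addrAC subrr add0r.
Qed.

(** As [(1 + T) Psi = Theta], the relation [T (T + 1) = - Delta] shows that minus the Laplacian of
    the convolution of [Psi] is [T] of that of [Theta]; [kint_lap] makes the Laplacian a difference
    of consecutive terms. *)
Lemma wD_kint_rec N Psi Theta i (x : E) : wD Psi Theta -> sphere x ->
 N.+2%:R * kint (zon N.+1) (Psi i) x - N.+1%:R * kint (zon N) (Psi i) x =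
 N.+1%:R^-1 * Tf (fun j => kint (zon N.+1) (Theta j)) i x.
Proof.
move=> hw hx; have [h1 h2 h3] := hw.
have aP j := kint_Alg (Kern_zon N.+1) (h1 j); have aT j := kint_Alg (Kern_zon N.+1) (h2 j).
have hT := Tf_Tf i (aP : forall j, Alg ((fun j => kint (zon N.+1) (Psi j)) j)) hx.
have e : Tf (Tf (fun j => kint (zon N.+1) (Psi j))) i x =
 Tf (fun j => kint (zon N.+1) (Theta j)) i x - Tf (fun j => kint (zon N.+1) (Psi j)) i x.
 rewrite !TfE -sumrB; apply: eq_bigr => k _; rewrite -mulrBr -XdB; [|exact: AlgC1|exact: AlgC1|exact: hx].
 by congr (_ * _); apply: Xd_ext hx => y hy; exact: wD_kint.
move: hT; rewrite e kint_lap // => /= {e}.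
have n0 : N.+1%:R != 0 :> R by rewrite pnatr_eq0.
move: (Tf _ i x) (Tf _ i x) (kint _ _ x) (kint _ _ x) => a b c d h.
by apply: (mulfI n0); rewrite mulVKf //; move: h; rewrite -(natr1 N.+1); move: (N.+1%:R : R) => n; lra.
Qed.

Lemma Alg_rdotsum n k (x : E) : Alg (fun y => 2^-1 * dot x (rot k y) * \sum_(j < n) zon j x y).
Proof.
apply: AlgM; last by apply: Alg_sum => j; exact: Kern_Algr (Kern_zon j).
apply: AlgM; first exact: AlgC.
by apply: (Alg_ext (AlgN (Alg_dotr (rot k x)))) => y _; rewrite rot_dot opprK.
Qed.

(** The recursion telescopes. The factor [2^-1 dot x (rot k y)] times the geometric sum is a
    truncated Green kernel of the Dirac operator; the full sum has a singularity of order
    [1 / |x - y|]. *)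
Lemma wD_conv_formula N Psi Theta i (x : E) : wD Psi Theta -> sphere x ->
 4 * pi * conv N (Psi i) x = pint (Theta i) - \sum_k js k i * \I_q (Theta (jp k i) q *
  (2^-1 * dot x (rot k q^S) * \sum_(j < N) zon j x q^S)).
Proof.
move=> hw hx; have [h1 h2 h3] := hw; have pi0 : pi != 0 :> R by rewrite gt_eqF ?pi_gt0.
have -> : 4 * pi * conv N (Psi i) x = N.+1%:R * kint (zon N) (Psi i) x.
 by rewrite conv_kint // mulrA [4 * pi * _]mulrC divfK // mulf_neq0 ?pnatr_eq0.
have aS n k := Alg_rdotsum n k x.
elim: N => [|N ih].
 rewrite mul1r big1 ?subr0 => [|k _]; last first.
  transitivity (js k i * pint (fun _ : R * R => 0)); last by rewrite pint0 mulr0.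
  by congr (_ * _); eqq; rewrite big_ord0 !mulr0.
 transitivity (kint (zon 0) (Theta i) x); last by eqq; rewrite /zon expr0 mul1r.
 have := wD_kint 0 i hw hx; rewrite TfE big1 => [|k _].
  by move/eqP; rewrite eq_sym subr_eq0 => /eqP ->.
 transitivity (js k i * pint (fun _ : R * R => 0)); last by rewrite pint0 mulr0.
 by rewrite Xd_kint_zon //; congr (_ * _); eqq; rewrite /dzon !mul0r.
have := wD_kint_rec N i hw hx; move/eqP; rewrite subr_eq => /eqP ->; rewrite ih addrC -addrA; congr (_ + _).
rewrite TfE mulr_sumr -!sumrN -big_split /=; apply: eq_bigr => k _.
rewrite Xd_kint_zon // mulrCA -mulrN -mulrDr -mulrN; congr (_ * _).
have iS n := L1MAlg (h2 (jp k i)) (aS n k).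
rewrite /kint -pintZ; last exact: kint_pL1 (Kern_dzon k N.+1) (h2 _).
set B := \I_p (_ * _); set A := pint _; set D := pint _.
suff -> : D = B - A by rewrite opprB addrC.
rewrite /D /A /B -pintB; [|exact: iS|exact: pL1Z (kint_pL1 x (Kern_dzon k N.+1) (h2 _))].
eqq; rewrite big_ord_recr /= /dzon [dot q^S _]dotC rot_dot /=.
have n0 : N.+1%:R != 0 :> R by rewrite pnatr_eq0.
by move: (dot _ _) (zon _ _ _) (Theta _ q) (\sum_(_ < _) _) (N.+1%:R : R) n0 => *; field.
Qed.

(** A majorant of the truncated Green kernels, one zonal kernel for each block of the geometric
    series between [16^k] and [16^(k+1)]. The weight [4 * 4^k] bounds the square root of the block
    length [15 * 16^k]. *)
Definition Udy (M : nat) (x y : E) : R := 1 + \sum_(k < M) 4 * 4 ^+ k * zon (16 ^ k) x y.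

Lemma Kern_Udy M : Kern (Udy M).
Proof.
rewrite /Udy; elim: M => [|M ih].
 by rewrite (_ : (fun x y : E => _) = (fun _ _ => 1)); [exact: Kern_cst|apply/funext => x; apply/funext => y; rewrite big_ord0 addr0].
have h := Kern_add ih (Kern_mul (Kern_cst (4 * 4 ^+ M)) (Kern_zon (16 ^ M))).
rewrite (_ : (fun x y : E => _) = (fun x y => 1 + \sum_(k < M) 4 * 4 ^+ k * zon (16 ^ k) x y + 4 * 4 ^+ M * zon (16 ^ M) x y)) //.
by apply/funext => x; apply/funext => y; rewrite big_ord_recr /= addrA.
Qed.

Lemma UdyC M (x y : E) : Udy M x y = Udy M y x.
Proof. by rewrite /Udy; congr (_ + _); apply: eq_bigr => k _; rewrite zonC. Qed.

Lemma Udy_ge1 M (x y : E) : sphere x -> sphere y -> 1 <= Udy M x y.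
Proof.
move=> hx hy; rewrite lerDl; apply: sumr_ge0 => k _; apply: mulr_ge0; last exact: zon_ge0.
by apply: mulr_ge0; rewrite ?exprn_ge0.
Qed.

(** One factor of the sum, times [1 - z], is at most 1, and the other is at most [n]; thus
    [sqrt (1 - z)] times the sum is at most [sqrt n]. *)
Lemma geo_block (z : R) n : 0 <= z <= 1 -> (1 - z) * (\sum_(j < n) z ^+ j) ^+ 2 <= n%:R.
Proof.
move=> /andP[z0 z1]; have e : (1 - z) * (\sum_(j < n) z ^+ j) = 1 - z ^+ n.
 elim: n => [|n ih]; first by rewrite big_ord0 mulr0 expr0 subrr.
 by rewrite big_ord_recr /= mulrDr ih exprS; ring.
have h1 : \sum_(j < n) z ^+ j <= n%:R.
 apply: (@le_trans _ _ (\sum_(j < n) 1)); last by rewrite sumr_const card_ord.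
 by apply: ler_sum => j _; exact: exprn_ile1.
have h0 : 0 <= \sum_(j < n) z ^+ j by apply: sumr_ge0 => j _; exact: exprn_ge0.
rewrite expr2 mulrA e; apply: (le_trans _ h1); apply: ler_piMl => //.
by rewrite lerBlDr lerDl exprn_ge0.
Qed.

Lemma geo_dyadic (z w : R) M : 0 <= z <= 1 -> 0 <= w -> w ^+ 2 = 1 - z ->
 w * \sum_(j < 16 ^ M) z ^+ j <= 1 + \sum_(k < M) 4 * 4 ^+ k * z ^+ (16 ^ k).
Proof.
move=> hz w0 hw; have /andP[z0 z1] := hz; elim: M => [|M ih].
 rewrite big_ord0 addr0 expn0 big_ord1 expr0 mulr1 -(@ler_pXn2r _ 2) ?nnegrE // hw expr1n; lra.
rewrite big_ord_recr /= addrA.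
have hs : (16 ^ M.+1 = 16 ^ M + 15 * 16 ^ M)%N by rewrite expnS; lia.
rewrite hs big_split_ord /= mulrDr; apply: lerD => //.
rewrite (eq_bigr (fun j : 'I__ => z ^+ (16 ^ M) * z ^+ j)) => [|j _]; last by rewrite exprD.
rewrite -mulr_sumr mulrCA [leRHS]mulrC; apply: ler_wpM2l; first exact: exprn_ge0.
have s0 : 0 <= \sum_(j < 15 * 16 ^ M) z ^+ j by apply: sumr_ge0 => j _; exact: exprn_ge0.
rewrite -(@ler_pXn2r _ 2) ?nnegrE ?mulr_ge0 ?exprn_ge0 // exprMn hw.
apply: (le_trans (geo_block _ hz)); rewrite natrM natrX exprMn -exprM mulnC exprM.
rewrite (_ : (4 : R) ^+ 2 = 16); last by rewrite -natrX.
by apply: ler_wpM2r; [exact: exprn_ge0|rewrite ler_nat].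
Qed.

Lemma rdot_le_Udy k M (x y : E) : sphere x -> sphere y ->
 `|2^-1 * dot x (rot k y) * \sum_(j < 16 ^ M) zon j x y| <= Udy M x y.
Proof.
move=> hx hy; have /andP[t1 t2] := dot_sphere_itv hx hy.
set z := (1 + dot x y) / 2; have hz : 0 <= z <= 1 by rewrite /z; lra.
have /andP[z0 z1] := hz; have w0 : 0 <= Num.sqrt (1 - z) by exact: sqrtr_ge0.
have hw : Num.sqrt (1 - z) ^+ 2 = 1 - z by rewrite sqr_sqrtr //; lra.
apply: (le_trans _ (geo_dyadic M hz w0 hw)); rewrite normrM [`|\sum_(_ < _) _|]ger0_norm; last first.
 by apply: sumr_ge0 => j _; exact: zon_ge0.
apply: ler_wpM2r; first by apply: sumr_ge0 => j _; exact: exprn_ge0.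
rewrite -(@ler_pXn2r _ 2) ?nnegrE // real_normK ?num_real // hw exprMn.
have h : dot x (rot k y) ^+ 2 <= 1 - dot x y ^+ 2.
 have -> : 1 - dot x y ^+ 2 = \sum_k dot x (rot k y) ^+ 2.
  have -> : 1 - dot x y ^+ 2 = dot x x * dot y y - dot x y ^+ 2 by rewrite hx hy mulr1.
  by rewrite sum3 !dotE !rotE; ring.
 by rewrite sum3; case: (ord3P k) => ->; have := sqr_ge0 (dot x (rot 0 y)); have := sqr_ge0 (dot x (rot 1 y)); have := sqr_ge0 (dot x (rot o2 y)); lra.
by rewrite /z; nra.
Qed.

(** The [M]-th term is of size [2^-M]. Where [rho^2 <= 2^M], the kernel mass [4 pi / (16^M + 1)]
    beats [4^M 2^M]; elsewhere [rho^2 <= 8^-M rho^8], and [4^M 8^-M = 2^-M]. Here the exponent 8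
    originates. *)
Lemma Udy_rho_bound (rho : R * R -> R) : pL1 (fun p => rho p ^+ 2) -> pL1 (fun p => rho p ^+ 8) ->
 exists2 C, 0 <= C & forall M (x : E), sphere x -> \I_q (Udy M x q^S * rho q ^+ 2) <= C.
Proof.
move=> i2 i8; set c := 4 * \I_p (rho p ^+ 8) + 16 * pi.
have p8 : 0 <= \I_p (rho p ^+ 8) by apply: pint_ge0 => p _; rewrite (exprM _ 2 4) exprn_ge0 ?sqr_ge0.
have c0 : 0 <= c by rewrite /c; have := pi_gt0 R; lra.
have p2 : 0 <= \I_p (rho p ^+ 2) by apply: pint_ge0 => p _; exact: sqr_ge0.
exists (\I_p (rho p ^+ 2) + c * 2) => [|M x hx]; first by rewrite addr_ge0 // mulr_ge0.
suff : \I_q (Udy M x q^S * rho q ^+ 2) <= \I_p (rho p ^+ 2) + c * (2 - 2 * 2^-1 ^+ M).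
 move=> h; apply: (le_trans h); rewrite lerD2l; apply: ler_wpM2l => //.
 by rewrite lerBlDr lerDl mulr_ge0 ?exprn_ge0 // invr_ge0.
elim: M => [|M ih].
 rewrite expr0 mulr1 subrr mulr0 addr0 le_eqVlt; apply/orP; left; apply/eqP.
 by eqq; rewrite /Udy big_ord0 addr0 mul1r.
have iU m := kint_pL1 x (Kern_Udy m) i2; have iz := kint_pL1 x (Kern_zon (16 ^ M)) i2.
have -> : \I_q (Udy M.+1 x q^S * rho q ^+ 2) =
  \I_q (Udy M x q^S * rho q ^+ 2) + 4 * 4 ^+ M * \I_q (zon (16 ^ M) x q^S * rho q ^+ 2).
 rewrite -pintZ // -pintD //; last exact: pL1Z.
 by eqq; rewrite /Udy big_ord_recr /= addrA mulrDl -mulrA.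
have Kz := AlgL1 (Kern_Algr x (Kern_zon (16 ^ M))).
have h : \I_q (zon (16 ^ M) x q^S * rho q ^+ 2) <= 8^-1 ^+ M * \I_p (rho p ^+ 8) + 2 ^+ M * (4 * pi / (16 ^ M).+1%:R).
 rewrite -(pint_zon _ hx) -!pintZ // -pintD; [|exact: pL1Z|exact: pL1Z].
 apply: le_pint => //; first by apply: pL1D; exact: pL1Z.
 move=> q _; have hq := sphS q; have := zon_ge0 (16 ^ M) hx hq.
 have z1 : zon (16 ^ M) x q^S <= 1.
  have /andP[t1 t2] := dot_sphere_itv hx hq; rewrite /zon; apply: exprn_ile1; lra.
 rewrite (exprM _ 2 4); move: (zon _ _ _) (rho q ^+ 2) (sqr_ge0 (rho q)) z1 => z a a0 z1 z0.
 have c2 : 0 < 2 ^+ M :> R by rewrite exprn_gt0.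
 have e8 : (8^-1 : R) ^+ M * (2 ^+ M) ^+ 3 = 1.
  by rewrite -exprM mulnC exprM -exprMn (_ : (8^-1 : R) * 2 ^+ 3 = 1) ?expr1n // -natrX mulVf ?pnatr_eq0.
 have e0 : 0 <= (8^-1 : R) ^+ M by rewrite exprn_ge0 // invr_ge0.
 have [ha|ha] := leP a (2 ^+ M).
  have := ler_wpM2l z0 ha; have : 0 <= 8^-1 ^+ M * a ^+ 4 by rewrite mulr_ge0 ?exprn_ge0.
  by rewrite [_ * 2 ^+ M]mulrC => h1 h2; lra.
 have h1 : a <= 8^-1 ^+ M * a ^+ 4.
  rewrite exprS mulrCA -[leLHS]mulr1; apply: ler_wpM2l => //.
  apply: (@le_trans _ _ (8^-1 ^+ M * (2 ^+ M) ^+ 3)); first by rewrite e8.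
  by apply: ler_wpM2l => //; apply: lerXn2r; rewrite ?nnegrE // ltW.
 by have := ler_piMl a0 z1; have : 0 <= 2 ^+ M * z by [rewrite mulr_ge0 // ltW]; lra.
have h4 : 4 * 4 ^+ M * \I_q (zon (16 ^ M) x q^S * rho q ^+ 2) <= c * 2^-1 ^+ M.
 apply: (le_trans (ler_wpM2l _ h)); first by rewrite mulr_ge0 ?exprn_ge0.
 have e1 : 4 ^+ M * 8^-1 ^+ M = 2^-1 ^+ M :> R by rewrite -exprMn; congr (_ ^+ M); field.
 have e2 : 4 ^+ M * 2 ^+ M / (16 ^ M).+1%:R <= 2^-1 ^+ M :> R.
  rewrite ler_pdivrMr ?ltr0n // -(natr1 (16 ^ M)) natrX mulrDr mulr1.
  have e3 : 4 ^+ M * 2 ^+ M = 2^-1 ^+ M * 16 ^+ M :> R by rewrite -!exprMn; congr (_ ^+ M); field.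
  by rewrite -e3 lerDl exprn_ge0 // invr_ge0.
 have := ler_wpM2l (mulr_ge0 (ler0n R 16) (ltW (pi_gt0 R))) e2.
 rewrite /c; move: e1 {h ih e2 iz Kz c0 p8}; move: (pint _) (4 ^+ M) (8^-1 ^+ M) (2 ^+ M) ((16 ^ M).+1%:R^-1) (2^-1 ^+ M) pi => P a b d m h q e1 e2.
 have -> : 4 * a * (b * P + d * (4 * q * m)) = 4 * (a * b) * P + 16 * q * (a * d * m) by ring.
 by rewrite e1 mulrDl; lra.
apply: (le_trans (lerD ih h4)); rewrite -addrA -mulrDr lerD2l; apply: ler_wpM2l => //.
by rewrite exprS; move: (2^-1 ^+ M) => a; lra.
Qed.

Lemma L1cvg_sub (m : nat -> nat) (F_ : nat -> R * R -> R) F : (forall n, (n <= m n)%N) ->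
 L1cvg F_ F -> L1cvg (fun n => F_ (m n)) F.
Proof.
move=> hm [h1 h2 h3]; split=> //; apply: (cvg_comp m _ _ h3).
by apply/cvgnyPge => A; exists A => // n /= An; exact: leq_trans An (hm n).
Qed.

(** A Schur test with weight [rho^2]. [Udy_rho_bound] is used twice: inside Cauchy-Schwarz at a
    fixed [x], and after the exchange of integrals, when [rho^2] sits on the kernel again. Fatou's
    lemma along the indices [16^n] ends the proof. *)
Theorem wD_regular (Psi : ppf) (rho : R * R -> R) : wD Psi (fun i p => rho p * Psi i p) ->
 pmeas rho -> (forall p, dom p -> 0 <= rho p) -> pL1 (fun p => rho p ^+ 2) -> pL1 (fun p => rho p ^+ 8) ->
 (forall i, pL1 (fun p => Psi i p ^+ 2)) -> forall i, pL1 (fun p => rho p ^+ 2 * Psi i p ^+ 2).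
Proof.
move=> hw mr r0 i2 i8 iP2 i; have [h1 h2 h3] := hw.
have mP j : pmeas (Psi j) by case: (h1 j).
have [C C0 hC] := Udy_rho_bound i2 i8.
pose sig p : R := \sum_j `|Psi j p|.
have msig : pmeas sig by apply: pmeas_sum => j; apply: pmeas_ct (mP j); exact: norm_continuous.
have sig0 p : 0 <= sig p by apply: sumr_ge0 => j _.
have isig2 : pL1 (fun p => sig p ^+ 2).
 apply: (@pL1_le _ (fun p => \sum_j 4 * Psi j p ^+ 2)).
 - exact: pmeas_ct (@exprn_continuous _ 2) msig.
 - move=> p _; rewrite ger0_norm ?sqr_ge0 // /sig !sum4.
  rewrite -!(real_normK (num_real (Psi _ p))).
  move: `|_| `|_| `|_| `|_| => a b c d.
  have := sqr_ge0 (a - b); have := sqr_ge0 (a - c); have := sqr_ge0 (a - d); have := sqr_ge0 (b - c); have := sqr_ge0 (b - d); have := sqr_ge0 (c - d).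
  by rewrite !sqrrB; nra.
 - by apply: pL1S => j; exact: pL1Z.
have irs : pL1 (fun p => rho p * sig p) by exact: pL1_prod.
have UA M (x : E) := Alg_cont2 (Kern_Algr x (Kern_Udy M)).
have key M (x : E) : sphere x -> (4 * pi * conv (16 ^ M) (Psi i) x) ^+ 2 <= 16 * C * kint (Udy M) (fun p => sig p ^+ 2) x.
 move=> hx; set T := \I_q (Udy M x q^S * (rho q * sig q)).
 have iT := L1Mct (UA M x) irs.
 have U1 q : 1 <= Udy M x q^S by apply: Udy_ge1 => //; exact: sphS.
 have U0 q : 0 <= Udy M x q^S by apply: (le_trans ler01).
 have T0 : 0 <= T by apply: pint_ge0 => q hq; do 2 rewrite mulr_ge0 //; exact: r0.
 have sj j q : `|Psi j q| <= sig q by rewrite /sig (bigD1 j) //= lerDl; apply: sumr_ge0.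
 (* One [T] for the mean of [Theta] and three for the rotation fields. *)
 have hA : `|4 * pi * conv (16 ^ M) (Psi i) x| <= 4 * T.
  rewrite (wD_conv_formula _ _ hw hx); apply: (le_trans (ler_normB _ _)).
  have b1 : `|\I_p (rho p * Psi i p)| <= T.
   apply: (le_trans (le_norm_pint (h2 i))); apply: le_pint => //; first exact: pL1n (h2 i).
   move=> q hq; rewrite normrM ger0_norm ?r0 //.
   apply: (@le_trans _ _ (rho q * sig q)); first by apply: ler_wpM2l; [exact: r0|exact: sj].
   by apply: ler_peMl => //; rewrite mulr_ge0 ?r0.
  have b2 k : `|js k i * \I_q (rho q * Psi (jp k i) q * (2^-1 * dot x (rot k q^S) * \sum_(j < 16 ^ M) zon j x q^S))| <= T.
   have js1 : `|js k i| = 1 by apply/eqP; rewrite -(@eqrXn2 _ 2) // ?real_normK ?num_real // expr2 js_sqr expr1n.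
   have iZ : pL1 (fun q => rho q * Psi (jp k i) q * (2^-1 * dot x (rot k q^S) * \sum_(j < 16 ^ M) zon j x q^S)).
    exact: L1MAlg (h2 (jp k i)) (Alg_rdotsum _ k x).
   rewrite normrM js1 mul1r; apply: (le_trans (le_norm_pint iZ)); apply: le_pint => //; first exact: pL1n.
   move=> q hq; rewrite normrM mulrC; apply: ler_pM => //.
    by apply: rdot_le_Udy => //; exact: sphS.
   by rewrite normrM ger0_norm ?r0 //; apply: ler_wpM2l; [exact: r0|exact: sj].
  have b3 := ler_norm_sum (index_enum 'I_3) (fun k => js k i * \I_q (rho q * Psi (jp k i) q * (2^-1 * dot x (rot k q^S) * \sum_(j < 16 ^ M) zon j x q^S))) predT.
  apply: (le_trans (lerD b1 b3)); rewrite sum3.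
  by have := b2 0; have := b2 1; have := b2 o2; move: T {T0 hw b1 b2 b3} => T; lra.
 have hB : T ^+ 2 <= C * kint (Udy M) (fun p => sig p ^+ 2) x.
  have i1 := L1Mct (UA M x) i2; have i3 := L1Mct (UA M x) isig2.
  apply: (@le_trans _ _ (\I_q (Udy M x q^S * rho q ^+ 2) * kint (Udy M) (fun p => sig p ^+ 2) x)).
   apply: (pint_CS i1 iT i3) => q _; [by rewrite mulr_ge0 ?sqr_ge0|by rewrite mulr_ge0 ?sqr_ge0|].
   by move: (Udy _ _ _) (rho q) (sig q) => a b c; apply: eq_lerW; ring.
  apply: ler_wpM2r; last exact: hC.
  by apply: pint_ge0 => q _; rewrite mulr_ge0 ?sqr_ge0.
 rewrite -(real_normK (num_real _)); apply: (@le_trans _ _ ((4 * T) ^+ 2)).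
  by rewrite ler_pXn2r ?nnegrE // mulr_ge0.
 by rewrite exprMn (_ : (4 : R) ^+ 2 = 16) -?natrX // -mulrA; apply: ler_wpM2l.
have iPsi n := conv_Alg n (h1 i).
pose f n p : R := rho p ^+ 2 * conv (16 ^ n) (Psi i) p^S ^+ 2.
have if_ n : pL1 (f n).
 by apply: (eqL1 _ (L1MAlg i2 (AlgXn 2 (iPsi (16 ^ n)%N)))) => p _.
pose S := \I_p (sig p ^+ 2).
have bnd n : pint (f n) <= 16 * C / (4 * pi) ^+ 2 * (C * S).
 have pi4 : 0 < (4 * pi) ^+ 2 :> R by rewrite exprn_gt0 // mulr_gt0 ?pi_gt0.
 have iK := L1MAlg i2 (kint_Alg (Kern_Udy n) isig2).
 apply: (@le_trans _ _ (16 * C / (4 * pi) ^+ 2 * \I_p (rho p ^+ 2 * kint (Udy n) (fun p => sig p ^+ 2) p^S))).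
  rewrite -pintZ //; apply: le_pint => //; first exact: pL1Z.
  move=> p _; rewrite mulrCA; apply: ler_wpM2l; first exact: sqr_ge0.
  by rewrite mulrAC ler_pdivlMr // mulrC -exprMn; apply: key; exact: sphS.
 apply: ler_wpM2l; first by apply: mulr_ge0; [exact: mulr_ge0|rewrite invr_ge0 ltW].
 rewrite (kint_fubini (Kern_Udy n) isig2 i2) -pintZ //; apply: le_pint; [|exact: pL1Z|].
  apply: L1MAlg => //; apply: kint_Alg => //.
  by rewrite (_ : (fun y x => _) = Udy n); [exact: Kern_Udy|apply/funext => x; apply/funext => y; exact: UdyC].
 move=> q _; rewrite mulrC; apply: ler_wpM2r; first exact: sqr_ge0.
 have := hC n q^S (sphS q); rewrite /kint; apply: le_trans.
 by apply: eq_lerW; apply: eq_pint => y _; rewrite UdyC.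
have [hsub] : exists2 s : nat -> nat, (forall n, (n <= s n)%N) & pae (fun p => conv (16 ^ s n) (Psi i) p^S @[n --> \oo] --> Psi i p).
 have h16 n : (n <= 16 ^ n)%N by rewrite ltnW // ltn_expl.
 exact: (L1cvg_subseq (L1cvg_sub h16 (conv_cvg (h1 i)))).
move=> hs ha.
clear key.
apply: (proj1 (@pint_fatou_ae (fun n => f (hsub n)) (fun p => rho p ^+ 2 * Psi i p ^+ 2) (16 * C / (4 * pi) ^+ 2 * (C * S)) _ _ _ _ _)).
- by move=> n; exact: if_.
- by apply: pmeasM; [case: i2|case: (iP2 i)].
- apply: paeS ha => p _ h; apply: cvgM; first exact: cvg_cst.
 exact: (cvg_ctf (@exprn_continuous _ 2) h).
- by move=> n p _; apply: mulr_ge0; exact: sqr_ge0.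
- by move=> n; exact: bnd.
Qed.

(** * The twistor form and the integral identity behind Bär's inequality *)

Section Baer.

Implicit Types (y z : 'I_3 -> V4) (v w : V4).

Definition tr y : V4 := fun i => \sum_k js k i * y k (jp k i).

(** On tangential derivatives, the squared norm of the twistor operator [nabla_X + 1/2 X . D]. In
    the trivialization the zeroth order terms of [nabla] and [D] cancel and leave flat derivatives
    and [T]. *)
Definition Bq y z : R := \sum_k ip (y k) (z k) - 2^-1 * ip (tr y) (tr z).

Lemma jsE :
 ((js 0 s00 = 1) * (js 0 s01 = -1) * (js 0 s10 = 1) * (js 0 s11 = -1)) *
 ((js 1 s00 = -1) * (js 1 s01 = -1) * (js 1 s10 = 1) * (js 1 s11 = 1)) *
 ((js o2 s00 = 1) * (js o2 s01 = -1) * (js o2 s10 = -1) * (js o2 s11 = 1)).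
Proof. by rewrite /js !o2_neq0 !o2_neq1 /= !expr0 !expr1 opprK. Qed.

Lemma jpE (i : ix) : (jp 0 i = (~~ i.1, ~~ i.2)) * (jp 1 i = (~~ i.1, i.2)) * (jp o2 i = (i.1, ~~ i.2)).
Proof. by rewrite /jp !o2_neq0 !o2_neq1. Qed.

Definition jE := (sum3, ipE, jsE, jpE).

Lemma ip_J (g : 'I_3 -> R) v : ip (tr (fun k i => g k * v i)) (tr (fun k i => g k * v i)) = (\sum_k g k ^+ 2) * ip v v.
Proof.
rewrite /tr !jE /= ?jE /=.
by move: (v s00) (v s01) (v s10) (v s11) (g 0) (g 1) (g o2) => *; ring.
Qed.

Lemma tr_skew y w : \sum_k ip (y k) (fun i => js k i * w (jp k i)) = - ip (tr y) w.
Proof.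
rewrite /tr !jE /= ?jE /=.
move: (y 0) (y 1) (y o2) => a b c.
by move: (a s00) (a s01) (a s10) (a s11)
(b s00) (b s01) (b s10) (b s11)
(c s00) (c s01) (c s10) (c s11) (w s00) (w s01) (w s10) (w s11) => *; ring.
Qed.

(* With [t = tr y], the form is the sum of the squares of [y_k + (J_k t - x_k (x . J) t) / 2], as [y] is tangential. *)
Lemma Bq_sos (x : E) y : sphere x -> (forall i, \sum_k x 0 k * y k i = 0) -> 0 <= Bq y y.
Proof.
move=> hx hy; pose t := tr y; pose a k i := js k i * t (jp k i); pose u := tr (fun k i => x 0 k * t i).
suff -> : Bq y y = \sum_k ip (fun i => y k i + 2^-1 * (a k i - x 0 k * u i)) (fun i => y k i + 2^-1 * (a k i - x 0 k * u i)).
 by apply: sumr_ge0 => k _; apply: sumr_ge0 => i _; rewrite -expr2 sqr_ge0.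
have e1 : \sum_k ip (y k) (a k) = - ip t t by exact: tr_skew.
have xx : \sum_k x 0 k ^+ 2 = 1 by rewrite -[RHS](hx : dot x x = 1) dotE sum3 -!expr2.
have e2 : \sum_k ip (a k) (a k) = 3 * ip t t.
 rewrite /a !jE /= ?jE /=.
 by move: (t s00) (t s01) (t s10) (t s11) => *; ring.
have e3 : ip u u = ip t t by rewrite ip_J xx mul1r.
have e4 : \sum_k ip (a k) (fun i => x 0 k * u i) = ip u u.
 have ua i : u i = \sum_k x 0 k * a k i by apply: eq_bigr => k _; rewrite /a mulrCA.
 rewrite !jE !ua !sum3; move: (a 0) (a 1) (a o2) => *; ring.
have e5 : \sum_k ip (fun i => x 0 k * u i) (fun i => x 0 k * u i) = ip u u.
 by rewrite -[RHS]mul1r -xx mulr_suml; apply: eq_bigr => k _; rewrite !ipE; ring.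
have e6 : \sum_k ip (y k) (fun i => x 0 k * u i) = 0.
 transitivity (\sum_i u i * \sum_k x 0 k * y k i); last by rewrite big1 // => i _; rewrite hy mulr0.
 by rewrite sum4 !jE; ring.
have e k : ip (fun i => y k i + 2^-1 * (a k i - x 0 k * u i)) (fun i => y k i + 2^-1 * (a k i - x 0 k * u i)) =
 ip (y k) (y k) + ip (y k) (a k) - ip (y k) (fun i => x 0 k * u i) + 4^-1 * (ip (a k) (a k) - 2 * ip (a k) (fun i => x 0 k * u i)
 + ip (fun i => x 0 k * u i) (fun i => x 0 k * u i)).
 rewrite !ipE; move: (y k) (a k) (x 0 k) => b c d.
 by move: (b s00) (b s01) (b s10) (b s11)
 (c s00) (c s01) (c s10) (c s11) (u s00) (u s01) (u s10) (u s11) => *; field.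
rewrite (eq_bigr _ (fun k _ => e k)) !big_split /= sumrN -mulr_sumr !big_split /= sumrN -mulr_sumr e1 e2 e4 e5 e6 e3 /Bq.
by rewrite -/t; move: (\sum_k _) (ip t t) => *; field.
Qed.

Lemma Bq_lin (s : R) y z : Bq (fun k i => s * y k i + z k i) (fun k i => s * y k i + z k i) = Bq y y * s ^+ 2 + 2 * Bq y z * s + Bq z z.
Proof.
have e : tr (fun k i => s * y k i + z k i) = (fun i => s * tr y i + tr z i).
 by apply/funext => i; rewrite /tr mulr_sumr -big_split; apply: eq_bigr => k _ /=; rewrite mulrDr mulrCA.
have q (a b : V4) : ip (fun i => s * a i + b i) (fun i => s * a i + b i) = ip a a * s ^+ 2 + 2 * ip a b * s + ip b b.
 by rewrite !ipE; move: (a _) (a _) (a _) (a _) (b _) (b _) (b _) (b _) => *; ring.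
by rewrite /Bq e q (eq_bigr _ (fun k _ => q (y k) (z k))) !sum3; ring.
Qed.

Lemma Bq_CS (x : E) y z : sphere x -> (forall i, \sum_k x 0 k * y k i = 0) -> (forall i, \sum_k x 0 k * z k i = 0) ->
 Bq y z ^+ 2 <= Bq y y * Bq z z.
Proof.
move=> hx hy hz; apply: disc_le => s.
rewrite (_ : _ + _ + _ = Bq (fun k i => s * y k i + z k i) (fun k i => s * y k i + z k i)); last by rewrite Bq_lin; ring.
apply: (Bq_sos hx) => i.
transitivity (s * (\sum_k x 0 k * y k i) + \sum_k x 0 k * z k i); last by rewrite hy hz mulr0 addr0.
by rewrite mulr_sumr -big_split; apply: eq_bigr => k _ /=; ring.
Qed.

Definition gr (f : spf) (x : E) : 'I_3 -> V4 := fun k i => Xd k (f i) x.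

Lemma Tf_tr f i x : Tf f i x = tr (gr f x) i.
Proof. exact: TfE. Qed.

Lemma gr_tangent (f : spf) (x : E) i : (forall i, Alg (f i)) -> sphere x -> \sum_k x 0 k * gr f x k i = 0.
Proof. by move=> af hx; rewrite sum3; exact: sum_coord_Xd (AlgC1 (af i)) (sphere0 hx). Qed.

Lemma pint_Xd_ibp k f g : Alg f -> Alg g -> \I_p (Xd k f p^S * g p^S) = - pint (fun p : R * R => f p^S * Xd k g p^S).
Proof. by move=> af ag; have [_ _ _ h] := wH1_Alg af; exact: h. Qed.

Lemma wD_Alg (f : spf) : (forall i, Alg (f i)) -> wD (fun i p => f i p^S) (fun i p => Df f i p^S).
Proof.
move=> af; split=> [i|i|i g ag]; [exact: AlgL1|exact: AlgL1 (Alg_Df i af)|].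
have h k : pL1 (fun p => js k i * (Xd k (f (jp k i)) p^S * g p^S)).
 by apply: pL1Z; apply: (AlgL1 (AlgM (Alg_Xd k (af _)) ag)).
transitivity (\I_p (f i p^S * g p^S) + \I_p (\sum_k js k i * (Xd k (f (jp k i)) p^S * g p^S))).
 rewrite -pintD; [|exact: (AlgL1 (AlgM (af i) ag))|exact: pL1S].
 eqp; rewrite /Df TfE mulrDl mulr_suml; congr (_ + _).
 by apply: eq_bigr => k _; rewrite mulrA.
rewrite pintS // -sumrN; congr (_ + _); apply: eq_bigr => k _.
by rewrite pintZ ?pint_Xd_ibp ?mulrN //; exact: (AlgL1 (AlgM (Alg_Xd k (af _)) ag)).
Qed.

Lemma Alg_ip (f g : spf) : (forall i, Alg (f i)) -> (forall i, Alg (g i)) -> Alg (fun x => ip (f ^~ x) (g ^~ x)).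
Proof. by move=> af ag; apply: Alg_sum => i; exact: AlgM. Qed.

Lemma Tf_sym (f g : spf) : (forall i, Alg (f i)) -> (forall i, Alg (g i)) ->
 \I_p (ip (f ^~ p^S) (Tf g ^~ p^S)) = \I_p (ip (Tf f ^~ p^S) (g ^~ p^S)).
Proof.
move=> af ag; have h := wD_test (wD_Alg af) ag.
have ifg := AlgL1 (Alg_ip af ag).
have aT (h' : spf) : (forall i, Alg (h' i)) -> forall i, Alg (Tf h' i) by move=> a i; exact: Alg_Tf.
have i1 := AlgL1 (Alg_ip af (aT _ ag)); have i2 := AlgL1 (Alg_ip (aT _ af) ag).
apply: (addrI (\I_p (ip (f ^~ p^S) (g ^~ p^S)))).
rewrite -!pintD //; transitivity (\I_p (ip (fun i => f i p^S) (fun i => Df g i p^S))).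
 by eqp; rewrite !ipE /Df; ring.
rewrite h; eqp; rewrite !ipE /Df; ring.
Qed.

(** The relation [T (T + 1) = - Delta] in integrated form. *)
Lemma green (f g : spf) : (forall i, Alg (f i)) -> (forall i, Alg (g i)) ->
 \I_p (\sum_k ip (gr f p^S k) (gr g p^S k)) =
 \I_p (ip (Tf f ^~ p^S) (Tf g ^~ p^S) + ip (Tf f ^~ p^S) (g ^~ p^S)).
Proof.
move=> af ag; have aT i := Alg_Tf i af; have aT' i := Alg_Tf i ag; have aTT i := Alg_Tf i aT.
rewrite pintD; [|exact: AlgL1 (Alg_ip aT aT')|exact: AlgL1 (Alg_ip aT ag)].
rewrite (Tf_sym aT ag) -pintD; [|exact: AlgL1 (Alg_ip aTT ag)|exact: AlgL1 (Alg_ip aT ag)].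
have iX k i : pL1 (fun p => Xd k (f i) p^S * Xd k (g i) p^S).
 exact: (AlgL1 (AlgM (Alg_Xd k (af i)) (Alg_Xd k (ag i)))).
have iX2 k i : pL1 (fun p => Xd k (Xd k (f i)) p^S * g i p^S).
 exact: (AlgL1 (AlgM (Alg_Xd k (Alg_Xd k (af i))) (ag i))).
transitivity (\sum_k \sum_i \I_p (Xd k (f i) p^S * Xd k (g i) p^S)).
 rewrite pintS; last by move=> k; apply: pL1S => i; exact: iX.
 by apply: eq_bigr => k _; rewrite -pintS // => i; exact: iX.
transitivity (- \I_p (\sum_k \sum_i Xd k (Xd k (f i)) p^S * g i p^S)).
 rewrite pintS -?sumrN; last by move=> k; apply: pL1S => i; exact: iX2.
 apply: eq_bigr => k _; rewrite pintS -?sumrN; last by move=> i; exact: iX2.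
 apply: eq_bigr => i _.
 by rewrite (pint_Xd_ibp k (Alg_Xd k (f := f i) (af i)) (ag i)) opprK.
rewrite -pintN; last by apply: pL1S => k; apply: pL1S => i; exact: iX2.
eqp; rewrite exchange_big /= -sumrN /ip -big_split; apply: eq_bigr => i _ /=.
by rewrite (Tf_Tf i af (sphS p)) -mulr_suml; ring.
Qed.

Lemma baer_arith (n d e Y S G W t m : R) : n * e = 1 -> W = n - d -> S = - (G * n ^+ 2 / 2) ->
 n * (e ^+ 2 * Y + 2 * e * S + G * W - 2^-1 * (e ^+ 2 * t + 2 * e * m + G * W)) + d / 2 * (n * G) = e * Y + S - 2^-1 * (e * t) - m.
Proof.
move=> h -> ->.
have -> : n * (e ^+ 2 * Y + 2 * e * - (G * n ^+ 2 / 2) + G * (n - d) - 2^-1 * (e ^+ 2 * t + 2 * e * m + G * (n - d))) =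
 (n * e) * e * Y - (n * e) * (G * n ^+ 2) + n * G * (n - d) / 2 - 2^-1 * ((n * e) * e * t + 2 * (n * e) * m) by field.
by rewrite h; field.
Qed.

Section Identity.

Variables (psi : spf) (d : R).
Hypotheses (ap : forall i, Alg (psi i))
(d0 : 0 < d).
Let n (x : E) : R := ip (psi ^~ x) (psi ^~ x) + d.
Let e (x : E) : R := (n x)^-1.
Let chi : spf := fun i x => e x * psi i x.

Lemma nd_gt0 (x : E) : 0 < n x.
Proof. by apply: ltr_wpDl => //; apply: sumr_ge0 => i _; rewrite -expr2 sqr_ge0. Qed.

Lemma Alg_n : Alg n.
Proof. exact: AlgD (Alg_ip ap ap) (AlgC d). Qed.

Lemma Alg_e : Alg e.
Proof. by apply: AlgV Alg_n _ => x _; rewrite gt_eqF // nd_gt0. Qed.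

Lemma Alg_chi i : Alg (chi i).
Proof. exact: AlgM Alg_e (ap i). Qed.

Lemma Xd_n k (x : E) : sphere x -> Xd k n x = 2 * ip (gr psi x k) (psi ^~ x).
Proof.
move=> hx; rewrite XdD ?Xd_cst ?addr0; [|exact: AlgC1 (Alg_ip ap ap)|exact: AlgC1 (AlgC d)|exact: sphere0].
transitivity (\sum_i 1 * Xd k (fun x => psi i x * psi i x) x).
 rewrite -Xd_sum //; last by move=> i; exact: AlgM.
 by apply: Xd_ext hx => y _; apply: eq_bigr => i _; rewrite mul1r.
rewrite mulr_sumr; apply: eq_bigr => i _; rewrite (XdM k (AlgC1 (ap i)) (AlgC1 (ap i)) hx) /gr.
by move: (Xd _ _ _) (psi i x) => *; ring.
Qed.

Lemma Xd_e k (x : E) : sphere x -> 2 * ip (gr psi x k) (psi ^~ x) = - (n x ^+ 2 * Xd k e x).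
Proof.
move=> hx; have nx := lt0r_neq0 (nd_gt0 x).
rewrite -Xd_n // (XdV k (AlgC1 Alg_n) (AlgC1 Alg_e) nx) //; last by move=> y _; rewrite lt0r_neq0 // nd_gt0.
by move: (Xd _ _ _) (n x) nx => *; field.
Qed.

Lemma gr_chi (x : E) : sphere x -> gr chi x = fun k i => e x * gr psi x k i + Xd k e x * psi i x.
Proof.
move=> hx; apply/funext => k; apply/funext => i.
by rewrite /gr /chi (XdM k (AlgC1 Alg_e) (AlgC1 (ap i)) hx) addrC.
Qed.

Let ct (x : E) : V4 := tr (fun k i => Xd k e x * psi i x).

Lemma Tf_chi (x : E) : sphere x -> Tf chi ^~ x = fun i => e x * Tf psi i x + ct x i.
Proof.
move=> hx; apply/funext => i; rewrite !Tf_tr gr_chi // /ct /tr mulr_sumr -big_split /=.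
by apply: eq_bigr => k _; rewrite mulrDr mulrCA.
Qed.

(** The gradients of [n] and of [e = 1 / n] are proportional, whence [S = - n^2 |grad e|^2 / 2].
    With [|psi|^2 = n - d], a remainder [- d / 2] times [n |grad e|^2] is left in [n Bq], and the
    left side adds it back. *)
Lemma baer_pointwise (x : E) : sphere x ->
 n x * Bq (gr chi x) (gr chi x) + d / 2 * (n x * \sum_k Xd k e x ^+ 2) =
 \sum_k ip (gr psi x k) (gr chi x k) - 2^-1 * ip (Tf psi ^~ x) (Tf chi ^~ x) - 2^-1 * ip (Tf psi ^~ x) (ct x).
Proof.
move=> hx; have nx := lt0r_neq0 (nd_gt0 x).
pose Y := \sum_k ip (gr psi x k) (gr psi x k); pose S := \sum_k Xd k e x * ip (gr psi x k) (psi ^~ x).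
pose G := \sum_k Xd k e x ^+ 2; pose W := ip (psi ^~ x) (psi ^~ x); pose t := ip (Tf psi ^~ x) (Tf psi ^~ x).
pose m := ip (Tf psi ^~ x) (ct x).
have hS : S = - (G * n x ^+ 2 / 2).
 rewrite /S /G mulr_suml mulr_suml -sumrN; apply: eq_bigr => k _.
 have := Xd_e k hx; move: (ip _ _) (Xd _ _ _) (n x) => a b c; move=> h.
 have -> : a = - (c ^+ 2 * b) / 2 by rewrite -h mulrC mulKf ?pnatr_eq0.
 by field.
have hB : Bq (gr chi x) (gr chi x) = e x ^+ 2 * Y + 2 * e x * S + G * W - 2^-1 * (e x ^+ 2 * t + 2 * e x * m + G * W).
 have e1 : ip (tr (gr chi x)) (tr (gr chi x)) = e x ^+ 2 * t + 2 * e x * m + G * W.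
  have -> : tr (gr chi x) = fun i => e x * Tf psi i x + ct x i by rewrite -Tf_chi //; apply/funext => i; rewrite Tf_tr.
  rewrite /G /W -ip_J -/(ct x) /t /m !ipE; move: (Tf psi) (ct x) (e x) => a b c.
  by move: (a _ _) (a _ _) (a _ _) (a _ _) (b _) (b _) (b _) (b _) => *; ring.
 rewrite /Bq e1; congr (_ - _).
 rewrite gr_chi // /Y /S /G /W mulr_suml !mulr_sumr -!big_split; apply: eq_bigr => k _ /=.
 rewrite !ipE; move: (gr psi x k) (Xd k e x) (e x) => a b f.
 by move: (a _) (a _) (a _) (a _) (psi _ x) (psi _ x) (psi _ x) (psi _ x) => *; ring.
rewrite hB (@baer_arith (n x) d (e x) Y S G W t m) //; last 2 first.
- exact: mulfV.
- by rewrite /W /n addrK.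
have -> : \sum_k ip (gr psi x k) (gr chi x k) = e x * Y + S.
 rewrite gr_chi // /Y /S !mulr_sumr -!big_split; apply: eq_bigr => k _ /=.
 rewrite !ipE; move: (gr psi x k) (Xd k e x) (e x) => a b f.
 by move: (a _) (a _) (a _) (a _) (psi _ x) (psi _ x) (psi _ x) (psi _ x) => *; ring.
have -> : ip (Tf psi ^~ x) (Tf chi ^~ x) = e x * t + m.
 rewrite Tf_chi // /t /m !ipE; move: (Tf psi) (ct x) (e x) => a b c.
 by move: (a _ _) (a _ _) (a _ _) (a _ _) (b _) (b _) (b _) (b _) => *; ring.
rewrite -/m; clear hB hS; clearbody Y S t m; move: (e x) => *; by field.
Qed.

(** Integrate [baer_pointwise] and apply [green] to [psi] and [chi]. If [D psi = rho psi], the right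
    side is half the integral of [(rho^2 - 1) |psi|^2 / (|psi|^2 + d)], while both terms on the left
    are nonnegative. The constant [d] keeps the quotients regular at zeros of [psi]. *)
Theorem baer_identity :
 \I_p (n p^S * Bq (gr chi p^S) (gr chi p^S) + d / 2 * (n p^S * \sum_k Xd k e p^S ^+ 2)) =
 2^-1 * \I_p (e p^S * (ip (Df psi ^~ p^S) (Df psi ^~ p^S) - ip (psi ^~ p^S) (psi ^~ p^S))).
Proof.
have aT i := Alg_Tf i ap; have aTc i := Alg_Tf i Alg_chi; have aD i := Alg_Df i ap.
have act i : Alg (ct ^~ i).
 by apply: Alg_sum => k; apply: AlgM (AlgC _) (AlgM (Alg_Xd k Alg_e) (ap _)).
have i1 : pL1 (fun p => ip (Tf psi ^~ p^S) (Tf chi ^~ p^S)) := AlgL1 (Alg_ip aT aTc).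
have i2 : pL1 (fun p => ip (Tf psi ^~ p^S) (ct p^S)) := AlgL1 (Alg_ip aT act).
have i3 : pL1 (fun p => ip (Tf psi ^~ p^S) (chi ^~ p^S)) := AlgL1 (Alg_ip aT Alg_chi).
have i4 : pL1 (fun p => \sum_k ip (gr psi p^S k) (gr chi p^S k)).
 by apply: pL1S => k; apply: (AlgL1 (@Alg_ip (fun i => Xd k (psi i)) (fun i => Xd k (chi i)) _ _)) => i; apply: Alg_Xd => //; exact: Alg_chi.
have -> : \I_p (n p^S * Bq (gr chi p^S) (gr chi p^S) + d / 2 * (n p^S * \sum_k Xd k e p^S ^+ 2)) =
 \I_p ((\sum_k ip (gr psi p^S k) (gr chi p^S k) - 2^-1 * ip (Tf psi ^~ p^S) (Tf chi ^~ p^S)) - 2^-1 * ip (Tf psi ^~ p^S) (ct p^S)).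
 by eqp; exact: baer_pointwise (sphS p).
have j1 := pL1Z 2^-1 i1; have j2 := pL1Z 2^-1 i2; have j3 := pL1B i4 j1; have j4 := pL1D i1 i3.
rewrite (pintB j3 j2) (pintB i4 j1) (green ap Alg_chi) -(pintB j4 j1) -pintB; [|exact: pL1B|exact: j2].
rewrite -pintZ; last first.
 exact: AlgL1 (AlgM Alg_e (AlgB (Alg_ip aD aD) (Alg_ip ap ap))).
eqp; rewrite (Tf_chi (sphS p)) /chi /Df !ipE.
move: (Tf psi s00 p^S) (Tf psi s01 p^S) (Tf psi s10 p^S) (Tf psi s11 p^S)
 (ct p^S) (e p^S) => a1 a2 a3 a4 b c.
by move: (b _) (b _) (b _) (b _) (psi _ _) (psi _ _) (psi _ _) (psi _ _) => *; field.
Qed.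

End Identity.

End Baer.

(** * Bär's inequality, unique continuation and the equality case for weak solutions *)

Section BaerLimit.

Lemma ip_ge0 (v : ix -> R) : 0 <= ip v v.
Proof. by apply: sumr_ge0 => i _; rewrite -expr2 sqr_ge0. Qed.

Lemma pmeas_inv (F : R * R -> R) d : pmeas F -> (forall p, 0 <= F p) -> 0 < d -> pmeas (fun p => (F p + d)^-1).
Proof.
move=> mF F0 d0; apply: (@eq_pmeas (fun p => (fun t => (`|t| + d)^-1) (F p))); first by move=> p _ /=; rewrite ger0_norm.
apply: (pmeas_ct (f := fun t => (`|t| + d)^-1) _ mF) => t; apply: cvgV; first by rewrite lt0r_neq0 // ltr_wpDl.
by apply: cvgD; [exact: norm_continuous|exact: cvg_cst].
Qed.

Lemma continuous_1m : continuous (fun t : R => 1 - t).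
Proof. by move=> t; apply: cvgB; [exact: cvg_cst|exact: cvg_id]. Qed.

Lemma continuous_1m2 : continuous (fun t : R => (1 - t) ^+ 2).
Proof. by move=> t; exact: (cvgM (@continuous_1m t) (@continuous_1m t)). Qed.

Lemma continuous_q1m2 : continuous (fun t : R => 8 * t * (1 - t) ^+ 2).
Proof. by move=> t; apply: cvgM (@continuous_1m2 t); apply: cvgM; [exact: cvg_cst|exact: cvg_id]. Qed.

Lemma cvg_le_sqr (a b c : nat -> R) (A B C : R) : (forall n, a n ^+ 2 <= b n * c n) ->
 a n @[n --> \oo] --> A -> b n @[n --> \oo] --> B -> c n @[n --> \oo] --> C -> A ^+ 2 <= B * C.
Proof.
move=> h ha hb hc; have h1 : b n * c n @[n --> \oo] --> B * C by exact: cvgM.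
have h2 : a n * a n @[n --> \oo] --> A * A by exact: cvgM.
rewrite expr2 -(cvg_lim _ h1) // -(cvg_lim _ h2) //; apply: ler_lim; [by apply/cvg_ex; eexists; exact: h2|by apply/cvg_ex; eexists; exact: h1|].
by apply: nearW => n; rewrite -expr2.
Qed.

Variables (Psi : ppf) (rho : R * R -> R).
Hypotheses (hw : wD Psi (fun i p => rho p * Psi i p))
(ir2 : pL1 (fun p => rho p ^+ 2))
(iP2 : forall i, pL1 (fun p => Psi i p ^+ 2))
(iT2 : forall i, pL1 (fun p => rho p ^+ 2 * Psi i p ^+ 2)).

Definition sqd (p : R * R) : R := ip (Psi ^~ p) (Psi ^~ p).

Let iP i : pL1 (Psi i). Proof. by have [h _ _] := hw. Qed.
Let iT i : pL1 (fun p => rho p * Psi i p). Proof. by have [_ h _] := hw. Qed.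

Let sqd_ge0 p : 0 <= sqd p. Proof. exact: ip_ge0. Qed.

Lemma sqd_pL1 : pL1 sqd.
Proof. by apply: pL1S => i; apply: eqL1 (iP2 i) => p _; exact: expr2. Qed.

Lemma rsqd_pL1 : pL1 (fun p => rho p ^+ 2 * sqd p).
Proof.
apply: eqL1 (pL1S (index_enum ix) iT2) => p _; rewrite mulr_sumr; apply: eq_bigr => i _; exact: (congr1 _ (expr2 _)).
Qed.

Section Level.

Variable d : R.
Hypothesis d0 : 0 < d.

Let e p := (sqd p + d)^-1.

Lemma me : pmeas e.
Proof. by apply: pmeas_inv => //; case: sqd_pL1. Qed.

Lemma inv_bnd (a : R) : 0 <= a -> 0 < (a + d)^-1 <= d^-1.
Proof.
move=> a0; have h : 0 < a + d by exact: ltr_wpDl.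
by rewrite invr_gt0 h /= lef_pV2 ?posrE // lerDr.
Qed.

(** For fixed [d], the limit of the upper bounds [Rn] for the right side of [baer_identity] along
    the mollified spinors. *)
Definition rlim : R := 2^-1 * \I_p (e p * (rho p ^+ 2 * sqd p - sqd p)).

Variable s : nat -> nat.
Hypotheses (hs : forall n, (n <= s n)%N)
(has : pae (fun p => forall i, conv (s n) (Psi i) p^S @[n --> \oo] --> Psi i p)).

Definition psin (n : nat) : spf := fun i => conv (s n) (Psi i).

Lemma Alg_psin n i : Alg (psin n i).
Proof. exact: conv_Alg. Qed.

Definition wn (n : nat) (x : E) : R := ip (psin n ^~ x) (psin n ^~ x).

Let en n (x : E) : R := (wn n x + d)^-1.

Lemma Alg_wn n : Alg (wn n).
Proof. exact: Alg_ip (Alg_psin n) (Alg_psin n). Qed.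

Lemma Alg_en n : Alg (en n).
Proof. exact: Alg_e (Alg_psin n) d0. Qed.

Lemma wn_cvg : pae (fun p => wn n p^S @[n --> \oo] --> sqd p).
Proof.
apply: paeS has => p _ h; apply: cvg_sumf => i; exact: cvgM (h i) (h i).
Qed.

Lemma en_cvg : pae (fun p => en n p^S @[n --> \oo] --> e p).
Proof.
apply: paeS wn_cvg => p _ h; apply: cvgV; first by rewrite lt0r_neq0 // ltr_wpDl.
by apply: cvgD h _; exact: cvg_cst.
Qed.

Lemma en_bnd n (x : E) : `|en n x| <= d^-1.
Proof. by have /andP[h1 h2] := inv_bnd (ip_ge0 (psin n ^~ x)); rewrite ger0_norm // ltW. Qed.

Let G p := rho p ^+ 2 * sqd p.

Let Rn n : R := 2^-1 * \I_p (en n p^S * (conv (s n) G p^S - wn n p^S)).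

Lemma en_G_cvg F : pL1 F -> \I_p (en n p^S * F p) @[n --> \oo] --> \I_p (e p * F p).
Proof.
move=> iF; have mF : pmeas F by case: iF.
apply: (proj2 (@pint_dct (fun n p => en n p^S * F p) (fun p => e p * F p) (fun p => d^-1 * `|F p|) _ _ _ _ _)).
- by move=> n; apply: pmeasM => //; case: (AlgL1 (Alg_en n)).
- by apply: pmeasM => //; exact: me.
- by apply: paeS en_cvg => p _ h; apply: cvgM h _; exact: cvg_cst.
- by apply: pL1Z; exact: pL1n.
- by move=> n p _; rewrite normrM; apply: ler_wpM2r => //; exact: en_bnd.
Qed.

Lemma en_conv_cvg F : pL1 F -> \I_p (en n p^S * conv (s n) F p^S) @[n --> \oo] --> \I_p (e p * F p).
Proof.
move=> iF; have [_ _ h] := L1cvg_sub hs (conv_cvg iF).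
have i1 n : pL1 (fun p => en n p^S * F p) by exact: L1Mct (Alg_cont2 (Alg_en n)) iF.
have i2 n : pL1 (fun p => en n p^S * conv (s n) F p^S) by exact: (AlgL1 (AlgM (Alg_en n) (conv_Alg (s n) iF))).
have e1 n : \I_p (en n p^S * conv (s n) F p^S) =
 \I_p (en n p^S * F p) + \I_p (en n p^S * (conv (s n) F p^S - F p)).
 rewrite -pintD //; first by eqp; rewrite mulrBr addrC subrK.
 by apply: (eqL1 _ (pL1B (i2 n) (i1 n))) => p _; rewrite mulrBr.
rewrite (funext e1) -[X in _ --> X]addr0; apply: cvgD; first exact: en_G_cvg.
apply: (@cvg_dist_le _ (fun n => d^-1 * \I_p (`|conv (s n) F p^S - F p|))); last first.
 by rewrite -[X in _ --> X](mulr0 d^-1); apply: cvgM h; exact: cvg_cst.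
move=> n; have i3 := pL1B (conv_L1 (s n) iF) iF.
rewrite subr0 -pintZ; last exact: pL1n.
have i4 : pL1 (fun p => en n p^S * (conv (s n) F p^S - F p)) by exact: L1Mct (Alg_cont2 (Alg_en n)) i3.
apply: (le_trans (le_norm_pint i4)); apply: le_pint; [exact: pL1n|by apply: pL1Z; exact: pL1n|].
by move=> p _; rewrite normrM; apply: ler_wpM2r => //; exact: en_bnd.
Qed.

Lemma en_wn_cvg : \I_p (en n p^S * wn n p^S) @[n --> \oo] --> \I_p (e p * sqd p).
Proof.
have mW : pmeas sqd by case: sqd_pL1.
apply: (proj2 (@pint_dct (fun n p => en n p^S * wn n p^S) (fun p => e p * sqd p) (fun _ => 1) _ _ _ _ _)).
- by move=> n; case: (AlgL1 (AlgM (Alg_en n) (Alg_wn n))).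
- by apply: pmeasM => //; exact: me.
- by apply: paeS (paeI en_cvg wn_cvg) => p _ [h1 h2]; exact: cvgM h1 h2.
- exact: pL1C.
- move=> n p _; have h0 : 0 <= wn n p^S by exact: ip_ge0.
 rewrite /en; move: (wn _ _) h0 => a a0; have h : 0 < a + d by exact: ltr_wpDl.
 rewrite ger0_norm; last by apply: mulr_ge0 => //; rewrite invr_ge0 ltW.
 by rewrite mulrC ler_pdivrMr // mul1r lerDl ltW.
Qed.

Lemma Alg_Bq (f : spf) : (forall i, Alg (f i)) -> Alg (fun x => Bq (gr f x) (gr f x)).
Proof.
move=> af; have a1 : Alg (fun x => \sum_k ip (gr f x k) (gr f x k)).
 by apply: Alg_sum => k; apply: (@Alg_ip (fun i => Xd k (f i)) (fun i => Xd k (f i))) => i; exact: Alg_Xd.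
have aT i := Alg_Tf i af.
apply: (Alg_ext (AlgB a1 (AlgM (AlgC 2^-1) (Alg_ip aT aT)))) => x _.
by rewrite /Bq; congr (_ - _ * _); apply: eq_bigr => i _; rewrite !Tf_tr.
Qed.

Lemma Rn_cvg : Rn n @[n --> \oo] --> rlim.
Proof.
have iw n : pL1 (fun p => en n p^S * wn n p^S) := AlgL1 (AlgM (Alg_en n) (Alg_wn n)).
have ic n : pL1 (fun p => en n p^S * conv (s n) G p^S) := AlgL1 (AlgM (Alg_en n) (conv_Alg (s n) rsqd_pL1)).
have ie F : pL1 F -> pL1 (fun p => e p * F p).
 move=> iF; apply: (pL1_Mbounded (C := d^-1) me _ iF) => p _.
 by have /andP[h1 h2] := inv_bnd (sqd_ge0 p); rewrite ger0_norm // ltW.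
have e1 n : Rn n = 2^-1 * (\I_p (en n p^S * conv (s n) G p^S) - \I_p (en n p^S * wn n p^S)).
 by rewrite -pintB // /Rn; congr (_ * _); eqp; rewrite mulrBr.
have e2 : rlim = 2^-1 * (\I_p (e p * G p) - \I_p (e p * sqd p)).
 rewrite -pintB; [|exact: ie rsqd_pL1|exact: ie sqd_pL1].
 by rewrite /rlim; congr (_ * _); eqp; rewrite mulrBr.
rewrite (funext e1) e2; apply: cvgM; first exact: cvg_cst.
by apply: cvgB; [exact: en_conv_cvg rsqd_pL1|exact: en_wn_cvg].
Qed.

Let chi n : spf := fun i x => en n x * psin n i x.

(** [D] of the mollified spinor is the mollification of [rho Psi], and Jensen's inequality bounds
    its square by the mollification of [rho^2 |Psi|^2]. *)
Lemma baer_le n :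
 \I_p ((wn n p^S + d) * Bq (gr (chi n) p^S) (gr (chi n) p^S) + d / 2 * ((wn n p^S + d) * \sum_k Xd k (en n) p^S ^+ 2)) <= Rn n.
Proof.
have ap := Alg_psin n.
have := baer_identity ap d0; rewrite -/(en n) => ->; rewrite /Rn; apply: ler_wpM2l; first by rewrite invr_ge0.
have aD i := Alg_Df i ap.
apply: le_pint.
- exact: AlgL1 (AlgM (Alg_en n) (AlgB (Alg_ip aD aD) (Alg_ip ap ap))).
- exact: AlgL1 (AlgM (Alg_en n) (AlgB (conv_Alg (s n) rsqd_pL1) (Alg_wn n))).
move=> p _; apply: ler_wpM2l; first by have /andP[/ltW] := inv_bnd (ip_ge0 (psin n ^~ p^S)).
rewrite lerD2r; have hx := sphS p.
apply: (@le_trans _ _ (\sum_i conv (s n) (fun p => rho p ^+ 2 * Psi i p ^+ 2) p^S)).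
 apply: ler_sum => i _; rewrite /psin (wD_conv (s n) i hw hx) -expr2.
 have i2 : pL1 (fun p => (rho p * Psi i p) ^+ 2) by apply: eqL1 (iT2 i) => q _; rewrite exprMn.
 apply: (le_trans (conv_sqr_le (s n) (iT i) i2 hx)); apply: eq_lerW.
 by apply: eq_conv => q _; rewrite exprMn.
rewrite -conv_sum // le_eqVlt; apply/orP; left; apply/eqP; apply: eq_conv => q _.
by rewrite /G /sqd mulr_sumr; apply: eq_bigr => i _; rewrite expr2.
Qed.

Lemma Bq_chi_ge0 n (x : E) : sphere x -> 0 <= (wn n x + d) * Bq (gr (chi n) x) (gr (chi n) x).
Proof.
move=> hx; apply: mulr_ge0; first by rewrite addr_ge0 ?ip_ge0 // ltW.
by apply: (Bq_sos hx) => i; apply: gr_tangent => // j; exact: AlgM (Alg_en n) (Alg_psin n j).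
Qed.

Lemma dXe_ge0 n (x : E) : 0 <= d / 2 * ((wn n x + d) * \sum_k Xd k (en n) x ^+ 2).
Proof.
apply: mulr_ge0; first by rewrite divr_ge0 // ltW.
apply: mulr_ge0; first by rewrite addr_ge0 ?ip_ge0 // ltW.
by apply: sumr_ge0 => k _; exact: sqr_ge0.
Qed.

Lemma pL1_Bq (f g : spf) (h : E -> R) : (forall i, Alg (f i)) -> (forall i, Alg (g i)) -> Alg h ->
 pL1 (fun p => h p^S * Bq (gr f p^S) (gr g p^S)).
Proof.
move=> af ag ah; have a1 : Alg (fun x => \sum_k ip (gr f x k) (gr g x k)).
 by apply: Alg_sum => k; apply: (@Alg_ip (fun i => Xd k (f i)) (fun i => Xd k (g i))) => i; exact: Alg_Xd.
have aT i := Alg_Tf i af; have aT' i := Alg_Tf i ag.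
apply: (eqL1 _ (AlgL1 (AlgM ah (AlgB a1 (AlgM (AlgC 2^-1) (Alg_ip aT aT')))))) => p _.
by rewrite /Bq; congr (_ * (_ - _ * _)); apply: eq_bigr => i _; rewrite !Tf_tr.
Qed.

Let ac n i : Alg (chi n i). Proof. exact: AlgM (Alg_en n) (Alg_psin n i). Qed.

Lemma pL1_grade n : pL1 (fun p => d / 2 * ((wn n p^S + d) * \sum_k Xd k (en n) p^S ^+ 2)).
Proof.
have aS : Alg (fun x => \sum_k Xd k (en n) x ^+ 2) by apply: Alg_sum => k; exact: AlgXn 2 (Alg_Xd k (Alg_en n)).
by apply: pL1Z; exact: (AlgL1 (AlgM (AlgD (Alg_wn n) (AlgC d)) aS)).
Qed.

Lemma rlim_ge0 : 0 <= rlim.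
Proof.
rewrite -(cvg_lim _ Rn_cvg) //; apply: limr_ge; first by apply/cvg_ex; eexists; exact: Rn_cvg.
apply: nearW => n; apply: le_trans (baer_le n); apply: pint_ge0 => p _; apply: addr_ge0; last exact: dXe_ge0.
exact: Bq_chi_ge0 (sphS p).
Qed.

Lemma en_q n (x : E) : 0 <= d * en n x <= 1.
Proof.
have /andP[h1 h2] := inv_bnd (ip_ge0 (psin n ^~ x)); apply/andP; split; first by rewrite mulr_ge0 // ltW.
by rewrite -(mulfV (lt0r_neq0 d0)); apply: ler_wpM2l => //; exact: ltW.
Qed.

Lemma hq_cvg (h : R -> R) (C : R) (f : E -> R) : continuous h -> (forall t, 0 <= t <= 1 -> `|h t| <= C) -> Alg f ->
 \I_p (h (d * en n p^S) * f p^S) @[n --> \oo] --> \I_p (h (d * e p) * f p^S).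
Proof.
move=> ch hC af; have [mf jf] := AlgL1 af; have mh F : pmeas F -> pmeas (fun p => h (d * F p)).
 by move=> mF; apply: pmeas_ct => //; apply: pmeasM mF; exact: pmeasC.
apply: (proj2 (@pint_dct (fun n p => h (d * en n p^S) * f p^S) (fun p => h (d * e p) * f p^S) (fun p => C * `|f p^S|) _ _ _ _ _)).
- by move=> n; apply: pmeasM mf; apply: mh; case: (AlgL1 (Alg_en n)).
- by apply: pmeasM mf; apply: mh; exact: me.
- apply: paeS en_cvg => p _ hp; apply: cvgM; last exact: cvg_cst.
 by apply: cvg_ctf => //; apply: cvgM hp; exact: cvg_cst.
- by apply: pL1Z; apply: pL1n; exact: AlgL1.
- by move=> n p _; rewrite normrM; apply: ler_wpM2r => //; apply: hC; exact: en_q.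
Qed.

(** Cauchy-Schwarz against the term with factor [d / 2] of the identity, using [n e = 1]. As [d]
    tends to 0, [d e] becomes the indicator of the zero set of [Psi], and the weight [8 t (1 - t)^2]
    on the right vanishes at both values [t = 0] and [t = 1]. *)
Lemma ucp_level k f : Alg f -> \I_p ((1 - d * e p) ^+ 2 * Xd k f p^S) ^+ 2 <=
 rlim * \I_p (8 * (d * e p) * (1 - d * e p) ^+ 2 * f p^S ^+ 2).
Proof.
move=> af; have af2 := AlgXn 2 af.
have l1 := @hq_cvg _ 1 _ continuous_1m2 _ (Alg_Xd k af); have l2 := @hq_cvg _ 8 _ continuous_q1m2 _ af2.
apply: (@cvg_le_sqr (fun n => \I_p ((1 - d * en n p^S) ^+ 2 * Xd k f p^S)) Rn
 (fun n => \I_p (8 * (d * en n p^S) * (1 - d * en n p^S) ^+ 2 * f p^S ^+ 2))); last 3 first.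
- apply: l1 => t /andP[t0 t1]; rewrite ger0_norm ?sqr_ge0 //; apply: exprn_ile1; lra.
- exact: Rn_cvg.
- apply: l2 => t /andP[t0 t1]; have t2 : 0 <= (1 - t) ^+ 2 <= 1 by rewrite sqr_ge0 /=; apply: exprn_ile1; lra.
 by move: ((1 - t) ^+ 2) t2 => a /andP[a0 a1]; rewrite ger0_norm ?mulr_ge0 //; nra.
move=> n; have ae := Alg_en n; have a1 : Alg (fun x => 1 - d * en n x) := AlgB (AlgC 1) (AlgM (AlgC d) ae).
have e1 (x : E) : sphere x -> Xd k (fun x => (1 - d * en n x) ^+ 2) x = - (2 * (1 - d * en n x) * d * Xd k (en n) x).
 move=> hx; rewrite (Xd_exp k 2 a1 hx) XdB; [|exact: AlgC1 (AlgC 1)|exact: AlgC1 (AlgM (AlgC d) ae)|exact: hx].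
 by rewrite Xd_cst (XdZ k d (AlgC1 ae) hx) /= expr1; move: (Xd _ _ _) (en n x) => *; ring.
have -> : \I_p ((1 - d * en n p^S) ^+ 2 * Xd k f p^S) = \I_p (2 * (1 - d * en n p^S) * d * Xd k (en n) p^S * f p^S).
 have aQ := AlgM (Alg_Xd k (AlgXn 2 a1)) af.
 have := pint_Xd_ibp k (AlgXn 2 a1) af; move/eqP; rewrite -eqr_oppLR => /eqP <-.
 by rewrite -pintN; [eqp; rewrite (e1 _ (sphS p)) mulNr opprK|exact: (AlgL1 aQ)].
apply: (@le_trans _ _ (\I_p (d / 2 * ((wn n p^S + d) * \sum_k Xd k (en n) p^S ^+ 2)) * \I_p (8 * (d * en n p^S) * (1 - d * en n p^S) ^+ 2 * f p^S ^+ 2))).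
 apply: pint_CS.
 - exact: pL1_grade.
 - by apply: (AlgL1 (AlgM (AlgM (AlgM (AlgM (AlgC 2) a1) (AlgC d)) (Alg_Xd k ae)) af)).
 - by apply: (AlgL1 (AlgM (AlgM (AlgM (AlgC 8) (AlgM (AlgC d) ae)) (AlgXn 2 a1)) af2)).
 - by move=> p _; exact: dXe_ge0.
 - move=> p _; have /andP[q0 _] := en_q n p^S.
  by apply: mulr_ge0; [apply: mulr_ge0; [exact: mulr_ge0|exact: sqr_ge0]|exact: sqr_ge0].
 move=> p _; have w0 := ip_ge0 (psin n ^~ p^S).
 have hk : Xd k (en n) p^S ^+ 2 <= \sum_k Xd k (en n) p^S ^+ 2 by rewrite (bigD1 k) //= lerDl; apply: sumr_ge0 => j _; exact: sqr_ge0.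
 have wd : (wn n p^S + d) * en n p^S = 1 by rewrite mulfV // lt0r_neq0 // ltr_wpDl.
 move: (\sum_k _) (Xd k _ _) (wn n p^S + d) (en n p^S) (f p^S) hk wd => S X a b c hk wd.
 have -> : d / 2 * (a * S) * (8 * (d * b) * (1 - d * b) ^+ 2 * c ^+ 2) = (a * b) * ((2 * (1 - d * b) * d * c) ^+ 2 * S) by field.
 rewrite wd mul1r (_ : 2 * (1 - d * b) * d * X * c = 2 * (1 - d * b) * d * c * X); last by ring.
 by rewrite exprMn; apply: ler_wpM2l => //; exact: sqr_ge0.
apply: ler_wpM2r.
 apply: pint_ge0 => p _; have /andP[q0 _] := en_q n p^S.
 by apply: mulr_ge0; [apply: mulr_ge0; [exact: mulr_ge0|exact: sqr_ge0]|exact: sqr_ge0].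
apply: le_trans (baer_le n); rewrite pintD; [|exact: pL1_Bq (ac n) (ac n) (AlgD (Alg_wn n) (AlgC d))|exact: pL1_grade].
by rewrite lerDr; apply: pint_ge0 => p _; exact: Bq_chi_ge0 (sphS p).
Qed.

(** The operator of the form [Bq], that is [1/2 T (T + 2)]; see [pint_Bq]. *)
Definition Lop (f : spf) : spf := fun i x => 2^-1 * Tf (Tf f) i x + Tf f i x.

Lemma pint_Bq (f g : spf) : (forall i, Alg (f i)) -> (forall i, Alg (g i)) ->
 \I_p (Bq (gr f p^S) (gr g p^S)) = \I_p (ip (f ^~ p^S) (Lop g ^~ p^S)).
Proof.
move=> af ag; have aT i := Alg_Tf i af; have aT' i := Alg_Tf i ag; have aTT i := Alg_Tf i aT'.
have j1 := AlgL1 (Alg_ip aT aT'); have j2 := AlgL1 (Alg_ip aT ag).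
have j3 : pL1 (fun p => \sum_k ip (gr f p^S k) (gr g p^S k)).
 by apply: pL1S => k; apply: (AlgL1 (@Alg_ip (fun i => Xd k (f i)) (fun i => Xd k (g i)) _ _)) => i; exact: Alg_Xd.
have j4 := AlgL1 (Alg_ip af aT'); have j5 := AlgL1 (Alg_ip af aTT).
transitivity (\I_p (\sum_k ip (gr f p^S k) (gr g p^S k)) - 2^-1 * \I_p (ip (Tf f ^~ p^S) (Tf g ^~ p^S))).
 rewrite -pintZ // -pintB //; last exact: pL1Z.
 by eqp; rewrite /Bq; congr (_ - _ * _); apply: eq_bigr => i _; rewrite !Tf_tr.
rewrite (green af ag) pintD // -(Tf_sym af aT') -(Tf_sym af ag).
rewrite -pintD // -pintZ // -pintB; [|exact: pL1D|exact: pL1Z].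
eqp; rewrite !ipE /Lop; by field.
Qed.

(** Cauchy-Schwarz for the nonnegative form [Bq] with weights [n] and [e = 1 / n]. When [rlim] tends
    to 0, it says that [Psi / |Psi|^2] solves [Lop = 0] weakly. *)
Lemma eq_level (f : spf) : (forall i, Alg (f i)) ->
 \I_p (ip (fun i => e p * Psi i p) (Lop f ^~ p^S)) ^+ 2 <= rlim * \I_p (e p * Bq (gr f p^S) (gr f p^S)).
Proof.
move=> af; have aL i : Alg (Lop f i).
 by apply: AlgD (Alg_Tf i af); apply: AlgM (AlgC _) _; apply: Alg_Tf => j; exact: Alg_Tf.
have iB : pL1 (fun p => Bq (gr f p^S) (gr f p^S)).
 by apply: (eqL1 _ (pL1_Bq af af (AlgC 1))) => p _; rewrite mul1r.
apply: (@cvg_le_sqr (fun n => \I_p (ip (chi n ^~ p^S) (Lop f ^~ p^S))) Rn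
 (fun n => \I_p (en n p^S * Bq (gr f p^S) (gr f p^S)))); last 3 first.
- have ie i : pL1 (fun p => e p * (Psi i p * Lop f i p^S)).
  apply: (pL1_Mbounded (C := d^-1) me) => [p _|]; last exact: L1MAlg (iP i) (aL i).
  by have /andP[q1 q2] := inv_bnd (sqd_ge0 p); rewrite ger0_norm // ltW.
 have -> : \I_p (ip (fun i => e p * Psi i p) (Lop f ^~ p^S)) = \sum_i \I_p (e p * (Psi i p * Lop f i p^S)).
  by rewrite -pintS //; eqp; apply: eq_bigr => i _; rewrite mulrA.
 have e2 n : \I_p (ip (chi n ^~ p^S) (Lop f ^~ p^S)) = \sum_i \I_p (en n p^S * (conv (s n) (Psi i) p^S * Lop f i p^S)).
  rewrite -pintS; last by move=> i; apply: (AlgL1 (AlgM (Alg_en n) (AlgM (Alg_psin n i) (aL i)))).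
  by eqp; apply: eq_bigr => i _; rewrite /chi mulrA.
 rewrite (funext e2); apply: cvg_sumf => i.
 have iPL := L1MAlg (iP i) (aL i); have iA n : pL1 (fun p => conv (s n) (Psi i) p^S * Lop f i p^S) := AlgL1 (AlgM (Alg_psin n i) (aL i)).
 have e3 n : \I_p (en n p^S * (conv (s n) (Psi i) p^S * Lop f i p^S)) =
  \I_p (en n p^S * (Psi i p * Lop f i p^S)) + \I_p (en n p^S * (conv (s n) (Psi i) p^S * Lop f i p^S - Psi i p * Lop f i p^S)).
  rewrite -pintD; [|exact: L1Mct (Alg_cont2 (Alg_en n)) iPL|exact: L1Mct (Alg_cont2 (Alg_en n)) (pL1B (iA n) iPL)].
  by eqp; rewrite mulrBr addrC subrK.
 rewrite (funext e3) -[X in _ --> X]addr0; apply: cvgD; first exact: en_G_cvg.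
 have [_ _ h] := L1cvg_sub hs (conv_cvg (iP i)); have [C hC] := cont2_bounded (Alg_cont2 (aL i)).
 apply: (@cvg_dist_le _ (fun n => d^-1 * C * \I_p (`|conv (s n) (Psi i) p^S - Psi i p|))); last first.
  by rewrite -[X in _ --> X](mulr0 (d^-1 * C)); apply: cvgM h; exact: cvg_cst.
 move=> n; have i3 := pL1B (conv_L1 (s n) (iP i)) (iP i).
 rewrite subr0 -pintZ; last exact: pL1n.
 have i4 := L1Mct (Alg_cont2 (Alg_en n)) (pL1B (iA n) iPL).
 apply: (le_trans (le_norm_pint i4)); apply: le_pint; [exact: pL1n|by apply: pL1Z; exact: pL1n|].
 move=> p hp; rewrite -mulrBl !normrM -mulrA [C * _]mulrC; apply: ler_pM => //; first exact: en_bnd.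
 by apply: ler_wpM2l => //; exact: hC.
- exact: Rn_cvg.
- exact: en_G_cvg.
move=> n; rewrite -(pint_Bq (ac n) af).
have i1 := pL1_Bq (ac n) (ac n) (AlgD (Alg_wn n) (AlgC d)).
have i2 : pL1 (fun p => Bq (gr (chi n) p^S) (gr f p^S)).
 by apply: (eqL1 _ (pL1_Bq (ac n) af (AlgC 1))) => p _; rewrite mul1r.
have t1 p i := gr_tangent i (ac n) (sphS p); have t2 p i := gr_tangent i af (sphS p).
have b0 p : 0 <= en n p^S * Bq (gr f p^S) (gr f p^S).
 by apply: mulr_ge0; [rewrite invr_ge0 addr_ge0 ?ip_ge0 // ltW|exact: Bq_sos (sphS p) (t2 p)].
apply: (@le_trans _ _ (\I_p ((wn n p^S + d) * Bq (gr (chi n) p^S) (gr (chi n) p^S)) * \I_p (en n p^S * Bq (gr f p^S) (gr f p^S)))).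
 apply: (pint_CS i1 i2 (pL1_Bq af af (Alg_en n))) => p _; [exact: Bq_chi_ge0 (sphS p)|exact: b0|].
 rewrite mulrACA mulfV; last by rewrite lt0r_neq0 // ltr_wpDl // ip_ge0.
 by rewrite mul1r; exact: Bq_CS (sphS p) (t1 p) (t2 p).
apply: ler_wpM2r; first by apply: pint_ge0 => p _; exact: b0.
apply: le_trans (baer_le n); rewrite pintD; [|exact: i1|exact: pL1_grade].
by rewrite lerDl; apply: pint_ge0 => p _; exact: dXe_ge0.
Qed.

Lemma rlimE : rlim = 2^-1 * \I_p ((1 - d * e p) * (rho p ^+ 2 - 1)).
Proof.
congr (_ * _); eqp; rewrite /e.
have : sqd p + d != 0 by rewrite lt0r_neq0 // ltr_wpDl.
by move: (sqd p) => a ha; field.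
Qed.

End Level.

Let dm (m : nat) : R := m.+1%:R^-1.

Let dm0 m : 0 < dm m. Proof. by rewrite invr_gt0. Qed.

(** The limit of [d e] as [d] tends to 0. *)
Let z (p : R * R) : R := \1_[set 0] (sqd p).

Let zE p : z p = (sqd p == 0)%:R.
Proof. by rewrite /z indicE; case: eqP => h; [rewrite h mem_set|rewrite memNset]. Qed.

Lemma q_cvg p : dm m * (sqd p + dm m)^-1 @[m --> \oo] --> z p.
Proof.
rewrite zE; have [->|w0] := eqVneq (sqd p) 0.
 rewrite (_ : (fun m => _) = (fun _ => 1)); first exact: cvg_cst.
 by apply/funext => m; rewrite add0r mulfV // lt0r_neq0.
rewrite [X in _ --> X](_ : _ = 0 * (sqd p + 0)^-1); last by rewrite mul0r.
apply: cvgM; first exact: cvg_harmonic.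
apply: cvgV; first by rewrite addr0.
by apply: cvgD; [exact: cvg_cst|exact: cvg_harmonic].
Qed.

Lemma q_itv m p : 0 <= dm m * (sqd p + dm m)^-1 <= 1.
Proof.
have h : 0 < sqd p + dm m by rewrite ltr_wpDl.
apply/andP; split; first by apply: mulr_ge0; [exact: ltW|rewrite invr_ge0 ltW].
by rewrite ler_pdivrMr // mul1r lerDr.
Qed.

Lemma hz_cvg (h : R -> R) (C : R) F : continuous h -> (forall t, 0 <= t <= 1 -> `|h t| <= C) -> pL1 F ->
 \I_p (h (dm m * (sqd p + dm m)^-1) * F p) @[m --> \oo] --> \I_p (h (z p) * F p).
Proof.
move=> ch hC iF; have mF : pmeas F by case: iF.
have mW : pmeas sqd by case: sqd_pL1.
apply: (proj2 (@pint_dct (fun m p => h (dm m * (sqd p + dm m)^-1) * F p) (fun p => h (z p) * F p) (fun p => C * `|F p|) _ _ _ _ _)).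
- move=> m; apply: pmeasM mF; apply: pmeas_ct => //; apply: pmeasM; [exact: pmeasC|exact: pmeas_inv].
- apply: pmeasM mF; apply: pmeas_ct => //; apply: (pmeas_comp (f := \1_[set (0 : R)])) => //.
- by apply: paeT => p _; apply: cvgM; [apply: cvg_ctf => //; exact: q_cvg|exact: cvg_cst].
- by apply: pL1Z; exact: pL1n.
- by move=> m p _; rewrite normrM; apply: ler_wpM2r => //; apply: hC; exact: q_itv.
Qed.

(** Every mollification has zero derivatives, hence is constant, and all of them have the mean of
    [F]. *)
Lemma wgrad0_cst (F : R * R -> R) : pL1 F -> (forall k (f : E -> R), Alg f -> \I_p (F p * Xd k f p^S) = 0) ->
 pae (fun p => F p = pint F / (4 * pi)).
Proof.
move=> iF hF; have pi4 : 4 * pi != 0 :> R by rewrite mulf_neq0 ?pnatr_eq0 // gt_eqF ?pi_gt0.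
have e N p : conv N F p^S = pint F / (4 * pi).
 have ac : C1s (conv N F) := AlgC1 (conv_Alg N iF).
 have hq q : conv N F q^S = conv N F p^S.
  apply: Xd0_cst ac _ q p => k x hx; rewrite (@conv_wderiv N F (fun _ => 0) k x iF (pL1C 0) hx) => [|f af].
   exact: conv_cst.
  by rewrite hF // oppr0 -[RHS](pint0); eqq; rewrite mul0r.
 apply: (mulIf pi4); rewrite divfK // -pint_cst -(pint_conv N iF); eqq; exact: esym (hq q).
have [_ _ h] := conv_cvg iF.
have i1 : pL1 (fun p => `|F p - pint F / (4 * pi)|) by apply: pL1n; apply: pL1B iF _; exact: pL1C.
have : \I_p (`|F p - pint F / (4 * pi)|) = 0.
 have e2 : (fun N => \I_p (`|conv N F p^S - F p|)) = (fun _ => \I_p (`|F p - pint F / (4 * pi)|)).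
  by apply/funext => N; eqp; rewrite e distrC.
 by rewrite e2 in h; rewrite -(cvg_lim _ h) // lim_cst.
move=> h0; apply: paeS (pint_eq0_ae i1 (fun p _ => normr_ge0 _) h0) => p _ /eqP.
by rewrite normr_eq0 subr_eq0 => /eqP.
Qed.

Hypothesis hnt : ~ pae (fun p => sqd p = 0).

Lemma seq_ex : exists2 s : nat -> nat, (forall n, (n <= s n)%N) &
 pae (fun p => forall i, conv (s n) (Psi i) p^S @[n --> \oo] --> Psi i p).
Proof. exact: conv_subseq. Qed.

Lemma rlim_dm_cvg : rlim (dm m) @[m --> \oo] --> 2^-1 * \I_p ((1 - z p) * (rho p ^+ 2 - 1)).
Proof.
rewrite (funext (fun m => rlimE (dm0 m))); apply: cvgM; first exact: cvg_cst.
apply: (@hz_cvg (fun t => 1 - t) 1); last by apply: pL1B ir2 _; exact: pL1C.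
 exact: continuous_1m.
by move=> t /andP[t0 t1]; rewrite ger0_norm; lra.
Qed.

(** In the limit of [ucp_level] the indicator of the set where [Psi] is nonzero has zero weak
    gradient. It is therefore constant, and the constant is 1 because [Psi] is not trivial. *)
Lemma unique_continuation : pae (fun p => sqd p != 0).
Proof.
have [s hs has] := seq_ex; have c1 := continuous_1m2.
have h0 k f : Alg f -> \I_p ((1 - z p) ^+ 2 * Xd k f p^S) = 0.
 move=> af; have af2 := AlgXn 2 af.
 have l1 := @hz_cvg (fun t => (1 - t) ^+ 2) 1 (fun p => Xd k f p^S) c1 _ (AlgL1 (Alg_Xd k af)).
 have l2 := @hz_cvg (fun t => 8 * t * (1 - t) ^+ 2) 8 (fun p => f p^S ^+ 2) _ _ (AlgL1 af2).
 have h := @cvg_le_sqr _ _ _ _ _ _ (fun m => ucp_level (dm0 m) hs has k af) (l1 _) rlim_dm_cvg (l2 _ _).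
 apply/eqP; rewrite -sqrf_eq0 eq_le sqr_ge0 andbT; apply: (le_trans (h _ _ _)).
 - by move=> t /andP[t0 t1]; rewrite ger0_norm ?sqr_ge0 //; apply: exprn_ile1; lra.
 - exact: continuous_q1m2.
 - move=> t /andP[t0 t1]; have t2 : 0 <= (1 - t) ^+ 2 <= 1 by rewrite sqr_ge0 /=; apply: exprn_ile1; lra.
  by move: ((1 - t) ^+ 2) t2 => a /andP[a0 a1]; rewrite ger0_norm ?mulr_ge0 //; nra.
 rewrite [X in _ * X](_ : _ = 0) ?mulr0 // -[RHS](pint0); eqp; rewrite zE.
 by case: eqP => _; rewrite /= ?subrr ?expr0n /= ?mulr0 ?mul0r.
pose F p := (1 - z p) ^+ 2.
have zv p : F p = (sqd p != 0)%:R by rewrite /F zE; case: eqP; rewrite /= ?subrr ?expr0n // subr0 expr1n.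
have iF : pL1 F.
 apply: (@pL1_bounded _ 1); last by move=> p _; rewrite zv; case: (_ != _); rewrite /= ?normr1 ?normr0.
 apply: (pmeas_ct (f := fun t => (1 - t) ^+ 2)); first exact: c1.
 by apply: (pmeas_comp (f := \1_[set (0 : R)])) => //; case: sqd_pL1.
have hF := wgrad0_cst iF h0; set c := pint F / _ in hF.
have [c1'|c1'] := eqVneq c 1.
 apply: paeS hF => p _; rewrite zv c1'; case: (_ != _) => //= /eqP.
 by rewrite eq_sym oner_eq0.
exfalso; apply: hnt; apply: paeS hF => p _; rewrite zv; case: eqP => //= _ h.
by rewrite -h eqxx in c1'.
Qed.

Let paez : pae (fun p => z p = 0).
Proof. by apply: paeS unique_continuation => p _ h; rewrite zE (negbTE h). Qed.

Lemma rlim_dm_lim : rlim (dm m) @[m --> \oo] --> 2^-1 * (\I_p (rho p ^+ 2) - 4 * pi).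
Proof.
suff <- : \I_p ((1 - z p) * (rho p ^+ 2 - 1)) = \I_p (rho p ^+ 2) - 4 * pi by exact: rlim_dm_cvg.
have i1 : pL1 (fun p => rho p ^+ 2 - 1) by apply: pL1B ir2 _; exact: pL1C.
transitivity (\I_p (rho p ^+ 2 - 1)); last by rewrite pintB ?pint_cst ?mul1r //; exact: pL1C.
apply: ae_eq_pint; [|by case: i1|by apply: paeS paez => p _ ->; rewrite subr0 mul1r].
apply: pmeasM; last by case: i1.
apply: pmeasB; first exact: pmeasC.
by apply: (pmeas_comp (f := \1_[set (0 : R)])) => //; case: sqd_pL1.
Qed.

Theorem baer_bound : 4 * pi <= \I_p (rho p ^+ 2).
Proof.
have [s hs has] := seq_ex.
rewrite -subr_ge0 -(pmulr_rge0 _ (_ : 0 < 2^-1)) ?invr_gt0 // -(cvg_lim _ rlim_dm_lim) //.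
apply: limr_ge; first by apply/cvg_ex; eexists; exact: rlim_dm_lim.
by apply: nearW => m; exact: (@rlim_ge0 _ (dm0 m) s hs has).
Qed.

Lemma einv_cvg F : pmeas (fun p => (sqd p)^-1) -> pL1 (fun p => `|(sqd p)^-1 * F p|) -> pmeas F ->
 \I_p ((sqd p + dm m)^-1 * F p) @[m --> \oo] --> \I_p ((sqd p)^-1 * F p).
Proof.
move=> mV iVF mF; have mW : pmeas sqd by case: sqd_pL1.
have mz : pmeas z by apply: (pmeas_comp (f := \1_[set (0 : R)])).
have me' m : pmeas (fun p => (sqd p + dm m)^-1) by exact: pmeas_inv.
pose g m p : R := (1 - z p) * ((sqd p + dm m)^-1 * F p).
have ge m : \I_p ((sqd p + dm m)^-1 * F p) = pint (g m).
 apply: ae_eq_pint; [exact: pmeasM|by apply: pmeasM; [apply: pmeasB => //; exact: pmeasC|exact: pmeasM]|].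
 by apply: paeS paez => p _ h; rewrite /g h subr0 mul1r.
have ecvg p : z p = 0 -> (sqd p + dm m)^-1 @[m --> \oo] --> (sqd p)^-1.
 rewrite zE; case: eqP => [_ /eqP|/eqP h _]; first by rewrite oner_eq0.
 apply: cvgV => //; rewrite -[X in _ --> X]addr0; apply: cvgD; [exact: cvg_cst|exact: cvg_harmonic].
rewrite (funext ge).
have : pint (g m) @[m --> \oo] --> \I_p ((1 - z p) * ((sqd p)^-1 * F p)).
 have m1 : pmeas (fun p => (1 - z p) * ((sqd p)^-1 * F p)).
  by apply: pmeasM; [apply: pmeasB => //; exact: pmeasC|exact: pmeasM].
 apply: (proj2 (@pint_dct g _ (fun p => `|(sqd p)^-1 * F p|) _ m1 _ iVF _)).
 - by move=> m; apply: pmeasM; [apply: pmeasB => //; exact: pmeasC|exact: pmeasM].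
 - apply: paeS paez => p _ h; apply: cvgM; first exact: cvg_cst.
  by apply: cvgM (ecvg p h) _; exact: cvg_cst.
 move=> m p _; rewrite /g zE; case: eqP => [w|/eqP w]; first by rewrite subrr mul0r normr0.
 have w0 : 0 < sqd p by rewrite lt_neqAle eq_sym w /=; exact: sqd_ge0.
 have w1 : 0 < sqd p + dm m by exact: addr_gt0.
 rewrite subr0 mul1r !normrM; apply: ler_wpM2r => //.
 rewrite ger0_norm; last by rewrite invr_ge0 ltW.
 rewrite ger0_norm; last by rewrite invr_ge0 ltW.
 by rewrite lef_pV2 ?posrE // lerDl ltW.
move=> h; rewrite (_ : \I_p ((sqd p)^-1 * F p) = \I_p ((1 - z p) * ((sqd p)^-1 * F p))) //.
apply: ae_eq_pint; [exact: pmeasM|by apply: pmeasM; [apply: pmeasB => //; exact: pmeasC|exact: pmeasM]|].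
by apply: paeS paez => p _ hz; rewrite hz subr0 mul1r.
Qed.

(** Integrability of [1 / |Psi|^2] lets [d] tend to 0 in [eq_level], and under equality the factor
    [rlim] on the right tends to 0. *)
Theorem baer_equality : \I_p (rho p ^+ 2) = 4 * pi -> pL1 (fun p => (sqd p)^-1) ->
 forall f : spf, (forall i, Alg (f i)) -> \I_p (ip (fun i => (sqd p)^-1 * Psi i p) (Lop f ^~ p^S)) = 0.
Proof.
move=> hr iV f af; have [s hs has] := seq_ex.
have aL i : Alg (Lop f i).
 by apply: AlgD (Alg_Tf i af); apply: AlgM (AlgC _) _; apply: Alg_Tf => j; exact: Alg_Tf.
have iB : pL1 (fun p => Bq (gr f p^S) (gr f p^S)).
 by apply: (eqL1 _ (pL1_Bq af af (AlgC 1))) => p _; rewrite mul1r.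
have mW : pmeas sqd by case: sqd_pL1.
have mV : pmeas (fun p => (sqd p)^-1) by case: iV.
have fL (F : R * R -> R) : pL1 (fun p => `|(sqd p)^-1 * F p|) -> pmeas F -> \I_p ((sqd p + dm m)^-1 * F p) @[m --> \oo] --> \I_p ((sqd p)^-1 * F p).
 by move=> i1 m1; exact: einv_cvg.
have vF (g : R * R -> R) (v : ix -> R) p : ip (fun i => g p * Psi i p) v = g p * ip (Psi ^~ p) v.
 by rewrite /ip mulr_sumr; apply: eq_bigr => i _; rewrite mulrA.
have iF : pL1 (fun p => (sqd p)^-1 * ip (Psi ^~ p) (Lop f ^~ p^S)).
 apply: (@eqL1 (fun p => \sum_i ((sqd p)^-1 * Psi i p) * Lop f i p^S)).
  by move=> p _; rewrite mulr_sumr; apply: eq_bigr => i _; rewrite mulrA.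
 apply: pL1S => i; apply: L1MAlg => //.
 apply: (@pL1_le _ (fun p => (sqd p)^-1 + 1)); [|move=> p _|by apply: pL1D iV _; exact: pL1C].
  by apply: pmeasM mV _; case: (iP i).
 have hi : Psi i p ^+ 2 <= sqd p by rewrite /sqd /ip (bigD1 i) //= -expr2 lerDl; apply: sumr_ge0 => j _; rewrite -expr2 sqr_ge0.
 have h0 := sqd_ge0 p; rewrite normrM ger0_norm ?invr_ge0 //.
 have [w0|w0] := eqVneq (sqd p) 0; first by rewrite w0 invr0 mul0r add0r ler01.
 have wp : 0 < sqd p by rewrite lt_neqAle eq_sym w0.
 rewrite -(ler_pM2l wp) mulrDr mulrA mulfV // mul1r mulr1.
 by move: hi; rewrite -(real_normK (num_real (Psi i p))); move: `|Psi i p| (normr_ge0 (Psi i p)) => a a0 ha; nra.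
have mF : pmeas (fun p => ip (Psi ^~ p) (Lop f ^~ p^S)).
 by apply: pmeas_sum => i; apply: pmeasM; [case: (iP i)|case: (AlgL1 (aL i))].
have l1 := fL _ (pL1n iF) mF.
have iB2 : pL1 (fun p => (sqd p)^-1 * Bq (gr f p^S) (gr f p^S)).
 have [C hC] := cont2_bounded (Alg_cont2 (Alg_Bq af)).
 by apply: (eqL1 _ (pL1_Mbounded (C := C) _ hC iV)) => [p _|]; [exact: mulrC|case: iB].
have l2 := fL _ (pL1n iB2) (proj1 iB).
have l3 := rlim_dm_lim; rewrite hr subrr mulr0 in l3.
have -> : \I_p (ip (fun i => (sqd p)^-1 * Psi i p) (Lop f ^~ p^S)) = \I_p ((sqd p)^-1 * ip (Psi ^~ p) (Lop f ^~ p^S)).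
 by eqp; exact: (vF (fun p => (sqd p)^-1)).
apply/eqP; rewrite -sqrf_eq0 eq_le sqr_ge0 andbT.
rewrite -[leRHS](mul0r (\I_p ((sqd p)^-1 * Bq (gr f p^S) (gr f p^S)))).
apply: (@cvg_le_sqr _ _ _ _ _ _ _ l1 l3 l2) => m.
have := eq_level (dm0 m) hs has af; congr (_ ^+ 2 <= _).
by eqp; rewrite (vF (fun p => (sqd p + dm m)^-1)).
Qed.

End BaerLimit.

(** * Spectral decomposition of the Dirac operator *)

Definition Lr (f g : ppf) : R := \I_p (ip (f ^~ p) (g ^~ p)).

Definition L2p (f : ppf) : Prop := forall i, pmeas (f i) /\ pL1 (fun p => f i p ^+ 2).

Definition ofs (f : spf) : ppf := fun i p => f i p^S.

Lemma ip_pL1 f g : L2p f -> L2p g -> pL1 (fun p => ip (f ^~ p) (g ^~ p)).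
Proof. by move=> hf hg; apply: pL1S => i; have [m1 s1] := hf i; have [m2 s2] := hg i; exact: pL1_prod. Qed.

Lemma LrC f g : Lr f g = Lr g f.
Proof. by eqp; apply: eq_bigr => i _; exact: mulrC. Qed.

Lemma L2pD f g : L2p f -> L2p g -> L2p (fun i p => f i p + g i p).
Proof.
move=> hf hg i; have [m1 s1] := hf i; have [m2 s2] := hg i; split; first exact: pmeasD.
apply: (eqL1 _ (pL1D (pL1D s1 s2) (pL1Z 2 (pL1_prod m1 m2 s1 s2)))) => p _; ring.
Qed.

Lemma L2pZ (c : R) f : L2p f -> L2p (fun i p => c * f i p).
Proof.
move=> hf i; have [m1 s1] := hf i; split; first by apply: pmeasM m1; exact: pmeasC.
by apply: (eqL1 _ (pL1Z (c ^+ 2) s1)) => p _; rewrite exprMn.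
Qed.

Lemma L2p_sum (I : finType) (c : I -> R) (d : I -> ppf) : (forall a, L2p (d a)) -> L2p (fun i p => \sum_a c a * d a i p).
Proof.
move=> hd; elim: (index_enum I) => [|a r ih].
 by move=> i; split; [apply: (eq_pmeas _ (pmeasC 0))|apply: (eqL1 _ (pL1C 0))] => p _; rewrite big_nil // expr0n.
move=> i; have [m s] := L2pD (L2pZ (c a) (hd a)) ih i.
by split; [apply: eq_pmeas m|apply: eqL1 s] => p _; rewrite big_cons.
Qed.

Lemma LrDr f g h : L2p f -> L2p g -> L2p h -> Lr f (fun i p => g i p + h i p) = Lr f g + Lr f h.
Proof.
move=> hf hg hh; rewrite /Lr -pintD; [|exact: ip_pL1|exact: ip_pL1].
by eqp; rewrite /ip -big_split; apply: eq_bigr => i _; exact: mulrDr.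
Qed.

Lemma LrZr (c : R) f g : L2p f -> L2p g -> Lr f (fun i p => c * g i p) = c * Lr f g.
Proof.
move=> hf hg; rewrite /Lr -pintZ; last exact: ip_pL1.
by eqp; rewrite /ip mulr_sumr; apply: eq_bigr => i _; exact: mulrCA.
Qed.

Lemma Lr_sumr (I : finType) (c : I -> R) (d : I -> ppf) f : L2p f -> (forall a, L2p (d a)) ->
 Lr f (fun i p => \sum_a c a * d a i p) = \sum_a c a * Lr f (d a).
Proof.
move=> hf hd; transitivity (\I_p (\sum_a c a * ip (f ^~ p) (d a ^~ p))).
 eqp; rewrite /ip; under eq_bigr do rewrite mulr_sumr; rewrite exchange_big /=.
 by apply: eq_bigr => a _; rewrite mulr_sumr; apply: eq_bigr => i _; exact: mulrCA.
by rewrite pintS => [|a]; [apply: eq_bigr => a _; rewrite pintZ //; exact: ip_pL1|apply: pL1Z; exact: ip_pL1].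
Qed.

Lemma Lr_ge0 f : 0 <= Lr f f.
Proof. by apply: pint_ge0 => p _; exact: ip_ge0. Qed.

Lemma Lr_CS f g : L2p f -> L2p g -> Lr f g ^+ 2 <= Lr f f * Lr g g.
Proof.
move=> hf hg; apply: (pint_CS (ip_pL1 hf hf) (ip_pL1 hf hg) (ip_pL1 hg hg)) => p _; [exact: ip_ge0|exact: ip_ge0|].
apply: disc_le => t.
rewrite (_ : _ + _ = ip (fun i => t * f i p + g i p) (fun i => t * f i p + g i p)); first exact: ip_ge0.
by rewrite !ipE; move: (f _ p) (f _ p) (f _ p) (f _ p) (g _ p) (g _ p) (g _ p) (g _ p) => *; ring.
Qed.

Definition dist2 f g : R := Lr (fun i p => f i p + -1 * g i p) (fun i p => f i p + -1 * g i p).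

Definition cvs N (F : ppf) : ppf := fun i p => conv N (F i) p^S.

Section Hilbert.

Variables (I : finType) (d : I -> ppf) (n : I -> R).
Hypotheses (hd : forall a, L2p (d a))
(orth : forall a b, Lr (d a) (d b) = (a == b)%:R * n a).

Definition lcomb (c : I -> R) : ppf := fun i p => \sum_a c a * d a i p.

Lemma Lr_lcomb c e : Lr (lcomb c) (lcomb e) = \sum_a c a * e a * n a.
Proof.
have hc := L2p_sum c hd; rewrite (Lr_sumr e hc hd); apply: eq_bigr => a _.
rewrite LrC (Lr_sumr c (hd a) hd) (bigD1 a) //= big1 => [|b ba]; last by rewrite orth eq_sym (negbTE ba) mul0r mulr0.
by rewrite orth eqxx mul1r addr0; ring.
Qed.

Lemma Lr_expand c f : L2p f -> dist2 f (lcomb c) =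
 Lr f f + \sum_a (c a ^+ 2 * n a - 2 * c a * Lr f (d a)).
Proof.
move=> hf; have hc := L2p_sum c hd; have hc1 := L2pZ (-1) hc; have hs := L2pD hf hc1.
rewrite /dist2 (LrDr hs hf hc1) (LrZr _ hs hc) [Lr _ f]LrC [Lr _ (lcomb c)]LrC (LrDr hf hf hc1) (LrZr _ hf hc) (LrDr hc hf hc1) (LrZr _ hc hc).
rewrite Lr_lcomb [Lr (lcomb c) f]LrC (Lr_sumr c hf hd).
rewrite big_split /= sumrN (_ : \sum_a 2 * c a * Lr f (d a) = 2 * \sum_a c a * Lr f (d a)).
 under [X in _ = _ + (X - _)]eq_bigr do rewrite expr2.
 by move: (\sum_a c a * Lr f (d a)) (\sum_a _) (Lr f f) => *; ring.
by rewrite mulr_sumr; apply: eq_bigr => a _; rewrite mulrA.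
Qed.

Lemma n_ge0 a : 0 <= n a.
Proof. by have := Lr_ge0 (d a); rewrite orth eqxx mul1r. Qed.

Lemma Lr_n0 f a : L2p f -> n a = 0 -> Lr f (d a) = 0.
Proof.
move=> hf n0; apply/eqP; rewrite -sqrf_eq0 eq_le sqr_ge0 andbT; apply: (le_trans (Lr_CS hf (hd a))).
by rewrite orth n0 !mulr0.
Qed.

(** Vectors of norm 0 are allowed in the family: division by [n a = 0] yields 0, and the matching
    inner product vanishes by [Lr_n0]. *)
Lemma best_approx c f : L2p f ->
 dist2 f (lcomb (fun a => Lr f (d a) / n a)) <= dist2 f (lcomb c).
Proof.
move=> hf; rewrite !Lr_expand // lerD2l; apply: ler_sum => a _.
have [n0|n0] := eqVneq (n a) 0; first by rewrite n0 (Lr_n0 hf n0) !mulr0.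
have np : 0 < n a by rewrite lt_neqAle eq_sym n0 n_ge0.
rewrite -subr_ge0 (_ : _ - _ = (c a * n a - Lr f (d a)) ^+ 2 / n a); first by rewrite divr_ge0 ?sqr_ge0 ?n_ge0.
by move: (Lr f (d a)) (n a) n0 => *; field.
Qed.

Lemma bessel f : L2p f -> \sum_a Lr f (d a) ^+ 2 / n a <= Lr f f.
Proof.
move=> hf; have : 0 <= dist2 f (lcomb (fun a => Lr f (d a) / n a)) by exact: Lr_ge0.
rewrite Lr_expand // (_ : \sum_a _ = - \sum_a Lr f (d a) ^+ 2 / n a) ?subr_ge0 // -sumrN; apply: eq_bigr => a _.
have [n0|n0] := eqVneq (n a) 0; first by rewrite n0 (Lr_n0 hf n0) invr0 !mulr0; ring.
by move: (Lr f (d a)) (n a) n0 => *; field.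
Qed.

End Hilbert.

Lemma C1s_L2p (f : spf) : (forall i, C1s (f i)) -> L2p (ofs f).
Proof.
move=> cf i; have c2 := C1s_cont2 (cf i); split; first exact: cont2_pmeas.
by apply: cont2_pL1; exact: (cont2M c2 c2).
Qed.

Lemma Df_symC1 (f g : spf) : (forall i, C1s (f i)) -> (forall i, C1s (g i)) -> Lr (ofs f) (ofs (Df g)) = Lr (ofs (Df f)) (ofs g).
Proof.
move=> cf cg.
have iM (F G : E -> R) : cont2 (fun p => F p^S) -> cont2 (fun p => G p^S) -> pL1 (fun p => F p^S * G p^S) by move=> a b; apply: cont2_pL1; exact: cont2M.
have cX k i : cont2 (fun p => Xd k (f i) p^S) by exact: Xd_cont2.
have cY k i : cont2 (fun p => Xd k (g i) p^S) by exact: Xd_cont2.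
have ibp k i j : \I_p (Xd k (f i) p^S * g j p^S) = - \I_p (f i p^S * Xd k (g j) p^S).
 apply/eqP; rewrite -addr_eq0 -pintD; [|exact: iM (cX _ _) (C1s_cont2 (cg _))|exact: iM (C1s_cont2 (cf _)) (cY _ _)].
 apply/eqP; rewrite -[RHS](sint_Xd k (C1sM (cf i) (cg j))).
 by eqp; rewrite (XdM k (cf i) (cg j) (sphS p)).
have e (a b : spf) : (forall i, cont2 (fun p => a i p^S)) -> (forall i, cont2 (fun p => b i p^S)) -> (forall k i, cont2 (fun p => Xd k (b i) p^S)) ->
 Lr (ofs a) (ofs (Df b)) = Lr (ofs a) (ofs b) + \sum_i \sum_k js k i * \I_p (a i p^S * Xd k (b (jp k i)) p^S).
 move=> ca cb cd; have i1 k i : pL1 (fun p => js k i * (a i p^S * Xd k (b (jp k i)) p^S)) by apply: pL1Z; exact: iM.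
 transitivity (\I_p (\sum_i a i p^S * b i p^S + \sum_i \sum_k js k i * (a i p^S * Xd k (b (jp k i)) p^S))).
  eqp; rewrite -big_split; apply: eq_bigr => i _; rewrite /ofs /Df TfE /= mulrDr; congr (_ + _).
  by rewrite mulr_sumr; apply: eq_bigr => k _; exact: mulrCA.
 rewrite pintD; [|by apply: pL1S => i; exact: iM|by apply: pL1S => i; exact: pL1S].
 congr (_ + _); rewrite pintS; last by move=> i; exact: pL1S.
 apply: eq_bigr => i _; rewrite pintS //; apply: eq_bigr => k _; rewrite pintZ //; exact: iM.
have kf i : cont2 (fun p => f i p^S) by exact: C1s_cont2.
have kg i : cont2 (fun p => g i p^S) by exact: C1s_cont2.
rewrite [RHS]LrC (e f g kf kg cY) (e g f kg kf cX).
rewrite [Lr (ofs g) (ofs f)]LrC; set A := Lr (ofs f) (ofs g); clearbody A; refine (f_equal (GRing.add A) _).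
pose P i k := \I_p (f i p^S * Xd k (g (jp k i)) p^S).
pose Q i k := \I_p (f (jp k i) p^S * Xd k (g i) p^S).
transitivity (\sum_i - \sum_k js k i * Q i k); first by apply: (@swap_jp P Q) => i k; rewrite /P /Q jpK.
have h i k : - Q i k = \I_p (g i p^S * Xd k (f (jp k i)) p^S).
 by rewrite /Q -ibp; eqp; exact: mulrC.
by apply: eq_bigr => i _; rewrite -sumrN; apply: eq_bigr => k _; rewrite -mulrN h.
Qed.

Lemma Ic_ip (v w : V4) : ip (Ic v) (Ic w) = ip v w.
Proof. by rewrite !ipE /Ic /=; ring. Qed.

Lemma eig_orth (f g : spf) (l m : R) : (forall i, C1s (f i)) -> (forall i, C1s (g i)) ->
 (forall i x, sphere x -> Df f i x = l * f i x) -> (forall i x, sphere x -> Df g i x = m * g i x) -> l != m ->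
 Lr (ofs f) (ofs g) = 0.
Proof.
move=> cf cg hf hg lm; have := Df_symC1 cf cg.
have -> : Lr (ofs f) (ofs (Df g)) = Lr (ofs f) (fun i p => m * ofs g i p).
 by eqp; apply: eq_bigr => i _; rewrite /ofs hg //; exact: sphS.
have -> : Lr (ofs (Df f)) (ofs g) = Lr (ofs g) (fun i p => l * ofs f i p).
 by rewrite LrC; eqp; apply: eq_bigr => i _; rewrite /ofs hf //; exact: sphS.
rewrite !LrZr ?[Lr (ofs g) _]LrC; try exact: C1s_L2p.
move/eqP; rewrite -subr_eq0 -mulrBl mulf_eq0 subr_eq0 eq_sym (negbTE lm) /= => /eqP.
by [].
Qed.

Lemma Ic_skew (v w : V4) : ip (Ic v) w = - ip v (Ic w).
Proof. by rewrite !ipE /Ic /=; ring. Qed.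

Definition If (f : spf) : spf := fun i x => Ic (f ^~ x) i.

Definition Ip (f : ppf) : ppf := fun i p => Ic (f ^~ p) i.

Lemma IfE (f : spf) : If f = fun i => let: (a, b) := i in if b then f (a, false) else (fun x => - f (a, true) x).
Proof. by apply/funext => -[a []]; apply/funext => x. Qed.

Lemma Alg_If (f : spf) : (forall i, Alg (f i)) -> forall i, Alg (If f i).
Proof. by move=> af -[a []]; rewrite IfE //; exact: AlgN. Qed.

Lemma C1s_If (f : spf) : (forall i, C1s (f i)) -> forall i, C1s (If f i).
Proof. by move=> af -[a []]; rewrite IfE //; exact: C1sN. Qed.

Lemma Df_If (f : spf) i (x : E) : (forall i, C1s (f i)) -> sphere x -> Df (If f) i x = If (Df f) i x.
Proof.
move=> cf hx; have e k j : Xd k (If f j) x = Ic (fun j => Xd k (f j) x) j.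
 by rewrite IfE; case: j => a []; rewrite /Ic //= XdN.
rewrite {1}/Df {1}/Tf sum3 !JkE [RHS]/If /Df /Tf; case: i => -[] []; rewrite /J0 /J1 /J2 !e /If /Ic /= !sum3 !JkE /J0 /J1 /J2 /=; ring.
Qed.

Lemma If_eig (f : spf) (l : R) : (forall i, C1s (f i)) -> (forall i x, sphere x -> Df f i x = l * f i x) ->
 forall i (x : E), sphere x -> Df (If f) i x = l * If f i x.
Proof. by move=> cf ef [a []] x hx; rewrite Df_If // /If /Ic ef // mulrN. Qed.

(** The functions [g = 2 F^2 + 2 conv (F^2) - (F - conv F)^2] are nonnegative by Jensen and tend to
    [4 F^2] along a subsequence. If every [L^2] error were at least [eps], their integrals would
    stay [eps] below that of the limit, against Fatou's lemma. *)
Lemma L2_approx (F : ppf) (eps : R) : L2p F -> 0 < eps ->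
 exists N, dist2 F (cvs N F) < eps.
Proof.
move=> hF e0.
have i2 i : pL1 (fun p => F i p ^+ 2) by case: (hF i).
have i1 i : pL1 (F i).
 have [m s] := hF i; apply: (@pL1_le _ (fun p => F i p ^+ 2 + 1)) => //; last by apply: pL1D s _; exact: pL1C.
 by move=> p _; rewrite -(real_normK (num_real (F i p))); move: `|F i p| => a; nra.
have [s hs] := conv_subseq (fun a : ix + ix => match a with inl i => i1 i | inr i => i2 i end
 : pL1 ((fun a : ix + ix => match a with inl i => F i | inr i => fun p => F i p ^+ 2 end) a)).
move=> ha; apply: contrapT => /forallNP h.
have h2 N : eps <= dist2 F (cvs N F) by rewrite leNgt; apply/negP; exact: h.
pose e N i p := (F i p + -1 * cvs N F i p) ^+ 2.
pose g N i p := 2 * F i p ^+ 2 + 2 * conv N (fun p => F i p ^+ 2) p^S - e N i p.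
have j3 N i : pL1 (e N i).
 have cL : L2p (cvs N F) by apply: (@C1s_L2p (fun i => conv N (F i))) => j; exact: AlgC1 (conv_Alg N (i1 j)).
 by have [] := L2pD hF (L2pZ (-1) cL) i.
have j1 N i := pL1D (pL1Z 2 (i2 i)) (pL1Z 2 (conv_L1 N (i2 i))).
have jg N i : pL1 (g N i) := pL1B (j1 N i) (j3 N i).
pose Q := \sum_i \I_p (F i p ^+ 2).
have bnd n : \I_p (\sum_i g (s n) i p) <= 4 * Q - eps.
 rewrite (pintS _ (jg _)) (_ : \sum_i _ = 4 * Q - \sum_i pint (e (s n) i)).
  rewrite lerD2l lerN2 -(pintS _ (j3 _)); apply: le_trans (h2 (s n)) (eq_lerW _).
  by eqp; apply: eq_bigr => i _; rewrite /e expr2.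
 rewrite /Q mulr_sumr -sumrB; apply: eq_bigr => i _.
 rewrite (pintB (j1 _ i) (j3 _ i)) (pintD (pL1Z 2 (i2 i)) (pL1Z 2 (conv_L1 _ (i2 i)))); congr (_ - _).
 by rewrite !pintZ ?pint_conv //; [ring|exact: conv_L1].
have : \I_p (\sum_i 4 * F i p ^+ 2) <= 4 * Q - eps.
 have ig n : pL1 (fun p => \sum_i g (s n) i p) by exact: pL1S.
 apply: (proj2 (@pint_fatou_ae _ (fun p => \sum_i 4 * F i p ^+ 2) (4 * Q - eps) ig _ _ _ bnd)).
 - by apply: pmeas_sum => i; case: (pL1Z 4 (i2 i)).
 - apply: paeS ha => p _ hp; apply: cvg_sumf => i.
  have h3 := hp (inl i); have h4 := hp (inr i); simpl in h3, h4.
  have -> : 4 * F i p ^+ 2 = 2 * F i p ^+ 2 + 2 * F i p ^+ 2 - (F i p + -1 * F i p) ^+ 2 by ring.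
  apply: cvgB.
   by apply: cvgD; [exact: cvg_cst|apply: cvgM h4; exact: cvg_cst].
  apply: (cvg_ctf (@exprn_continuous _ 2)); apply: cvgD; first exact: cvg_cst.
  by apply: cvgM h3; exact: cvg_cst.
 move=> n p _; apply: sumr_ge0 => i _; rewrite /g /e /cvs; have := conv_sqr_le (s n) (i1 i) (i2 i) (sphS p).
 move: (conv _ _ _) (conv _ _ _) (F i p) => a b c hab.
 have := sqr_ge0 (c + b); rewrite !expr2; rewrite expr2 in hab; nra.
rewrite pintS; last by move=> i; exact: pL1Z.
under eq_bigr do rewrite pintZ //.
by rewrite -mulr_sumr -/Q => hh; clear -hh e0; lra.
Qed.

Lemma lap_sum (I : Type) (s : seq I) (c : I -> R) (f : I -> E -> R) (x : E) : (forall i, Alg (f i)) -> sphere x ->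
 \sum_k Xd k (Xd k (fun y => \sum_(i <- s) c i * f i y)) x = \sum_(i <- s) c i * \sum_k Xd k (Xd k (f i)) x.
Proof.
move=> af hx; under [RHS]eq_bigr do rewrite mulr_sumr.
rewrite exchange_big; apply: eq_bigr => k _; rewrite (Xd_ext k (fun y => Xd_sum s c k af) hx) Xd_sum // => i.
exact: Alg_Xd.
Qed.

(** Splitting into Laplace eigenfunctions, by induction with [kint_lap]. Write [k_N] for the [N]-th
    convolution and let it be the sum of the [h_l]. The coefficients [c l] make [k_(N+1)] minus the
    sum of the [c_l h_l] an eigenfunction for [(N + 1) (N + 2)]; their denominators are nonzero for
    [l <= N]. *)
Lemma kint_decomp N (F : ppf) : (forall i, pL1 (F i)) -> exists h : nat -> spf,
 [/\ forall l i, Alg (h l i),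
   forall l i (x : E), sphere x -> \sum_k Xd k (Xd k (h l i)) x = - (l%:R * l.+1%:R * h l i x) &
   forall i (x : E), sphere x -> kint (zon N) (F i) x = \sum_(l < N.+1) h l i x].
Proof.
move=> iF; have aK n i := kint_Alg (Kern_zon n) (iF i).
elim: N => [|N [h [h1 h2 h3]]].
 exists (fun l i x => \sum_(j < 1) (l == 0%N)%:R * kint (zon 0) (F i) x); split.
 - by move=> l i; apply: Alg_sum => _; exact: AlgM (AlgC _) (aK _ _).
 - move=> l i x hx; rewrite lap_sum // !big_ord1 kint_lap // mulr0n expr0n /= !mul0r subrr mulr0.
  by case: l => [|l]; rewrite ?mulr0n !mul0r ?mulr0 oppr0.
 - by move=> i x hx; rewrite !big_ord1 mul1r.
pose c (l : nat) : R := N.+1%:R ^+ 2 / (N.+1%:R * N.+2%:R - l%:R * l.+1%:R).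
(* [None] carries the leading term: the new convolution in degree [N + 1], a multiple of the old
   component otherwise. [Some j] carries the corrections, which are present in degree [N + 1]
   alone. *)
pose C (l : nat) (o : option 'I_N.+1) : R := if o is Some j then if l == N.+1 then - c j else 0 else if l == N.+1 then 1 else c l.
pose g (l : nat) (o : option 'I_N.+1) i : E -> R := if o is Some j then h j i else if l == N.+1 then kint (zon N.+1) (F i) else h l i.
pose s := None :: map Some (index_enum 'I_N.+1).
have ag l i o : Alg (g l o i) by case: o => [j|] /=; [exact: h1|rewrite /g; case: ifP].
exists (fun l i x => \sum_(o <- s) C l o * g l o i x); split.
- by move=> l i; apply: Alg_sum => o; exact: AlgM (AlgC _) (ag _ _ _).
- move=> l i x hx; rewrite (lap_sum _ _ (ag l i) hx) !big_cons !big_map /= /g /C; case: ifP => [/eqP ->|_]; last first.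
  by rewrite -!mulr_sumr !mul0r (h2 _ _ _ hx); move: (h l i x) (c l) => a b; ring.
 have e (j : 'I_N.+1) : - c j * \sum_k Xd k (Xd k (h j i)) x = N.+1%:R * N.+2%:R * (c j * h j i x) - N.+1%:R ^+ 2 * h j i x.
  have hj : N.+1%:R * N.+2%:R - j%:R * j.+1%:R != 0 :> R.
   by rewrite subr_eq0 -!natrM eqr_nat; apply/negP => /eqP; have := ltn_ord j; nia.
  rewrite h2 // /c; move: (h j i x) hj; move: (N.+2%:R : R) (N.+1%:R : R) (j%:R : R) (j.+1%:R : R) => p q r t v hj; by field.
 rewrite (eq_bigr _ (fun j _ => e j)) sumrB -!mulr_sumr kint_lap // h3 //.
 under [in RHS]eq_bigr do rewrite mulNr.
 by rewrite sumrN; move: (\sum_j _) (\sum_j _) (kint _ _ _) => p q r; ring.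
- move=> i x hx; rewrite big_ord_recr /= !big_cons !big_map /= /g /C eqxx mul1r.
 rewrite (eq_bigr (fun j : 'I_N.+1 => c j * h j i x)) => [|j _].
  by rewrite addrC; under [X in _ + X + _]eq_bigr do rewrite mulNr; rewrite sumrN subrK.
 by rewrite big_cons big_map /= ltn_eqF ?ltn_ord // big1 ?addr0 // => k _; rewrite mul0r.
Qed.

(** The eigenvalues [l + 1] and [- l] of [1 + T] in degree [l]. They are pairwise distinct, so the
    components are orthogonal. *)
Definition lam N (m : 'I_N.+1 * bool) : R := if m.2 then m.1.+1%:R else - m.1%:R.

Lemma lam_inj N : injective (@lam N).
Proof.
move=> [i a] [j b]; rewrite /lam /=; case: a; case: b => /eqP.
- by rewrite eqr_nat eqSS => /eqP /val_inj ->.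
- by rewrite -addr_eq0 -natrD pnatr_eq0.
- by rewrite eq_sym -addr_eq0 -natrD pnatr_eq0.
- by rewrite eqr_opp eqr_nat => /eqP /val_inj ->.
Qed.

Lemma conv_eig N (F : ppf) : (forall i, pL1 (F i)) -> exists Y : 'I_N.+1 * bool -> spf,
 [/\ forall m i, Alg (Y m i), forall m i (x : E), sphere x -> Df (Y m) i x = lam m * Y m i x &
   forall i (x : E), sphere x -> conv N (F i) x = \sum_m N.+1%:R / (4 * pi) * Y m i x].
Proof.
move=> iF; have [h [h1 h2 h3]] := kint_decomp N iF.
have TT (l : nat) i (x : E) : sphere x -> Tf (Tf (h l)) i x = l%:R * l.+1%:R * h l i x - Tf (h l) i x.
 by move=> hx; rewrite (Tf_Tf i (h1 l) hx) h2 // opprK.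
have aT l i := Alg_Tf i (h1 l).
pose c (l : nat) : R := (2 * l%:R + 1)^-1.
have c0 (l : nat) : 2 * l%:R + 1 != 0 :> R by rewrite gt_eqF // ltr_wpDl // mulr_ge0.
(* In degree [l], [T (T + 1) = l (l + 1)]; hence [(T + l + 1) / (2 l + 1)] and [(l - T) / (2 l + 1)]
   project onto the two eigenspaces of [T]. *)
pose Y (m : 'I_N.+1 * bool) : spf := fun i x => if m.2 then c m.1 * Tf (h m.1) i x + c m.1 * m.1.+1%:R * h m.1 i x
 else - c m.1 * Tf (h m.1) i x + c m.1 * m.1%:R * h m.1 i x.
have TL (a b : R) l i (x : E) : sphere x -> Tf (fun i x => a * Tf (h l) i x + b * h l i x) i x = a * Tf (Tf (h l)) i x + b * Tf (h l) i x.
 move=> hx; rewrite !TfE !mulr_sumr -big_split; apply: eq_bigr => k _ /=.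
 have C1a j := AlgC1 (aT l j); have C1b j := AlgC1 (h1 l j).
 rewrite XdD; [|exact: AlgC1 (AlgM (AlgC _) (aT _ _))|exact: AlgC1 (AlgM (AlgC _) (h1 _ _))|exact: sphere0].
 by rewrite (XdZ k a (C1a _) hx) (XdZ k b (C1b _) hx) mulrDr [js k i * (a * _)]mulrCA [js k i * (b * _)]mulrCA.
exists Y; split.
- by move=> [l []] i; apply: AlgD; [apply: AlgM (AlgC _) (aT _ _)|exact: AlgM (AlgC _) (h1 _ _)|apply: AlgM (AlgC _) (aT _ _)|exact: AlgM (AlgC _) (h1 _ _)].
- move=> [l []] i x hx; rewrite /Df /lam /=.
  rewrite [Tf _ i x](TL (c l) (c l * l.+1%:R) l i x hx) TT // /Y /=; move: (h l i x) (Tf _ _ _) (c l) => u v w.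
  by rewrite -natr1; move: (l%:R : R) => n; ring.
 rewrite [Tf _ i x](TL (- c l) (c l * l%:R) l i x hx) TT // /Y /=; move: (h l i x) (Tf _ _ _) (c l) => u v w.
 by rewrite -natr1; move: (l%:R : R) => n; ring.
- move=> i x hx; rewrite conv_kint // h3 // -mulr_sumr; congr (_ * _).
 rewrite -(pair_bigA _ (fun l b => Y (l, b) i x)) /=; apply: eq_bigr => l _.
 rewrite big_bool /Y /=; have := c0 l; rewrite /c -(natr1 l); move: (h l i x) (Tf _ _ _) (l%:R : R) => u v w hc; field.
 exact: hc.
Qed.

Lemma L2dotE (psi phi : E -> 'cV[R[i]]_2) :
 L2dot psi phi = Lr (ofs (fcomp psi)) (ofs (fcomp phi)) +i* Lr (ofs (fcomp psi)) (Ip (ofs (fcomp phi))).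
Proof.
rewrite /L2dot /sintC; apply/eqP; rewrite eq_complex /=; apply/andP; split; apply/eqP; eqp;
 by rewrite hdotE.
Qed.

Lemma L2p_Ip (f : ppf) : L2p f -> L2p (Ip f).
Proof.
move=> hf -[a []]; have [m1 s1] := hf (a, false); have [m2 s2] := hf (a, true); split; rewrite /Ip /Ic //.
 exact: pmeasN.
by apply: (eqL1 _ s2) => p _; rewrite sqrrN.
Qed.

Lemma Lr_Ip (f g : ppf) : Lr (Ip f) (Ip g) = Lr f g.
Proof. by eqp; exact: Ic_ip. Qed.

Lemma Lr_Ip_skew (f g : ppf) : L2p f -> L2p g -> Lr (Ip f) g = - Lr f (Ip g).
Proof. by move=> hf hg; rewrite /Lr -pintN; [eqp; exact: Ic_skew|exact: ip_pL1 hf (L2p_Ip hg)]. Qed.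

Lemma Lr_Ip_diag (f : ppf) : Lr f (Ip f) = 0.
Proof. by rewrite -[RHS](pint0); eqp; rewrite !ipE /Ip /Ic /=; ring. Qed.

(** A complex family regarded as a real one: each vector together with its multiple by [i]. *)
Definition dbl (I : Type) (Y : I -> ppf) (a : I * bool) : ppf := if a.2 then Ip (Y a.1) else Y a.1.

Lemma dbl_L2p (I : Type) (Y : I -> ppf) : (forall m, L2p (Y m)) -> forall a, L2p (dbl Y a).
Proof. by move=> hY [m []]; rewrite /dbl //=; exact: L2p_Ip. Qed.

Lemma dbl_orth (I : finType) (Y : I -> ppf) : (forall m, L2p (Y m)) ->
 (forall m k, m != k -> Lr (Y m) (Y k) = 0 /\ Lr (Y m) (Ip (Y k)) = 0) ->
 forall a b, Lr (dbl Y a) (dbl Y b) = (a == b)%:R * Lr (Y a.1) (Y a.1).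
Proof.
move=> hY ho [m a] [k b]; rewrite /dbl xpair_eqE /=; have [->|mk] /= := eqVneq m k.
 by case: a; case: b; rewrite /= ?mul1r ?mul0r ?Lr_Ip // ?Lr_Ip_diag // Lr_Ip_skew // Lr_Ip_diag oppr0.
rewrite mul0r; have [h1 h2] := ho _ _ mk; case: a; case: b; rewrite ?Lr_Ip // Lr_Ip_skew // h2 oppr0 //.
Qed.

Definition mkS (f : spf) (x : E) : 'cV[R[i]]_2 := mkC (f ^~ x).

Lemma fcomp_mkS f : fcomp (mkS f) = f.
Proof. by apply/funext => i; apply/funext => x; rewrite /fcomp mkCK. Qed.

Lemma smooth_mkS (f : spf) : (forall i, Alg (f i)) -> smooth_spinor (mkS f).
Proof.
move=> af a.
have h (b : bool) : (fun x => complex.Re (mkS f x (cidx b) 0)) = f (b, false) /\ (fun x => complex.Im (mkS f x (cidx b) 0)) = f (b, true).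
 by have e := fcomp_mkS f; split; [rewrite -[RHS](congr1 (fun g => g (b, false)) e)|rewrite -[RHS](congr1 (fun g => g (b, true)) e)]; apply/funext => x.
have [-> | ->] : a = cidx false \/ a = cidx true by case: a => -[|[|//]] ha; [left|right]; apply: val_inj.
- by have [e1 e2] := h false; split; rewrite ?e1 ?e2; exact: Alg_smooth.
- by have [e1 e2] := h true; split; rewrite ?e1 ?e2; exact: Alg_smooth.
Qed.

Lemma smooth_fcomp (psi : E -> 'cV[R[i]]_2) i : smooth_spinor psi -> C1s (fcomp psi i).
Proof. by case: i => a b hs; have [h1 h2] := hs (cidx a); apply: smooth_C1s; case: b. Qed.

Lemma dirac_mkS (f : spf) (x : E) : (forall i, Alg (f i)) -> sphere x -> dirac_op (mkS f) x = mkC (Df f ^~ x).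
Proof.
move=> af hx; apply: comps_inj; rewrite comps_dirac ?mkCK ?fcomp_mkS // => i.
exact: AlgC1.
Qed.

Section Eigenfamily.

Variables (n : nat) (l : 'I_n -> R) (phi : 'I_n -> E -> 'cV[R[i]]_2).
Hypothesis he : eigenfamily l phi.

Lemma eigenfamily_C1s j i : C1s (fcomp (phi j) i).
Proof. by case: he => h _ _; exact: smooth_fcomp. Qed.

Lemma eigenfamily_L2p j : L2p (ofs (fcomp (phi j))).
Proof. apply: C1s_L2p => i; exact: eigenfamily_C1s. Qed.

Lemma eigenfamily_Df j i (x : E) : sphere x -> Df (fcomp (phi j)) i x = l j * fcomp (phi j) i x.
Proof.
case: he => _ h _ hx; have /(congr1 (fun s => comps s i)) := h j x hx.
by rewrite comps_dirac ?comps_scale // => k; exact: eigenfamily_C1s.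
Qed.

Lemma eigenfamily_orth j k : Lr (ofs (fcomp (phi j))) (ofs (fcomp (phi k))) = (j == k)%:R /\
 Lr (ofs (fcomp (phi j))) (Ip (ofs (fcomp (phi k)))) = 0.
Proof.
case: he => _ _ h; have := h j k; rewrite L2dotE => /eqP; rewrite eq_complex /= => /andP[/eqP -> /eqP ->].
by case: (j == k).
Qed.

Lemma eigenfamily_neq j k : j != k -> Lr (ofs (fcomp (phi j))) (ofs (fcomp (phi k))) = 0 /\
 Lr (ofs (fcomp (phi j))) (Ip (ofs (fcomp (phi k)))) = 0.
Proof. by move=> jk; have [-> ->] := eigenfamily_orth j k; rewrite (negbTE jk). Qed.

End Eigenfamily.

Definition neg_part (Q : ppf) n (l : 'I_n -> R) (phi : 'I_n -> E -> 'cV[R[i]]_2) : R :=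
 \sum_(j | l j < 0) - l j * (Lr Q (ofs (fcomp (phi j))) ^+ 2 + Lr Q (Ip (ofs (fcomp (phi j)))) ^+ 2).

(** * A lower bound for the Dirac form *)

Section DiracForm.

Variables (psi : E -> 'cV[R[i]]_2) (Theta : ppf).
Let Psi : ppf := ofs (fcomp psi).
Hypotheses (hw : wD Psi Theta)
(LP : L2p Psi)
(LT : L2p Theta)
(hH : H12 psi).

Lemma sqC_L2dot phi : sqC (L2dot psi phi) = Lr Psi (ofs (fcomp phi)) ^+ 2 + Lr Psi (Ip (ofs (fcomp phi))) ^+ 2.
Proof. by rewrite L2dotE. Qed.

Lemma dirac_sums_bounded : has_sup (dirac_sums psi) /\ has_inf (dirac_sums psi).
Proof.
have [_ [M hM]] := hH.
have b s : dirac_sums psi s -> `|s| <= M.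
 move=> [n [l [phi [he ->]]]]; apply: (le_trans _ (hM n l phi he)); apply: (le_trans (ler_norm_sum _ _ _)).
 apply: ler_sum => j _; rewrite normrM [`|sqC _|]ger0_norm // addr_ge0 ?sqr_ge0 //.
have ne : (dirac_sums psi) !=set0.
 exists 0; exists 0%N, (fun _ => 0), (fun _ _ => 0); split; last by rewrite big_ord0.
 by split=> [[]|[]|[]].
split; split=> //; [exists M|exists (- M)] => s /b; by rewrite ler_norml => /andP[].
Qed.

Section AtN.

Variables (I : finType) (Y : I -> spf) (l : I -> R).
Hypotheses (aY : forall m i, Alg (Y m i))
(eY : forall m i (x : E), sphere x -> Df (Y m) i x = l m * Y m i x)
(linj : injective l).

Let Z (m : I) : ppf := ofs (Y m).
Let nr (m : I) : R := Lr (Z m) (Z m).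

Let LZ m : L2p (Z m). Proof. by apply: C1s_L2p => i; exact: AlgC1. Qed.

Let IpZ m : Ip (Z m) = ofs (If (Y m)). Proof. by []. Qed.

Let cYm m i : C1s (Y m i) := AlgC1 (aY m i).
Let cIm m i : C1s (If (Y m) i) := C1s_If (cYm m) i.
Let eI m := If_eig (cYm m) (eY m).

Let orthZ m k : m != k -> Lr (Z m) (Z k) = 0 /\ Lr (Z m) (Ip (Z k)) = 0.
Proof.
move=> mk; have lk : l m != l k by rewrite (inj_eq linj).
split; first exact: (eig_orth (cYm m) (cYm k) (eY m) (eY k) lk).
by rewrite IpZ; exact: (eig_orth (cYm m) (cIm k) (eY m) (eI k) lk).
Qed.

Definition coef2 (m : I) : R := (Lr Psi (Z m) ^+ 2 + Lr Psi (Ip (Z m)) ^+ 2) / nr m.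

(** Components of norm 0 are dropped and the others normalized, which makes them an
    [eigenfamily]. *)
Lemma eig_dirac_sum (A : {pred I}) : dirac_sums psi (\sum_(m in A) l m * coef2 m).
Proof.
pose A' := [pred m | (m \in A) && (nr m != 0)].
have eA : \sum_(m in A) l m * coef2 m = \sum_(m in A') l m * coef2 m.
 rewrite big_mkcond [RHS]big_mkcond; apply: eq_bigr => m _; rewrite !inE.
 by case: (m \in A) => //=; case: eqP => //= n0; rewrite /coef2 n0 invr0 !mulr0.
rewrite eA big_enum_val /=; set e := enum_val.
pose c j := (Num.sqrt (nr (e j)))^-1.
pose f j : spf := fun i x => c j * Y (e j) i x.
have ne j : nr (e j) != 0 by have := enum_valP j; rewrite inE => /andP[].
have np j : 0 < nr (e j) by rewrite lt_neqAle eq_sym ne Lr_ge0.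
have c2 j : c j ^+ 2 = (nr (e j))^-1 by rewrite exprVn sqr_sqrtr // ltW.
have af j i : Alg (f j i) by exact: AlgM (AlgC _) (aY _ _).
have Lf j : L2p (ofs (f j)) by apply: C1s_L2p => i; exact: AlgC1.
have IpE j : Ip (ofs (f j)) = fun i p => c j * Ip (Z (e j)) i p.
 by apply/funext => -[a []]; apply/funext => p; rewrite /Ip /Ic /ofs /f ?mulrN.
have LIZ m : L2p (Ip (Z m)) by exact: L2p_Ip.
have Lc (g : ppf) j : L2p g -> Lr g (ofs (f j)) = c j * Lr g (Z (e j)) by move=> Lg; rewrite -LrZr.
have LcI (g : ppf) j : L2p g -> Lr g (Ip (ofs (f j))) = c j * Lr g (Ip (Z (e j))) by move=> Lg; rewrite IpE LrZr.
exists #|A'|, (fun j => l (e j)), (fun j => mkS (f j)); split; last first.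
 apply: eq_bigr => j _; rewrite sqC_L2dot fcomp_mkS LcI // Lc //.
 by rewrite !exprMn c2 -mulrDr mulrC /coef2 [_ * (nr _)^-1]mulrC [RHS]mulrC.
split=> [j|j x hx|j k].
- exact: smooth_mkS.
- rewrite dirac_mkS //; apply: comps_inj; rewrite comps_scale !mkCK; apply/funext => i.
 have -> : Df (f j) i x = c j * Df (Y (e j)) i x.
  rewrite /Df !TfE mulrDr mulr_sumr; congr (_ + _); apply: eq_bigr => k _.
  by rewrite (XdZ k (c j) (cYm _ _) hx) mulrCA.
 by rewrite eY // mulrCA.
have r1 : Lr (ofs (f j)) (Z (e k)) = c j * Lr (Z (e k)) (Z (e j)) by rewrite LrC Lc.
have r2 : Lr (ofs (f j)) (Ip (Z (e k))) = c j * Lr (Ip (Z (e k))) (Z (e j)) by rewrite LrC Lc.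
rewrite L2dotE !fcomp_mkS LcI // Lc // r1 r2.
have [<-|jk] := eqVneq j k.
 by rewrite [Lr (Ip _) _]LrC Lr_Ip_diag !mulr0 mulrA -expr2 c2 -/(nr _) mulVf.
have ejk : e k != e j by rewrite (inj_eq enum_val_inj) eq_sym.
have ekj : e j != e k by rewrite eq_sym.
have [q1 _] := orthZ ejk; have [_ q2] := orthZ ekj.
by rewrite q1 [Lr (Ip _) _]LrC q2 !mulr0.
Qed.

Lemma Theta_coef (f : spf) (c : R) : (forall i, Alg (f i)) -> (forall i (x : E), sphere x -> Df f i x = c * f i x) ->
 Lr Theta (ofs f) = c * Lr Psi (ofs f).
Proof.
move=> af ef; have Lf : L2p (ofs f) by apply: C1s_L2p => i; exact: AlgC1.
rewrite -(LrZr _ LP Lf) -[LHS](wD_test hw af); eqp; apply: eq_bigr => i _.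
by rewrite ef //; exact: sphS.
Qed.

Definition proj : ppf := lcomb (dbl Z) (fun a => Lr Psi (dbl Z a) / nr a.1).

Lemma sum_coef2 : \sum_m l m * coef2 m = Lr Theta proj.
Proof.
rewrite /proj Lr_sumr //; last exact: dbl_L2p.
rewrite -(pair_bigA _ (fun m b => Lr Psi (dbl Z (m, b)) / nr m * Lr Theta (dbl Z (m, b)))) /=.
apply: eq_bigr => m _; rewrite big_bool /dbl /= !IpZ (Theta_coef (Alg_If (aY m)) (eI m)) (Theta_coef (aY m) (eY m)).
by rewrite /coef2 IpZ; move: (Lr Psi _) (Lr Psi _) (nr m)^-1 => *; ring.
Qed.

(* Bessel for the eigenfamily [phi], applied to the negative part of [proj] with each component weighted by the square root of its eigenvalue. *)
Lemma neg_bessel n (lambda : 'I_n -> R) (phi : 'I_n -> E -> 'cV[R[i]]_2) : eigenfamily lambda phi ->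
 neg_part proj lambda phi <= \sum_(m | l m < 0) - l m * coef2 m.
Proof.
move=> he; pose G j : ppf := ofs (fcomp (phi j)).
have cG := eigenfamily_C1s he; have eG := eigenfamily_Df he; have eIG j := If_eig (cG j) (eG j).
have LG := eigenfamily_L2p he; have LDG := dbl_L2p LG; have LDZ := dbl_L2p LZ.
pose cf a := Lr Psi (dbl Z a) / nr a.1.
pose w m := if l m < 0 then Num.sqrt (- l m) else 0.
pose Zm : ppf := lcomb (dbl Z) (fun a => w a.1 * cf a).
have LZm : L2p Zm by exact: L2p_sum.
have w2 m : w m ^+ 2 = if l m < 0 then - l m else 0.
 by rewrite /w; case: ifP => hl; rewrite ?expr0n // sqr_sqrtr // oppr_ge0 ltW.
have nZm : Lr Zm Zm = \sum_(m | l m < 0) - l m * coef2 m.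
 rewrite (Lr_lcomb LDZ (dbl_orth LZ orthZ)) -(pair_bigA _ (fun m b => w m * cf (m, b) * (w m * cf (m, b)) * nr m)) /= [RHS]big_mkcond.
 apply: eq_bigr => m _; rewrite big_bool /cf /dbl /= /coef2.
 rewrite (_ : _ + _ = w m ^+ 2 * ((Lr Psi (Z m) / nr m) ^+ 2 * nr m + (Lr Psi (Ip (Z m)) / nr m) ^+ 2 * nr m)); last by ring.
 rewrite w2; case: ifP => _; last by rewrite mul0r.
 congr (_ * _); have [->|n0] := eqVneq (nr m) 0; first by rewrite invr0 !mulr0 addr0.
 by move: (Lr _ _) (Lr _ _) (nr m) n0 => *; field.
have ob := dbl_orth LG (eigenfamily_neq he).
have one j : Lr (G j) (G j) = 1 by have [-> _] := eigenfamily_orth he j j; rewrite eqxx.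
have dif (a : I * bool) (b : 'I_n * bool) : l a.1 != lambda b.1 -> Lr (dbl G b) (dbl Z a) = 0.
 rewrite eq_sym; case: a => m [] /=; case: b => j [] /= lne.
 - by apply: (eig_orth (C1s_If (cG j)) (cIm m) (eIG j) (eI m) lne).
 - by apply: (eig_orth (cG j) (cIm m) (eG j) (eI m) lne).
 - by apply: (eig_orth (C1s_If (cG j)) (cYm m) (eIG j) (eY m) lne).
 - by apply: (eig_orth (cG j) (cYm m) (eG j) (eY m) lne).
have LrZm b : lambda b.1 < 0 -> Lr Zm (dbl G b) ^+ 2 = - lambda b.1 * Lr proj (dbl G b) ^+ 2.
 move=> lb; rewrite [Lr Zm _]LrC [Lr proj _]LrC (Lr_sumr _ (LDG b) LDZ) (Lr_sumr _ (LDG b) LDZ).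
 have -> : - lambda b.1 = Num.sqrt (- lambda b.1) ^+ 2 by rewrite sqr_sqrtr // oppr_ge0 ltW.
 rewrite -exprMn; congr (_ ^+ 2); rewrite mulr_sumr; apply: eq_bigr => a _.
 have [e|ne] := eqVneq (l a.1) (lambda b.1); last by rewrite dif // !mulr0.
 by rewrite /w e lb /cf -!mulrA.
rewrite -nZm; apply: le_trans (bessel LDG ob LZm).
rewrite -(pair_bigA _ (fun j b => Lr Zm (dbl G (j, b)) ^+ 2 / Lr (G j) (G j))) /= [leLHS]big_mkcond.
apply: ler_sum => j _; rewrite big_bool one divr1 divr1.
case: ifP => lj; last by rewrite addr_ge0 ?sqr_ge0.
by rewrite /= (LrZm (j, true) lj) (LrZm (j, false) lj) -mulrDr addrC.
Qed.

(** The mollification lies in the span of the components, so the orthogonal projection onto that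
    span is at least as close. *)
Lemma proj_approx (c : R) N : (forall i (x : E), sphere x -> conv N (Psi i) x = \sum_m c * Y m i x) ->
 dist2 Psi proj <= dist2 Psi (cvs N Psi).
Proof.
move=> hc; apply: (le_trans (best_approx (dbl_L2p LZ) (dbl_orth LZ orthZ) (fun a => if a.2 then 0 else c) LP)).
apply: eq_lerW.
have e i p : lcomb (dbl Z) (fun a => if a.2 then 0 else c) i p = conv N (Psi i) p^S.
 rewrite hc /lcomb; last exact: sphS.
 rewrite -(pair_bigA _ (fun m (b : bool) => (if b then 0 else c) * dbl Z (m, b) i p)) /=.
 by apply: eq_bigr => m _; rewrite big_bool /= mul0r add0r.
by eqp; apply: eq_bigr => i _; rewrite e.
Qed.

End AtN.

(** For the projection [P], the pairing with [Theta] splits by the sign of the eigenvalue. The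
    positive part is a member of [dirac_sums]; the negative part absorbs [neg_part] by
    [neg_bessel]. *)
Lemma dirac_form_approx (eps : R) : 0 < eps -> exists P : ppf, [/\ L2p P, dist2 Psi P < eps &
  forall n (lambda : 'I_n -> R) phi, eigenfamily lambda phi -> Lr Theta P + neg_part P lambda phi <= sup (dirac_sums psi)].
Proof.
move=> e0; have [N hN] := L2_approx LP e0; have [iP _ _] := hw; have [[_ hs] _] := dirac_sums_bounded.
have [Y [aY eY cY]] := conv_eig N iP; have linj := @lam_inj N.
exists (proj Y); split; first by apply: L2p_sum; apply: dbl_L2p => m; apply: C1s_L2p => i; exact: AlgC1.
 exact: le_lt_trans (proj_approx aY eY linj cY) hN.
move=> n lambda phi he; apply: le_trans (ub_le_sup hs (eig_dirac_sum aY eY linj [pred m | 0 < lam m])).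
rewrite -lerBrDl; apply: le_trans (neg_bessel aY eY linj he) (eq_lerW _).
rewrite -(sum_coef2 aY eY) big_mkcond [X in _ = X - _]big_mkcond -sumrB; apply: eq_bigr => m _ /=.
by rewrite inE; case: ltrgt0P => h; rewrite ?subrr ?sub0r ?mulNr // h mul0r oppr0.
Qed.

(** Each sum entering the infimum is at least minus its [neg_part], and [dirac_form_approx], in the
    limit of the projections, bounds the pairing plus that [neg_part] by the supremum. Errors
    [(n + 1)^-2] are chosen because [dist2] is a squared distance. *)
Theorem dirac_form_ge : Lr Theta Psi <= dirac_form psi.
Proof.
have [hs hi] := dirac_sums_bounded.
have h0 (n : nat) : 0 < (n.+1%:R^-1) ^+ 2 :> R by rewrite exprn_gt0 // invr_gt0.
have /choice[P hP] := fun n => dirac_form_approx (h0 n).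
have cv f : L2p f -> Lr (P n) f @[n --> \oo] --> Lr Psi f.
 move=> Lf; apply: (@cvg_dist_le _ (fun n => n.+1%:R^-1 * (Lr f f + 1))); last first.
  by rewrite -[X in _ --> X](mul0r (Lr f f + 1)); apply: cvgM; [exact: cvg_harmonic|exact: cvg_cst].
 move=> n; have [LPn hn _] := hP n; have K0 := Lr_ge0 f.
 have hn0 : 0 <= n.+1%:R^-1 * (Lr f f + 1) by rewrite mulr_ge0 ?invr_ge0 // addr_ge0.
 rewrite -(@ler_pXn2r _ 2) ?nnegrE // real_normK ?num_real //.
 have -> : Lr (P n) f - Lr Psi f = - Lr f (fun i p => Psi i p + -1 * P n i p).
  by rewrite LrDr ?LrZr //; [rewrite [Lr f Psi]LrC [Lr f (P n)]LrC; ring|exact: L2pZ].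
 rewrite sqrrN; apply: (le_trans (Lr_CS Lf (L2pD LP (L2pZ (-1) LPn)))).
 rewrite exprMn mulrC; apply: ler_pM; [exact: Lr_ge0|exact: K0|exact: ltW|].
 by move: (Lr f f) K0 => a a0; nra.
suff hg n (lambda : 'I_n -> R) phi : eigenfamily lambda phi ->
  Lr Theta Psi <= sup (dirac_sums psi) + \sum_j lambda j * sqC (L2dot psi (phi j)).
 rewrite -lerBlDl; apply: lb_le_inf; first by case: hi.
 by move=> s [n [l [phi [he ->]]]]; rewrite lerBlDl; exact: hg.
move=> he; have LG := eigenfamily_L2p he.
have cng : neg_part (P n) lambda phi @[n --> \oo] --> neg_part Psi lambda phi.
 rewrite /neg_part; under eq_fun do rewrite big_mkcond; rewrite big_mkcond; apply: cvg_sumf => j; case: ifP => _; last exact: cvg_cst.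
 apply: cvgM; first exact: cvg_cst.
 have sq (f : ppf) : L2p f -> Lr (P n) f ^+ 2 @[n --> \oo] --> Lr Psi f ^+ 2 by move=> /cv hf; exact: (cvg_ctf (@exprn_continuous _ 2) hf).
 by apply: cvgD; apply: sq => //; exact: L2p_Ip.
have cT : Lr Theta (P n) @[n --> \oo] --> Lr Theta Psi.
 by rewrite LrC; under eq_fun do rewrite LrC; exact: cv.
have le : Lr Theta Psi + neg_part Psi lambda phi <= sup (dirac_sums psi).
 have cc : Lr Theta (P n) + neg_part (P n) lambda phi @[n --> \oo] --> Lr Theta Psi + neg_part Psi lambda phi by exact: cvgD.
 rewrite -(cvg_lim _ cc) //; apply: limr_le; first by apply/cvg_ex; eexists; exact: cc.
 by apply: nearW => m; have [_ _ h] := hP m; exact: h.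
apply: (@le_trans _ _ (sup (dirac_sums psi) - neg_part Psi lambda phi)); first by rewrite lerBrDr.
rewrite lerD2l /neg_part -sumrN big_mkcond; apply: ler_sum => j _; rewrite sqC_L2dot.
case: ifP => lj; first by rewrite mulNr opprK.
by rewrite mulr_ge0 ?addr_ge0 ?sqr_ge0 // leNgt lj.
Qed.

End DiracForm.

(** * Solutions whose energy is at most that of the constant one *)

Section Solution.

Lemma pmeas_V (F : R * R -> R) : pmeas F -> (forall p, 0 <= F p) -> pmeas (fun p => (F p)^-1).
Proof.
move=> mF F0; have md m : 0 < m.+1%:R^-1 :> R by rewrite invr_gt0.
apply: (@measurable_fun_cvg _ _ _ _ (fun m (p : mR * mR) => (1 - \1_[set (0 : R)] (F p)) * (F p + m.+1%:R^-1)^-1)).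
 move=> m; apply: pmeasM; last exact: pmeas_inv.
 by apply: pmeasB; [exact: pmeasC|apply: (pmeas_comp (f := \1_[set (0 : R)]))].
move=> p _; rewrite indicE; have [e|e] := eqVneq (F p) 0.
 rewrite e invr0 mem_set // subrr (_ : (fun m => _) = (fun _ => 0)); first exact: cvg_cst.
 by apply/funext => m; rewrite mul0r.
rewrite memNset; last exact/eqP.
rewrite subr0 -[X in _ --> X]mul1r; apply: cvgM; first exact: cvg_cst.
apply: cvgV => //; rewrite -[X in _ --> X]addr0; apply: cvgD; [exact: cvg_cst|exact: cvg_harmonic].
Qed.

Lemma quot_arith (a b d q : R) : b != 0 -> q != 0 ->
 [/\ a / b ^+ 2 * (b ^+ 2 * d / q) = a * d / q, d = q * (b ^+ 2 * d / q / b ^+ 2) & q * a / (q / b ^+ 2) = b ^+ 2 * a].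
Proof. by move=> b0 q0; split; field; rewrite ?b0 ?q0. Qed.

Lemma quad_zero (x y e : R) : 0 < e -> (forall t, `|t| <= e -> 0 <= t * x + t ^+ 2 * y) -> x = 0.
Proof.
move=> e0 h; apply/eqP; apply/contraT => x0.
pose s := Num.min e (`|x| / (2 * (`|y| + 1))).
have y1 : 0 < 2 * (`|y| + 1) by rewrite mulr_gt0 // ltr_wpDl.
have s0 : 0 < s by rewrite lt_min e0 divr_gt0 // normr_gt0.
have s1 : s <= `|x| / (2 * (`|y| + 1)) by rewrite ge_min lexx orbT.
have s2 : s * (2 * (`|y| + 1)) <= `|x| by rewrite -ler_pdivlMr.
have se : s <= e by rewrite ge_min lexx.
have ny := ler_norm y; have xp : 0 < `|x| by rewrite normr_gt0.
have sy : s * y <= s * `|y| by apply: ler_wpM2l => //; exact: ltW.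
have sz : 2 * (s * `|y|) + 2 * s <= `|x| by move: s2; rewrite (_ : s * (2 * (`|y| + 1)) = 2 * (s * `|y|) + 2 * s) //; ring.
have sn : 0 <= s * `|y| by rewrite mulr_ge0 // ltW.
have [xs|xs] := leP 0 x.
 rewrite (ger0_norm xs) in sz; have := h (- s); rewrite normrN gtr0_norm // => /(_ se).
 rewrite sqrrN expr2 (_ : _ + _ = s * (s * y - x)) ?pmulr_rge0 //; [lra|ring].
rewrite (ltr0_norm xs) in sz; have := h s; rewrite gtr0_norm // => /(_ se).
rewrite expr2 (_ : _ + _ = s * (s * y + x)) ?pmulr_rge0 //; [lra|ring].
Qed.

Lemma ln1D_ge (s : R) : `|s| <= 2^-1 -> s - 2 * s ^+ 2 <= ln (1 + s).
Proof.
rewrite ler_norml => /andP[s1 s2]; have p1 : 0 < 1 + s by lra.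
have h : ln (1 + s)^-1 <= (1 + s)^-1 - 1.
 have e : (1 + s)^-1 = 1 + ((1 + s)^-1 - 1) by ring.
 by rewrite {1}e; apply: le_ln1Dx; rewrite ltrBrDr addNr invr_gt0.
rewrite lnV ?posrE // lerNl opprB in h; apply: (le_trans _ h).
have -> : 1 - (1 + s)^-1 = s / (1 + s) by have p2 := lt0r_neq0 p1; field.
rewrite ler_pdivlMr // -subr_ge0 (_ : _ - _ = s ^+ 2 * (1 + 2 * s)); last by ring.
by apply: mulr_ge0; [exact: sqr_ge0|lra].
Qed.

(** The Euler-Lagrange equation of an extremal. Perturb by [t w], bound [e^(2 t w)] below by
    [1 + 2 t w] and the logarithm by [ln1D_ge]; [quad_zero] is then the first order condition at a
    minimum. *)
Lemma onofri_equality (U : R * R -> R) G (w : E -> R) : wH1 U G -> Alg w ->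
 \I_p (\sum_k G k p ^+ 2) + 2 * pint U = 4 * pi * ln (\I_p (expR (2 * U p)) / (4 * pi)) ->
 \I_p (\sum_k G k p * Xd k w p^S) + \I_p (w p^S) =
 4 * pi * \I_p (expR (2 * U p) * w p^S) / \I_p (expR (2 * U p)).
Proof.
move=> hU aw hJ; have [iU iG iG2 hG] := hU; have iE := wH1_exp 2 hU.
have pp := pi_gt0 R; have p4 : 0 < 4 * pi :> R by rewrite mulr_gt0.
set D := \I_p (expR (2 * U p)) in hJ *.
have D0 : 0 < D by apply: pint_gt0 => // p _; exact: expR_gt0.
have iEw := L1MAlg iE aw; set m := \I_p (expR (2 * U p) * w p^S).
have iGX : pL1 (fun p => \sum_k G k p * Xd k w p^S) by apply: pL1S => k; exact: L1MAlg (iG k) (Alg_Xd k aw).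
have iw := AlgL1 aw; set a1 := \I_p (\sum_k _); set a2 := \I_p (w p^S).
have iXX : pL1 (fun p => \sum_k Xd k w p^S ^+ 2).
 by apply: pL1S => k; exact: (AlgL1 (AlgXn 2 (Alg_Xd k aw))).
pose b := \I_p (\sum_k Xd k w p^S ^+ 2).
apply/eqP; rewrite -subr_eq0; apply/eqP.
(* The quadratic remainder gathers the Dirichlet integral of [w] and the second order term of the
   logarithm; the range of [t] ensures [|s| <= 1/2]. *)
apply: (@quad_zero _ (b / 2 + 16 * pi * (m / D) ^+ 2) (D / (4 * (`|m| + 1)))); first by rewrite divr_gt0 // mulr_gt0 // ltr_wpDl.
move=> t ht; have hUt := wH1D hU (wH1Z t (wH1_Alg aw)).
have [iEt ho] := onofri hUt.
pose s := 2 * t * m / D.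
have hs : `|s| <= 2^-1.
 rewrite /s !normrM normfV (gtr0_norm D0) ger0_norm // ler_pdivrMr //.
 have m1 : 0 < `|m| + 1 by rewrite ltr_wpDl.
 have : `|t| * (4 * (`|m| + 1)) <= D by rewrite -ler_pdivlMr // mulr_gt0.
 by have := normr_ge0 t; move: `|t| `|m| (normr_ge0 m) => x y; nra.
have s1 : 0 < 1 + s by move: hs; rewrite ler_norml => /andP[]; lra.
have hD : D * (1 + s) <= \I_p (expR (2 * (U p + t * w p^S))).
 have -> : D * (1 + s) = \I_p (expR (2 * U p) + 2 * t * (expR (2 * U p) * w p^S)).
  by rewrite pintD ?pintZ // ?/s -/D -/m; [field; exact: lt0r_neq0|exact: pL1Z].
 apply: le_pint => // [|p _]; first by apply: pL1D => //; exact: pL1Z.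
 rewrite mulrDr expRD [2 * (t * _)]mulrA [2 * t * (_ * _)]mulrCA -[X in X + _]mulr1 -mulrDr.
 by apply: ler_wpM2l; [exact: expR_ge0|exact: expR_ge1Dx].
have e1 : \I_p (\sum_k (G k p + t * Xd k w p^S) ^+ 2) = \I_p (\sum_k G k p ^+ 2) + 2 * t * a1 + t ^+ 2 * b.
 have j1 : pL1 (fun p => \sum_k G k p ^+ 2) by exact: pL1S.
 rewrite -!pintZ // -pintD //; last exact: pL1Z.
 rewrite -pintD; [|by apply: pL1D => //; exact: pL1Z|exact: pL1Z].
 eqp; rewrite !mulr_sumr -!big_split; apply: eq_bigr => k _ /=; ring.
have e2 : \I_p (U p + t * w p^S) = pint U + t * a2 by rewrite pintD ?pintZ //; exact: pL1Z.
have hl : ln (D / (4 * pi)) + ln (1 + s) <= ln (\I_p (expR (2 * (U p + t * w p^S))) / (4 * pi)).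
 have P1 : 0 < D / (4 * pi) by exact: divr_gt0.
 have P2 : 0 < \I_p (expR (2 * (U p + t * w p^S))) / (4 * pi).
  by apply: divr_gt0 => //; apply: lt_le_trans hD; exact: mulr_gt0.
 rewrite -lnM ?posrE // ler_ln ?posrE //; last exact: mulr_gt0.
 by rewrite mulrAC; apply: ler_wpM2r => //; rewrite invr_ge0 ltW.
have h3 := ln1D_ge hs.
rewrite e1 e2 in ho; have h4 := le_trans (ler_wpM2l (ltW p4) hl) ho.
have h5 := ler_wpM2l (ltW p4) h3.
have es : s = 2 * t * (m / D) by rewrite /s mulrA.
rewrite es in h4 h5; rewrite mulrDr -hJ in h4.
have -> : 4 * pi * m / D = 4 * pi * (m / D) by rewrite mulrA.
move: h4 h5; clear; clearbody a1 a2 b.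
move: (\I_p (\sum_k G k p ^+ 2)) (pint U) (ln (1 + 2 * t * (m / D))) (m / D) (pi : R) => J U' L q P h4 h5; lra.
Qed.

Variables (A B : R) (u : E -> R) (psi : E -> 'cV[R[i]]_2).
Hypotheses (hA : 0 < A)
(hB : 0 < B)
(hsol : is_solution A B u psi).
Let U p := u p^S.
Let Psi : ppf := ofs (fcomp psi).
Let rho p := B * expR (U p).

Lemma sol_H1 : H1 u. Proof. by case: hsol. Qed.

Let hU : wH1 U (wgk u). Proof. by case: (H1_wgrad sol_H1). Qed.

Lemma pL1_rho n : pL1 (fun p => rho p ^+ n).
Proof.
apply: (eqL1 _ (pL1Z (B ^+ n) (wH1_exp n%:R hU))) => p _.
by rewrite /rho exprMn -expRM_natl.
Qed.

Lemma sol_L2 : L2p Psi.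
Proof.
have [_ [[m1 m2 hs] _] _ _] := hsol.
have mP i : pmeas (Psi i) by case: i => a []; [exact: m2|exact: m1].
move=> i; split=> //; apply: (@pL1_le _ (fun p => sqnorm (psi p^S))).
- exact: pmeas_ct (@exprn_continuous _ 2) (mP i).
- move=> p _; rewrite sqnormE ger0_norm ?sqr_ge0 // /ip (bigD1 i) //= -expr2 lerDl.
 by apply: sumr_ge0 => j _; rewrite -expr2 sqr_ge0.
- split; last exact: hs.
 apply: (@eq_pmeas (fun p => ip (Psi ^~ p) (Psi ^~ p))); first by move=> p _; rewrite sqnormE.
 by apply: pmeas_sum => j; exact: pmeasM.
Qed.

Let Theta : ppf := fun i p => rho p * Psi i p.

Let mP i : pmeas (Psi i). Proof. by case: (sol_L2 i). Qed.
Let mr : pmeas rho. Proof. by case: (pL1_rho 1). Qed.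
Let r0 p : 0 <= rho p. Proof. by rewrite mulr_ge0 ?expR_ge0 // ltW. Qed.

(** A test spinor with a single nonzero real component isolates one component of the equation. *)
Lemma sol_wD : wD Psi Theta.
Proof.
have [_ _ _ hD] := hsol; split=> [i|i|i f af].
- have [m s] := sol_L2 i; apply: (@pL1_le _ (fun p => Psi i p ^+ 2 + 1)) => //; last by apply: pL1D s _; exact: pL1C.
 by move=> p _; rewrite -(real_normK (num_real (Psi i p))); move: `|Psi i p| => a; nra.
- by apply: pL1_prod => //; [exact: pL1_rho|case: (sol_L2 i)].
pose phi : spf := fun j x => (j == i)%:R * f x.
have aphi j : Alg (phi j) by exact: AlgM (AlgC _) af.
have := hD _ (smooth_mkS aphi) => /(congr1 (@complex.Re R)) /= h.
have e1 : \I_p (ip (Psi ^~ p) (Df phi ^~ p^S)) = \I_p (Theta i p * f p^S).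
 rewrite (_ : \I_p (ip _ _) = sint (fun x => complex.Re (hdot (psi x) (dirac_op (mkS phi) x)))); last first.
  by eqp; rewrite dirac_mkS ?hdotE ?mkCK //; exact: sphS.
 rewrite h; eqp; rewrite hdotE /= mkCK mul0r subr0 /Theta /rho -mulrA; congr (_ * _).
 by rewrite /ip (bigD1 i) //= big1 ?addr0 ?/phi ?eqxx ?mul1r // => j /negbTE ->; rewrite mul0r mulr0.
have iPf j k : pL1 (fun p => Psi j p * Xd k f p^S).
 apply: L1MAlg (Alg_Xd k af); have [m s] := sol_L2 j.
 apply: (@pL1_le _ (fun p => Psi j p ^+ 2 + 1)) => //; last by apply: pL1D s _; exact: pL1C.
 by move=> p _; rewrite -(real_normK (num_real (Psi j p))); move: `|Psi j p| => a; nra.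
have iPi : pL1 (fun p => Psi i p * f p^S).
 apply: L1MAlg af; have [m s] := sol_L2 i.
 apply: (@pL1_le _ (fun p => Psi i p ^+ 2 + 1)) => //; last by apply: pL1D s _; exact: pL1C.
 by move=> p _; rewrite -(real_normK (num_real (Psi i p))); move: `|Psi i p| => a; nra.
rewrite -e1 -sumrN.
have -> : \sum_k - (js k i * \I_p (Psi (jp k i) p * Xd k f p^S)) = \I_p (\sum_k - js k i * (Psi (jp k i) p * Xd k f p^S)).
 rewrite pintS; last by move=> k; exact: pL1Z.
 by apply: eq_bigr => k _; rewrite pintZ // mulNr.
rewrite -pintD //; last by apply: pL1S => k; exact: pL1Z.
eqp; have hx := sphS p.
have eX k j : Xd k (phi j) p^S = (j == i)%:R * Xd k f p^S by rewrite /phi (XdZ k _ (AlgC1 af) hx).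
have -> : ip (Psi ^~ p) (Df phi ^~ p^S) = \sum_j Psi j p * ((j == i)%:R * f p^S) + \sum_k \sum_j js k j * (Psi j p * ((jp k j == i)%:R * Xd k f p^S)).
 rewrite exchange_big -big_split; apply: eq_bigr => j _ /=; rewrite /Df TfE mulrDr mulr_sumr; congr (_ + _).
 by apply: eq_bigr => k _; rewrite eX mulrCA.
congr (_ + _).
 by rewrite (bigD1 i) //= big1 ?addr0 ?eqxx ?mul1r // => j /negbTE ->; rewrite mul0r mulr0.
apply: eq_bigr => k _; rewrite (bigD1 (jp k i)) //= jpK eqxx mul1r jsN big1 ?addr0 // => j.
by rewrite (inv_eq (@jpK k)) => /negbTE ->; rewrite mul0r !mulr0.
Qed.

Lemma sol_Theta : L2p Theta.
Proof.
have ir8 := pL1_rho 8; have iP2 i : pL1 (fun p => Psi i p ^+ 2) by case: (sol_L2 i).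
move=> i; split; first exact: pmeasM.
have hr := wD_regular sol_wD mr (fun p _ => r0 p) (pL1_rho 2) ir8 iP2 i.
by apply: eqL1 hr => p _; rewrite [RHS]exprMn.
Qed.

Let iT2 i : pL1 (fun p => rho p ^+ 2 * Psi i p ^+ 2).
Proof. by have [_ h] := sol_Theta i; apply: eqL1 h => p _; rewrite exprMn. Qed.

Let iP2 i : pL1 (fun p => Psi i p ^+ 2). Proof. by case: (sol_L2 i). Qed.

Let sq := sqd Psi.

Let sq0 p : 0 <= sq p. Proof. exact: ip_ge0. Qed.

Let rsq : pL1 (fun p => rho p * sq p).
Proof.
apply: eqL1 (ip_pL1 sol_Theta sol_L2) => p _; rewrite /sq /sqd /ip mulr_sumr.
by apply: eq_bigr => i _; rewrite mulrA.
Qed.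

Let Lrsq : Lr Theta Psi = \I_p (rho p * sq p).
Proof. by eqp; rewrite /sq /sqd /ip mulr_sumr; apply: eq_bigr => i _; rewrite mulrA. Qed.

Let iE : pL1 (fun p => expR (2 * U p)). Proof. exact: wH1_exp hU. Qed.

Let r2E p : rho p ^+ 2 = B ^+ 2 * expR (2 * U p).
Proof. by rewrite /rho exprMn -expRM_natl. Qed.

Lemma sol_eq1 w : Alg w -> \I_p (\sum_k wgk u k p * Xd k w p^S) =
 \I_p ((A * expR (2 * U p) - 1 + rho p * sq p) * w p^S).
Proof.
move=> aw; have [_ _ h _] := hsol; have [_ _ _ _ h2] := H1_wgrad sol_H1.
rewrite -h2; last exact: AlgC1.
rewrite -[LHS]/(sint (fun x => dot (wgrad u x) (grad w x))) (h w (Alg_smooth aw)).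
by eqp; rewrite sqnormE.
Qed.

Lemma sol_mass : A * \I_p (expR (2 * U p)) <= 4 * pi.
Proof.
have := sol_eq1 (AlgC 1).
rewrite (_ : pint _ = 0); last first.
 by rewrite -[RHS](pint0); eqp; rewrite big1 // => k _; rewrite Xd_cst mulr0.
have -> : \I_p ((A * expR (2 * U p) - 1 + rho p * sq p) * 1) = A * \I_p (expR (2 * U p)) - 4 * pi + \I_p (rho p * sq p).
 have i1 := pL1Z A iE; have i2 := pL1B i1 (pL1C 1).
 rewrite -[X in _ - X]mul1r -pint_cst -pintZ // -pintB //; last exact: pL1C.
 by rewrite -pintD //; eqp; rewrite mulr1.
have : 0 <= \I_p (rho p * sq p) by apply: pint_ge0 => p _; exact: mulr_ge0.
by lra.
Qed.

Lemma sol_energy : \I_p (\sum_k wgk u k p ^+ 2) + 2 * pint U - A * \I_p (expR (2 * U p)) + 4 * pi <= energy A B u psi.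
Proof.
have [_ iu2 id hd _] := H1_wgrad sol_H1; have [iU _ _ _] := hU.
have hdf := dirac_form_ge sol_wD sol_L2 sol_Theta (let: And4 _ h _ _ := hsol in h).
rewrite Lrsq in hdf; rewrite /energy.
have -> : sint (fun x => dot (wgrad u x) (wgrad u x) + 2 * u x - A * expR (2 * u x)) =
  \I_p (\sum_k wgk u k p ^+ 2) + 2 * pint U - A * \I_p (expR (2 * U p)).
 rewrite hd -!pintZ // -pintD //; last exact: pL1Z.
 by rewrite -pintB //; [apply: pL1D => //; exact: pL1Z|exact: pL1Z].
have -> : B * sint (fun x => expR (u x) * sqnorm (psi x)) = \I_p (rho p * sq p).
 have h : pL1 (fun p => expR (U p) * sq p).
  by apply: (eqL1 _ (pL1Z B^-1 rsq)) => p _; rewrite /rho -mulrA mulKf // lt0r_neq0.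
 rewrite -[sint _]/(\I_p (expR (U p) * sqnorm (psi p^S))) (_ : pint _ = \I_p (expR (U p) * sq p)).
  by rewrite -pintZ //; eqp; rewrite mulrA.
 by eqp; rewrite sqnormE.
rewrite lerD2r lerDl mulr_ge0 // subr_ge0 //.
Qed.

Hypothesis hnt : nontrivial psi.

Let hnt' : ~ pae (fun p => sq p = 0).
Proof.
move=> h; apply: hnt; apply: paeS h => p _ e; apply: comps_inj; apply/funext => i.
have /eqP : \sum_i Psi i p * Psi i p = 0 by exact: e.
rewrite psumr_eq0 => [/allP /(_ i)|j _]; last by rewrite -expr2 sqr_ge0.
rewrite mem_index_enum /= mulf_eq0 orbb => /(_ isT) /eqP hi.
by rewrite -[LHS]/(Psi i p) hi /comps; case: i hi => a []; rewrite /= mxE.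
Qed.

Hypothesis hmin : energy A B u psi <= 4 * pi * (1 - A / B ^+ 2 - 2 * ln B).

(** Put [y = B^2 D / (4 pi)] and [a = A / B^2]. Bär's inequality is [y >= 1], the mass bound is
    [a y <= 1], and the energy comparison is [ln y <= a (y - 1)]. If [y > 1], the strict inequality
    [1 / y > 1 - ln y] gives [(y - 1) (1 - a y) < 0], a contradiction. *)
Lemma sol_extremal : \I_p (expR (2 * U p)) = 4 * pi / B ^+ 2 /\
 \I_p (\sum_k wgk u k p ^+ 2) + 2 * pint U = 4 * pi * ln (\I_p (expR (2 * U p)) / (4 * pi)).
Proof.
have p4 : 0 < 4 * pi :> R by rewrite mulr_gt0 // pi_gt0.
have Bn := lt0r_neq0 hB; have B2 : 0 < B ^+ 2 by rewrite exprn_gt0.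
have hb := baer_bound sol_wD (pL1_rho 2) iP2 iT2 hnt'.
have [_ hO] := onofri hU; have hE := le_trans sol_energy hmin; have hm := sol_mass.
set D := \I_p (expR (2 * U p)) in hO hE hm *; set J := pint _ + 2 * pint U in hO hE *.
have er : \I_p (rho p ^+ 2) = B ^+ 2 * D by rewrite -pintZ //; eqp; exact: r2E.
rewrite er in hb; pose y := B ^+ 2 * D / (4 * pi); pose a := A / B ^+ 2.
have y1 : 1 <= y by rewrite /y ler_pdivlMr // mul1r.
have yp : 0 < y by lra.
have ay : a * y <= 1.
 have -> : a * y = A * D / (4 * pi) by case: (quot_arith A D Bn (lt0r_neq0 p4)).
 by rewrite ler_pdivrMr // mul1r.
have eD : D = 4 * pi * (y / B ^+ 2) by case: (quot_arith A D Bn (lt0r_neq0 p4)).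
have eq1 : D / (4 * pi) = y / B ^+ 2 by rewrite eD [4 * pi * _]mulrC mulfK // lt0r_neq0.
have el : ln (D / (4 * pi)) = ln y - 2 * ln B.
 by rewrite eq1 lnM ?posrE ?invr_gt0 // lnV ?posrE // lnXn // mulr_natl.
have eA : A * D = 4 * pi * (a * y) by rewrite eD /a mulrCA; congr (_ * _); rewrite mulrA mulrAC.
rewrite el in hO *; rewrite eA -/a in hE.
have h1 : ln y <= a * (y - 1).
 by rewrite -(ler_pM2l p4); move: hO hE; move: (4 * pi) J (ln y) (ln B) => q j l b; nra.
have ye : y = 1.
 apply/eqP; apply/contraT => yn; have ly : - ln y != 0.
  by rewrite oppr_eq0; apply: contra yn => /eqP h; rewrite -[y]lnK ?posrE // h expR0.
 have := expR_gt1Dx ly; rewrite expRN lnK ?posrE // => h2.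
 have h3 : y * (1 - a * (y - 1)) < 1.
  apply: (@le_lt_trans _ _ (y * (1 + - ln y))); first by apply: ler_wpM2l; [exact: ltW|lra].
  by move: h2; rewrite -(ltr_pM2l yp) mulfV // lt0r_neq0.
 have y2 : 0 < y - 1 by rewrite subr_gt0 lt_neqAle eq_sym yn.
 have := mulr_ge0 (ltW y2) (_ : 0 <= 1 - a * y); rewrite subr_ge0 => /(_ ay).
 by move: h3; rewrite -subr_ge0 -subr_lt0; move: (a * y) => ?; nra.
rewrite ye in eD el h1 hO hE ay *; rewrite ln1 in hO hE h1 *; split; first by rewrite eD mul1r.
apply/eqP; rewrite eq_le hO andbT sub0r; move: hE; rewrite mulr1.
by rewrite (_ : 4 * pi * (1 - a - 2 * ln B) = 4 * pi * - (2 * ln B) - 4 * pi * a + 4 * pi) ?lerD2r //; ring.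
Qed.

(** The equation of [u] and the Euler-Lagrange equation of Onofri's functional share their gradient
    term; the difference is orthogonal to all of [Alg], and dividing by [B e^u] gives the
    density. *)
Lemma sol_density : pae (fun p => sq p = (B ^+ 2 - A) / B * expR (U p)).
Proof.
have [hD hJ] := sol_extremal; have p4 : 4 * pi != 0 :> R by rewrite mulf_neq0 ?pnatr_eq0 // gt_eqF // pi_gt0.
have Bn := lt0r_neq0 hB.
have iF : pL1 (fun p => (A - B ^+ 2) * expR (2 * U p) + rho p * sq p) by apply: pL1D rsq; exact: pL1Z.
have h0 f : Alg f -> \I_p (((A - B ^+ 2) * expR (2 * U p) + rho p * sq p) * f p^S) = 0.
 move=> af; have := onofri_equality hU af hJ; rewrite hD sol_eq1 // => h.
 have i1 := L1MAlg iE af; have i2 := L1MAlg rsq af; have i3 := AlgL1 af.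
 have e : \I_p ((A * expR (2 * U p) - 1 + rho p * sq p) * f p^S) = A * \I_p (expR (2 * U p) * f p^S) - \I_p (f p^S) + \I_p (rho p * sq p * f p^S).
  rewrite -pintZ // -pintB //; last exact: pL1Z.
  by rewrite -pintD //; [eqp; ring|apply: pL1B => //; exact: pL1Z].
 have -> : \I_p (((A - B ^+ 2) * expR (2 * U p) + rho p * sq p) * f p^S) = (A - B ^+ 2) * \I_p (expR (2 * U p) * f p^S) + \I_p (rho p * sq p * f p^S).
  by rewrite -pintZ // -pintD //; [eqp; ring|exact: pL1Z].
 move: h; rewrite e; move: (\I_p (expR (2 * U p) * f p^S)) (\I_p (f p^S)) (\I_p (rho p * sq p * f p^S)) => x y z.
 have [_ _ ->] := quot_arith x 0 Bn p4.
 by lra.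
apply: paeS (pint_orth0 iF h0) => p _.
have e2 : expR (2 * U p) = expR (U p) * expR (U p) by rewrite -expRD; congr expR; ring.
rewrite /rho e2; have := lt0r_neq0 (expR_gt0 (U p)); move: (expR (U p)) (sq p) => x y x0 h.
have Bx : B * x != 0 by rewrite mulf_neq0.
apply: (mulfI Bx); have -> : B * x * ((B ^+ 2 - A) / B * x) = (B ^+ 2 - A) * (x * x) by field.
by rewrite -[LHS]subr0 -h; ring.
Qed.

Hypothesis hAB : A < B ^+ 2.

(** The density makes [1 / |psi|^2] a multiple of [e^(- u)], which is integrable by [wH1_exp], as
    the equality case requires. *)
Lemma sol_baer f : (forall i, Alg (f i)) -> \I_p (ip (fun i => (sq p)^-1 * Psi i p) (Lop f ^~ p^S)) = 0.
Proof.
move=> af; have [hD _] := sol_extremal; have Bn := lt0r_neq0 hB.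
apply: (baer_equality sol_wD (pL1_rho 2) iP2 iT2 hnt' _ _ af).
 rewrite (_ : pint _ = B ^+ 2 * \I_p (expR (2 * U p))).
  by rewrite hD mulrC divfK // expf_neq0.
 by rewrite -pintZ //; eqp; exact: r2E.
have mV : pmeas (fun p => (sq p)^-1) by apply: pmeas_V => //; case: (ip_pL1 sol_L2 sol_L2).
apply: (ae_eq_pL1 mV _ (pL1Z ((B ^+ 2 - A) / B)^-1 (wH1_exp (-1) hU))).
by apply: paeS sol_density => p _ ->; rewrite mulN1r expRN -invfM.
Qed.

End Solution.

(** * The constant solution and its energy *)

Section Competitor.

(** Rewritten with rotation fields, the divergence of any smooth tangent field integrates to 0 by
    [sint_Xd]; this yields the weak gradient of a constant. *)
Lemma sdivE (V : E -> E) (x : E) : (forall i, C1s (fun y => V y 0 i)) -> sphere x -> tangent x (V x) ->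
 sdiv V x = \sum_k Xd k (fun y => dot (V y) (rot k y)) x.
Proof.
move=> cV hx ht; have x0 := sphere0 hx.
have cr k i : C1s (fun y : E => rot k y 0 i) := AlgC1 (Alg_rot k i).
have cM k i : C1s (fun y => V y 0 i * rot k y 0 i) by exact: C1sM.
have e k : Xd k (fun y => dot (V y) (rot k y)) x = \sum_i (Xd k (fun y => V y 0 i) x * rot k x 0 i + V x 0 i * rot k (rot k x) 0 i).
 rewrite (@Xd_ext k _ (fun y => V y 0 0 * rot k y 0 0 + V y 0 1 * rot k y 0 1 + V y 0 o2 * rot k y 0 o2) x) //; last by move=> y _; rewrite dotE.
 rewrite XdD; [|exact: C1sD|exact: cM|exact: x0]; rewrite XdD; [|exact: cM|exact: cM|exact: x0].
 have er i : Xd k (fun y => rot k y 0 i) x = rot k (rot k x) 0 i.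
  by rewrite -(Xd_Xd_coord k k i hx); apply: Xd_ext hx => y hy; rewrite Xd_coord.
 by rewrite !(XdM k (cV _) (cr k _) hx) !er sum3.
rewrite (eq_bigr _ (fun k _ => e k)) /sdiv !sum3.
pose d i j := tderiv (fun y => V y 0 i) x (bvec R j).
have r i : x 0 0 * d i 0 + x 0 1 * d i 1 + x 0 o2 * d i o2 = 0 by rewrite -(tderiv_lin x (cV i) x0) tderiv_radial.
have X0 i : Xd 0 (fun y => V y 0 i) x = x 0 1 * d i o2 - x 0 o2 * d i 1 by have [h _ _] := XdE (cV i) x0; exact: h.
have X1 i : Xd 1 (fun y => V y 0 i) x = x 0 o2 * d i 0 - x 0 0 * d i o2 by have [_ h _] := XdE (cV i) x0; exact: h.
have X2 i : Xd o2 (fun y => V y 0 i) x = x 0 0 * d i 1 - x 0 1 * d i 0 by have [_ _ h] := XdE (cV i) x0; exact: h.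
rewrite !X0 !X1 !X2 !rotE -!/(d _ _) /=.
have := ht; rewrite /tangent dotE; have := hx; rewrite /sphere /= dotE; have := r 0; have := r 1; have := r o2.
move: (d 0 0) (d 0 1) (d 0 o2) (d 1 0) (d 1 1) (d 1 o2) (d o2 0) (d o2 1) (d o2 o2) (x 0 0) (x 0 1) (x 0 o2) (V x 0 0) (V x 0 1) (V x 0 o2).
clear; move=> a b c a' b' c' a2 b2 c2 X Y Z v w t r2 r1 r0 hx hv.
transitivity ((X * X + Y * Y + Z * Z) * (a + b' + c2) - (X * (X * a + Y * b + Z * c) + Y * (X * a' + Y * b' + Z * c') + Z * (X * a2 + Y * b2 + Z * c2)) - 2 * (X * v + Y * w + Z * t)); last by ring.
by rewrite hx r0 r1 r2 hv; ring.
Qed.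

Lemma sint_sdiv (V : E -> E) : smooth_vec V -> (forall x, sphere x -> tangent x (V x)) -> sint (sdiv V) = 0.
Proof.
move=> sV tV; have cV i : C1s (fun y => V y 0 i) by exact: smooth_C1s (sV i).
have cD k : C1s (fun y => dot (V y) (rot k y)).
 apply: (@C1s_ext (fun y => V y 0 0 * rot k y 0 0 + V y 0 1 * rot k y 0 1 + V y 0 o2 * rot k y 0 o2)); first by move=> y _; rewrite dotE.
 have cM i : C1s (fun y => V y 0 i * rot k y 0 i) by apply: C1sM => //; exact: AlgC1 (Alg_rot k i).
 by apply: C1sD => //; exact: C1sD.
transitivity (\I_p (\sum_k Xd k (fun y => dot (V y) (rot k y)) p^S)).
 by eqp; apply: sdivE (sphS p) _ => //; exact: tV (sphS p).
rewrite pintS; first by rewrite big1 // => k _; exact: sint_Xd.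
by move=> k; apply: cont2_pL1; exact: Xd_cont2.
Qed.

Lemma H1_cst (c : R) : H1 (fun _ : E => c).
Proof.
split; [exact: pmeasC|exact: (proj2 (pL1C _))|].
exists (fun _ => 0); split=> [i|||V sV tV].
- by apply: (eq_pmeas _ (pmeasC 0)) => p _ /=; rewrite mxE.
- by apply: (proj2 (eqL1 _ (pL1C 0))) => p _; rewrite dotE !mxE; ring.
- by apply: paeT => p _; rewrite /tangent dotE !mxE; ring.
rewrite (_ : sint _ = 0); last by rewrite -[RHS](pint0); eqp; rewrite dotE !mxE; ring.
have h := sint_sdiv sV tV; have cV i : C1s (fun y => V y 0 i) by exact: smooth_C1s (sV i).
have iS : pL1 (fun p => sdiv V p^S).
 by apply: pL1S => i; apply: cont2_pL1; exact: C1s_tderiv_cont2.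
by rewrite -[sint _]/(\I_p (c * sdiv V p^S)) pintZ // [pint _]h mulr0 oppr0.
Qed.

(** [wgrad] is a chosen weak gradient, so its vanishing for a constant can be asserted almost
    everywhere. *)
Lemma wgk_cst (c : R) : pae (fun p => forall k, wgk (fun _ => c) k p = 0).
Proof.
have [[_ iG _ hG] _ _ _ _] := H1_wgrad (H1_cst c).
have h k : pae (fun p => wgk (fun _ => c) k p = 0).
 apply: pint_orth0 => // f af; rewrite hG // pintZ; last exact: AlgL1 (Alg_Xd k af).
 by rewrite [pint _](sint_Xd k (AlgC1 af)) mulr0 oppr0.
by apply: paeS (paeI (h 0) (paeI (h 1) (h o2))) => p _ [h0 [h1 h2]] k; case: (ord3P k) => ->.
Qed.

Variables A B : R.
Hypotheses (hA : 0 < A)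
(hB : 0 < B)
(hAB : A < B ^+ 2).

Let K : R := 1 - A / B ^+ 2.
Let v0 (i : ix) : R := if i == s00 then Num.sqrt K else 0.
Let f0 : spf := fun i _ => v0 i.
Let psi0 : E -> 'cV[R[i]]_2 := mkS f0.
Let u0 : E -> R := fun _ => - ln B.

Let K0 : 0 < K. Proof. by rewrite subr_gt0 ltr_pdivrMr ?mul1r // exprn_gt0. Qed.

Let af0 i : Alg (f0 i). Proof. exact: AlgC. Qed.
Let cf0 i : C1s (f0 i). Proof. exact: AlgC1. Qed.

Let ipv0 : ip v0 v0 = K.
Proof. by rewrite ipE /v0 /= !mulr0 !addr0 -expr2 sqr_sqrtr // ltW. Qed.

Let Df0 i (x : E) : sphere x -> Df f0 i x = f0 i x.
Proof. by move=> hx; rewrite /Df TfE big1 ?addr0 // => k _; rewrite Xd_cst mulr0. Qed.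

Let L0 : L2p (ofs f0). Proof. exact: C1s_L2p. Qed.

Let n0 : Lr (ofs f0) (ofs f0) = K * (4 * pi).
Proof. by rewrite -pint_cst; eqp; exact: ipv0. Qed.

Let symD (g : spf) : (forall i, C1s (g i)) -> Lr (ofs f0) (ofs (Df g)) = Lr (ofs f0) (ofs g).
Proof.
move=> cg; rewrite Df_symC1 //; eqp; apply: eq_bigr => i _.
by rewrite /ofs Df0 //; exact: sphS.
Qed.

(** [psi0] is an eigenspinor for the eigenvalue 1: either [l j = 1] or the coefficient is 0. *)
Lemma competitor_coef n (l : 'I_n -> R) phi j : eigenfamily l phi ->
 l j * sqC (L2dot psi0 (phi j)) = sqC (L2dot psi0 (phi j)).
Proof.
move=> he; have cp := eigenfamily_C1s he j; have ef := eigenfamily_Df he j.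
have eD (g : spf) : (forall i, C1s (g i)) -> (forall i (x : E), sphere x -> Df g i x = l j * g i x) -> (l j - 1) * Lr (ofs f0) (ofs g) = 0.
 move=> cg eg; rewrite mulrBl mul1r -{2}(symD cg) -LrZr //; last exact: C1s_L2p.
 apply/eqP; rewrite subr_eq0; apply/eqP; eqp; apply: eq_bigr => i _.
 by rewrite /ofs eg //; exact: sphS.
rewrite L2dotE fcomp_mkS /sqC /=; have := eD _ (C1s_If cp) (If_eig cp ef); have := eD _ cp ef.
rewrite -[Ip _]/(ofs (If (fcomp (phi j)))); move: (Lr _ _) (Lr _ _) (l j) => a b c ha hb.
apply/eqP; rewrite -subr_eq0 (_ : _ - _ = (c - 1) * a * a + (c - 1) * b * b); last by ring.
by rewrite ha hb !mul0r addr0.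
Qed.

Lemma competitor_bessel n (l : 'I_n -> R) phi : eigenfamily l phi -> \sum_j sqC (L2dot psi0 (phi j)) <= K * (4 * pi).
Proof.
move=> he; have LG := eigenfamily_L2p he; pose G j : ppf := ofs (fcomp (phi j)).
rewrite -n0; apply: le_trans (bessel (dbl_L2p LG) (dbl_orth LG (eigenfamily_neq he)) L0).
rewrite -(pair_bigA _ (fun j b => Lr (ofs f0) (dbl G (j, b)) ^+ 2 / Lr (G j) (G j))) /=.
apply: ler_sum => j _; rewrite big_bool /= L2dotE fcomp_mkS /sqC /dbl /=.
by have [-> _] := eigenfamily_orth he j j; rewrite eqxx !divr1 addrC.
Qed.

Lemma competitor_dirac : H12 psi0 /\ dirac_form psi0 <= K * (4 * pi).
Proof.
have sq0 (z : R[i]) : 0 <= sqC z by rewrite addr_ge0 ?sqr_ge0.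
have hb s : dirac_sums psi0 s -> 0 <= s <= K * (4 * pi).
 move=> [n [l [phi [he ->]]]]; rewrite (eq_bigr _ (fun j _ => competitor_coef j he)) (competitor_bessel he) andbT.
 by apply: sumr_ge0 => j _; exact: sq0.
have h0 : dirac_sums psi0 0.
 exists 0%N, (fun _ => 0), (fun _ _ => 0); split; last by rewrite big_ord0.
 by split=> [[]|[]|[]].
split; last first.
 rewrite -[leRHS]addr0; apply: lerD.
  by apply: ge_sup; [exists 0|move=> s /hb /andP[]].
 by apply: ge_inf => //; exists 0 => s /hb /andP[].
split.
 have mc i : pmeas (ofs f0 i) by have [] := L0 i.
 split=> [a|a|].
 - by apply: (eq_pmeas _ (pmeasC (complex.Re (psi0 0 a 0)))).
 - by apply: (eq_pmeas _ (pmeasC (complex.Im (psi0 0 a 0)))).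
 - by apply: (proj2 (eqL1 _ (pL1C (sqnorm (psi0 0))))).
exists (K * (4 * pi)) => n l phi he; apply: le_trans (competitor_bessel he); apply: ler_sum => j _.
have := competitor_coef j he; have := sq0 (L2dot psi0 (phi j)); move: (sqC _) (l j) => c a c0 h.
by rewrite -{2}h -{1}(ger0_norm c0) -normrM h ger0_norm.
Qed.

Let eB : B * expR (- ln B) = 1.
Proof. by rewrite expRN lnK ?posrE // mulfV // lt0r_neq0. Qed.

Let e2B : expR (2 * - ln B) = B ^- 2.
Proof. by rewrite expRM_natl expRN lnK ?posrE // exprVn. Qed.

Let sq0 (x : E) : sqnorm (psi0 x) = K.
Proof. by rewrite sqnormE mkCK ipv0. Qed.

Lemma competitor_solution : is_solution A B u0 psi0.
Proof.
have [[iU iG iG2 hG] _ _ _ hw] := H1_wgrad (H1_cst (- ln B)).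
split; [exact: H1_cst|by case: competitor_dirac| |].
- move=> w sw; have cw := smooth_C1s sw; rewrite [LHS](hw w cw).
 rewrite (_ : sint _ = 0); last first.
  rewrite -[RHS](pint0); eqp; rewrite /u0 e2B sq0 eB /K.
  by rewrite (_ : A * B ^- 2 - 1 + 1 * _ = 0) ?mul0r //; ring.
 rewrite -[RHS](pint0); apply: ae_eq_pint; [|exact: pmeasC|].
  apply: pmeas_sum => k; apply: pmeasM; first by case: (iG k).
  by apply: cont2_pmeas; exact: Xd_cont2.
 by apply: paeS (wgk_cst (- ln B)) => p _ h; rewrite big1 // => k _; rewrite h mul0r.
move=> phi sp; have cp i : C1s (fcomp phi i) by exact: smooth_fcomp.
have ed : forall p, fcomp (dirac_op phi) ^~ p^S = Df (fcomp phi) ^~ p^S.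
 by move=> p; apply/funext => i; rewrite /fcomp comps_dirac //; exact: sphS.
have -> : sintC (fun x => (B * expR (u0 x))%:C * hdot (psi0 x) (phi x)) = L2dot psi0 phi.
 by congr (_ +i* _); eqp; rewrite /u0 eB mul1r.
rewrite !L2dotE fcomp_mkS; congr (_ +i* _).
 by rewrite -(symD cp); eqp; rewrite /ofs ed.
rewrite -[Ip (ofs (fcomp phi))]/(ofs (If (fcomp phi))) -(symD (C1s_If cp)); eqp; apply: eq_bigr => i _.
by rewrite /ofs Df_If //; [rewrite /If -ed|exact: sphS].
Qed.

Lemma competitor_energy : energy A B u0 psi0 <= 4 * pi * (1 - A / B ^+ 2 - 2 * ln B).
Proof.
have [_ _ id hd _] := H1_wgrad (H1_cst (- ln B)); have [_ hD] := competitor_dirac.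
have [[_ iG _ _] _ _ _ _] := H1_wgrad (H1_cst (- ln B)).
have z : \I_p (dot (wgrad u0 p^S) (wgrad u0 p^S)) = 0.
 rewrite -hd -[RHS](pint0); apply: ae_eq_pint; [|exact: pmeasC|].
  by apply: pmeas_sum => k; apply: (pmeas_ct (@exprn_continuous _ 2)); case: (iG k).
 by apply: paeS (wgk_cst (- ln B)) => p _ h; rewrite big1 // => k _; rewrite h expr0n.
have -> : energy A B u0 psi0 = (2 * - ln B - A * B ^- 2) * (4 * pi) + 2 * (dirac_form psi0 - K * (4 * pi)) + 4 * pi.
 congr (_ + 2 * (_ - _) + _).
  rewrite -[RHS]add0r -z -pint_cst -pintD //; last exact: pL1C.
  by eqp; rewrite /u0 e2B addrA.
 transitivity (B * pint (fun _ : R * R => expR (- ln B) * K)); last by rewrite pint_cst !mulrA eB mul1r.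
 by congr (_ * _); eqp; rewrite sq0.
by move: hD; rewrite /K; move: (dirac_form _) (4 * pi) (ln B) (A / B ^+ 2) => D q l a; nra.
Qed.

End Competitor.

(** * The kernel of the twistor form *)

Section Kernel.

Definition sgc (k : 'I_3) (i : ix) : R := (-1) ^+ (~~ i.2) * js k (i.1, ~~ i.2).

Definition sgp (k : 'I_3) (i : ix) : ix := jp k (i.1, ~~ i.2).

Lemma sgS (X : E) (v : V4) i : sg X v i = \sum_k sgc k i * (X 0 k * v (sgp k i)).
Proof. by rewrite sum3 /sgc /sgp !jE; case: i => -[] [] /=; rewrite !jE /=; ring. Qed.

Definition sgf (g : spf) : spf := fun i x => sg x (g ^~ x) i.

Lemma Alg_sgf g : (forall i, Alg (g i)) -> forall i, Alg (sgf g i).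
Proof.
move=> ag i; apply: (@Alg_ext (fun x => \sum_k sgc k i * (x 0 k * g (sgp k i) x))); last by move=> x _; rewrite /sgf sgS.
by apply: Alg_sum => k; apply: AlgM (AlgC _) (AlgM (AlgX _) (ag _)).
Qed.

Lemma Xd_sgf k (g : spf) i (x : E) : (forall i, Alg (g i)) -> sphere x ->
 Xd k (sgf g i) x = sg (rot k x) (g ^~ x) i + sg x (gr g x k) i.
Proof.
move=> ag hx; rewrite (@Xd_ext k _ (fun x => \sum_l sgc l i * (x 0 l * g (sgp l i) x)) x) //; last by move=> y _; rewrite /sgf sgS.
rewrite (@Xd_sum _ _ (fun l => sgc l i) (fun l x => x 0 l * g (sgp l i) x)) //; last by move=> l; exact: AlgM (AlgX _) (ag _).
rewrite !sgS -big_split; apply: eq_bigr => l _ /=.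
by rewrite (XdM k (AlgC1 (AlgX l)) (AlgC1 (ag _)) hx) Xd_coord // mulrDr.
Qed.

Lemma sg_tr_arith (x : E) (v : V4) (y : 'I_3 -> V4) i :
 \sum_k js k i * (sg (rot k x) v (jp k i) + sg x (y k) (jp k i)) =
 - 2 * sg x v i - sg x (tr y) i + - 2 * Ic (fun j => \sum_k x 0 k * y k j) i.
Proof.
rewrite /tr; case: i => -[] []; rewrite !jE /sg /Ic /= !jE /= !rotE;
 move: (y 0) (y 1) (y o2) (x 0 0) (x 0 1) (x 0 o2) => a b c X0 X1 X2;
 move: (a s00) (a s01) (a s10) (a s11)
(b s00) (b s01) (b s10) (b s11)
(c s00) (c s01) (c s10) (c s11) (v s00) (v s01) (v s10) (v s11) => *; ring.
Qed.

(** [sigma(x)] intertwines [T] with [- 2 - T], hence maps the kernel of [T + 2] into that of [T]. *)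
Lemma Tf_sgf (g : spf) i (x : E) : (forall i, Alg (g i)) -> sphere x ->
 Tf (sgf g) i x = - 2 * sgf g i x - sg x (Tf g ^~ x) i.
Proof.
move=> ag hx; have ht j := gr_tangent j ag hx.
have -> : Tf g ^~ x = tr (gr g x) by apply/funext => j; rewrite Tf_tr.
have e : Tf (sgf g) i x = \sum_k js k i * (sg (rot k x) (g ^~ x) (jp k i) + sg x (gr g x k) (jp k i)).
 by rewrite TfE; apply: eq_bigr => k _; rewrite Xd_sgf.
have h4 : - 2 * Ic (fun j => \sum_k x 0 k * gr g x k j) i = 0.
 by rewrite (_ : (fun j => _) = (fun _ => 0)); [case: i {e} => a []; rewrite /Ic ?oppr0 mulr0|apply/funext => j; exact: ht].
by rewrite e sg_tr_arith h4 addr0.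
Qed.

(** By [green], all derivatives of a solution of [T f = 0] vanish. *)
Lemma T0_cst (f : spf) : (forall i, Alg (f i)) -> pae (fun p => forall i, Tf f i p^S = 0) ->
 pae (fun p => forall i, f i p^S = \I_p (f i p^S) / (4 * pi)).
Proof.
move=> af hT; have aT i := Alg_Tf i af.
have iG k i : pL1 (fun p => Xd k (f i) p^S ^+ 2) := AlgL1 (AlgXn 2 (Alg_Xd k (af i))).
have h0 : \I_p (\sum_k ip (gr f p^S k) (gr f p^S k)) = 0.
 rewrite (green af af) -[RHS](pint0); apply: ae_eq_pint; [|exact: pmeasC|].
  by case: (pL1D (AlgL1 (Alg_ip aT aT)) (AlgL1 (Alg_ip aT af))).
 by apply: paeS hT => p _ h; rewrite !ipE !h; ring.
have iS : pL1 (fun p => \sum_k ip (gr f p^S k) (gr f p^S k)).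
 by apply: pL1S => k; apply: pL1S => i; apply: eqL1 (iG k i) => p _; exact: expr2.
have S0 p : 0 <= \sum_k ip (gr f p^S k) (gr f p^S k) by apply: sumr_ge0 => k _; exact: ip_ge0.
have hX : pae (fun p => forall k i, Xd k (f i) p^S = 0).
 apply: paeS (pint_eq0_ae iS (fun p _ => S0 p) h0) => p _ /eqP; rewrite psumr_eq0; last by move=> k _; exact: ip_ge0.
 move=> /allP h k i; have := h k (mem_index_enum k); rewrite /= psumr_eq0; last by move=> j _; rewrite -expr2 sqr_ge0.
 by move=> /allP /(_ i (mem_index_enum i)) /=; rewrite mulf_eq0 orbb => /eqP.
have hc i : pae (fun p => f i p^S = \I_p (f i p^S) / (4 * pi)).
 apply: (wgrad0_cst (AlgL1 (af i))) => k w aw.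
 apply/eqP; rewrite -oppr_eq0 -(pint_Xd_ibp k (af i) aw); apply/eqP.
 rewrite -[RHS](pint0); apply: ae_eq_pint; [by case: (AlgL1 (AlgM (Alg_Xd k (af i)) aw))|exact: pmeasC|].
 by apply: paeS hX => p _ h; rewrite h mul0r.
apply: paeS (paeI (paeI (hc s00) (hc s01)) (paeI (hc s10) (hc s11))) => p _.
by move=> [[h1 h2] [h3 h4]] [[] []].
Qed.

Lemma pint_coord i : pint (fun p : R * R => sph p 0 i) = 0.
Proof.
have h k j : pint (fun p : R * R => rot k p^S 0 j) = 0.
 by rewrite -[RHS](sint_Xd k (AlgC1 (AlgX j))); eqp; rewrite Xd_coord //; exact: sphS.
case: (ord3P i) => ->.
- by rewrite -(h o2 1); eqp; rewrite !rotE.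
- by rewrite -(h 0 o2); eqp; rewrite !rotE.
- by rewrite -(h 1 0); eqp; rewrite !rotE.
Qed.

(** [g = T f] satisfies [(T + 2) g = 0], so [sigma(x) g] is a constant [c]; then
    [f + 1/2 sigma(x) c] is killed by [T], hence constant as well. *)
Lemma Lop_kernel (f : spf) : (forall i, Alg (f i)) -> pae (fun p => forall i, Lop f i p^S = 0) ->
 exists Q : V4, pae (fun p => forall i, f i p^S = \I_p (f i p^S) / (4 * pi) + sg p^S Q i).
Proof.
move=> af hL; pose g : spf := Tf f; have ag i : Alg (g i) := Alg_Tf i af.
have hg : pae (fun p => forall i, Tf (sgf g) i p^S = 0).
 apply: paeS hL => p _ h i; rewrite Tf_sgf //; last exact: sphS.
 have -> : Tf g ^~ p^S = fun i => - 2 * g i p^S.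
  by apply/funext => j; have := h j; rewrite /Lop -/g; lra.
 by rewrite /sgf !sgS mulr_sumr -sumrB big1 // => k _; ring.
pose c : V4 := fun i => \I_p (sgf g i p^S) / (4 * pi).
have hc : pae (fun p => forall i, sgf g i p^S = c i) := T0_cst (Alg_sgf ag) hg.
pose cf : spf := fun i _ => c i; have acf i : Alg (cf i) by exact: AlgC.
pose P : spf := fun i x => f i x + 2^-1 * sgf cf i x.
have aP i : Alg (P i) by apply: AlgD (af i) (AlgM (AlgC _) (Alg_sgf acf i)).
have hP : pae (fun p => forall i, Tf P i p^S = 0).
 apply: paeS hc => p _ h i; have hx := sphS p.
 have -> : Tf P i p^S = g i p^S + 2^-1 * Tf (sgf cf) i p^S.
  rewrite /g !TfE mulr_sumr -big_split; apply: eq_bigr => k _ /=.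
  rewrite XdD; [|exact: AlgC1|exact: AlgC1 (AlgM (AlgC _) (Alg_sgf acf _))|exact: sphere0].
  by rewrite (XdZ k _ (AlgC1 (Alg_sgf acf _)) hx) mulrDr mulrCA.
 rewrite Tf_sgf // (_ : Tf cf ^~ p^S = fun _ => 0); last first.
  by apply/funext => j; rewrite TfE big1 // => k _; rewrite Xd_cst mulr0.
 have -> : g i p^S = sgf cf i p^S.
  by rewrite /sgf (_ : cf ^~ _ = sg p^S (g ^~ p^S)) ?sg_sphere //; apply/funext => j; exact: esym (h j).
 by rewrite [sg _ (fun _ => 0) i]sgS big1 ?subr0 => [|k _]; [field|rewrite !mulr0].
exists (fun i => - 2^-1 * c i); apply: paeS (T0_cst aP hP) => p _ h i.
have -> : sg p^S (fun i => - 2^-1 * c i) i = - (2^-1 * sgf cf i p^S).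
 by rewrite /sgf !sgS mulr_sumr -sumrN; apply: eq_bigr => k _; rewrite /cf; ring.
have := h i; rewrite /P pintD; [|exact: AlgL1|exact: AlgL1 (AlgM (AlgC _) (Alg_sgf acf i))].
have z : \I_p (2^-1 * sgf cf i p^S) = 0.
 rewrite pintZ; last exact: AlgL1 (Alg_sgf acf i).
 rewrite (_ : pint _ = pint (fun p : R * R => \sum_k sgc k i * c (sgp k i) * sph p 0 k)); last first.
  by eqq; rewrite /sgf sgS; apply: eq_bigr => k _; rewrite /cf; ring.
 have ic k : pL1 (fun p : R * R => sph p 0 k) := AlgL1 (AlgX k).
 rewrite pintS; last by move=> k; exact: pL1Z.
 by rewrite big1 ?mulr0 // => k _; rewrite pintZ // pint_coord mulr0.
by rewrite z addr0 => <-; rewrite addrK.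
Qed.

Variable X : ppf.
Hypotheses (iX : forall i, pL1 (X i))
(hX : forall f : spf, (forall i, Alg (f i)) -> \I_p (ip (X ^~ p) (Lop f ^~ p^S)) = 0).

Let Y M : spf := fun i => conv M (X i).
Let aY M i : Alg (Y M i) := conv_Alg M (iX i).

Let aLop (f : spf) : (forall i, Alg (f i)) -> forall i, Alg (Lop f i).
Proof.
move=> af i; apply: AlgD (Alg_Tf i af); apply: AlgM (AlgC _) _.
by apply: Alg_Tf => j; exact: Alg_Tf.
Qed.

Lemma ip_half (a b c : V4) : ip (fun i => 2^-1 * a i + b i) c = 2^-1 * ip a c + ip b c.
Proof. by rewrite !ipE; move: (a _) (a _) (a _) (a _) (b _) (b _) (b _) (b _) => *; ring. Qed.

Lemma ip_half_r (a b c : V4) : 2^-1 * ip c a + ip c b = ip c (fun i => 2^-1 * a i + b i).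
Proof. by rewrite !ipE; move: (a _) (a _) (a _) (a _) (b _) (b _) (b _) (b _) => *; ring. Qed.

Lemma conv_Tf M (f : spf) i (x : E) : (forall i, Alg (f i)) -> sphere x ->
 Tf (fun j => conv M (ofs f j)) i x = conv M (ofs (Tf f) i) x.
Proof.
move=> af hx; have := wD_conv M i (wD_Alg af) hx; rewrite /Df.
rewrite (convD M x (AlgL1 (af i)) (AlgL1 (Alg_Tf i af))).
by move/addrI.
Qed.

(** Mollification is symmetric and commutes with [T], so [Y M] is orthogonal to every [Lop f]. As
    [Lop] is symmetric, the choice [f = Lop (Y M)] shows that [Lop (Y M)] has norm 0. *)
Lemma Lop_conv M : pae (fun p => forall i, Lop (Y M) i p^S = 0).
Proof.
have aL := aLop (aY M); have aT f (af : forall i, Alg (f i)) i := Alg_Tf i (af : forall i, Alg ((f : spf) i)).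
have key (f : spf) : (forall i, Alg (f i)) -> \I_p (ip (Y M ^~ p^S) (Lop f ^~ p^S)) = 0.
 move=> af; have aLf := aLop af; pose h : spf := fun i => conv M (ofs f i).
 have ah i : Alg (h i) := conv_Alg M (AlgL1 (af i)).
 rewrite -[RHS](hX ah).
 have i1 i : pL1 (fun p => conv M (X i) p^S * Lop f i p^S) := AlgL1 (AlgM (aY M i) (aLf i)).
 have i2 i : pL1 (fun p => X i p * Lop h i p^S) := L1MAlg (iX i) (aLop ah i).
 transitivity (\sum_i \I_p (conv M (X i) p^S * Lop f i p^S)); first exact: pintS i1.
 transitivity (\sum_i \I_p (X i p * Lop h i p^S)); last by symmetry; exact: pintS i2.
 apply: eq_bigr => i _.
 transitivity (\I_p (Lop f i p^S * conv M (X i) p^S)); first by eqp; exact: mulrC.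
 rewrite (conv_sym M (iX i) (AlgL1 (aLf i))); eqp; congr (_ * _); have hx := sphS p.
 have aTf j : Alg (Tf f j) by exact: Alg_Tf.
 rewrite /Lop (convD M p^S (pL1Z _ (AlgL1 (Alg_Tf i aTf))) (AlgL1 (aTf i))) (convZ M _ p^S (AlgL1 (Alg_Tf i aTf))).
 rewrite -(conv_Tf M i af hx) -(conv_Tf M i aTf hx); congr (_ * _ + _).
 rewrite !TfE; apply: eq_bigr => k _; congr (_ * _); apply: Xd_ext hx => y hy.
 by rewrite (conv_Tf M _ af hy).
have h2 : \I_p (ip (Lop (Y M) ^~ p^S) (Lop (Y M) ^~ p^S)) = 0.
 rewrite -[RHS](key _ aL); set L := Lop (Y M) in aL *.
 have aTY := aT _ (aY M); have aTTY := aT _ aTY; have aTL := aT _ aL; have aTTL := aT _ aTL.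
 have e1 := Tf_sym (aY M) aL; have e2 := Tf_sym (aY M) aTL; have e3 := Tf_sym aTY aL.
 have j1 := AlgL1 (Alg_ip aTTY aL); have j2 := AlgL1 (Alg_ip aTY aL).
 have j3 := AlgL1 (Alg_ip (aY M) aTTL); have j4 := AlgL1 (Alg_ip (aY M) aTL).
 transitivity (2^-1 * \I_p (ip (Tf (Tf (Y M)) ^~ p^S) (L ^~ p^S)) + \I_p (ip (Tf (Y M) ^~ p^S) (L ^~ p^S))).
  rewrite -(pintZ 2^-1 j1) -(pintD (pL1Z 2^-1 j1) j2).
  by eqp; exact: ip_half.
 rewrite -e3 -e2 -e1 -(pintZ 2^-1 j3) -(pintD (pL1Z 2^-1 j3) j4).
 by eqp; exact: ip_half_r.
have i0 := AlgL1 (Alg_ip aL aL).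
apply: paeS (pint_eq0_ae i0 (fun p _ => ip_ge0 _) h2) => p _ /eqP; rewrite psumr_eq0; last by move=> j _; rewrite -expr2 sqr_ge0.
by move=> /allP h i; have := h i (mem_index_enum i); rewrite /= mulf_eq0 orbb => /eqP.
Qed.

(** Every mollification has the form given by [Lop_kernel]. Since [sigma(x)^2 = 1], its coefficient
    [QM M] is the mean of [sigma(x)] applied to the centred mollification, so the coefficients
    converge too. *)
Theorem Lop_weak_kernel : exists P Q : V4, pae (fun p => forall i, X i p = P i + sg p^S Q i).
Proof.
have pi4 : 4 * pi != 0 :> R by rewrite mulf_neq0 ?pnatr_eq0 // gt_eqF ?pi_gt0.
pose P : V4 := fun i => pint (X i) / (4 * pi).
pose D (i : ix) p := X i p - P i; have iD i : pL1 (D i) by apply: pL1B (iX i) _; exact: pL1C.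
pose Q : V4 := fun i => \sum_k sgc k i * \I_p (D (sgp k i) p * sph p 0 k) / (4 * pi).
exists P, Q.
have ic k : Alg (fun x : E => x 0 k) := AlgX k.
pose QM M : V4 := fun i => \sum_k sgc k i * \I_p (conv M (D (sgp k i)) p^S * sph p 0 k) / (4 * pi).
have hM M : pae (fun p => forall i, conv M (D i) p^S = sg p^S (QM M) i).
 have [q hq] := Lop_kernel (aY M) (Lop_conv M).
 have e : pae (fun p => forall i, conv M (D i) p^S = sg p^S q i).
  apply: paeS hq => p _ h i; rewrite convB //; last exact: pL1C.
  by rewrite (conv_cst _ _ (sphS p)) -[conv M (X i) _]/(Y M i p^S) h pint_conv // addrAC subrr add0r.
 suff -> : QM M = q by [].
 apply/funext => i; rewrite /QM -mulr_suml; apply: (mulIf pi4); rewrite divfK // -pint_cst.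
 have i1 k : pL1 (fun p => conv M (D (sgp k i)) p^S * sph p 0 k) := AlgL1 (AlgM (conv_Alg M (iD _)) (ic k)).
 transitivity (\I_p (\sum_k sgc k i * (conv M (D (sgp k i)) p^S * sph p 0 k))).
  by rewrite pintS; [apply: eq_bigr => k _; rewrite pintZ|move=> k; exact: pL1Z].
 apply: ae_eq_pint; [by apply: pmeas_sum => k; case: (pL1Z (sgc k i) (i1 k))|exact: pmeasC|].
 apply: paeS e => p _ h; rewrite -[RHS](congr1 (fun v : V4 => v i) (sg_sphere q (sphS p))) [RHS]sgS.
 by apply: eq_bigr => k _; rewrite h [_ * sph p 0 k]mulrC.
have cQ i : QM M i @[M --> \oo] --> Q i.
 apply: cvg_sumf => k; apply: cvgM; last exact: cvg_cst.
 apply: cvgM; first exact: cvg_cst.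
 have [C hC] := cont2_bounded (Alg_cont2 (ic k)); have [_ _ h] := conv_cvg (iD (sgp k i)).
 apply: (@cvg_dist_le _ (fun M => C * \I_p (`|conv M (D (sgp k i)) p^S - D (sgp k i) p|))); last first.
  by rewrite -[X in _ --> X](mulr0 C); apply: cvgM h; exact: cvg_cst.
 move=> M; have i1 := pL1B (conv_L1 M (iD (sgp k i))) (iD (sgp k i)).
 rewrite -pintB; [|exact: L1MAlg (conv_L1 M (iD _)) (ic k)|exact: L1MAlg (iD _) (ic k)].
 have -> : \I_p (conv M (D (sgp k i)) p^S * sph p 0 k - D (sgp k i) p * sph p 0 k) = \I_p ((conv M (D (sgp k i)) p^S - D (sgp k i) p) * sph p 0 k).
  by eqp; rewrite [RHS]mulrBl.
 have i2 := L1MAlg i1 (ic k); apply: (le_trans (le_norm_pint i2)).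
 rewrite -pintZ; last exact: pL1n.
 apply: le_pint; [exact: pL1n|by apply: pL1Z; exact: pL1n|move=> p hp].
 by rewrite normrM mulrC; apply: ler_wpM2r => //; exact: hC.
have [s hs ha] := conv_subseq iD.
have hall : pae (fun p => forall n i, conv (s n) (D i) p^S = sg p^S (QM (s n)) i).
 have h : {ae (@lebesgue_measure R \x @lebesgue_measure R)%E, forall p n, dom p -> forall i, conv (s n) (D i) p^S = sg p^S (QM (s n)) i}.
  by apply: ae_foralln => n; exact: (hM (s n)).
 by apply: filterS h => p h hp n; exact: h.
apply: paeS (paeI ha hall) => p _ [h1 h2] i.
suff : D i p = sg p^S Q i by rewrite /D => <-; rewrite addrC subrK.
rewrite -(cvg_lim _ (h1 i)) //; apply: cvg_lim => //.
under eq_fun do rewrite h2 sgS; rewrite sgS; apply: cvg_sumf => k; apply: cvgM; first exact: cvg_cst.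
apply: cvgM; first exact: cvg_cst.
apply: (cvg_comp s _ _ (cQ (sgp k i))).
by apply/cvgnyPge => N; exists N => // n /= Nn; exact: leq_trans Nn (hs n).
Qed.

End Kernel.

(** * The Dirac equation for [chi / |chi|^2] with [chi] a twistor spinor *)

Section ChiAlgebra.

Lemma sgD (X : E) (v w : V4) i : sg X (fun j => v j + w j) i = sg X v i + sg X w i.
Proof. by rewrite !sgS -big_split; apply: eq_bigr => k _ /=; ring. Qed.

Lemma ip_sg (X : E) (v : V4) : ip (sg X v) (sg X v) = dot X X * ip v v.
Proof. by rewrite !ipE dotE /=; move: (X 0 0) (X 0 1) (X 0 o2) (v _) (v _) (v _) (v _) => *; ring. Qed.

Lemma ip_sgC (X : E) (v w : V4) : ip v (sg X w) = ip (sg X v) w.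
Proof. by rewrite !ipE /=; move: (X 0 0) (X 0 1) (X 0 o2) (v _) (v _) (v _) (v _) (w _) (w _) (w _) (w _) => *; ring. Qed.

Lemma J_rot_sg (x : E) (v : V4) i : \sum_k js k i * sg (rot k x) v (jp k i) = - 2 * sg x v i.
Proof.
by case: i => -[] []; rewrite sum3 !jE /sg /= !rotE; move: (x 0 0) (x 0 1) (x 0 o2) (v _) (v _) (v _) (v _) => *; ring.
Qed.

Lemma J_rot_dot (x m : E) (v : V4) i : \sum_k js k i * (v (jp k i) * (2 * dot m (rot k x))) = - 2 * (sg x (sg m v) i - dot m x * v i).
Proof.
by case: i => -[] []; rewrite sum3 !jE /sg /= !dotE !rotE; move: (x 0 0) (x 0 1) (x 0 o2) (m 0 0) (m 0 1) (m 0 o2) (v _) (v _) (v _) (v _) => *; ring.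
Qed.

Variables (P Q : V4) (kappa : R) (Psi Theta : ppf).
Let chi : spf := fun i x => P i + sg x Q i.
Let n (x : E) : R := ip (chi ^~ x) (chi ^~ x).
Hypotheses (k0 : 0 < kappa)
(hw : wD Psi Theta)
(hP : pae (fun p => [/\ 0 < n p^S, forall i, Psi i p = chi i p^S / n p^S & forall i, Theta i p = kappa * chi i p^S / n p^S ^+ 2])).

Let m : E := \row_k ip P (sg (bvec R k) Q).
Let a : R := ip P P + ip Q Q.

Let Achi i : Alg (chi i).
Proof. by apply: AlgD (AlgC _) (@Alg_sgf (fun j _ => Q j) _ i) => j; exact: AlgC. Qed.

Let An : Alg n. Proof. exact: Alg_ip. Qed.

Let dot_m (x : E) : dot m x = ip P (sg x Q).
Proof.
have em k : m 0 k = ip P (sg (bvec R k) Q) by rewrite mxE.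
rewrite dotE !em !ipE /= !b3 /=; move: (x 0 0) (x 0 1) (x 0 o2) (P _) (P _) (P _) (P _) (Q _) (Q _) (Q _) (Q _) => *; ring.
Qed.

Let nE (x : E) : sphere x -> n x = a + 2 * dot m x.
Proof.
move=> hx; have e : ip (sg x Q) (sg x Q) = ip Q Q by rewrite ip_sg (hx : dot x x = 1) mul1r.
rewrite dot_m /a -e /n /chi !ipE.
by move: (P _) (P _) (P _) (P _) (sg x Q _) (sg x Q _) (sg x Q _) (sg x Q _) => *; ring.
Qed.

Let Xchi k i (x : E) : sphere x -> Xd k (chi i) x = sg (rot k x) Q i.
Proof.
move=> hx; rewrite (XdD k (AlgC1 (AlgC (P i))) (AlgC1 (@Alg_sgf (fun j _ => Q j) (fun j => AlgC (Q j)) i)) (sphere0 hx)).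
rewrite Xd_cst add0r (Xd_sgf k i (fun j => AlgC (Q j)) hx).
rewrite -[RHS]addr0; congr (_ + _); rewrite sgS big1 // => l _.
by rewrite /gr Xd_cst !mulr0.
Qed.

Let Xn k (x : E) : sphere x -> Xd k n x = 2 * dot m (rot k x).
Proof.
move=> hx; rewrite (Xd_ext k nE hx) XdD; [|exact: C1sC|exact: AlgC1 (AlgM (AlgC _) (Alg_dotr m))|exact: sphere0].
by rewrite Xd_cst add0r (XdZ k _ (AlgC1 (Alg_dotr m)) hx) Xd_dotr.
Qed.

(** [n^2] times the difference of [kappa chi / n^2] and [D (chi / n)], free of denominators. *)
Let G i (x : E) := kappa * chi i x - n x * chi i x - \sum_k js k i * (n x * Xd k (chi (jp k i)) x - chi (jp k i) x * Xd k n x).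

Let AG i : Alg (G i).
Proof.
apply: AlgB; first by apply: AlgB; [apply: AlgM (AlgC _) (Achi i)|apply: AlgM An (Achi i)].
apply: Alg_sum => k; apply: AlgM (AlgC _) (AlgB _ _).
 exact: AlgM An (Alg_Xd k (Achi _)).
exact: AlgM (Achi _) (Alg_Xd k An).
Qed.

Let A0 i := (kappa - a) * P i + 2 * sg m Q i.
Let B0 i := (kappa + a) * Q i - 2 * sg m P i.

Let GE i (x : E) : sphere x -> G i x = A0 i + sg x B0 i.
Proof.
move=> hx; rewrite /G.
have -> : \sum_k js k i * (n x * Xd k (chi (jp k i)) x - chi (jp k i) x * Xd k n x) =
 n x * (- 2 * sg x Q i) + 2 * (sg x (sg m (chi ^~ x)) i - dot m x * chi i x).
 rewrite -J_rot_sg -[RHS]addr0 -[2 * (_ - _)]opprK -mulNr -J_rot_dot addr0 mulr_sumr -sumrB; apply: eq_bigr => k _.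
 by rewrite Xchi // Xn //; ring.
have e1 : sg x (sg m (chi ^~ x)) i = sg x (sg m P) i + sg x (sg m (sg x Q)) i.
 by rewrite -sgD; congr (sg x _ i); apply/funext => j; rewrite -sgD.
have e2 : sg x (sg m (sg x Q)) i = 2 * dot m x * sg x Q i - sg m Q i.
 have e := sg_sg m x (sg x Q) i; rewrite (sg_sphere Q hx) in e.
 by rewrite -e addrAC subrr add0r.
have e3 : sg x B0 i = (kappa + a) * sg x Q i - 2 * sg x (sg m P) i.
 by rewrite /B0 (_ : (fun j => _) = fun j => (kappa + a) * Q j + - 2 * sg m P j); [rewrite sgD !sgZ; ring|apply/funext => j; ring].
rewrite e1 e2 e3 (nE hx) /A0 /chi; move: a (dot m x) kappa (P i) (sg x Q i) (sg x (sg m P) i) (sg m Q i) => *; ring.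
Qed.

Let weakG i f : Alg f -> \I_p (G i p^S * f p^S) = 0.
Proof.
move=> af; have [h1 h2 h3] := hw; have An2 := AlgXn 2 An.
have e := h3 i _ (AlgM An2 af).
have t1 : \I_p (Theta i p * (n p^S ^+ 2 * f p^S)) = \I_p (kappa * chi i p^S * f p^S).
 apply: ae_eq_pint; [by case: (L1MAlg (h2 i) (AlgM An2 af))|by case: (AlgL1 (AlgM (AlgM (AlgC kappa) (Achi i)) af))|].
 apply: paeS hP => p _ [n0 _ ->]; move: (n _) (chi _ _) (f _) (lt0r_neq0 n0) => b c d b0; field; exact: b0.
have t2 : \I_p (Psi i p * (n p^S ^+ 2 * f p^S)) = \I_p (n p^S * chi i p^S * f p^S).
 apply: ae_eq_pint; [by case: (L1MAlg (h1 i) (AlgM An2 af))|by case: (AlgL1 (AlgM (AlgM An (Achi i)) af))|].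
 apply: paeS hP => p _ [n0 -> _]; move: (n _) (chi _ _) (f _) (lt0r_neq0 n0) => b c d b0; field; exact: b0.
have t3 k j : \I_p (Psi j p * Xd k (fun x => n x ^+ 2 * f x) p^S) =
 - \I_p ((n p^S * Xd k (chi j) p^S - chi j p^S * Xd k n p^S) * f p^S).
 have c1 := Achi j; have c2 := Alg_Xd k An; have c3 := Alg_Xd k c1; have c4 := Alg_Xd k af.
 transitivity (\I_p (2 * (chi j p^S * Xd k n p^S * f p^S) + (chi j p^S * n p^S) * Xd k f p^S)).
  apply: ae_eq_pint; [by case: (L1MAlg (h1 j) (Alg_Xd k (AlgM An2 af)))| |].
   by case: (AlgL1 (AlgD (AlgM (AlgC 2) (AlgM (AlgM c1 c2) af)) (AlgM (AlgM c1 An) c4))).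
  apply: paeS hP => p _ [n0 -> _]; have hx := sphS p.
  rewrite (XdM k (AlgC1 An2) (AlgC1 af) hx) (Xd_exp k 2 An hx) /= expr1.
  by move: (n _) (chi _ _) (f _) (Xd k f _) (Xd k n _) (lt0r_neq0 n0) => b c d b' d' b0; field; exact: b0.
 rewrite pintD; [|exact: AlgL1 (AlgM (AlgC 2) (AlgM (AlgM c1 c2) af))|exact: AlgL1 (AlgM (AlgM c1 An) c4)].
 have := pint_Xd_ibp k (AlgM c1 An) af => /= /(congr1 -%R); rewrite opprK => <-.
 rewrite -pintN; last exact: AlgL1 (AlgM (Alg_Xd k (AlgM c1 An)) af).
 rewrite -pintN; last exact: AlgL1 (AlgM (AlgB (AlgM An c3) (AlgM c1 c2)) af).
 rewrite -pintD; [|exact: AlgL1 (AlgM (AlgC 2) (AlgM (AlgM c1 c2) af))|exact: AlgL1 (AlgN (AlgM (Alg_Xd k (AlgM c1 An)) af))].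
 eqp; rewrite (XdM k (AlgC1 c1) (AlgC1 An) (sphS p)).
 by move: (n _) (chi _ _) (f _) (Xd k n _) (Xd k (chi j) _) => *; ring.
have q1 := AlgL1 (AlgM (AlgM (AlgC kappa) (Achi i)) af).
have q2 := AlgL1 (AlgM (AlgM An (Achi i)) af).
have q3 k : pL1 (fun p => js k i * ((n p^S * Xd k (chi (jp k i)) p^S - chi (jp k i) p^S * Xd k n p^S) * f p^S)).
 exact: pL1Z _ (AlgL1 (AlgM (AlgB (AlgM An (Alg_Xd k (Achi _))) (AlgM (Achi _) (Alg_Xd k An))) af)).
transitivity (\I_p (kappa * chi i p^S * f p^S - n p^S * chi i p^S * f p^S - \sum_k js k i * ((n p^S * Xd k (chi (jp k i)) p^S - chi (jp k i) p^S * Xd k n p^S) * f p^S))).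
 eqp; rewrite /G [LHS]mulrBl [X in X - _]mulrBl; refine (f_equal (fun z => _ - z) _).
 by rewrite mulr_suml; apply: eq_bigr => k _; exact/esym/mulrA.
rewrite (pintB (pL1B q1 q2) (pL1S _ q3)) (pintB q1 q2) (pintS _ q3).
have ar (y s z : R) : z = - s -> y - s - y - z = 0 by move=> ->; ring.
rewrite -t1 -t2 e; apply: ar; rewrite -sumrN; apply: eq_bigr => k _; rewrite t3 mulrN opprK; apply: pintZ.
exact: AlgL1 (AlgM (AlgB (AlgM An (Alg_Xd k (Achi _))) (AlgM (Achi _) (Alg_Xd k An))) af).
Qed.

(** The functions [sigma(x) v] have mean 0, which isolates the constant [A0]; multiplying by
    [sigma(x)] exchanges the roles of [A0] and [B0]. *)
Let AB0 : (forall i, A0 i = 0) /\ (forall i, B0 i = 0).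
Proof.
have pi4 : 4 * pi != 0 :> R by rewrite mulf_neq0 ?pnatr_eq0 // gt_eqF ?pi_gt0.
have h i : pae (fun p => G i p^S = 0) := pint_orth0 (AlgL1 (AG i)) (@weakG i).
have ia (v : V4) i : pL1 (fun p => sg p^S v i) := AlgL1 (@Alg_sgf (fun j _ => v j) (fun j => AlgC (v j)) i).
have z (v : V4) i : \I_p (sg p^S v i) = 0.
 transitivity (pint (fun p : R * R => \sum_k sgc k i * v (sgp k i) * sph p 0 k)).
  by eqp; rewrite sgS; apply: eq_bigr => k _; ring.
 rewrite pintS; last by move=> k; exact: pL1Z _ (AlgL1 (AlgX k)).
 by rewrite big1 // => k _; rewrite (pintZ _ (AlgL1 (AlgX k))) pint_coord mulr0.
have key (u v : V4) i : pae (fun p => u i + sg p^S v i = 0) -> u i = 0.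
 move=> hp; apply: (mulIf pi4); rewrite mul0r -pint_cst -[LHS]addr0 -(z v i) -pintD //; last exact: pL1C.
 rewrite z -(pint0); apply: ae_eq_pint hp; last exact: pmeasC.
 by case: (pL1D (pL1C (u i)) (ia v i)).
split=> i; first by apply: (key _ B0); apply: paeS (h i) => p _; rewrite GE //; exact: sphS.
apply: (key _ A0).
have ha : pae (fun p => forall i, G i p^S = 0).
 by apply: paeS (paeI (paeI (h s00) (h s01)) (paeI (h s10) (h s11))) => p _ [[? ?] [? ?]] [[] []].
apply: paeS ha => p _ hp; have hx := sphS p.
rewrite -[B0](sg_sphere _ hx) -sgD sgS big1 // => k _.
by rewrite [_ + _]addrC -GE // hp !mulr0.
Qed.

(** [B0 = 0] reads [(kappa + a) Q = 2 sigma(m) P], that is [Q = sigma(w) P] with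
    [w = 2 m / (kappa + a)]. Inserted in [A0 = 0], this gives the value of [kappa]. *)
Lemma chi_algebra : exists w : E, [/\ Q = sg w P, kappa = ip P P * (1 - dot w w) & 0 < ip P P].
Proof.
have [hA hB] := AB0.
have a0 : 0 <= a by rewrite addr_ge0 // ip_ge0.
have ka : kappa + a != 0 by rewrite gt_eqF // ltr_pwDl.
pose w : E := (2 / (kappa + a)) *: m.
have sw (v : V4) : sg w v = fun i => 2 / (kappa + a) * sg m v i.
 apply/funext => i; rewrite !sgS mulr_sumr; apply: eq_bigr => k _; rewrite mxE; ring.
have eQ : Q = sg w P.
 rewrite sw; apply/funext => i; have := hB i; rewrite /B0 => /eqP; rewrite subr_eq0 => /eqP h.
 by apply: (mulfI ka); rewrite h; field.
have P0 : 0 < ip P P.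
 rewrite lt_neqAle ip_ge0 andbT eq_sym; apply/eqP => z.
 have Pz i : P i = 0.
  move/eqP: z; rewrite psumr_eq0; last by move=> j _; rewrite -expr2 sqr_ge0.
  by move=> /allP /(_ i (mem_index_enum i)) /=; rewrite mulf_eq0 orbb => /eqP.
 apply: pae_contra; apply: paeS hP => p _ [+ _ _]; rewrite /n (_ : chi ^~ p^S = fun _ => 0); last first.
  apply/funext => i; rewrite /chi Pz add0r sgS big1 // => k _.
  by rewrite eQ sgS big1 ?mulr0 // => l _; rewrite Pz !mulr0.
 by rewrite ipE !mulr0 !addr0 ltxx.
exists w; split=> //.
have i0 : exists i, P i != 0.
 apply: contrapT => h; move: P0; rewrite (_ : ip P P = 0) ?ltxx //; apply: big1 => i _.
 by apply/eqP; rewrite mulf_eq0 orbb; apply: contrapT => /negP h'; apply: h; exists i.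
have [i Pi] := i0; have := hA i; rewrite /A0 [in sg m Q]eQ.
have ea : a = ip P P * (1 + dot w w) by rewrite /a {1 2}eQ ip_sg; ring.
have em : sg m (sg w P) i = (kappa + a) / 2 * (dot w w * P i).
 have := sg_sg w w P i; rewrite {1 2}(sw (sg w P)) => h.
 have e2 : dot w w * P i = 2 / (kappa + a) * sg m (sg w P) i by lra.
 by rewrite e2; field.
rewrite em ea => h; apply: (mulIf Pi).
have nz : 1 + dot w w != 0 by rewrite gt_eqF // ltr_pwDl // dot_ge0.
apply: (mulfI nz); move: h; move: (ip P P) (dot w w) (P i) => b c d h; lra.
Qed.

End ChiAlgebra.

(** * Derivatives on the sphere in an arbitrary direction *)

Section TangentialDerivatives.

Variables (x X : E).
Hypothesis hx : sphere x.
Let x0 : x != 0 := sphere0 hx.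
Local Notation t := (tproj x X).
Local Notation "'d' f" := (tderiv f x X) (at level 10).

Lemma td_coord i : d (fun y => y 0 i) = t 0 i.
Proof.
rewrite (tderiv_lin X (AlgC1 (AlgX i)) x0) !tderiv_coord // /tproj !mxE dotE.
by case: (ord3P i) => ->; rewrite ?b3 /=; move: (x 0 0) (x 0 1) (x 0 o2) (X 0 0) (X 0 1) (X 0 o2) => *; ring.
Qed.

Lemma td_cst c : d (fun _ => c) = 0.
Proof. by apply: tderiv_eq; exact: is_derive_cst. Qed.

Lemma td_D f g : C1s f -> C1s g -> d (fun y => f y + g y) = d f + d g.
Proof. by move=> cf cg; exact: tderivD. Qed.

Lemma td_M f g : C1s f -> C1s g -> d (fun y => f y * g y) = d f * g x + f x * d g.
Proof. by move=> cf cg; rewrite tderivM // !hext_sphere. Qed.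

Lemma td_V f : Alg f -> (forall y, sphere y -> f y != 0) -> d (fun y => (f y)^-1) = - (d f / f x ^+ 2).
Proof.
move=> af f0; have aV := AlgV af f0; have fx := f0 x hx; have := td_cst 1.
rewrite (@tderiv_ext _ (fun y => f y * (f y)^-1)) //; last by move=> y /f0 fy; rewrite divff.
rewrite (td_M (AlgC1 af) (AlgC1 aV)) => /eqP; rewrite addrC addr_eq0 => /eqP h.
by apply: (mulfI fx); rewrite h; field.
Qed.

Lemma td_sqrt f : Alg f -> (forall y, sphere y -> 0 < f y) -> d (fun y => Num.sqrt (f y)) = d f / (2 * Num.sqrt (f x)).
Proof.
move=> af f0; have aS := Alg_sqr af f0; have s0 : Num.sqrt (f x) != 0 by rewrite gt_eqF // sqrtr_gt0 f0.
have e : d f = d (fun y => Num.sqrt (f y) * Num.sqrt (f y)).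
 by apply: tderiv_ext => // y /f0 fy; rewrite -expr2 sqr_sqrtr // ltW.
by rewrite e (td_M (AlgC1 aS) (AlgC1 aS)); field.
Qed.

Lemma td_ln f : Alg f -> (forall y, sphere y -> 0 < f y) -> d (fun y => ln (f y)) = d f / f x.
Proof.
move=> af f0; apply: tderiv_eq; apply/line_is_deriveP; rewrite mulrC.
have e : hext f (x + 0 *: X) = f x by rewrite scale0r addr0 hext_sphere.
have h1 : dva (@ln R) (hext f (x + 0 *: X)) (f x)^-1 by rewrite e; apply: is_derive1_ln; exact: f0.
have h2 : dva (fun r : R => hext f (x + r *: X)) 0 (d f) by apply/line_is_deriveP; exact: C1s_is_derive (AlgC1 af) x0.
exact: (dv_comp h1 h2).
Qed.

Lemma td_dot w : d (dot w) = dot w t.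
Proof.
have a i : Alg (fun y : E => w 0 i * y 0 i) := AlgM (AlgC _) (AlgX i).
have e i : d (fun y : E => w 0 i * y 0 i) = w 0 i * t 0 i.
 by rewrite (td_M (C1sC _) (AlgC1 (AlgX i))) td_cst td_coord mul0r add0r.
rewrite (@tderiv_ext _ (fun y => w 0 0 * y 0 0 + w 0 1 * y 0 1 + w 0 o2 * y 0 o2)) //; last by move=> y _; rewrite dotE.
rewrite (td_D (AlgC1 (AlgD (a 0) (a 1))) (AlgC1 (a o2))) (td_D (AlgC1 (a 0)) (AlgC1 (a 1))).
by rewrite !e dotE.
Qed.

Lemma td_sum (f : 'I_3 -> E -> R) : (forall k, C1s (f k)) -> d (fun y => \sum_k f k y) = \sum_k d (f k).
Proof.
move=> cf; rewrite (@tderiv_ext _ (fun y => f 0 y + f 1 y + f o2 y)) //; last by move=> y _; rewrite sum3.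
by rewrite (td_D (C1sD (cf 0) (cf 1)) (cf o2)) td_D // sum3.
Qed.

Lemma C1s_sgf (g : spf) i : (forall i, C1s (g i)) -> C1s (sgf g i).
Proof.
move=> cg; apply: (@C1s_ext (fun y => sgc 0 i * (y 0 0 * g (sgp 0 i) y) + sgc 1 i * (y 0 1 * g (sgp 1 i) y) + sgc o2 i * (y 0 o2 * g (sgp o2 i) y))).
 by move=> y _; rewrite /sgf sgS sum3.
have h k : C1s (fun y : E => sgc k i * (y 0 k * g (sgp k i) y)).
 exact: C1sM (C1sC _) (C1sM (AlgC1 (AlgX k)) (cg _)).
exact: C1sD (C1sD (h 0) (h 1)) (h o2).
Qed.

Lemma td_sgf (g : spf) i : (forall i, C1s (g i)) -> d (sgf g i) = sg t (g ^~ x) i + sg x (fun j => d (g j)) i.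
Proof.
move=> cg; rewrite (@tderiv_ext _ (fun y => \sum_k sgc k i * (y 0 k * g (sgp k i) y))) //; last by move=> y _; rewrite /sgf sgS.
have cc k : C1s (fun y : E => y 0 k) := AlgC1 (AlgX k).
rewrite (@td_sum (fun k y => sgc k i * (y 0 k * g (sgp k i) y))); last by move=> k; exact: C1sM (C1sC _) (C1sM (cc k) (cg _)).
rewrite !sgS -big_split; apply: eq_bigr => k _ /=.
by rewrite (td_M (C1sC _) (C1sM (cc k) (cg _))) (td_M (cc k) (cg _)) td_cst td_coord; ring.
Qed.

Lemma td_sg w (g : spf) i : (forall i, C1s (g i)) -> d (fun y => sg w (g ^~ y) i) = sg w (fun j => d (g j)) i.
Proof.
move=> cg; rewrite (@tderiv_ext _ (fun y => \sum_k sgc k i * (w 0 k * g (sgp k i) y))) //; last by move=> y _; rewrite sgS.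
rewrite (@td_sum (fun k y => sgc k i * (w 0 k * g (sgp k i) y))); last by move=> k; exact: C1sM (C1sC _) (C1sM (C1sC _) (cg _)).
rewrite sgS; apply: eq_bigr => k _.
by rewrite (td_M (C1sC _) (C1sM (C1sC _) (cg _))) (td_M (C1sC _) (cg _)) !td_cst; ring.
Qed.

End TangentialDerivatives.

Lemma det3 (A : comPzRingType) (M : 'M[A]_3) : \det M = M 0 0 * (M 1 1 * M o2 o2 - M 1 o2 * M o2 1)
 - M 0 1 * (M 1 0 * M o2 o2 - M 1 o2 * M o2 0) + M 0 o2 * (M 1 0 * M o2 1 - M 1 1 * M o2 0).
Proof.
rewrite (expand_det_row _ 0) sum3 /cofactor !(expand_det_row _ 0) !sum2 /cofactor !det_mx11 !mxE.
have v2 : (o2 : nat) = 2%N by rewrite -o2E inordK.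
have l1 : (lift 0 0 : 'I_3) = 1 by exact: val_inj.
have l2 : (lift 0 1 : 'I_3) = o2 by apply: val_inj; rewrite /= v2.
have l3 : (lift 1 0 : 'I_3) = 0 by exact: val_inj.
have l4 : (lift 1 1 : 'I_3) = o2 by apply: val_inj; rewrite /= v2.
have l5 : (lift o2 0 : 'I_3) = 0 by apply: val_inj; rewrite /= v2.
have l6 : (lift o2 1 : 'I_3) = 1 by apply: val_inj; rewrite /= v2.
have l7 : (lift 0 0 : 'I_2) = 1 by exact: val_inj.
have l8 : (lift 1 0 : 'I_2) = 0 by exact: val_inj.
rewrite !l7 !l8 !l1 !l2 !l3 !l4 !l5 !l6 v2 /=.
by move: (M _ _) (M _ _) (M _ _) => *; ring.
Qed.

Lemma det_rank1 (c b : R) (y : E) : \det (c%:M + b *: (y^T *m y)) = c ^+ 2 * (c + b * dot y y).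
Proof.
rewrite det3 dotE !mxE !big_ord1 !mxE ?b3 ?o2_neq0 ?o2_neq1 ?(eq_sym (0 : 'I_3) o2) ?(eq_sym (1 : 'I_3) o2) /=.
by move: (y 0 0) (y 0 1) (y 0 o2) => *; ring.
Qed.

(** * Möbius maps of the sphere and their spin lifts *)

Section Moebius.

Lemma sg_lin (X Y : E) (a b : R) (v : V4) i : sg (a *: X + b *: Y) v i = a * sg X v i + b * sg Y v i.
Proof. by rewrite !sgS !mulr_sumr -big_split; apply: eq_bigr => k _; rewrite /= !mxE; ring. Qed.

(* The reflection of [y] across the line of [z], scaled by [|z|^2]. *)
Lemma sg_refl (z y : E) (v : V4) : sg z (sg y (sg z v)) = sg ((2 * dot z y) *: z + (- dot z z) *: y) v.
Proof.
apply/funext => i; rewrite sg_lin; have h1 := sg_sg z y (sg z v) i; have h2 := sg_sg z z v.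
have e : sg y (sg z (sg z v)) i = dot z z * sg y v i.
 by rewrite -sgZ; congr (sg y _ i); apply/funext => j; have := h2 j; lra.
by move: h1; rewrite e; lra.
Qed.

(** For [|w| < 1], the boundary value of a hyperbolic translation of the unit ball. With [z = x + w]
    it equals [2 (x . z) z / |z|^2 - x] on the sphere, minus the reflection of [x] along [z]. *)
Definition moebius (w x : E) : E := w + ((1 - dot w w) / (1 + dot w w + 2 * dot w x)) *: (x + w).

Variable w : E.
Hypothesis w1 : dot w w < 1.
Let nz (x : E) : R := 1 + dot w w + 2 * dot w x.
Let a (x : E) : R := (1 - dot w w) / nz x.

Lemma nzE (x : E) : sphere x -> nz x = dot (x + w) (x + w).
Proof. by move=> hx; rewrite dotDl !dotDr (hx : dot x x = 1) (dotC x w) /nz; ring. Qed.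

Lemma nz_gt0 (x : E) : sphere x -> 0 < nz x.
Proof.
move=> hx; rewrite nzE // dot_gt0 //; apply/eqP => /eqP; rewrite addr_eq0 => /eqP xw.
by move: w1; rewrite -[w]opprK -xw -scaleN1r dotZl dotZr (hx : dot x x = 1) !mulN1r opprK ltxx.
Qed.

Let a_gt0 (x : E) : sphere x -> 0 < a x.
Proof. by move=> hx; rewrite divr_gt0 ?subr_gt0 //; exact: nz_gt0. Qed.

Let Anz : Alg nz. Proof. exact: AlgD (AlgC _) (AlgM (AlgC 2) (Alg_dotr w)). Qed.

Let nz0 (x : E) : sphere x -> nz x != 0. Proof. by move=> hx; rewrite gt_eqF // nz_gt0. Qed.

Let Aa : Alg a. Proof. exact: AlgM (AlgC _) (AlgV Anz nz0). Qed.

Lemma Alg_moebius i : Alg (fun x => moebius w x 0 i).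
Proof.
apply: (@Alg_ext (fun x => w 0 i + a x * (x 0 i + w 0 i))); last by move=> x _; rewrite !mxE.
by apply: AlgD (AlgC _) (AlgM Aa (AlgD (AlgX i) (AlgC _))).
Qed.

Lemma moebius_sphere (x : E) : sphere x -> sphere (moebius w x).
Proof.
move=> hx; rewrite /sphere /= /moebius !(dotDl, dotDr, dotZl, dotZr) (hx : dot x x = 1) (dotC x w) -!/(nz x).
have := nz0 hx; rewrite /nz; move: (dot w w) (dot w x) => b c h; field; exact: h.
Qed.

Lemma td_nz (x X : E) : sphere x -> tderiv nz x X = 2 * dot w (tproj x X).
Proof.
move=> hx; have cd := AlgC1 (Alg_dotr w).
by rewrite (td_D X hx (C1sC _) (C1sM (C1sC _) cd)) td_cst (td_M X hx (C1sC _) cd) td_cst td_dot //; ring.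
Qed.

Lemma td_moebius (x X : E) i : sphere x -> tderiv (fun y => moebius w y 0 i) x X =
 a x * (tproj x X 0 i - 2 * dot w (tproj x X) / nz x * (x 0 i + w 0 i)).
Proof.
move=> hx; rewrite (@tderiv_ext _ (fun x => w 0 i + a x * (x 0 i + w 0 i))); [|by move=> y _; rewrite !mxE|exact: sphere0].
have cc := AlgC1 (AlgX i); have cca := AlgC1 (AlgD (AlgX i) (AlgC (w 0 i))).
rewrite (td_D X hx (C1sC _) (C1sM (AlgC1 Aa) cca)) td_cst (td_M X hx (AlgC1 Aa) cca).
rewrite (td_D X hx cc (C1sC _)) td_cst td_coord //.
rewrite (td_M X hx (C1sC _) (AlgC1 (AlgV Anz nz0))) td_cst (td_V X hx Anz nz0) td_nz // /a.
by have := nz0 hx; move: (nz x) (dot w w) (dot w (tproj x X)) (tproj x X 0 i) (x 0 i) (w 0 i) => * /=; field.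
Qed.

Lemma diff_moebius (x X : E) : sphere x -> diff_at (moebius w) x X =
 a x *: tproj x X + (- (2 * a x * dot w (tproj x X) / nz x)) *: (x + w).
Proof.
move=> hx; apply/rowP => j; rewrite /diff_at !mxE.
transitivity (tderiv (fun y => moebius w y 0 j) x X); last by rewrite td_moebius // !mxE; ring.
rewrite (tderiv_lin X (AlgC1 (Alg_moebius j)) (sphere0 hx)) sum3.
by rewrite /jac !mxE.
Qed.

Lemma tprojE (x : E) i j : tproj x (bvec R i) 0 j = (i == j)%:R - x 0 i * x 0 j.
Proof. by rewrite /tproj dot_bvec; transitivity (bvec R i 0 j - x 0 i * x 0 j); [rewrite !mxE|rewrite bvecE eq_sym]. Qed.

Lemma dot_tproj (y x X : E) : dot y (tproj x X) = dot y X - dot x X * dot y x.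
Proof. by rewrite /tproj -scaleNr dotDr dotZr mulNr. Qed.

Lemma rank1_mul (x z : E) (c b d : R) : (c%:M + b *: (x^T *m x)) *m (1%:M + d *: (z^T *m z)) =
 c%:M + b *: (x^T *m x) + (c * d) *: (z^T *m z) + (b * d * dot x z) *: (x^T *m z).
Proof.
rewrite mulmxDr mulmx1 mulmxDl -!scalemxAr mul_scalar_mx -scalemxAl addrA.
have e : x *m z^T = (dot x z)%:M by apply/matrixP => i j; rewrite !ord1 !mxE /dot mulr1n; apply: eq_bigr => k _; rewrite mxE.
by rewrite -mulmxA (mulmxA x) e mul_scalar_mx -scalemxAr !scalerA (mulrC d c) (mulrC d b).
Qed.

(** The differential, completed on the normal, is a product of two maps: one scales the tangent
    plane by [a x] and sends [x] to [- x], the other is the reflection along [x + w]. Their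
    determinants are [- a^2] and [- 1]. *)
Lemma jacdet_moebius (x : E) : sphere x -> jacdet (moebius w) x = a x ^+ 2.
Proof.
move=> hx; have n0 := nz0 hx; rewrite /jacdet; set z := x + w.
have -> : jac (moebius w) x + x^T *m moebius w x =
 ((a x)%:M + (- (a x + 1)) *: (x^T *m x)) *m (1%:M + (- (2 / nz x)) *: (z^T *m z)).
 rewrite [RHS]rank1_mul.
 apply/matrixP => i j; rewrite !mxE !big_ord1 !mxE td_moebius //.
 rewrite /z [dot x (x + w)]dotDr (hx : dot x x = 1) tprojE dot_tproj !dot_bvec (dotC x w) -!/(nz x) -!/(a x).
 have ea : a x * nz x = 1 - dot w w by rewrite divfK.
 have ed : dot w x = (nz x - 1 - dot w w) / 2 by rewrite /nz; field.
 have ew : dot w w = 1 - a x * nz x by rewrite ea; ring.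
 rewrite ed ew -[a x *+ _]mulr_natr; move: n0; move: (nz x) (a x) (i == j)%:R (x 0 i) (x 0 j) (w 0 i) (w 0 j) => n b dl xi xj wi wj n0.
 by field.
rewrite det_mulmx !det_rank1 (hx : dot x x = 1) -nzE // expr1n mul1r.
by move: n0; move: (a x) (nz x) => b n n0; field.
Qed.

Lemma moebiusK (x : E) : sphere x -> moebius (- w) (moebius w x) = x.
Proof.
move=> hx; have n0 := nz0 hx; have b0 := lt0r_neq0 (a_gt0 hx).
have v0 : 1 - dot w w != 0 by rewrite gt_eqF // subr_gt0.
have e1 : moebius w x - w = a x *: (x + w) by rewrite /moebius addrAC subrr add0r.
have e2 : dot (- w) (- w) = dot w w by rewrite -scaleN1r dotZl dotZr; ring.
have e3 : 1 + dot w w + 2 * dot (- w) (moebius w x) = a x * (1 - dot w w).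
 rewrite -scaleN1r !(dotZl, dotDr, dotZr) -!/(nz x) -!/(a x).
 have ed : dot w x = (nz x - 1 - dot w w) / 2 by rewrite /nz; field.
 by rewrite ed /a; move: n0; move: (nz x) (dot w w) => n b n0; field.
rewrite {1}/moebius e2 e3 e1 scalerA (_ : _ * a x = 1); first by rewrite scale1r addrC addrK.
by move: v0 b0; move: (a x) (1 - dot w w) => *; field; apply/andP.
Qed.

Lemma moebius_conf (X Y x : E) : sphere x -> tangent x X -> tangent x Y ->
 dot (diff_at (moebius w) x X) (diff_at (moebius w) x Y) = jacdet (moebius w) x * dot X Y.
Proof.
move=> hx tX tY; rewrite jacdet_moebius // !diff_moebius //.
have tp Z : tangent x Z -> tproj x Z = Z by move=> hZ; rewrite /tproj hZ scale0r subr0.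
rewrite !tp // !(dotDl, dotDr, dotZl, dotZr) (hx : dot x x = 1) (dotC X x) (tX : dot x X = 0) (tY : dot x Y = 0) (dotC x w) (dotC X w).
have n0 := nz0 hx; have ed : dot w w = nz x - 1 - 2 * dot w x by rewrite /nz; ring.
by rewrite ed; move: n0; move: (nz x) (a x) (dot w x) (dot w X) (dot w Y) (dot X Y) => *; field.
Qed.

(** The Clifford product of the unit vectors [(x + w) / |x + w|] and [x]: the reflections along them
    compose, up to scale, to the differential of [moebius w]. *)
Definition moebius_lift (x : E) : 'M[R[i]]_2 := ((Num.sqrt (nz x))^-1)%:C *: (pauli (x + w) *m pauli x).

Lemma comps_lift (x : E) s : comps (moebius_lift x *m s) = fun i => (Num.sqrt (nz x))^-1 * sg (x + w) (sg x (comps s)) i.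
Proof. by rewrite -scalemxAl comps_scale -mulmxA !comps_pauli. Qed.

Let s_sqr (x : E) : sphere x -> Num.sqrt (nz x) ^+ 2 = nz x.
Proof. by move=> hx; rewrite sqr_sqrtr // ltW // nz_gt0. Qed.

Let s_neq0 (x : E) : sphere x -> Num.sqrt (nz x) != 0.
Proof. by move=> hx; rewrite gt_eqF // sqrtr_gt0 nz_gt0. Qed.

Let As : Alg (fun x => (Num.sqrt (nz x))^-1). Proof. exact: AlgV (Alg_sqr Anz nz_gt0) s_neq0. Qed.

Lemma sg_add (X Y : E) (v : V4) i : sg (X + Y) v i = sg X v i + sg Y v i.
Proof. by rewrite -[X]scale1r -[Y]scale1r sg_lin !scale1r !mul1r. Qed.

Lemma mul_delta_entry (A : 'M[R[i]]_2) k l : (A *m delta_mx l 0 : 'cV_2) k 0 = A k l.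
Proof. by rewrite -colE mxE. Qed.

Lemma mx_act_inj (A B : 'M[R[i]]_2) : (forall s : 'cV_2, A *m s = B *m s) -> A = B.
Proof. by move=> h; apply/matrixP => k l; rewrite -!mul_delta_entry h. Qed.

Lemma lift_smooth k l : smoothC (fun x => moebius_lift x k l).
Proof.
pose f : spf := fun i x => (Num.sqrt (nz x))^-1 * sg (x + w) (sg x (comps (delta_mx l 0))) i.
have Af i : Alg (f i).
 apply: AlgM As _; pose g : spf := sgf (fun j _ => comps (delta_mx l 0) j).
 have Ag j : Alg (g j) by apply: Alg_sgf => ?; exact: AlgC.
 apply: (@Alg_ext (fun x => sgf g i x + \sum_k sgc k i * (w 0 k * g (sgp k i) x))); last by move=> x _; rewrite sg_add -sgS.
 apply: AlgD (Alg_sgf Ag i) (Alg_sum _ _) => j.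
 by apply: AlgM (AlgC _) (AlgM (AlgC _) (Ag _)).
rewrite (_ : (fun x => _) = (fun x => mkS f x k 0)); first exact: smooth_mkS.
apply/funext => x; by rewrite /mkS -[f ^~ x]comps_lift compsK mul_delta_entry.
Qed.

Lemma sg_unit (z : E) (c : R) (v : V4) : dot z z = c -> sg z (sg z v) = fun i => c * v i.
Proof. by move=> hz; apply/funext => i; have := sg_sg z z v i; rewrite hz; lra. Qed.

Lemma Ic_sg (X : E) (v : V4) : Ic (sg X v) = sg X (Ic v).
Proof. by apply/funext => -[[] []] /=; ring. Qed.

Lemma ipC (v v' : V4) : ip v v' = ip v' v.
Proof. by apply: eq_bigr => i _; rewrite mulrC. Qed.

Lemma ipZl (c : R) (v v' : V4) : ip (fun i => c * v i) v' = c * ip v v'.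
Proof. by rewrite /ip mulr_sumr; apply: eq_bigr => i _; rewrite mulrA. Qed.

Lemma lift_isom (x : E) s t : sphere x -> hdot (moebius_lift x *m s) (moebius_lift x *m t) = hdot s t.
Proof.
move=> hx; have n0 := s_neq0 hx; have ne := nzE hx.
have key (u v : V4) : ip (fun i => (Num.sqrt (nz x))^-1 * sg (x + w) (sg x u) i) (fun i => (Num.sqrt (nz x))^-1 * sg (x + w) (sg x v) i) = ip u v.
 transitivity ((Num.sqrt (nz x))^-1 ^+ 2 * ip (sg (x + w) (sg x u)) (sg (x + w) (sg x v))).
  by rewrite ipZl ipC ipZl mulrA ipC.
 rewrite ip_sgC (sg_unit _ (esym ne)).
 transitivity ((Num.sqrt (nz x))^-1 ^+ 2 * nz x * ip (sg x u) (sg x v)).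
  by rewrite ipZl mulrA.
 rewrite -{2}(s_sqr hx) exprVn mulVf ?expf_neq0 // mul1r ip_sgC (sg_sphere _ hx) //.
rewrite !hdotE !comps_lift key; congr (_ +i* _).
rewrite (_ : Ic _ = fun i => (Num.sqrt (nz x))^-1 * sg (x + w) (sg x (Ic (comps t))) i) ?key //.
by rewrite -Ic_sg -Ic_sg; apply/funext => -[b []] /=; rewrite /Ic ?mulrN.
Qed.

Lemma det_pauli (X : E) : \det (pauli X) = (- dot X X)%:C.
Proof.
rewrite (expand_det_row _ 0) sum2 /cofactor !det_mx11 !mxE /= dotE -o2E.
by apply/eqP; rewrite eq_complex /=; apply/andP; split; apply/eqP; rewrite ?expr0 ?expr1; simpc => /=; ring.
Qed.

Lemma lift_det (x : E) : sphere x -> \det (moebius_lift x) = 1.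
Proof.
move=> hx; rewrite /moebius_lift detZ det_mulmx !det_pauli -nzE // (hx : dot x x = 1).
rewrite -rmorphXn -!rmorphM exprVn (s_sqr hx) mulrNN mulr1 mulVf //; exact: nz0.
Qed.

Lemma conf_factor_moebius (x : E) : sphere x -> conf_factor (moebius w) x = ln (a x).
Proof. by move=> hx; rewrite /conf_factor jacdet_moebius // lnXn ?a_gt0 // mulr2n; field. Qed.

Lemma td_conf_factor (x X : E) : sphere x -> tderiv (conf_factor (moebius w)) x X = - (2 * dot w (tproj x X) / nz x).
Proof.
move=> hx; rewrite (@tderiv_ext _ (fun y => ln (a y))); [|by move=> y hy; exact: conf_factor_moebius|exact: sphere0].
rewrite (td_ln X hx Aa a_gt0) (td_M X hx (C1sC _) (AlgC1 (AlgV Anz nz0))) td_cst (td_V X hx Anz nz0) td_nz // /a.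
have v0 : 1 - dot w w != 0 by rewrite gt_eqF // subr_gt0.
have := nz0 hx; move: v0; move: (nz x) (1 - dot w w) (dot w _) => * /=; field; exact/andP.
Qed.

Lemma grad_conf_factor (x : E) : sphere x -> grad (conf_factor (moebius w)) x = (- 2 / nz x) *: w + (2 * dot w x / nz x) *: x.
Proof.
move=> hx; apply/rowP => i; rewrite [LHS]mxE td_conf_factor // dot_tproj !dot_bvec !mxE; ring.
Qed.

Let expa (x : E) : sphere x -> expR (conf_factor (moebius w) x) = a x.
Proof. by move=> hx; rewrite conf_factor_moebius // lnK ?posrE ?a_gt0. Qed.

Let sg_moebius (x : E) (v : V4) i : sphere x -> sg (moebius w x) v i = (nz x)^-1 * sg (x + w) (sg x (sg (x + w) v)) i.
Proof.
move=> hx; have n0 := nz0 hx; rewrite sg_refl (_ : moebius w x = (2 * dot (x + w) x / nz x) *: (x + w) + (- 1) *: x).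
 by rewrite !sg_lin -(nzE hx); move: (sg _ _ _) (sg _ _ _) (dot _ _) => *; field.
rewrite /moebius -!/(nz x) -!/(a x); apply/rowP => i'; rewrite !mxE dotDl (hx : dot x x = 1).
have ew : dot w w = 1 - a x * nz x by rewrite divfK //; ring.
have ed : dot w x = (nz x - 1 - dot w w) / 2 by rewrite /nz; field.
by rewrite -!/(nz x) -!/(a x) ed ew; move: n0; move: (a x) (nz x) (x 0 i') (w 0 i') => b n ? ? n0; field.
Qed.

Let sg_diff (x X : E) (v : V4) i : sphere x -> tangent x X ->
 sg (diff_at (moebius w) x X) v i = - (a x / nz x) * sg (x + w) (sg X (sg (x + w) v)) i.
Proof.
move=> hx tX; have n0 := nz0 hx; rewrite diff_moebius // sg_refl !sg_lin /tproj (tX : dot x X = 0) scale0r subr0 -(nzE hx).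
by rewrite dotDl (tX : dot x X = 0); move: (sg _ _ _) (sg _ _ _) (dot _ _) (a x) => *; field.
Qed.

Let sgsg_lift (x X : E) (v : V4) : sphere x -> tangent x X ->
 sg (diff_at (moebius w) x X) (sg (moebius w x) (sg (x + w) (sg x v))) = fun i => - a x * sg (x + w) (sg X v) i.
Proof.
move=> hx tX; apply/funext => i; have ne := esym (nzE hx); have n0 := nz0 hx.
rewrite sg_diff // (_ : sg (moebius w x) _ = sg (x + w) v).
 rewrite (sg_unit v ne) (_ : sg X _ = fun i => nz x * sg X v i); last by apply/funext => j; rewrite sgZ.
 by rewrite sgZ; move: (sg _ _ i) (a x) => *; field.
apply/funext => j; rewrite sg_moebius // (sg_unit _ ne).
have -> : sg x (fun i => nz x * sg x v i) = fun i => nz x * v i.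
 by apply/funext => l; rewrite sgZ (sg_sphere _ hx).
by rewrite sgZ mulKf.
Qed.

Lemma comps_cliff (x X : E) s : comps (cliff x X *m s) = sg X (sg x (comps s)).
Proof. by rewrite /cliff -mulmxA !comps_pauli. Qed.

Lemma comps_conf v (x X : E) s : comps (conf_cliff v x X *m s) = fun i => expR (v x) * sg X (sg x (comps s)) i.
Proof. by rewrite -comps_cliff -comps_scale scalemxAl. Qed.

Lemma lift_cliff (x X : E) : sphere x -> tangent x X ->
 moebius_lift x *m conf_cliff (conf_factor (moebius w)) x X = cliff (moebius w x) (diff_at (moebius w) x X) *m moebius_lift x.
Proof.
move=> hx tX.
have key (s : 'cV[R[i]]_2) : (moebius_lift x *m conf_cliff (conf_factor (moebius w)) x X) *m s = (cliff (moebius w x) (diff_at (moebius w) x X) *m moebius_lift x) *m s.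
 apply: etrans (esym (mulmxA (moebius_lift x) _ s)) _; apply: etrans (mulmxA (cliff _ _) _ s); apply: comps_inj.
 apply: etrans (comps_lift x _) _.
 apply: etrans (esym (comps_cliff _ _ _)).
 rewrite (comps_conf _ x X s).
 rewrite (expa hx).
 rewrite (comps_lift x s).
 have -> : sg (moebius w x) (fun i => (Num.sqrt (nz x))^-1 * sg (x + w) (sg x (comps s)) i) = fun i => (Num.sqrt (nz x))^-1 * sg (moebius w x) (sg (x + w) (sg x (comps s))) i.
  by apply/funext => i; rewrite sgZ.
 apply/funext => i; rewrite sgZ sgsg_lift //; set v := comps s.
 have e : sg x (fun i => a x * sg X (sg x v) i) = fun i => - a x * sg X v i.
  apply/funext => j; rewrite sgZ; have := sg_sg x X (sg x v) j; rewrite (tX : dot x X = 0) (sg_sphere _ hx); move=> h.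
  by rewrite -[sg x _ j](addrK (sg X v j)) h; ring.
 by rewrite e sgZ; ring.
exact: mx_act_inj key.
Qed.

Lemma sg_lin5 (X : E) (v1 v2 v3 v4 v5 : V4) (b c d e : R) i : sg X (fun i => v1 i - b * v2 i - c * v3 i + d * v4 i + e * v5 i) i =
 sg X v1 i - b * sg X v2 i - c * sg X v3 i + d * sg X v4 i + e * sg X v5 i.
Proof. by rewrite !sgS !mulr_sumr -!sumrB -!big_split; apply: eq_bigr => k _ /=; ring. Qed.

(** Both sides expand into Clifford products of [x], [w], [X] applied to [u = psi x] and to its
    derivative [u']. The relations [sg_sg] bring all products to a common order, and the
    coefficients agree once [dot w x] is expressed through [nz x]. *)
Lemma lift_nabla (psi : E -> 'cV[R[i]]_2) (x X : E) : smooth_spinor psi -> sphere x -> tangent x X ->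
 pull_nabla (moebius w) (fun y => moebius_lift y *m psi y) x X = moebius_lift x *m conf_nabla (conf_factor (moebius w)) psi x X.
Proof.
move=> sp hx tX; have n0 := nz0 hx; have cp i : C1s (fcomp psi i) := smooth_fcomp i sp.
pose u := comps (psi x); pose u' : V4 := fun i => tderiv (fcomp psi i) x X; pose r := (Num.sqrt (nz x))^-1.
have tt : tproj x X = X by rewrite /tproj tX scale0r subr0.
have dr : tderiv (fun y => (Num.sqrt (nz y))^-1) x X = - (dot w X / nz x * r).
 rewrite (td_V X hx (Alg_sqr Anz nz_gt0) s_neq0) (td_sqrt X hx Anz nz_gt0) td_nz // tt s_sqr // /r.
 by have := s_neq0 hx; move: n0; move: (Num.sqrt (nz x)) (nz x) (dot w X) => *; field; apply/andP.
pose g : spf := sgf (fcomp psi); have cg i : C1s (g i) := C1s_sgf i cp.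
have dg j : tderiv (g j) x X = sg X u j + sg x u' j by rewrite /g td_sgf // tt.
have eF i : tderiv (fcomp (fun y => moebius_lift y *m psi y) i) x X =
  - (dot w X / nz x * r) * sg (x + w) (sg x u) i + r * (u' i + sg w (sg X u) i + sg w (sg x u') i).
 have cw : C1s (fun y => sg w (g ^~ y) i).
  apply: (@C1s_ext (fun y => sgc 0 i * (w 0 0 * g (sgp 0 i) y) + sgc 1 i * (w 0 1 * g (sgp 1 i) y) + sgc o2 i * (w 0 o2 * g (sgp o2 i) y))).
   by move=> y _; rewrite sgS sum3.
  have h k : C1s (fun y : E => sgc k i * (w 0 k * g (sgp k i) y)) := C1sM (C1sC _) (C1sM (C1sC _) (cg _)).
  exact: C1sD (C1sD (h 0) (h 1)) (h o2).
 rewrite (@tderiv_ext _ (fun y => (Num.sqrt (nz y))^-1 * (fcomp psi i y + sg w (g ^~ y) i))) //; last exact: sphere0.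
  rewrite (td_M X hx (AlgC1 As) (C1sD (cp i) cw)) (td_D X hx (cp i) cw) dr (td_sg X hx w i cg).
  have -> : sg w (fun j => tderiv (g j) x X) i = sg w (sg X u) i + sg w (sg x u') i.
   by rewrite -sgD; congr (sg w _ i); apply/funext.
  rewrite sg_add (sg_sphere _ hx) -/r -/(u' i) -[fcomp psi i x]/(u i) -[g ^~ x]/(sg x u).
  by move: (sg _ _ i) (sg _ _ i) (sg _ _ i) (dot w X / nz x) => *; ring.
 move=> y hy; rewrite /fcomp comps_lift sg_add (sg_sphere _ hy).
 by [].
have e1 : comps (pull_nabla (moebius w) (fun y => moebius_lift y *m psi y) x X) =
 fun i => tderiv (fcomp (fun y => moebius_lift y *m psi y) i) x X + 2^-1 * a x * r * sg (x + w) (sg X u) i.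
 rewrite /pull_nabla halfC -scaleNr -rmorphN comps_add comps_scale comps_sderiv comps_cliff (comps_lift x (psi x)).
 apply/funext => i; congr (_ + _); rewrite (_ : sg (moebius w x) _ = fun i => r * sg (moebius w x) (sg (x + w) (sg x u)) i); last by apply/funext => j; rewrite sgZ.
 by rewrite sgZ sgsg_lift //; ring.
have e2 : comps (conf_nabla (conf_factor (moebius w)) psi x X) = fun i => u' i - 2^-1 * sg X (sg x u) i
  - (nz x)^-1 * sg X (sg w u) i + dot w x / nz x * sg X (sg x u) i + dot w X / nz x * u i.
 have xwx j : sg x (sg w (sg x u)) j = 2 * dot w x * sg x u j - sg w u j.
  by have := sg_sg x w (sg x u) j; rewrite (sg_sphere _ hx) (dotC x w); lra.
 have e3 : sg x (sg (grad (conf_factor (moebius w)) x) (sg x u)) = fun j => (2 / nz x) * sg w u j + - (2 * dot w x / nz x) * sg x u j.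
  apply/funext => j; rewrite grad_conf_factor //.
  rewrite (_ : sg _ (sg x u) = fun j => (- 2 / nz x) * sg w (sg x u) j + (2 * dot w x / nz x) * u j); last first.
   by apply/funext => l; rewrite sg_lin (sg_sphere _ hx).
  by rewrite sgDZ sgZ xwx; ring.
 rewrite /conf_nabla /nabla halfC -!scaleNr -!rmorphN !comps_add !comps_scale comps_sderiv !comps_cliff e3 td_conf_factor // tt.
 by apply/funext => i; rewrite sgDZ sgZ -/u -/(u' i); move: (sg _ _ i) (sg _ _ i) (u i) (u' i) (dot w x) (dot w X) => *; field.
have xXx : sg x (sg X (sg x u)) = fun i => - 1 * sg X u i.
 by apply/funext => j; have := sg_sg x X (sg x u) j; rewrite (sg_sphere _ hx) (tX : dot x X = 0); lra.
have e4 : sg x (comps (conf_nabla (conf_factor (moebius w)) psi x X)) = fun i => sg x u' i - 2^-1 * (- 1 * sg X u i) - (nz x)^-1 * sg x (sg X (sg w u)) i + dot w x / nz x * (- 1 * sg X u i) + dot w X / nz x * sg x u i.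
 by apply/funext => j; rewrite e2 sg_lin5 xXx.
apply: comps_inj; apply: etrans e1 _; apply: etrans (esym (comps_lift x _)); apply/funext => i.
rewrite eF -/r e4 sg_lin5 !sgZ.
have zxw y j : sg (x + w) (sg x (sg w y)) j = nz x * sg w y j - dot w w * sg (x + w) y j.
 have -> : sg x (sg w y) = fun j => sg (x + w) (sg w y) j + - dot w w * y j.
  by apply/funext => l; rewrite sg_add (sg_unit y (erefl (dot w w))); ring.
 by rewrite sgDZ (sg_unit _ (esym (nzE hx))); ring.
have -> : sg (x + w) (sg x (sg X (sg w u))) i = 2 * dot w X * sg (x + w) (sg x u) i - (nz x * sg w (sg X u) i - dot w w * sg (x + w) (sg X u) i).
 rewrite -zxw (_ : sg X (sg w u) = fun j => 2 * dot w X * u j + - 1 * sg w (sg X u) j); last first.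
  by apply/funext => j; have := sg_sg X w u j; rewrite (dotC X w); lra.
 rewrite (_ : sg x _ = fun j => 2 * dot w X * sg x u j + - 1 * sg x (sg w (sg X u)) j); last first.
  by apply/funext => j; rewrite sgD !sgZ.
 by rewrite sgD !sgZ; ring.
have -> : sg (x + w) (sg x u') i = u' i + sg w (sg x u') i by rewrite sg_add (sg_sphere _ hx).
have ed : dot w x = (nz x - 1 - dot w w) / 2 by rewrite /nz; field.
rewrite /a ed; move: n0; move: (nz x) (sg _ _ i) (sg _ _ i) (sg _ _ i) (sg _ _ i) (u' i) (dot w X) (dot w w) => *; by field.
Qed.

End Moebius.

Lemma moebius_is_conf (w : E) : dot w w < 1 -> is_conf (moebius w).
Proof.
move=> w1; have w1' : dot (- w) (- w) < 1 by rewrite -scaleN1r dotZl dotZr mulrA mulrNN !mul1r.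
split=> [i|x hx||x hx|x X Y hx tX tY].
- exact: Alg_smooth (Alg_moebius w1 i).
- exact: moebius_sphere.
- exists (moebius (- w)); first by move=> i; exact: Alg_smooth (Alg_moebius w1' i).
 move=> x hx; split; [exact: moebius_sphere|exact: moebiusK|].
 by rewrite -{1}[w]opprK; exact: moebiusK.
- by rewrite jacdet_moebius // exprn_gt0 // divr_gt0 ?subr_gt0 //; exact: nz_gt0.
- exact: moebius_conf.
Qed.

Lemma moebius_is_lift (w : E) : dot w w < 1 -> is_spin_lift (moebius w) (moebius_lift w).
Proof.
move=> w1; split=> [k l|x s t hx|x hx|x X hx tX|psi x X sp hx tX].
- exact: lift_smooth.
- exact: lift_isom.
- exact: lift_det.
- exact: lift_cliff.
- exact: lift_nabla.
Qed.

(** Spinors constant in the trivialization are killed by [T], so [D = 1 + T] acts on them as the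
    identity. *)
Lemma cst_first_eigenspinor (v : V4) : ip v v = 1 -> first_eigenspinor (mkS (fun i _ => v i)).
Proof.
move=> hv; have av i : Alg (fun _ : E => v i) := AlgC (v i).
split=> [|x hx|x hx]; first exact: (smooth_mkS av).
 rewrite (dirac_mkS av hx); congr mkC; apply/funext => i.
 by rewrite /Df TfE big1 ?addr0 // => k _; rewrite Xd_cst mulr0.
by rewrite sqnormE mkCK.
Qed.

(** * Classification of the extremal solutions *)

Section Conclusion.

Variables (A B : R) (u : E -> R) (psi : E -> 'cV[R[i]]_2).
Hypotheses (hB : 0 < B)
(hAB : A < B ^+ 2)
(hsol : is_solution A B u psi)
(hnt : nontrivial psi)
(hmin : energy A B u psi <= 4 * pi * (1 - A / B ^+ 2 - 2 * ln B)).
Let Psi : ppf := ofs (fcomp psi).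
Let sq := sqd Psi.
Let c : R := (B ^+ 2 - A) / B.

Let c0 : 0 < c. Proof. by rewrite divr_gt0 // subr_gt0. Qed.

Let hd : pae (fun p => sq p = c * expR (u p^S)). Proof. exact: sol_density hmin. Qed.

Lemma sol_chi_pL1 i : pL1 (fun p => (sq p)^-1 * Psi i p).
Proof.
have sq0 p : 0 <= sq p by exact: ip_ge0.
have ms : pmeas sq by case: (ip_pL1 (sol_L2 hsol) (sol_L2 hsol)).
have mV : pmeas (fun p => (sq p)^-1) := pmeas_V ms sq0.
have [hU _ _ _ _] := H1_wgrad (sol_H1 hsol).
have iV : pL1 (fun p => (sq p)^-1).
 apply: (ae_eq_pL1 mV _ (pL1Z c^-1 (wH1_exp (-1) hU))).
 by apply: paeS hd => p _ ->; rewrite mulN1r expRN -invfM.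
apply: (@pL1_le _ (fun p => (sq p)^-1 + 1)); last exact: pL1D iV (pL1C 1).
 by apply: pmeasM mV _; have [] := sol_L2 hsol i.
move=> p _; rewrite normrM ger0_norm ?invr_ge0 //.
have h1 : Psi i p ^+ 2 <= sq p.
 rewrite /sq /sqd /ip (bigD1 i) //= -expr2 lerDl sumr_ge0 // => j _; exact: sqr_ge0.
have h2 : `|Psi i p| <= 1 + sq p.
 apply: le_trans (_ : 1 + Psi i p ^+ 2 <= _); last by rewrite lerD2l.
 by rewrite -[_ ^+ 2]real_normK ?num_real //; have := sqr_ge0 (`|Psi i p| - 1); have := normr_ge0 (Psi i p); move: `|_| => y; nra.
apply: le_trans (ler_wpM2l _ h2) _; first by rewrite invr_ge0.
rewrite mulrDr mulr1 lerD2l; have [->|n0] := eqVneq (sq p) 0; first by rewrite mulr0.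
by rewrite mulVf.
Qed.

(** The twistor spinor [chi = Psi / |Psi|^2 = v + sigma(x) q] has squared norm [1 / |Psi|^2], so
    [Psi = chi / |chi|^2], and the density turns the Dirac equation into the one of [chi_algebra]
    with [kappa = B / c]. From [q = sigma(w) v] one gets [chi = sigma(x) sigma(x + w) v]. *)
Lemma sol_form : exists w v, [/\ dot w w < 1, 0 < ip v v, ip v v * (1 - dot w w) = B / c &
 pae (fun p => sq p = ((1 + dot w w + 2 * dot w p^S) * ip v v)^-1 /\
  forall i, Psi i p = sq p * sg p^S (sg (sph p + w) v) i)].
Proof.
have [v [q hv]] := Lop_weak_kernel sol_chi_pL1 (sol_baer hB hsol hnt hmin).
pose chi (i : ix) (x : E) := v i + sg x q i.
have e : pae (fun p => [/\ 0 < sq p, ip (chi ^~ p^S) (chi ^~ p^S) = (sq p)^-1 & forall i, Psi i p = sq p * chi i p^S]).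
 apply: paeS (paeI hv hd) => p _ [h1 h2].
 have s0 : 0 < sq p by rewrite h2 mulr_gt0 ?expR_gt0.
 have h3 : chi ^~ p^S = fun i => (sq p)^-1 * Psi i p by apply/funext => i; rewrite /chi -h1.
 split=> // [|i]; last by rewrite /chi -h1 mulVKf // gt_eqF.
 by rewrite h3 ipZl ipC ipZl -[ip _ _]/(sq p) mulVf ?mulr1 // gt_eqF.
have k0 : 0 < B / c by rewrite divr_gt0.
have hP : pae (fun p => [/\ 0 < ip (chi ^~ p^S) (chi ^~ p^S), forall i, Psi i p = chi i p^S / ip (chi ^~ p^S) (chi ^~ p^S) & forall i, B * expR (u p^S) * Psi i p = B / c * chi i p^S / ip (chi ^~ p^S) (chi ^~ p^S) ^+ 2]).
 apply: paeS (paeI e hd) => p _ [[s0 -> h] h2]; rewrite invr_gt0; split=> // i; first by rewrite invrK mulrC.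
 have -> : expR (u p^S) = sq p / c by rewrite h2 mulrC mulKf // gt_eqF.
 rewrite h; move: (sq p) s0 (chi _ _) c c0 => s s0 ch d d0; field.
 by rewrite !gt_eqF.
have [w [eq ek v0]] := chi_algebra k0 (sol_wD hsol) hP.
have w1 : dot w w < 1 by move: k0; rewrite ek pmulr_rgt0 // subr_gt0.
exists w, v; split=> //; apply: paeS e => p _ [s0 h1 h2]; have hx := sphS p.
have ec : chi ^~ p^S = sg p^S (sg (sph p + w) v).
 apply/funext => i; rewrite (_ : sg (sph p + w) v = fun j => sg p^S v j + sg w v j); last by apply/funext => j; rewrite sg_add.
 by rewrite sgD (sg_sphere _ hx) /chi eq.
split; last by move=> i; rewrite h2 -ec.
rewrite -[LHS]invrK -h1 ec ip_sg (hx : dot _ _ = 1) mul1r ip_sg.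
by rewrite -(nzE w hx).
Qed.

Lemma sol_classified : exists Phi F phi1, [/\ is_conf Phi, is_spin_lift Phi F, first_eigenspinor phi1,
    sae (fun x => u x = - ln B + 2^-1 * ln (jacdet Phi x)) &
    sae (fun x => psi x = (Num.sqrt (1 - A / B ^+ 2))%:C *: conf_act_spinor Phi F phi1 x)].
Proof.
have [w [v [w1 v0 ek h]]] := sol_form; pose s := Num.sqrt (ip v v).
have s0 : s != 0 by rewrite gt_eqF // sqrtr_gt0.
have ss : s ^+ 2 = ip v v by rewrite sqr_sqrtr // ltW.
(* The eigenspinor is [v], normalized; [sol_form] gives both [psi] and, through the density, [e^u]
   in terms of [w] and [v]. *)
exists (moebius w), (moebius_lift w), (mkS (fun i _ => s^-1 * v i)).
have cB : c * B != 0 by rewrite mulf_neq0 ?gt_eqF.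
split; [exact: moebius_is_conf|exact: moebius_is_lift| | |].
- by apply: cst_first_eigenspinor; rewrite ipZl ipC ipZl -ss; field.
- apply: paeS (paeI h hd) => p _ [[e1 _] e2]; have hx := sphS p.
 have n0 := nz_gt0 w1 hx; rewrite [RHS]addrC.
 rewrite -[2^-1 * _]/(conf_factor (moebius w) p^S) conf_factor_moebius //.
 have a0 : 0 < (1 - dot w w) / (1 + dot w w + 2 * dot w p^S) by rewrite divr_gt0 // subr_gt0.
 rewrite -lnV ?posrE // -lnM ?posrE ?invr_gt0 // -[LHS]expRK; congr ln.
 have -> : expR (u p^S) = sq p / c by rewrite e2 mulrC mulKf // gt_eqF.
 rewrite e1; have -> : c = B / (ip v v * (1 - dot w w)) by rewrite ek invf_div mulrCA mulfV ?mulr1 ?gt_eqF.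
 have b0 : 0 < 1 - dot w w by rewrite subr_gt0.
 move: n0 b0 v0 hB; move: (1 + _ + _) (1 - dot w w) (ip v v) => n b d n0 b0 d0 B0; field.
 by rewrite !gt_eqF.
apply: paeS h => p _ [e1 e2]; have hx := sphS p; have n0 := nz_gt0 w1 hx.
pose n := 1 + dot w w + 2 * dot w p^S; pose K := 1 - A / B ^+ 2.
have uF : moebius_lift w p^S \in unitmx by rewrite unitmxE lift_det // unitr1.
have a0 : 0 < (1 - dot w w) / n by rewrite divr_gt0 // subr_gt0.
have ea : expR (conf_factor (moebius w) p^S / 2) = Num.sqrt ((1 - dot w w) / n).
 rewrite conf_factor_moebius // -/n -{2}(lnK (a0 : _ \is Num.pos)); set l := ln _.
 by rewrite (_ : expR l = expR (l / 2) ^+ 2) ?sqrtr_sqr ?ger0_norm ?expR_ge0 // -expRM_natl; congr expR; field.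
(* Since [B / c = |v|^2 (1 - |w|^2)], the amplitude [sqrt (1 - A / B^2)] and the conformal factor
   combine to [1 / (sqrt n |v|)]. *)
have eK : Num.sqrt K * Num.sqrt ((1 - dot w w) / n) = (Num.sqrt n)^-1 * s^-1.
 have K0 : 0 <= K by rewrite subr_ge0 ler_pdivrMr ?mul1r ?ltW // exprn_gt0.
 rewrite -sqrtrM // -invfM -sqrtrM ?(ltW n0) // -sqrtrV ?mulr_ge0 ?(ltW n0) ?(ltW v0) //; congr Num.sqrt.
 have eb : 1 - dot w w = B / c / ip v v by rewrite -ek mulrC mulKf // gt_eqF.
 have ar (m d : R) : 0 < m -> 0 < d -> (1 - A / B ^+ 2) * (B / ((B ^+ 2 - A) / B) / d / m) = (m * d)^-1.
  by move=> m0 d0; field; rewrite !gt_eqF // subr_gt0.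
 by rewrite eb; exact: ar.
rewrite /conf_act_spinor ea scalerA -rmorphM eK scalemxAr -[LHS](mulKmx uF); congr (_ *m _).
apply: comps_inj; rewrite comps_scale mkCK (comps_lift w p^S); apply/funext => i.
have -> : comps (psi p^S) = fun i => sq p * sg p^S (sg (sph p + w) v) i by apply/funext => j; exact: e2.
have -> : sg p^S (fun i => sq p * sg p^S (sg (sph p + w) v) i) = fun i => sq p * sg (sph p + w) v i.
 by apply/funext => j; rewrite sgZ (sg_sphere _ hx).
rewrite sgZ (sg_unit v (esym (nzE w hx))) e1 -/n -ss.
have ar (m t y z : R) : m != 0 -> t != 0 -> z * ((m * t ^+ 2)^-1 * (m * y)) = z * t^-1 * (t^-1 * y).
 by move=> m0 t0; field; rewrite t0 m0.
exact: ar (lt0r_neq0 n0) s0.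
Qed.

End Conclusion.

End Main.

Theorem theorem1p16 (R : realType) (A B : R)
    (u : 'rV[R]_3 -> R) (psi : 'rV[R]_3 -> 'cV[R[i]]_2)
    (hA : 0 < A) (hB : 0 < B) (hAB : A < B ^+ 2)
    (hmin : least_energy_solution A B u psi) (hpsi : nontrivial psi) :
  exists (Phi : 'rV[R]_3 -> 'rV[R]_3) (F : 'rV[R]_3 -> 'M[R[i]]_2)
         (phi1 : 'rV[R]_3 -> 'cV[R[i]]_2),
    [/\ is_conf Phi, is_spin_lift Phi F, first_eigenspinor phi1,
        sae (fun x => u x = - ln B + 2^-1 * ln (jacdet Phi x)) &
        sae (fun x => psi x = (Num.sqrt (1 - A / B ^+ 2))%:C *:
                              conf_act_spinor Phi F phi1 x)].
Proof.
have [hsol hle] := hmin.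
(* Minimality enters through a single comparison, with the constant solution. *)
apply: (sol_classified hB hAB hsol hpsi).
exact: le_trans (hle _ _ (competitor_solution hB hAB)) (competitor_energy hB hAB).
Qed.
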